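(* Let $k\ge2$, $\ell\in\{0,1,\dots,k-1\}$ and $\delta>1/2$ be fixed. For every $\varepsilon>0$ there is $n_0$ such that every $k$-uniform hypergraph $G$ on $n\ge n_0$ vertices with $(k-\ell)\mid n$ and $\delta_{k-1}(G)\ge\delta n$ satisfies $$\log\Psi_{\ell}(G)\ge \frac{k}{k-\ell}h(G)-\frac{n}{k-\ell}\log\left(\binom{n}{k-1}\frac{(n-k+1)!}{(n-\ell)!\,n}\right)-n\log e-\log C_{n,k,\ell}-\varepsilon n.$$
   Context: All logarithms are base 2, with $0\log 0=0$. A $k$-uniform hypergraph $G$ has edges that are $k$-subsets of $V(G)$; $\delta_{k-1}(G)$ is the minimum, over all $(k-1)$-subsets $S\subseteq V(G)$, of the number of vertices $v$ with $S\cup\{v\}\in E(G)$. A perfect fractional matching of $G$ is $\mathbf{x}:E(G)\to\mathbb{R}_{\ge0}$ with $\sum_{e\ni v}\mathbf{x}(e)=1$ for all $v\in V(G)$; $h(\mathbf{x})=\sum_{e}\mathbf{x}(e)\log\frac1{\mathbf{x}(e)}$ and $h(G)=\sup_{\mathbf{x}}h(\mathbf{x})$ over perfect fractional matchings. A $k$-graph $C$ is an $\ell$-cycle if there is a cyclic ordering of $V(C)$ such that every edge of $C$ consists of $k$ consecutive vertices and every two consecutive edges intersect in exactly $\ell$ vertices. A Hamilton $\ell$-cycle of $G$ is a subgraph of $G$ which is an $\ell$-cycle with vertex set $V(G)$; $\Psi_\ell(G)$ is the number of Hamilton $\ell$-cycles of $G$ (for $\ell=0$ this is the number of perfect matchings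 of $G$). Finally, with $\pi_1=k \bmod (k-\ell)$ and $\pi_2=(k-\ell)-\pi_1$, $C_{n,k,\ell}=(\pi_1!\,\pi_2!)^{n/(k-\ell)}$ if $\ell\in\{1,\dots,k-1\}$ and $C_{n,k,0}=(n/k)!\,(k!)^{n/k}$. *)

(* Defs.v *)
From mathcomp Require Import all_boot all_order all_algebra.
From mathcomp Require Import all_classical all_reals all_analysis.

Set Implicit Arguments.
Unset Strict Implicit.
Unset Printing Implicit Defensive.

Import Order.TTheory GRing.Theory Num.Theory.
Local Open Scope ring_scope.

(* A hypergraph with vertex set V (all of the finite type V) is given by its
   edge set E : {set {set V}}. *)

Definition log2 {R : realType} (x : R) : R := ln x / ln 2.

Section Hypergraph.
Variable V : finType.
Implicit Types (E F : {set {set V}}) (S : {set V}).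

Definition is_kuniform (k : nat) E : Prop := forall e, e \in E -> #|e| = k.

Definition codegree E S : nat := #|[set v : V | v |: S \in E]|.

(* delta_{k-1}; the default value #|V| bounds every codegree, so it only
   matters when V has no (k-1)-subset. *)
Definition min_codegree (k : nat) E : nat :=
  \big[minn/#|V|]_(S : {set V} | #|S| == k.-1) codegree E S.

(* The values of x outside E play no role. *)
Definition perfect_fractional_matching {R : realType} E (x : {set V} -> R)
  : Prop :=
  (forall e, e \in E -> 0 <= x e) /\
  (forall v : V, \sum_(e in E | v \in e) x e = 1).

(* 0 log (1/0) = 0 holds because of the factor x e. *)
Definition matching_entropy {R : realType} E (x : {set V} -> R) : R :=
  \sum_(e in E) x e * log2 (x e)^-1.

Definition graph_entropy (R : realType) E : R :=
  sup [set matching_entropy E x |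
       x in [set x : {set V} -> R | perfect_fractional_matching E x]]%classic.

(* The k cyclically consecutive vertices starting at position i of the cyclic
   ordering s. *)
Definition window (k : nat) (s : seq V) (i : nat) : {set V} :=
  [set v in take k (rot i s)].

(* F is the edge set of an l-cycle with vertex set V: for some ordering s of V,
   read cyclically, the edges are the windows starting at the positions in P.
   The sequence enum P lists the positions in increasing order, so `cycle`
   compares each edge with the next one along the cycle, and the last with the
   first. The condition on the cover says that the cycle has no isolated vertex;
   for l = 0 it makes F a perfect matching. *)
Definition is_spanning_lcycle (k l : nat) F : bool :=
  [exists s : #|V|.-tuple V, exists P : {set 'I_#|V|},
    [&& uniq s,
        F == [set window k s i | i : 'I_#|V| in P],
        path.cycle (fun i j : 'I_#|V| =>
                 #|window k s i :&: window k s j| == l) (enum P)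
      & finset.cover F == [set: V]]].

(* A Hamilton l-cycle is a subgraph, hence is identified with its edge set. *)
Definition num_hamilton_lcycles (k l : nat) E : nat :=
  #|[set F : {set {set V}} | (F \subset E) && is_spanning_lcycle k l F]|.

End Hypergraph.

Definition Cnkl (n k l : nat) : nat :=
  let p1 := (k %% (k - l))%N in
  let p2 := ((k - l) - p1)%N in
  if l == 0%N then ((n %/ k)`! * k`! ^ (n %/ k))%N
  else ((p1`! * p2`!) ^ (n %/ (k - l)))%N.

(* Main.v *)
(** With [q = k - l], every ordering of the vertices whose windows of length [k] at the
    multiples of [q] are all edges gives a Hamilton l-cycle, and a cycle arises from at most
    [n^2 * Cnkl n k l] orderings.  It remains to count such orderings.

    Step 1: if [x] is a perfect fractional matching with entropy close to [h(G)], then at least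
    [n! exp(- (n/q) v(x) - eps n)] orderings have at most [eps n] bad windows, where
    [v(x) = ln (n^(k-1) / (k-1)!) - (k/n) h(x)].  The matching is first replaced by the maximiser
    of a softened entropy on the complete k-graph (non-edges are charged a large penalty); an
    exchange argument shows that all its weights are comparable.  It is then the window marginal
    of a Markov chain producing pieces of bounded length, and sequences of disjoint pieces are
    counted by a potential: the logarithm of the total weight of the pieces that are still
    available, corrected by the variance of the weighted degrees.

    Step 2: the number of orderings with at most [b] bad windows is at most [(K n)^b / b!] times
    the number of those without bad windows, which costs only [exp(eps n)] when [b] is a small
    multiple of [n].  Take [g] blocks of length [g], one starting at a bad window and the others
    random, and let each block exchange its vertices for a transversal of all the blocks.  By
    Chernoff's bound the transversals inherit the codegree condition, hence can be ordered as
    tight paths with the prescribed ends.  This repairs the bad window, spoils none, and only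
    boundedly many orderings lead to the same result.

    The tight Hamilton paths of Step 2 have bounded length and come from the absorption method:
    a reservoir of vertices each equipped with an absorber, a nearly spanning family of tight
    pieces given by Step 1 with [q = 1], and a connecting lemma. *)

Require Import Defs.
From mathcomp Require Import all_boot all_order all_algebra perm.
From mathcomp Require Import all_classical all_reals all_analysis.
From mathcomp Require Import ring lra zify.
Set Implicit Arguments.
Unset Strict Implicit.
Unset Printing Implicit Defensive.
Import Order.TTheory GRing.Theory Num.Theory numFieldNormedType.Exports.
Local Open Scope ring_scope.

(** * Counting sequences of disjoint pieces *)

Section RealFacts.
Variable R : realType.
Implicit Types (a x : R).

(** A matching of large entropy may have very uneven weights, and then nothing keeps a random choice
    of disjoint pieces under control until only few vertices are left. A finite price for non-edges
    makes every k-set admissible, so that ratios of weights can be bounded at all; and the value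
    cannot drop, as the original matching is a competitor. The price is so high that orderings with
    many bad windows carry at most half of the weighted count. Long pieces replace single edges
    because windows that straddle two pieces are not controlled; their proportion tends to zero as
    the pieces get longer. The degrees of the available pieces may drift, but their total squared
    deviation starts at order [n^-3] and grows by a factor [1 + O(1/n)] per step, so a potential
    corrected by it survives linearly many steps. All constants must be uniform in the matching.
    This requires a bound on [v(x)] independent of [n], which the codegree condition supplies
    through a matching with weights at most of order [n^(1-k)]. The bounded tight paths of Step 2
    need Step 1 only in a weak form, for one ordering with few bad windows, so the argument is not
    circular. *)

Lemma ln_le_subr1 x : 0 < x -> ln x <= x - 1.
Proof.
move=> x0; have -> : x = 1 + (x - 1) by ring.
by rewrite [leRHS](_ : _ = x - 1); [apply: le_ln1Dx; lra|ring].
Qed.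
Lemma ln_ge_1subV x : 0 < x -> 1 - x^-1 <= ln x.
Proof.
move=> x0; have := @ln_le_subr1 x^-1; rewrite invr_gt0 lnV ?posrE // => /(_ x0); lra.
Qed.
Lemma ln_ge_sub a : 0 <= a -> a <= 1 / 2 -> - a - 2 * a ^+ 2 <= ln (1 - a).
Proof.
move=> a0 a1; have b0 : 0 < 1 - a by lra.
apply: le_trans (ln_ge_1subV b0).
have -> : 1 - (1 - a)^-1 = - (a / (1 - a)) by field; rewrite gt_eqF.
rewrite (_ : - a - 2 * a ^+ 2 = - (a + 2 * a ^+ 2)); last by ring.
rewrite lerN2 ler_pdivrMr //; nra.
Qed.
(** The tangent line of the exponential at the weighted mean [mu] of [x] lies below it. This turns a
    lower bound for the expected potential after one step into a lower bound for a weighted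
    count. *)
Lemma jensen_exp (Y : finType) (f x : Y -> R) : (forall y, 0 <= f y) -> 0 < \sum_y f y ->
  (\sum_y f y) * expR ((\sum_y f y * x y) / \sum_y f y) <= \sum_y f y * expR (x y).
Proof.
move=> f0 s0; set s := \sum_y f y; set mu := _ / s.
apply: (@le_trans _ _ (\sum_y f y * (expR mu * (1 + (x y - mu))))).
  rewrite (eq_bigr (fun y => expR mu * (1 - mu) * f y + expR mu * (f y * x y))); last by move=> y _; ring.
  rewrite big_split /= -!mulr_sumr -/s.
  have -> : \sum_y f y * x y = mu * s by rewrite /mu divfK // gt_eqF.
  by rewrite [leRHS](_ : _ = s * expR mu) //; ring.
apply: ler_sum => y _; apply: ler_wpM2l => //.
have -> : x y = mu + (x y - mu) by ring.
rewrite expRD (_ : mu + (x y - mu) - mu = x y - mu); last by ring.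
by apply: ler_wpM2l; rewrite ?expR_ge0 // expR_ge1Dx.
Qed.
End RealFacts.

Section Potential.
Variables (R : realType) (V Y : finType) (sp : Y -> {set V}) (F psi : Y -> R).
Variables (m : nat) (K eps B : R).
Implicit Types (U : {set V}) (u v w : V) (y z : Y).
Hypothesis F_ge0 : forall y, 0 <= F y.
Hypothesis F_card : forall y, F y != 0 -> #|sp y| = m.
Hypothesis K_ge1 : 1 <= K.
Hypothesis eps_gt0 : 0 < eps.
Hypothesis V_gt0 : (0 < #|V|)%N.
Hypothesis psi_le : forall y, `|psi y| <= B.
Let n : R := #|V|%:R.
Hypothesis deg1 : forall v, \sum_y F y * (v \in sp y)%:R <= K / n.
Hypothesis deg2 : forall u v, u != v ->
  \sum_y F y * ((u \in sp y)%:R * (v \in sp y)%:R) <= K / n ^+ 2.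
Hypothesis deg3 : forall u v w, u != v -> u != w -> v != w ->
  \sum_y F y * ((u \in sp y)%:R * (v \in sp y)%:R * (w \in sp y)%:R)
    <= K / n ^+ 3.

(** A point [y] of [Y] is a piece with vertex set [sp y], weight [F y] and reward [expR (psi y)].
    Throughout, [U] is the set of vertices not yet covered. *)
Definition fw U y : R := (sp y \subset U)%:R * F y.
Definition FU U := \sum_y fw U y.
Definition GU U := \sum_y fw U y * psi y.
Definition D1 U v := \sum_y fw U y * (v \in sp y)%:R.
Definition D2 U u v := \sum_y fw U y * ((u \in sp y)%:R * (v \in sp y)%:R).
Definition Dpsi U v := \sum_y fw U y * ((v \in sp y)%:R * psi y).
(** The degrees in [U] sum to [m * FU U], so [Rd] is the deviation of a degree from the average and
    [SU] is the total squared deviation. It measures how far one step is from being predictable. *)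
Definition Rd U v := D1 U v - m%:R * FU U / #|U|%:R.
Definition SU U := \sum_(v in U) Rd U v ^+ 2.

Hypothesis FU_ge : forall U, eps * n <= #|U|%:R -> K^-1 <= FU U.

Let n_gt0 : 0 < n. Proof. by rewrite ltr0n. Qed.
Let n_ge1 : 1 <= n. Proof. by rewrite ler1n. Qed.
Let K_gt0 : 0 < K. Proof. exact: lt_le_trans K_ge1. Qed.
Let B_ge0 : (exists y : Y, True) -> 0 <= B.
Proof. by case=> y _; apply: le_trans (psi_le y). Qed.

Lemma sumc U (c : R) : \sum_(v in U) c = #|U|%:R * c.
Proof. by rewrite sumr_const mulr_natl. Qed.
Lemma fw_ge0 U y : 0 <= fw U y.
Proof. by rewrite mulr_ge0 ?ler0n. Qed.
Lemma fw_le U y : fw U y <= F y.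
Proof. by rewrite /fw; case: (_ \subset _); rewrite ?mul1r ?mul0r. Qed.
Lemma fw_out U y v : v \notin U -> fw U y * (v \in sp y)%:R = 0.
Proof.
move=> vU; rewrite /fw; case: (boolP (sp y \subset U)) => [/fintype.subsetP s|]; last by rewrite !mul0r.
case: (boolP (v \in sp y)) => [/s|]; last by rewrite mulr0.
by rewrite (negbTE vU).
Qed.
Lemma D1_out U v : v \notin U -> D1 U v = 0.
Proof. by move=> vU; rewrite /D1 big1 // => y _; rewrite fw_out. Qed.
Lemma D2_out U u v : u \notin U -> D2 U u v = 0.
Proof. by move=> vU; rewrite /D2 big1 // => y _; rewrite mulrA fw_out ?mul0r. Qed.
Lemma Dpsi_out U u : u \notin U -> Dpsi U u = 0.
Proof. by move=> vU; rewrite /Dpsi big1 // => y _; rewrite mulrA fw_out ?mul0r. Qed.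

Lemma fw_card U y : fw U y * #|sp y|%:R = m%:R * fw U y.
Proof.
case: (eqVneq (F y) 0) => [E|/F_card ->]; last by rewrite mulrC.
by rewrite /fw E !(mulr0, mul0r).
Qed.
Lemma sum_mem y : \sum_v (v \in sp y)%:R = #|sp y|%:R :> R.
Proof.
rewrite -sum1_card natr_sum [RHS]big_mkcond; apply: eq_bigr => v _.
by case: ifP.
Qed.
Lemma sum_D1 U : \sum_v D1 U v = m%:R * FU U.
Proof.
rewrite exchange_big /= mulr_sumr; apply: eq_bigr => y _.
by rewrite -mulr_sumr sum_mem fw_card.
Qed.
Lemma sum_in (h : V -> R) U : (forall v, v \notin U -> h v = 0) ->
  \sum_(v in U) h v = \sum_v h v.
Proof. by move=> h0; rewrite [RHS](bigID (mem U)) /= [X in _ = _ + X]big1 ?addr0. Qed.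
Lemma sum_D1in U : \sum_(v in U) D1 U v = m%:R * FU U.
Proof. by rewrite sum_in ?sum_D1 //; apply: D1_out. Qed.
Lemma sum_Dpsiin U : \sum_(v in U) Dpsi U v = m%:R * GU U.
Proof.
rewrite sum_in; last exact: Dpsi_out.
rewrite exchange_big /= mulr_sumr; apply: eq_bigr => y _.
rewrite (eq_bigr (fun v => fw U y * psi y * (v \in sp y)%:R)); last by move=> v _; ring.
by rewrite -mulr_sumr sum_mem mulrAC fw_card; ring.
Qed.
Lemma sum_D2 U v : \sum_u D2 U u v = m%:R * D1 U v.
Proof.
rewrite exchange_big /= mulr_sumr; apply: eq_bigr => y _.
by rewrite -mulr_sumr -mulr_suml sum_mem mulrA fw_card mulrA.
Qed.
Lemma D2_diag U v : D2 U v v = D1 U v.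
Proof. by apply: eq_bigr => y _; case: (_ \in _); rewrite ?mulr1 ?mulr0. Qed.
Lemma sum_D2N U v : \sum_(u | u != v) D2 U u v = (m%:R - 1) * D1 U v.
Proof.
rewrite mulrBl mul1r -sum_D2 [X in _ = X - _](bigD1 v) //= D2_diag.
by rewrite [D1 _ _ + _]addrC addrK.
Qed.

Lemma fsum_le U (h : Y -> R) : (forall y, 0 <= h y) ->
  \sum_y fw U y * h y <= \sum_y F y * h y.
Proof. by move=> h0; apply: ler_sum => y _; apply: ler_wpM2r (fw_le _ _). Qed.
Lemma D1_ge0 U v : 0 <= D1 U v.
Proof. by apply: sumr_ge0 => y _; rewrite mulr_ge0 ?fw_ge0 ?ler0n. Qed.
Lemma D2_ge0 U u v : 0 <= D2 U u v.
Proof. by apply: sumr_ge0 => y _; rewrite !mulr_ge0 ?fw_ge0 ?ler0n. Qed.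
Lemma D1_le U v : D1 U v <= K / n.
Proof. by apply: le_trans (deg1 v); apply: fsum_le => y; rewrite ler0n. Qed.
Lemma D2_le U u v : u != v -> D2 U u v <= K / n ^+ 2.
Proof. by move=> uv; apply: le_trans (deg2 uv); apply: fsum_le => y; rewrite mulr_ge0 ?ler0n. Qed.
Lemma FU_ge0 U : 0 <= FU U.
Proof. by apply: sumr_ge0 => y _; apply: fw_ge0. Qed.
Lemma FU_le U : (0 < m)%N -> FU U <= K.
Proof.
move=> m0; have : m%:R * FU U <= K.
  rewrite -sum_D1; apply: (@le_trans _ _ (\sum_(v : V) K / n)).
    by apply: ler_sum => v _; apply: D1_le.
  by rewrite sumr_const -/n -(@mulr_natl R) mulrC divfK // gt_eqF.
by apply: le_trans; rewrite ler_peMl ?FU_ge0 // ler1n.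
Qed.
Lemma Dpsi_le U v : `|Dpsi U v| <= B * D1 U v.
Proof.
rewrite /D1 mulr_sumr; apply: le_trans (ler_norm_sum _ _ _) _.
apply: ler_sum => y _; rewrite normrM (ger0_norm (fw_ge0 U y)) normrM.
rewrite (ger0_norm (ler0n _ _)) mulrA [leLHS]mulrC; apply: ler_wpM2r (psi_le y).
by rewrite mulr_ge0 ?fw_ge0 ?ler0n.
Qed.
Lemma GU_le U : `|GU U| <= B * FU U.
Proof.
rewrite /FU mulr_sumr; apply: le_trans (ler_norm_sum _ _ _) _.
apply: ler_sum => y _; rewrite normrM (ger0_norm (fw_ge0 _ _)) mulrC.
by apply: ler_wpM2r (psi_le y); rewrite fw_ge0.
Qed.

Lemma fw_setD U y z :
  fw (U :\: sp y) z = fw U z * (#|sp z :&: sp y| == 0)%:R.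
Proof.
by rewrite /fw subsetD -setI_eq0 cards_eq0 -mulnb natrM mulrAC.
Qed.
Lemma bonferroni (t : nat) :
  `|(t == 0)%:R - (1 - t%:R)| <= t%:R * (t%:R - 1) :> R.
Proof.
case: t => [|[|t]] /=; first by rewrite subr0 subrr normr0 mul0r.
  by rewrite !subrr normr0 mulr0.
rewrite sub0r opprB ger0_norm ?subr_ge0 ?ler1n //.
by apply: ler_peMl; rewrite ?subr_ge0 ler1n.
Qed.
Lemma cardI_sum (z y : Y) : #|sp z :&: sp y|%:R =
  \sum_u (u \in sp z)%:R * (u \in sp y)%:R :> R.
Proof.
rewrite -sum1_card natr_sum big_mkcond /=; apply: eq_bigr => u _.
by rewrite inE; do 2!case: (u \in _); rewrite ?mulr0 ?mul0r ?mulr1.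
Qed.
Lemma cardI_sum2 (z y : Y) :
  #|sp z :&: sp y|%:R * (#|sp z :&: sp y|%:R - 1) =
  \sum_u \sum_(w | w != u) ((u \in sp y)%:R * (w \in sp y)%:R) *
     ((u \in sp z)%:R * (w \in sp z)%:R) :> R.
Proof.
have E : \sum_u \sum_w ((u \in sp y)%:R * (w \in sp y)%:R) *
     ((u \in sp z)%:R * (w \in sp z)%:R) = #|sp z :&: sp y|%:R * #|sp z :&: sp y|%:R :> R.
  rewrite {1}cardI_sum mulr_suml; apply: eq_bigr => u _.
  by rewrite cardI_sum mulr_sumr; apply: eq_bigr => w _; ring.
have E1 : \sum_u ((u \in sp y)%:R * (u \in sp y)%:R) *
     ((u \in sp z)%:R * (u \in sp z)%:R) = #|sp z :&: sp y|%:R :> R.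
  rewrite cardI_sum; apply: eq_bigr => i _.
  by do 2!case: (i \in _); rewrite ?mulr0 ?mul0r ?mulr1.
rewrite mulrBr mulr1 -E -E1 -sumrB; apply: eq_bigr => u _.
by rewrite (bigD1 u) //= addrC addrK.
Qed.

(** Removing the vertices of [y] keeps exactly the pieces disjoint from [sp y]. The indicator of
    disjointness is replaced by one minus the number of common vertices; the error is at most the
    number of ordered pairs of distinct common vertices, hence a sum of pair degrees. Taking for [h]
    the constant one, [psi] or membership of [v] gives the three estimates below. *)
Lemma step_gen U y (h : Y -> R) :
  `|\sum_z fw (U :\: sp y) z * h z
    - (\sum_z fw U z * h z - \sum_u (u \in sp y)%:R * \sum_z fw U z * ((u \in sp z)%:R * h z))|
  <= \sum_u \sum_(w | w != u) ((u \in sp y)%:R * (w \in sp y)%:R) *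
       \sum_z F z * ((u \in sp z)%:R * (w \in sp z)%:R * `|h z|).
Proof.
have -> : \sum_z fw (U :\: sp y) z * h z
    - (\sum_z fw U z * h z - \sum_u (u \in sp y)%:R * \sum_z fw U z * ((u \in sp z)%:R * h z))
  = \sum_z fw U z * h z * ((#|sp z :&: sp y| == 0)%:R - (1 - #|sp z :&: sp y|%:R)).
  under [X in _ - (_ - X)]eq_bigr do rewrite mulr_sumr.
  rewrite [X in _ - (_ - X)]exchange_big /= -!sumrB; apply: eq_bigr => z _.
  rewrite fw_setD cardI_sum.
  rewrite (eq_bigr (fun u => fw U z * h z * ((u \in sp z)%:R * (u \in sp y)%:R))); last by move=> u _; ring.
  by rewrite -mulr_sumr; ring.
apply: le_trans (ler_norm_sum _ _ _) _.
have -> : \sum_u \sum_(w | w != u) ((u \in sp y)%:R * (w \in sp y)%:R) *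
       \sum_z F z * ((u \in sp z)%:R * (w \in sp z)%:R * `|h z|) =
  \sum_z F z * `|h z| * (#|sp z :&: sp y|%:R * (#|sp z :&: sp y|%:R - 1)).
  under [RHS]eq_bigr do rewrite cardI_sum2 mulr_sumr.
  rewrite [RHS]exchange_big /=; apply: eq_bigr => u _.
  under [RHS]eq_bigr do rewrite mulr_sumr.
  rewrite [RHS]exchange_big /=; apply: eq_bigr => w _.
  by rewrite mulr_sumr; apply: eq_bigr => z _; ring.
apply: ler_sum => z _; rewrite normrM; apply: ler_pM; rewrite ?normr_ge0 ?bonferroni //.
rewrite normrM (ger0_norm (fw_ge0 U z)).
by apply: ler_wpM2r; rewrite ?fw_le.
Qed.

Lemma sum_mem2 (A : {set V}) : (\sum_u \sum_(w | w != u) ((u \in A)%:R * (w \in A)%:R) : R) <= #|A|%:R ^+ 2.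
Proof.
have E : \sum_u (u \in A)%:R = #|A|%:R :> R.
  by rewrite -sum1_card natr_sum [RHS]big_mkcond; apply: eq_bigr => v _; case: ifP.
rewrite expr2 -{1}E mulr_suml; apply: ler_sum => u _.
rewrite -E mulr_sumr [leRHS](bigD1 u) //= lerDr.
by rewrite mulr_ge0 ?ler0n.
Qed.
Lemma pair_bound (A : {set V}) (c : V -> V -> R) (C : R) : 0 <= C ->
  (forall u w, u \in A -> w \in A -> w != u -> c u w <= C) ->
  \sum_u \sum_(w | w != u) ((u \in A)%:R * (w \in A)%:R) * c u w <= #|A|%:R ^+ 2 * C.
Proof.
move=> C0 H; apply: (@le_trans _ _ (\sum_u \sum_(w | w != u) ((u \in A)%:R * (w \in A)%:R) * C)).
  apply: ler_sum => u _; apply: ler_sum => w wu.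
  case: (boolP (u \in A)) => uA; last by rewrite !mul0r.
  case: (boolP (w \in A)) => wA; last by rewrite mulr0 !mul0r.
  by apply: ler_wpM2l; rewrite ?mulr1 ?ler01 // H.
under eq_bigr do rewrite -mulr_suml.
by rewrite -mulr_suml; apply: ler_wpM2r; rewrite // sum_mem2.
Qed.

Lemma FU_step U y : #|sp y| = m ->
  `|FU (U :\: sp y) - (FU U - \sum_u (u \in sp y)%:R * D1 U u)| <= m%:R ^+ 2 * (K / n ^+ 2).
Proof.
move=> ym; have := step_gen U y (fun _ => 1).
have -> : \sum_z fw (U :\: sp y) z * 1 = FU (U :\: sp y) by apply: eq_bigr => z _; rewrite mulr1.
have -> : \sum_z fw U z * 1 = FU U by apply: eq_bigr => z _; rewrite mulr1.
have -> : \sum_u (u \in sp y)%:R * \sum_z fw U z * ((u \in sp z)%:R * 1) =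
  \sum_u (u \in sp y)%:R * D1 U u.
  by apply: eq_bigr => u _; congr (_ * _); apply: eq_bigr => z _; rewrite mulr1.
move/le_trans; apply; rewrite -ym; apply: pair_bound.
  by rewrite divr_ge0 ?exprn_ge0 // ltW.
move=> u w _ _ wu; apply: le_trans (deg2 (_ : u != w)); last by rewrite eq_sym.
by apply: ler_sum => z _; rewrite normr1 mulr1.
Qed.
Lemma GU_step U y : 0 <= B -> #|sp y| = m ->
  `|GU (U :\: sp y) - (GU U - \sum_u (u \in sp y)%:R * Dpsi U u)| <= m%:R ^+ 2 * (B * K / n ^+ 2).
Proof.
move=> B0 ym; have := step_gen U y psi.
move/le_trans; apply; rewrite -ym; apply: pair_bound.
  by rewrite divr_ge0 ?exprn_ge0 ?mulr_ge0 // ltW.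
move=> u w _ _ wu; rewrite -mulrA.
apply: (@le_trans _ _ (B * \sum_z F z * ((u \in sp z)%:R * (w \in sp z)%:R))).
  rewrite mulr_sumr; apply: ler_sum => z _; rewrite [leLHS]mulrA [leLHS]mulrC; apply: ler_wpM2r; rewrite ?psi_le //.
  by rewrite !mulr_ge0 ?ler0n.
by apply: ler_wpM2l => //; apply: deg2; rewrite eq_sym.
Qed.
Lemma D1_step U y v : #|sp y| = m -> v \notin sp y ->
  `|D1 (U :\: sp y) v - (D1 U v - \sum_(u | u != v) (u \in sp y)%:R * D2 U u v)|
     <= m%:R ^+ 2 * (K / n ^+ 3).
Proof.
move=> ym vy; have := step_gen U y (fun z => (v \in sp z)%:R).
rewrite [X in `|_ - (_ - X)|](bigD1 v) //= (negbTE vy) mul0r add0r.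
move/le_trans; apply; rewrite -ym; apply: pair_bound.
  by rewrite divr_ge0 ?exprn_ge0 // ltW.
move=> u w uy wy wu; apply: le_trans (deg3 (_ : u != w) (_ : u != v) (_ : w != v)).
- by apply: ler_sum => z _; rewrite ger0_norm ?ler0n.
- by rewrite eq_sym.
- by apply: contraNneq vy => <-.
- by apply: contraNneq vy => <-.
Qed.

Lemma sum_sq_min (A : {set V}) (a : V -> R) (t : R) :
  \sum_(v in A) (a v - (\sum_(u in A) a u) / #|A|%:R) ^+ 2 <= \sum_(v in A) (a v - t) ^+ 2.
Proof.
case: (posnP #|A|) => [/eqP|A0].
  by rewrite cards_eq0 => /eqP ->; rewrite !big_set0.
set s := \sum_(u in A) a u; set N : R := #|A|%:R.
have N0 : 0 < N by rewrite ltr0n.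
have E c : \sum_(v in A) (a v - c) ^+ 2 = \sum_(v in A) a v ^+ 2 - 2 * c * s + N * c ^+ 2.
  rewrite (eq_bigr (fun v => a v ^+ 2 + ((- (2 * c)) * a v + c ^+ 2))); last by move=> v _; ring.
  by rewrite !big_split /= -mulr_sumr sumc -/s -/N; ring.
rewrite !E -subr_ge0.
have -> : \sum_(v in A) a v ^+ 2 - 2 * t * s + N * t ^+ 2 -
  (\sum_(v in A) a v ^+ 2 - 2 * (s / N) * s + N * (s / N) ^+ 2) = N * (t - s / N) ^+ 2.
  by field; rewrite gt_eqF.
by rewrite mulr_ge0 ?sqr_ge0 // ltW.
Qed.
(** The average minimises a sum of squares, so after a step the deviations may be measured from any
    convenient centre instead of the new average. *)
Lemma SU_min U t : SU U <= \sum_(v in U) (D1 U v - t) ^+ 2.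
Proof. by rewrite /SU; under eq_bigr do rewrite /Rd -sum_D1in; exact: sum_sq_min. Qed.

Lemma sum_Rd U : (0 < #|U|)%N -> \sum_(v in U) Rd U v = 0.
Proof.
move=> U0; rewrite sumrB sum_D1in sumc [X in _ - X]mulrC divfK ?subrr //.
by rewrite pnatr_eq0 -lt0n.
Qed.
Lemma sum_D1sq U : (0 < #|U|)%N ->
  \sum_u D1 U u ^+ 2 = (m%:R * FU U) ^+ 2 / #|U|%:R + SU U.
Proof.
move=> U0; rewrite -(@sum_in _ U); last by move=> v vU; rewrite D1_out ?expr0n.
have N0 : #|U|%:R != 0 :> R by rewrite pnatr_eq0 -lt0n.
set c := m%:R * FU U / #|U|%:R.
rewrite (eq_bigr (fun v => Rd U v ^+ 2 + (2 * c * Rd U v + c ^+ 2))); last by move=> v _; rewrite /Rd -/c; ring.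
rewrite !big_split /= -mulr_sumr sum_Rd // mulr0 add0r sumc.
by rewrite addrC; congr (_ + _); rewrite /c; field.
Qed.

Lemma sum_abs_sq U : (\sum_(v in U) `|Rd U v|) ^+ 2 <= n * SU U.
Proof.
have S0 : 0 <= SU U by apply: sumr_ge0 => v _; apply: sqr_ge0.
have Nn : #|U|%:R <= n by rewrite ler_nat max_card.
apply: le_trans (ler_wpM2r S0 Nn).
case: (posnP #|U|) => [/eqP|U0].
  by rewrite cards_eq0 => /eqP ->; rewrite !big_set0 expr0n cards0 mul0r.
set N : R := #|U|%:R; have N0 : 0 < N by rewrite ltr0n.
set s := \sum_(v in U) _.
have : 0 <= \sum_(v in U) (`|Rd U v| - s / N) ^+ 2 by apply: sumr_ge0 => v _; apply: sqr_ge0.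
rewrite (eq_bigr (fun v => Rd U v ^+ 2 + ((- (2 * (s / N))) * `|Rd U v| + (s / N) ^+ 2))); last first.
  by move=> v _; rewrite -[Rd U v ^+ 2]real_normK ?num_real //; ring.
rewrite !big_split /= -mulr_sumr sumc -/s -/N -/(SU U) => H.
rewrite -subr_ge0 (_ : _ - _ = N * (SU U + (- (2 * (s / N)) * s + N * (s / N) ^+ 2))); last by field; rewrite gt_eqF.
by rewrite mulr_ge0 // ltW.
Qed.
Lemma SU_ge0 U : 0 <= SU U.
Proof. by apply: sumr_ge0 => v _; apply: sqr_ge0. Qed.
(** Cauchy-Schwarz, then [s <= d + s^2 / d]. Absolute deviations enter the average reward linearly;
    a small [d] turns them into a small constant plus a multiple of the variance, which the
    potential absorbs. *)
Lemma sum_abs_le U (d : R) : 0 < d -> \sum_(v in U) `|Rd U v| <= d + n / d * SU U.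
Proof.
move=> d0; have := sum_abs_sq U; set s := \sum_(v in U) _; have S0 := SU_ge0 U.
move=> H; have : s <= d + s ^+ 2 / d.
  rewrite -subr_ge0 (_ : _ - _ = ((s - d / 2) ^+ 2 + 3/4 * d ^+2) / d); last by field; rewrite gt_eqF.
  rewrite divr_ge0 ?(ltW d0) // addr_ge0 ?sqr_ge0 // mulr_ge0 ?sqr_ge0 //; lra.
move/le_trans; apply; rewrite lerD2l [leRHS]mulrAC; apply: ler_wpM2r => //.
by rewrite invr_ge0 ltW.
Qed.

(** [CX / n^2] bounds the change of a deviation: actual loss, predicted loss and Bonferroni error,
    in this order. [CS1] and [CS2] govern the multiplicative and the additive growth of the variance
    in one step. *)
Definition CX : R := m%:R * K + m%:R ^+ 3 * K / eps ^+ 2 + m%:R ^+ 2 * K.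
Definition CS1 : R := 2 * K ^+ 2 + m%:R ^+ 2 * K.
Definition CS2 : R := m%:R ^+ 2 * K + CX ^+ 2.

Lemma D1_Rd U v : D1 U v = m%:R * FU U / #|U|%:R + Rd U v.
Proof. by rewrite /Rd addrC subrK. Qed.

Lemma sum_fwX U v : \sum_y fw U y * (\sum_(u | u != v) (u \in sp y)%:R * D2 U u v) =
  \sum_(u | u != v) D1 U u * D2 U u v.
Proof.
under eq_bigr do rewrite mulr_sumr.
rewrite exchange_big /=; apply: eq_bigr => u _; rewrite mulr_suml; apply: eq_bigr => y _.
by rewrite mulrA.
Qed.

Lemma S_step_y U y : (0 < m)%N -> eps * n <= #|U|%:R -> #|sp y| = m ->
  SU (U :\: sp y) <= \sum_(v in U) (Rd U v ^+ 2 +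
    2 * Rd U v * (m%:R ^+ 2 * (m%:R - 1) * FU U / #|U|%:R ^+ 2
        - \sum_(u | u != v) (u \in sp y)%:R * D2 U u v)
    + 2 * `|Rd U v| * (m%:R ^+ 2 * K / n ^+ 3) + CX ^+ 2 / n ^+ 4).
Proof.
move=> m0 UN ym; set N : R := #|U|%:R.
have N0 : 0 < N by apply: lt_le_trans UN; rewrite mulr_gt0.
have F0 := FU_ge0 U; have FK := FU_le U m0.
(* The loss of a vertex if all degrees were average: [m] removed vertices, each at average pair
   degree [m (m-1) FU / |U|^2]. *)
set De := m%:R ^+ 2 * (m%:R - 1) * FU U / N ^+ 2.
have m1 : 1 <= m%:R :> R by rewrite ler1n.
have De0 : 0 <= De by rewrite /De !mulr_ge0 ?invr_ge0 ?exprn_ge0 ?subr_ge0 ?FU_ge0 ?ler0n // ltW.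
have DeU : De <= m%:R ^+ 3 * K / eps ^+ 2 / n ^+ 2.
  rewrite /De -mulrA -[leRHS]mulrA -[leRHS]mulrA; apply: ler_pM.
  - by rewrite mulr_ge0 ?exprn_ge0 // subr_ge0.
  - by rewrite divr_ge0 ?exprn_ge0 // ltW.
  - by rewrite [leRHS]exprSr; apply: ler_wpM2l; rewrite ?exprn_ge0 // gerBl.
  - apply: ler_pM => //; first by rewrite invr_ge0 exprn_ge0 // ltW.
    rewrite -invfM lef_pV2 ?posrE ?mulr_gt0 ?exprn_gt0 // -exprMn.
    by apply: lerXn2r; rewrite // nnegrE ltW // mulr_gt0.
(* The centre is the old average minus the predicted loss. *)
set t := m%:R * FU U / N - De.
apply: le_trans (SU_min (U :\: sp y) t) _.
set T := fun v => (Rd U v ^+ 2 +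
    2 * Rd U v * (De - \sum_(u | u != v) (u \in sp y)%:R * D2 U u v)
    + 2 * `|Rd U v| * (m%:R ^+ 2 * K / n ^+ 3) + CX ^+ 2 / n ^+ 4).
have Xb v : `|De - \sum_(u | u != v) (u \in sp y)%:R * D2 U u v| + m%:R ^+ 2 * K / n ^+ 3 <= CX / n ^+ 2.
  have X0 : 0 <= \sum_(u | u != v) (u \in sp y)%:R * D2 U u v.
    by apply: sumr_ge0 => u _; rewrite mulr_ge0 ?ler0n ?D2_ge0.
  have XU : \sum_(u | u != v) (u \in sp y)%:R * D2 U u v <= m%:R * K / n ^+ 2.
    rewrite -ym -sum_mem -mulrA mulr_suml [leRHS](bigID (fun u => u != v)) /=.
    apply: (@le_trans _ _ (\sum_(u | u != v) (u \in sp y)%:R * (K / n ^+ 2))).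
      by apply: ler_sum => u uv; apply: ler_wpM2l; rewrite ?ler0n // D2_le.
    rewrite lerDl; apply: sumr_ge0 => u _.
    by rewrite mulr_ge0 ?ler0n // divr_ge0 ?exprn_ge0 // ltW.
  have e3 : m%:R ^+ 2 * K / n ^+ 3 <= m%:R ^+ 2 * K / n ^+ 2.
    apply: ler_wpM2l; first by rewrite mulr_ge0 ?exprn_ge0 // ltW.
    by rewrite lef_pV2 ?posrE ?exprn_gt0 // [leRHS]exprSr ler_peMr ?exprn_ge0 // ltW.
  have := ler_normB De (\sum_(u | u != v) (u \in sp y)%:R * D2 U u v).
  rewrite (ger0_norm De0) (ger0_norm X0) /CX !mulrDl; lra.
(* The vertices of [sp y] leave the sum on the left; nonnegativity allows them to be put back on the
   right. *)
have T0 v : 0 <= T v.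
  have := Xb v; rewrite /T; set xi := De - _; set e0 := m%:R ^+ 2 * K / n ^+ 3.
  have e00 : 0 <= e0 by rewrite divr_ge0 ?exprn_ge0 ?mulr_ge0 ?exprn_ge0 // ltW.
  move=> Xv; have q : xi ^+ 2 <= CX ^+ 2 / n ^+ 4.
    have -> : CX ^+ 2 / n ^+ 4 = (CX / n ^+ 2) ^+ 2 by field; rewrite gt_eqF.
    have nx := normr_ge0 xi.
    by rewrite -[xi ^+ 2]real_normK ?num_real //; apply: lerXn2r; rewrite ?nnegrE ?normr_ge0 //; lra.
  have := sqr_ge0 (Rd U v + xi); have : 0 <= 2 * `|Rd U v| * e0 by apply: mulr_ge0 => //; apply: mulr_ge0.
  by rewrite sqrrD; lra.
rewrite [leRHS](bigID (mem (sp y))) /=.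
apply: (@le_trans _ _ (\sum_(i in U | i \notin sp y) T i)); last first.
  by rewrite lerDr; apply: sumr_ge0 => v _; apply: T0.
rewrite [leLHS](eq_bigl (fun i => (i \in U) && (i \notin sp y))); last by move=> v; rewrite !inE andbC.
apply: ler_sum => v /andP[vU vy].
have := D1_step U ym vy; have := Xb v; rewrite /T; set xi := De - _.
set e0 := m%:R ^+ 2 * K / n ^+ 3; set X := \sum_(u | u != v) _ in xi *.
have -> : m%:R ^+ 2 * (K / n ^+ 3) = e0 by rewrite /e0 mulrA.
set e := D1 (U :\: sp y) v - (D1 U v - X) => Xv ee.
have -> : D1 (U :\: sp y) v - t = Rd U v + (xi + e).
  by rewrite /t /xi /e /Rd -/N; ring.
have q : (xi + e) ^+ 2 <= CX ^+ 2 / n ^+ 4.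
  have -> : CX ^+ 2 / n ^+ 4 = (CX / n ^+ 2) ^+ 2 by field; rewrite gt_eqF.
  rewrite -[(xi + e) ^+ 2]real_normK ?num_real //; apply: lerXn2r; rewrite ?nnegrE ?normr_ge0 //.
    by apply: le_trans Xv; rewrite addr_ge0 ?normr_ge0 //; exact: le_trans (normr_ge0 e) _.
  by apply: le_trans (ler_normD _ _) _; apply: le_trans Xv; rewrite lerD2l.
have h : Rd U v * e <= `|Rd U v| * e0.
  by apply: le_trans (ler_norm _) _; rewrite normrM; apply: ler_wpM2l.
rewrite sqrrD (_ : 2 * Rd U v * xi = 2 * (Rd U v * xi)); last by ring.
rewrite (_ : Rd U v * (xi + e) *+ 2 = 2 * (Rd U v * xi) + 2 * (Rd U v * e)); last by ring.
rewrite -[2 * `|_| * e0]mulrA; lra.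
Qed.

(** On average over [y] the linear terms cancel: the expected loss at [v] is [De], plus a
    nonnegative multiple of [Rd U v], which has the favourable sign and is dropped, plus a term [Q]
    weighted by the other deviations. By Cauchy-Schwarz the latter costs a factor [1 + O(1/n)], and
    the squared changes add [O(n^-3)]. *)
Lemma S_step U : (0 < m)%N -> eps * n <= #|U|%:R ->
  \sum_y fw U y * SU (U :\: sp y) <= FU U * (SU U + CS1 / n * SU U + CS2 / n ^+ 3).
Proof.
move=> m0 UN; set N : R := #|U|%:R.
have N0 : 0 < N by apply: lt_le_trans UN; rewrite mulr_gt0.
have Nn : N <= n by rewrite ler_nat max_card.
have FK := FU_ge UN; have F0 := FU_ge0 U; set De := m%:R ^+ 2 * (m%:R - 1) * FU U / N ^+ 2.
have m1 : 1 <= m%:R :> R by rewrite ler1n.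
apply: (@le_trans _ _ (\sum_y fw U y * \sum_(v in U) (Rd U v ^+ 2 +
    2 * Rd U v * (De - \sum_(u | u != v) (u \in sp y)%:R * D2 U u v)
    + 2 * `|Rd U v| * (m%:R ^+ 2 * K / n ^+ 3) + CX ^+ 2 / n ^+ 4))).
  apply: ler_sum => y _; case: (eqVneq (F y) 0) => [E|/F_card ym].
    by rewrite /fw E mulr0 !mul0r.
  by apply: ler_wpM2l; rewrite ?fw_ge0 // S_step_y.
under eq_bigr do rewrite mulr_sumr.
rewrite exchange_big /=.
set s := \sum_(v in U) `|Rd U v|.
apply: (@le_trans _ _ (\sum_(v in U) (FU U * Rd U v ^+ 2 + 2 * (K / n ^+ 2 * s) * `|Rd U v|
   + FU U * (2 * (m%:R ^+ 2 * K / n ^+ 3)) * `|Rd U v| + FU U * (CX ^+ 2 / n ^+ 4)))).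
  apply: ler_sum => v vU.
  rewrite (eq_bigr (fun y => fw U y * (Rd U v ^+ 2 + 2 * Rd U v * De + 2 * `|Rd U v| * (m%:R ^+ 2 * K / n ^+ 3) + CX ^+ 2 / n ^+ 4)
     + (- (2 * Rd U v)) * (fw U y * (\sum_(u | u != v) (u \in sp y)%:R * D2 U u v)))); last by move=> y _; ring.
  rewrite big_split /= -mulr_suml -mulr_sumr sum_fwX -/(FU U).
  rewrite (eq_bigr (fun u => m%:R * FU U / N * D2 U u v + Rd U u * D2 U u v)); last first.
    by move=> u _; rewrite D1_Rd -/N mulrDl.
  rewrite big_split /= -mulr_sumr sum_D2N D1_Rd -/N.
  set Q := \sum_(u | u != v) Rd U u * D2 U u v.
  have Qb : `|Q| <= K / n ^+ 2 * s.
    apply: le_trans (ler_norm_sum _ _ _) _; rewrite /s mulr_sumr.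
    rewrite (bigID (mem U)) /= [X in _ + X]big1 ?addr0; last first.
      by move=> u /andP[_ uU]; rewrite D2_out // mulr0 normr0.
    rewrite [leRHS](bigID (fun u => u != v)) /=.
    rewrite (eq_bigl (fun u => (u \in U) && (u != v))); last by move=> u; rewrite andbC.
    apply: ler_wpDr; first by apply: sumr_ge0 => u _; rewrite mulr_ge0 // divr_ge0 ?exprn_ge0 // ltW.
    apply: ler_sum => u /andP[_ uv]; rewrite normrM mulrC (ger0_norm (D2_ge0 _ _ _)).
    by apply: ler_wpM2r; rewrite // D2_le.
  have h1 : - (Rd U v * Q) <= `|Rd U v| * (K / n ^+ 2 * s).
    by apply: le_trans (ler_norm _) _; rewrite normrN normrM; apply: ler_wpM2l.
  have h2 : 0 <= m%:R * (m%:R - 1) * FU U / N * Rd U v ^+ 2.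
    rewrite mulr_ge0 ?sqr_ge0 // divr_ge0 ?(ltW N0) // mulr_ge0 // mulr_ge0 ?subr_ge0 //.
  rewrite -subr_ge0.
  set a3 := m%:R ^+ 2 * K / n ^+ 3; set a4 := CX ^+ 2 / n ^+ 4; set kk := K / n ^+ 2 * s in h1 *.
  rewrite (_ : _ - _ = 2 * (`|Rd U v| * kk + Rd U v * Q) + 2 * (m%:R * (m%:R - 1) * FU U / N * Rd U v ^+ 2)); last first.
    by rewrite /De; field; rewrite gt_eqF.
  by rewrite addr_ge0 // mulr_ge0 //; lra.
rewrite !big_split /= -!mulr_sumr -/(SU U) -/s sumc -/N.
have s0 : 0 <= s by apply: sumr_ge0 => v _; rewrite normr_ge0.
have S0 := SU_ge0 U.
have s2 := sum_abs_sq U; rewrite -/s in s2.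
have e1 : K / n ^+ 2 * s * s <= FU U * (K ^+ 2 / n * SU U).
  have : K / n ^+ 2 * s * s <= K / n * SU U.
    rewrite -mulrA -expr2 (_ : K / n * SU U = K / n ^+ 2 * (n * SU U)); last by field; rewrite gt_eqF.
    by apply: ler_wpM2l => //; rewrite divr_ge0 ?exprn_ge0 // ltW.
  move/le_trans; apply.
  rewrite (_ : FU U * _ = (FU U * K) * (K / n * SU U)); last by field; rewrite gt_eqF.
  apply: ler_peMl; first by rewrite mulr_ge0 // divr_ge0 // ltW.
  by rewrite -(@ler_pdivrMr _ _ _ _ K_gt0) mul1r.
have e2 : 2 / n ^+ 3 * s <= SU U / n + n ^- 3.
  have n0 := n_gt0.
  have q1 : 2 * s / n ^+ 3 <= s ^+ 2 / n ^+ 2 + n ^- 4.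
    rewrite -subr_ge0 (_ : _ - _ = (s / n - n ^- 2) ^+ 2); first exact: sqr_ge0.
    by field; rewrite gt_eqF.
  have q2 : s ^+ 2 / n ^+ 2 <= SU U / n.
    rewrite (_ : SU U / n = n * SU U / n ^+ 2); last by field; rewrite gt_eqF.
    by apply: ler_wpM2r; rewrite // invr_ge0 exprn_ge0 // ltW.
  have q3 : n ^- 4 <= n ^- 3.
    by rewrite lef_pV2 ?posrE ?exprn_gt0 // [leRHS]exprSr ler_peMr ?exprn_ge0 // ltW.
  have -> : 2 / n ^+ 3 * s = 2 * s / n ^+ 3 by ring.
  lra.
have e3 : N * (FU U * (CX ^+ 2 / n ^+ 4)) <= FU U * (CX ^+ 2 / n ^+ 3).
  rewrite mulrCA; apply: ler_wpM2l => //.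
  rewrite (_ : CX ^+ 2 / n ^+ 3 = n * (CX ^+ 2 / n ^+ 4)); last by field; rewrite gt_eqF.
  by apply: ler_wpM2r; rewrite // divr_ge0 ?sqr_ge0 ?exprn_ge0 // ltW.
have e4 : FU U * (2 * (m%:R ^+ 2 * K / n ^+ 3)) * s <= FU U * (m%:R ^+ 2 * K * (SU U / n + n ^- 3)).
  rewrite -mulrA; apply: ler_wpM2l => //.
  rewrite (_ : _ * s = m%:R ^+ 2 * K * (2 / n ^+ 3 * s)); last by ring.
  by apply: ler_wpM2l => //; rewrite mulr_ge0 ?exprn_ge0 // ltW.
rewrite /CS1 /CS2.
have -> : FU U * (SU U + (2 * K ^+ 2 + m%:R ^+ 2 * K) / n * SU U + (m%:R ^+ 2 * K + CX ^+ 2) / n ^+ 3) =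
  FU U * SU U + 2 * (FU U * (K ^+ 2 / n * SU U)) + FU U * (m%:R ^+ 2 * K * (SU U / n + n ^- 3)) + FU U * (CX ^+ 2 / n ^+ 3).
  by field; rewrite gt_eqF.
have -> : 2 * (K / n ^+ 2 * s) * s = 2 * (K / n ^+ 2 * s * s) by ring.
lra.
Qed.


Lemma FU_sub U y : FU (U :\: sp y) <= FU U.
Proof.
apply: ler_sum => z _; rewrite fw_setD -[leRHS]mulr1.
by apply: ler_wpM2l; rewrite ?fw_ge0 //; case: (_ == _).
Qed.
Lemma GU_sub U y : `|GU U - GU (U :\: sp y)| <= B * (FU U - FU (U :\: sp y)).
Proof.
rewrite -!sumrB mulr_sumr; apply: le_trans (ler_norm_sum _ _ _) _.
apply: ler_sum => z _; rewrite -mulrBl normrM [leLHS]mulrC.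
have d0 : 0 <= fw U z - fw (U :\: sp y) z.
  rewrite fw_setD -{1}[fw U z]mulr1 -mulrBr mulr_ge0 ?fw_ge0 //.
  by case: (_ == _); rewrite ?subrr ?subr0.
by rewrite (ger0_norm d0); apply: ler_wpM2r (psi_le z).
Qed.

Hypothesis n_large : 4 * m%:R ^+ 2 * K ^+ 2 <= n.
Hypothesis m_gt0 : (0 < m)%N.
Let m1 : 1 <= m%:R :> R. Proof. by rewrite ler1n. Qed.

Lemma sumD1_le U y : #|sp y| = m -> \sum_u (u \in sp y)%:R * D1 U u <= m%:R * (K / n).
Proof.
move=> ym; rewrite -ym -sum_mem mulr_suml; apply: ler_sum => u _.
by apply: ler_wpM2l; rewrite ?ler0n // D1_le.
Qed.
Lemma Ydiff_le U y : #|sp y| = m -> FU U - FU (U :\: sp y) <= 2 * m%:R ^+ 2 * K / n.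
Proof.
move=> ym; have := FU_step U ym; have := sumD1_le U ym.
rewrite ler_norml; set x := \sum_u _ => h /andP[h1 _].
have e1 : m%:R * (K / n) <= m%:R ^+ 2 * (K / n).
  by apply: ler_wpM2r; [rewrite divr_ge0 // ltW | rewrite expr2 ler_peMl // ler0n].
have e2 : m%:R ^+ 2 * (K / n ^+ 2) <= m%:R ^+ 2 * (K / n).
  apply: ler_wpM2l; first by rewrite exprn_ge0.
  apply: ler_wpM2l; first exact: ltW.
  by rewrite lef_pV2 ?posrE ?exprn_gt0 // expr2 ler_peMl // ltW.
have -> : 2 * m%:R ^+ 2 * K / n = 2 * (m%:R ^+ 2 * (K / n)) by ring.
lra.
Qed.
Lemma sum_fwD1 U (h : V -> R) : \sum_y fw U y * (\sum_u (u \in sp y)%:R * h u) = \sum_u D1 U u * h u.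
Proof.
under eq_bigr do rewrite mulr_sumr.
rewrite exchange_big /=; apply: eq_bigr => u _; rewrite mulr_suml; apply: eq_bigr => y _.
by rewrite mulrA.
Qed.
Lemma eps_setD U y : #|sp y| = m -> eps * n + m%:R <= #|U|%:R -> eps * n <= #|U :\: sp y|%:R.
Proof.
move=> ym UN; rewrite -(lerD2r m%:R); apply: le_trans UN _.
rewrite -natrD ler_nat -[in leqRHS]ym -[in leqLHS](cardsID (sp y) U) addnC leq_add2l.
by apply/subset_leq_card/subsetIr.
Qed.

Definition CF : R := m%:R ^+ 2 * K ^+ 2 + 8 * m%:R ^+ 4 * K ^+ 4.
(** The expected loss of [FU] is the sum of the squared degrees divided by [FU], that is
    [m^2 FU / |U|] plus [SU / FU]. Each loss is [O(1/n)] relative to [FU], so the logarithm may be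
    expanded to second order. *)
Lemma F_step U : eps * n + m%:R <= #|U|%:R ->
  FU U * (ln (FU U) - m%:R ^+ 2 / #|U|%:R - K ^+ 2 * SU U - CF / n ^+ 2) <=
  \sum_y fw U y * ln (FU (U :\: sp y)).
Proof.
move=> UN; have UN' : eps * n <= #|U|%:R by apply: le_trans UN; rewrite lerDl.
set N : R := #|U|%:R; set Fu := FU U.
have N0 : 0 < N by apply: lt_le_trans UN'; rewrite mulr_gt0.
have FK : K^-1 <= Fu := FU_ge UN'.
have F0 : 0 < Fu by apply: lt_le_trans FK; rewrite invr_gt0.
have U0 : (0 < #|U|)%N by rewrite -(ltr0n R).
have n0 := n_gt0.
have FK1 : 1 <= K * Fu by rewrite mulrC -ler_pdivrMr // mul1r.
apply: (@le_trans _ _ (\sum_y fw U y * (ln Fu - 8 * m%:R ^+ 4 * K ^+ 4 / n ^+ 2 -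
    (m%:R ^+ 2 * K / n ^+ 2 + \sum_u (u \in sp y)%:R * D1 U u) / Fu))).
  rewrite (eq_bigr (fun y => fw U y * (ln Fu - 8 * m%:R ^+ 4 * K ^+ 4 / n ^+ 2 - m%:R ^+ 2 * K / n ^+ 2 / Fu)
    + (- Fu^-1) * (fw U y * (\sum_u (u \in sp y)%:R * D1 U u)))); last first.
    by move=> y _; field; rewrite !gt_eqF.
  rewrite big_split /= -mulr_suml -mulr_sumr sum_fwD1 -/(FU U) -/Fu.
  rewrite (eq_bigr (fun u => D1 U u ^+ 2)) // sum_D1sq // -/Fu -/N.
  have S0 := SU_ge0 U; rewrite -subr_ge0 /CF.
  rewrite (_ : _ - _ = ((K * Fu) ^+ 2 - 1) * SU U / Fu + m%:R ^+ 2 * K / n ^+ 2 * (K * Fu - 1)); last first.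
    by field; rewrite !gt_eqF.
  have q : 1 <= (K * Fu) ^+ 2 by rewrite exprn_ege1.
  by rewrite addr_ge0 // !mulr_ge0 ?invr_ge0 ?exprn_ge0 // ?subr_ge0 // ltW.
apply: ler_sum => y _; case: (eqVneq (F y) 0) => [E|/F_card ym]; first by rewrite /fw E mulr0 !mul0r.
apply: ler_wpM2l; first exact: fw_ge0.
set F' := FU (U :\: sp y).
have F'0 : 0 < F' by apply: lt_le_trans (FU_ge (eps_setD ym UN)); rewrite invr_gt0.
have Y0 : 0 <= Fu - F' by rewrite subr_ge0 FU_sub.
have Y1 : Fu - F' <= 2 * m%:R ^+ 2 * K / n := Ydiff_le U ym.
have FVK : Fu^-1 <= K by rewrite -[K]invrK lef_pV2 ?posrE ?invr_gt0.
set a := (Fu - F') / Fu.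
have a0 : 0 <= a by rewrite divr_ge0 // ltW.
have a1 : a <= 2 * m%:R ^+ 2 * K ^+ 2 / n.
  rewrite (_ : _ / n = 2 * m%:R ^+ 2 * K / n * K); last by ring.
  by apply: ler_pM => //; rewrite invr_ge0 ltW.
have a2 : a <= 1 / 2.
  apply: le_trans a1 _; rewrite ler_pdivrMr //.
  have := n_large; rewrite -[4 * _ * _]mulrA -[2 * _ * _]mulrA; lra.
have -> : F' = Fu * (1 - a) by rewrite /a; field; rewrite gt_eqF.
rewrite lnM ?posrE //; last by lra.
have := ln_ge_sub a0 a2.
have q2 : 2 * a ^+ 2 <= 8 * m%:R ^+ 4 * K ^+ 4 / n ^+ 2.
  rewrite (_ : 8 * _ * _ / _ = 2 * (2 * m%:R ^+ 2 * K ^+ 2 / n) ^+ 2); last by field; rewrite gt_eqF.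
  by apply: ler_wpM2l => //; apply: lerXn2r; rewrite // nnegrE //; exact: le_trans a1.
have q1 : a <= (m%:R ^+ 2 * K / n ^+ 2 + \sum_u (u \in sp y)%:R * D1 U u) / Fu.
  apply: ler_wpM2r; first by rewrite invr_ge0 ltW.
  have := FU_step U ym; rewrite ler_norml -/Fu -/F' mulrA => /andP[h _]; lra.
lra.
Qed.

Definition gU U := GU U / FU U.
Definition CG : R := 8 * B * m%:R ^+ 4 * K ^+ 4 + 2 * B * m%:R ^+ 2 * K ^+ 2.
(** [gU] is the average log-reward of an available piece. To first order its expected change is
    proportional to the sum over [u] of the degree of [u] times [g * D1 U u - Dpsi U u]. The second
    factors sum to zero, so the average part of the degrees drops out and only the deviations
    contribute. *)
Lemma G_step U : 0 <= B -> eps * n + m%:R <= #|U|%:R ->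
  FU U * (gU U - CG / n ^+ 2 - 2 * B * K ^+ 3 / n * \sum_(u in U) `|Rd U u|) <=
  \sum_y fw U y * gU (U :\: sp y).
Proof.
move=> B0 UN; have UN' : eps * n <= #|U|%:R by apply: le_trans UN; rewrite lerDl.
set N : R := #|U|%:R; set Fu := FU U; set s := \sum_(u in U) _.
have N0 : 0 < N by apply: lt_le_trans UN'; rewrite mulr_gt0.
have FK : K^-1 <= Fu := FU_ge UN'.
have F0 : 0 < Fu by apply: lt_le_trans FK; rewrite invr_gt0.
have n0 := n_gt0.
have FK1 : 1 <= K * Fu by rewrite mulrC -ler_pdivrMr // mul1r.
have FVK : Fu^-1 <= K by rewrite -[K]invrK lef_pV2 ?posrE ?invr_gt0.
set g := gU U.
have gB : `|g| <= B.
  by rewrite /g /gU normrM normfV (ger0_norm (ltW F0)) ler_pdivrMr // GU_le.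
have gE : GU U = g * Fu by rewrite /g /gU divfK // gt_eqF.
apply: (@le_trans _ _ (\sum_y fw U y * (g - CG / n ^+ 2 +
    (\sum_u (u \in sp y)%:R * (g * D1 U u - Dpsi U u)) / Fu))).
  rewrite (eq_bigr (fun y => fw U y * (g - CG / n ^+ 2)
    + Fu^-1 * (fw U y * (\sum_u (u \in sp y)%:R * (g * D1 U u - Dpsi U u))))); last first.
    by move=> y _; ring.
  rewrite big_split /= -mulr_suml -mulr_sumr sum_fwD1 -/(FU U) -/Fu.
  set Q := \sum_u _.
  have Qb : `|Q| <= 2 * B * K / n * s.
    have -> : Q = \sum_(u in U) Rd U u * (g * D1 U u - Dpsi U u).
      rewrite /Q -(@sum_in _ U); last by move=> v vU; rewrite D1_out ?mul0r.
      rewrite (eq_bigr (fun u => m%:R * Fu / N * (g * D1 U u - Dpsi U u) + Rd U u * (g * D1 U u - Dpsi U u))).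
        rewrite big_split /= -mulr_sumr sumrB -mulr_sumr sum_D1in sum_Dpsiin gE -/Fu.
        by rewrite [X in X + _](_ : _ = 0) ?add0r //; ring.
      by move=> u _; rewrite -mulrDl {1}D1_Rd.
    apply: le_trans (ler_norm_sum _ _ _) _; rewrite /s mulr_sumr; apply: ler_sum => u uU.
    rewrite normrM mulrC; apply: ler_wpM2r => //.
    apply: le_trans (ler_normB _ _) _.
    have D0 := D1_ge0 U u; have DK := D1_le U u; have := Dpsi_le U u.
    rewrite normrM (ger0_norm D0) => h.
    have : `|g| * D1 U u <= B * (K / n) by apply: ler_pM.
    have : B * D1 U u <= B * (K / n) by apply: ler_wpM2l.
    rewrite (_ : 2 * B * K / n = 2 * (B * (K / n))); last by ring.
    lra.
  have s0 : 0 <= s by apply: sumr_ge0 => v _; rewrite normr_ge0.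
  have h : - Q <= 2 * B * K / n * s by apply: le_trans Qb; rewrite -normrN ler_norm.
  have h2 : Fu^-1 * - Q <= K * (2 * B * K / n * s).
    apply: (@le_trans _ _ (Fu^-1 * (2 * B * K / n * s))).
      by apply: ler_wpM2l; rewrite ?invr_ge0 // ltW.
    by apply: ler_wpM2r; rewrite // (le_trans _ Qb).
  have h3 : K * (2 * B * K / n * s) <= Fu * (2 * B * K ^+ 3 / n * s).
    rewrite (_ : Fu * _ = (K * Fu) * (K * (2 * B * K / n * s))); last by field; rewrite gt_eqF.
    apply: ler_peMl => //; rewrite !mulr_ge0 ?invr_ge0 // ltW //.
  rewrite mulrBr; lra.
apply: ler_sum => y _; case: (eqVneq (F y) 0) => [E|/F_card ym]; first by rewrite /fw E mulr0 !mul0r.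
apply: ler_wpM2l; first exact: fw_ge0.
set F' := FU (U :\: sp y); set G' := GU (U :\: sp y).
have F'K : K^-1 <= F' := FU_ge (eps_setD ym UN).
have F'0 : 0 < F' by apply: lt_le_trans F'K; rewrite invr_gt0.
have F'VK : F'^-1 <= K by rewrite -[K]invrK lef_pV2 ?posrE ?invr_gt0.
have Y0 : 0 <= Fu - F' by rewrite subr_ge0 FU_sub.
have Y1 : Fu - F' <= 2 * m%:R ^+ 2 * K / n := Ydiff_le U ym.
have Z1 : `|GU U - G'| <= B * (Fu - F') := GU_sub U y.
set W := g * (Fu - F') - (GU U - G').
have -> : gU (U :\: sp y) = g + W / Fu + W * (Fu - F') / (Fu * F').
  by rewrite /gU -/F' -/G' /W gE; field; rewrite !gt_eqF.
have WB : `|W| <= 2 * B * (Fu - F').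
  apply: le_trans (ler_normB _ _) _; rewrite normrM (ger0_norm Y0).
  have := ler_wpM2r Y0 gB; lra.
have t2 : `|W * (Fu - F') / (Fu * F')| <= 8 * B * m%:R ^+ 4 * K ^+ 4 / n ^+ 2.
  rewrite (_ : 8 * B * _ * _ / _ = 2 * B * (2 * m%:R ^+ 2 * K / n) * (2 * m%:R ^+ 2 * K / n) * (K * K)); last first.
    by field; rewrite gt_eqF.
  rewrite 2!normrM (ger0_norm Y0) [`|_^-1|]ger0_norm; last by rewrite invr_ge0 mulr_ge0 // ltW.
  rewrite invfM; apply: ler_pM; rewrite ?mulr_ge0 ?invr_ge0 ?(ltW F0) ?(ltW F'0) //.
    apply: ler_pM => //; apply: le_trans WB _; apply: ler_wpM2l => //.
    by rewrite mulr_ge0.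
  by apply: ler_pM; rewrite ?invr_ge0 // ltW.
have t1 : (\sum_u (u \in sp y)%:R * (g * D1 U u - Dpsi U u)) - 2 * B * m%:R ^+ 2 * K / n ^+ 2 <= W.
  have h1 := FU_step U ym; have h2 := GU_step U B0 ym.
  rewrite -/Fu -/F' in h1; rewrite -/G' in h2.
  rewrite (eq_bigr (fun u => g * ((u \in sp y)%:R * D1 U u) - (u \in sp y)%:R * Dpsi U u)); last by move=> u _; ring.
  rewrite sumrB -mulr_sumr; set x := \sum_u _ in h1 *; set xp := \sum_u _ in h2 *.
  have : `|g * (F' - (Fu - x))| <= B * (m%:R ^+ 2 * (K / n ^+ 2)) by rewrite normrM; apply: ler_pM.
  move: h2; rewrite !ler_norml /W => /andP[p1 p2] /andP[p3 p4].
  have e1 : m%:R ^+ 2 * (B * K / n ^+ 2) = B * (m%:R ^+ 2 * (K / n ^+ 2)) by ring.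
  have e2 : 2 * B * m%:R ^+ 2 * K / n ^+ 2 = 2 * (B * (m%:R ^+ 2 * (K / n ^+ 2))) by ring.
  move: p1 p2 p3 p4; rewrite e1 e2; nra.
have t3 : (\sum_u (u \in sp y)%:R * (g * D1 U u - Dpsi U u)) / Fu - 2 * B * m%:R ^+ 2 * K ^+ 2 / n ^+ 2 <= W / Fu.
  apply: (@le_trans _ _ (((\sum_u (u \in sp y)%:R * (g * D1 U u - Dpsi U u)) - 2 * B * m%:R ^+ 2 * K / n ^+ 2) / Fu)).
    rewrite mulrBl lerD2l lerN2 (_ : _ * K ^+ 2 / _ = 2 * B * m%:R ^+ 2 * K / n ^+ 2 * K); last by ring.
    by apply: ler_wpM2l => //; rewrite !mulr_ge0 ?invr_ge0 ?exprn_ge0 // ltW.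
  by apply: ler_wpM2r => //; rewrite invr_ge0 ltW.
have := lerNnormlW t2; rewrite /CG mulrDl; lra.
Qed.

(** [cc d j] is the coefficient of the variance in the potential with [j] steps to go. It pays for
    the variance terms of [F_step] and [G_step], multiplied by up to [n] remaining steps, and for
    the growth of the variance itself; [n ^+ 2 * Hc d] bounds the solution of this recursion.
    [errc d] is the other loss per step. *)
Definition Hc (d : R) : R := (K ^+ 2 + 2 * B * K ^+ 3 / d) * expR CS1.
Definition errc (d : R) : R := (CF + CG) / n + 2 * B * K ^+ 3 * d + Hc d * CS2 / n.
Fixpoint cc (d : R) (j : nat) : R :=
  if j is j'.+1 then cc d j' * (1 + CS1 / n) + n * (K ^+ 2 + 2 * B * K ^+ 3 / d) else 0.

Lemma CS1_ge0 : 0 <= CS1.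
Proof. by rewrite /CS1 addr_ge0 // !mulr_ge0 ?exprn_ge0 // ltW. Qed.
Lemma CS2_ge0 : 0 <= CS2.
Proof. by rewrite /CS2 addr_ge0 ?sqr_ge0 // !mulr_ge0 ?exprn_ge0 // ltW. Qed.
Lemma cc_le (d : R) j : 0 <= B -> 0 < d ->
  cc d j <= j%:R * (n * (K ^+ 2 + 2 * B * K ^+ 3 / d)) * expR (CS1 * j%:R / n).
Proof.
move=> B0 d0; set A := n * _; have A0 : 0 <= A.
  by rewrite !mulr_ge0 ?addr_ge0 ?mulr_ge0 ?invr_ge0 ?exprn_ge0 // ltW.
have c0 := CS1_ge0; have n0 := n_gt0.
elim: j => [|j IH] /=; first by rewrite mul0r mul0r.
apply: (@le_trans _ _ (j%:R * A * expR (CS1 * j%:R / n) * expR (CS1 / n) + A)).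
  rewrite lerD2r; apply: (@le_trans _ _ (j%:R * A * expR (CS1 * j%:R / n) * (1 + CS1 / n))).
    by apply: ler_wpM2r => //; rewrite addr_ge0 // divr_ge0 // ltW.
  by apply: ler_wpM2l (expR_ge1Dx _); apply: mulr_ge0; rewrite ?expR_ge0 // mulr_ge0.
set E := expR (CS1 * j.+1%:R / n).
have -> : j%:R * A * expR (CS1 * j%:R / n) * expR (CS1 / n) = j%:R * A * E.
  by rewrite -mulrA -expRD; congr (_ * expR _); rewrite -natr1; ring.
have -> : j.+1%:R * A * E = j%:R * A * E + A * E by rewrite -natr1; ring.
rewrite lerD2l.
apply: ler_peMr => //; rewrite -[leLHS]expR0 ler_expR divr_ge0 ?(ltW n0) // mulr_ge0 //.
Qed.
Lemma cc_ge0 (d : R) j : 0 <= B -> 0 < d -> 0 <= cc d j.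
Proof.
move=> B0 d0; elim: j => //= j IH; have h1 : 0 <= 1 + CS1 / n by rewrite addr_ge0 // divr_ge0 ?CS1_ge0 // ltW.
have h2 : 0 <= K ^+ 2 + 2 * B * K ^+ 3 / d by rewrite !(addr_ge0, mulr_ge0, exprn_ge0) ?invr_ge0 // ltW.
by apply: addr_ge0; apply: mulr_ge0 => //; apply: ltW.
Qed.
Lemma cc_leH (d : R) j : 0 <= B -> 0 < d -> j%:R <= n -> cc d j <= n ^+ 2 * Hc d.
Proof.
move=> B0 d0 jn; apply: le_trans (cc_le j B0 d0) _.
have n0 := n_gt0; set A := K ^+ 2 + _; have A0 : 0 <= A.
  by rewrite ?addr_ge0 ?mulr_ge0 ?invr_ge0 ?exprn_ge0 // ltW.
rewrite (_ : n ^+ 2 * Hc d = n * (n * A) * expR CS1); last by rewrite /Hc -/A; ring.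
apply: ler_pM; rewrite ?expR_ge0 ?mulr_ge0 // ?(ltW n0) //.
  by apply: ler_wpM2r; rewrite // mulr_ge0 // ltW.
by rewrite ler_expR -mulrA ler_piMr ?CS1_ge0 // ler_pdivrMr // mul1r.
Qed.

Variables (Om : {set V} -> nat -> R) (om0 : R) (N0 : nat).
Hypothesis om0_gt0 : 0 < om0.
Hypothesis N0_ge : eps * n <= N0%:R.
Hypothesis Om0 : forall U, #|U| = N0 -> om0 <= Om U 0.
Hypothesis OmS : forall U j, #|U| = (N0 + j.+1 * m)%N ->
  \sum_y fw U y * (expR (psi y) * Om (U :\: sp y) j) <= Om U j.+1.

(** Induction on the number of steps to go: the next piece is drawn with probability proportional to
    [fw U], the induction hypothesis applies to the rest, and [jensen_exp] replaces the mean of the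
    exponential by the exponential of the mean, which the three one-step estimates control. *)
Lemma potential_step (d : R) U j : 0 <= B -> 0 < d -> #|U| = (N0 + j * m)%N ->
  om0 * expR (j%:R * (ln (FU U) + gU U) - j%:R * (m%:R + errc d) - cc d j * SU U) <= Om U j.
Proof.
move=> B0 d0; have n0 := n_gt0.
elim: j U => [|j IH] U cU.
  by rewrite !mul0r !subr0 expR0 mulr1; apply: Om0; rewrite cU addn0.
have UN : eps * n + m%:R <= #|U|%:R.
  by rewrite cU mulSn natrD lerD // natrD lerDl ler0n.
have UN' : eps * n <= #|U|%:R by apply: le_trans UN; rewrite lerDl.
have FK : K^-1 <= FU U := FU_ge UN'.
have F0 : 0 < FU U by apply: lt_le_trans FK; rewrite invr_gt0.
have Nn : (#|U| <= #|V|)%N by apply: max_card.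
have jn : j%:R <= n.
  rewrite ler_nat; apply: leq_trans Nn; rewrite cU mulSn.
  by apply: leq_trans (leq_pmulr j m_gt0) _; rewrite addnA leq_addl.
have N0' : 0 < #|U|%:R :> R by apply: lt_le_trans UN'; rewrite mulr_gt0.
(* A step lowers [ln FU] by about [m^2 / |U|], which counts in each of the [j] steps to come. As
   [|U|] is at least [j * m], this costs at most [m] per step and at most [n] altogether: the factor
   [exp (- n)] of Stirling's formula. *)
have jm : j%:R * (m%:R ^+ 2 / #|U|%:R) <= m%:R :> R.
  rewrite mulrA ler_pdivrMr // expr2 mulrA [leRHS]mulrC; apply: ler_wpM2r => //.
  by rewrite -natrM ler_nat cU mulSn addnA leq_addl.
apply: le_trans (OmS cU).
set J := fun y => psi y + (j%:R * (ln (FU (U :\: sp y)) + gU (U :\: sp y)) - j%:R * (m%:R + errc d) - cc d j * SU (U :\: sp y)).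
apply: (@le_trans _ _ (om0 * \sum_y fw U y * expR (J y))); last first.
  rewrite mulr_sumr; apply: ler_sum => y _; rewrite mulrCA.
  case: (eqVneq (fw U y) 0) => [->|fy]; first by rewrite !mul0r.
  have [ym yU] : #|sp y| = m /\ sp y \subset U.
    move: fy; rewrite /fw mulf_eq0 negb_or => /andP[+ /F_card ->].
    by case: (_ \subset _); rewrite ?eqxx.
  apply: ler_wpM2l; first exact: fw_ge0.
  rewrite expRD mulrCA; apply: ler_wpM2l; first exact: expR_ge0.
  apply: IH; apply/eqP; rewrite -(eqn_add2l m) -[X in (X + _ == _)%N]ym.
  have := cardsID (sp y) U; rewrite (finset.setIidPr yU) => ->.
  by rewrite cU mulSn addnCA.
apply: ler_wpM2l; first exact: ltW.
apply: le_trans (jensen_exp J (fw_ge0 U) F0).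
have FE : FU U = expR (ln (FU U)) by rewrite lnK ?posrE.
rewrite -/(FU U) [X in _ <= X * _]FE -expRD ler_expR.
have F1 := F_step UN; have G1 := G_step B0 UN; have S1 := S_step m_gt0 UN'.
have -> : \sum_y fw U y * J y = GU U + j%:R * (\sum_y fw U y * ln (FU (U :\: sp y))
   + \sum_y fw U y * gU (U :\: sp y)) - j%:R * (m%:R + errc d) * FU U - cc d j * \sum_y fw U y * SU (U :\: sp y).
  rewrite /GU /FU mulrDr !mulr_sumr -!big_split /= -!sumrB; apply: eq_bigr => y _.
  by rewrite /J; ring.
set Fu := FU U in F1 G1 S1 FK F0 *; set S := SU U in F1 S1 *; set s := \sum_(u in U) _ in G1.
have S0 : 0 <= S := SU_ge0 U.
have j0 : 0 <= j%:R :> R by rewrite ler0n.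
have c0 := cc_ge0 j B0 d0; have cH := cc_leH B0 d0 jn.
rewrite -(@ler_pM2r _ Fu) // [leRHS]mulrDl divfK ?gt_eqF //.
have e1 := ler_wpM2l j0 F1; have e2 := ler_wpM2l j0 G1; have e3 := ler_wpM2l c0 S1.
have sd := sum_abs_le U d0; rewrite -/s -/S in sd.
have Gg : GU U = gU U * Fu by rewrite /gU divfK // gt_eqF.
apply: (@le_trans _ _ (GU U + (j%:R * (Fu * (ln Fu - m%:R ^+ 2 / #|U|%:R - K ^+ 2 * S - CF / n ^+ 2)) +
   j%:R * (Fu * (gU U - CG / n ^+ 2 - 2 * B * K ^+ 3 / n * s))) - j%:R * (m%:R + errc d) * Fu
   - cc d j * (Fu * (S + CS1 / n * S + CS2 / n ^+ 3)) + ln Fu * Fu)); last by lra.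
have X1 : j%:R * (K ^+ 2 * S) <= n * (K ^+ 2 * S) by apply: ler_wpM2r => //; rewrite mulr_ge0 // exprn_ge0 // ltW.
have X2 : j%:R * ((CF + CG) / n ^+ 2) <= (CF + CG) / n.
  rewrite (_ : (CF + CG) / n = n * ((CF + CG) / n ^+ 2)); last by field; rewrite gt_eqF.
  apply: ler_wpM2r => //; rewrite /CF /CG !(divr_ge0,addr_ge0,mulr_ge0,exprn_ge0) // ltW //.
have X3 : j%:R * (2 * B * K ^+ 3 / n * s) <= 2 * B * K ^+ 3 * (d + n / d * S).
  apply: (@le_trans _ _ (n * (2 * B * K ^+ 3 / n * s))).
    apply: ler_wpM2r => //; rewrite !mulr_ge0 ?invr_ge0 ?exprn_ge0 // ?(ltW n0) ?(ltW K_gt0) //.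
    by apply: sumr_ge0 => v _; rewrite normr_ge0.
  rewrite (_ : n * _ = 2 * B * K ^+ 3 * s); last by field; rewrite gt_eqF.
  by apply: ler_wpM2l => //; rewrite !mulr_ge0 ?exprn_ge0 // ltW.
have X4 : cc d j * (CS2 / n ^+ 3) <= Hc d * CS2 / n.
  rewrite (_ : Hc d * CS2 / n = n ^+ 2 * Hc d * (CS2 / n ^+ 3)); last by field; rewrite gt_eqF.
  by apply: ler_wpM2r => //; rewrite divr_ge0 ?CS2_ge0 ?exprn_ge0 // ltW.
rewrite -subr_ge0 Gg /= /errc -[j.+1%:R]natr1.
rewrite (_ : _ - _ = Fu * ((m%:R - j%:R * (m%:R ^+ 2 / #|U|%:R)) + (n * (K ^+ 2 * S) - j%:R * (K ^+ 2 * S)) +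
   ((CF + CG) / n - j%:R * ((CF + CG) / n ^+ 2)) + (2 * B * K ^+ 3 * (d + n / d * S) - j%:R * (2 * B * K ^+ 3 / n * s))
   + (Hc d * CS2 / n - cc d j * (CS2 / n ^+ 3)))); last first.
  by field; rewrite !gt_eqF.
apply: mulr_ge0; first exact: ltW.
do 4!(apply: addr_ge0; last by rewrite subr_ge0).
by rewrite subr_ge0.
Qed.

(** The initial variance is [O(n^-3)] and its coefficient [O(n^2)], so it costs only [O(1/n)]. *)
Lemma potential_main (d : R) T : 0 <= B -> 0 < d -> #|V| = (N0 + T * m)%N -> SU [set: V] <= K / n ^+ 3 ->
  om0 * expR (T%:R * (ln (FU [set: V]) + gU [set: V]) - n - n * errc d - Hc d * K / n) <= Om [set: V] T.
Proof.
move=> B0 d0 cV SV; have n0 := n_gt0.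
apply: le_trans (potential_step B0 d0 _); last by rewrite cardsT.
apply: ler_wpM2l; first exact: ltW.
have T1 : T%:R * m%:R <= n by rewrite -natrM ler_nat cV leq_addl.
have T2 : T%:R <= n by apply: le_trans T1; rewrite ler_peMr ?ler0n.
have e0 : 0 <= errc d.
  rewrite /errc /Hc !addr_ge0 // !mulr_ge0 ?invr_ge0 ?expR_ge0 ?CS2_ge0 ?exprn_ge0 // ?(ltW n0) ?(ltW K_gt0) ?(ltW d0) //.
    rewrite /CF /CG !(divr_ge0,addr_ge0,mulr_ge0,exprn_ge0) // ltW //.
  by rewrite !(addr_ge0,mulr_ge0,exprn_ge0) ?invr_ge0 // ltW.
have e1 := ler_wpM2r e0 T2.
have e2 : cc d T * SU [set: V] <= Hc d * K / n.
  rewrite (_ : Hc d * K / n = n ^+ 2 * Hc d * (K / n ^+ 3)); last by field; rewrite gt_eqF.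
  by apply: ler_pM; rewrite ?SU_ge0 ?cc_ge0 // cc_leH.
rewrite ler_expR; lra.
Qed.
End Potential.

(** * Chains with prescribed window marginals *)

Section Words.
Variables (R : realType) (V : finType).
Implicit Types (A : {set V}) (f g : seq V -> R) (s t : seq V).

(** Sum over all words of length [n] with letters in [A], repetitions included. Recursion on the
    length lets words be split and joined without dependent types; [wsum_tuple] is the bridge to
    tuples. *)
Fixpoint wsum A n f : R :=
  if n is n'.+1 then \sum_(x in A) wsum A n' (fun s => f (x :: s)) else f [::].

Lemma wsumD A a b f :
  wsum A (a + b) f = wsum A a (fun s => wsum A b (fun t => f (s ++ t))).
Proof.
elim: a f => [|a IH] f //=; apply: eq_bigr => x _; exact: IH.
Qed.
Lemma eq_wsum A n f g :
  (forall s, size s = n -> all (mem A) s -> f s = g s) -> wsum A n f = wsum A n g.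
Proof.
elim: n f g => [|n IH] f g H /=; first exact: H.
apply: eq_bigr => x xA; apply: IH => s sn sA; apply: H; rewrite /= ?sn // sA andbT.
exact: xA.
Qed.
Lemma ler_wsum A n f g :
  (forall s, size s = n -> all (mem A) s -> f s <= g s) -> wsum A n f <= wsum A n g.
Proof.
elim: n f g => [|n IH] f g H /=; first exact: H.
apply: ler_sum => x xA; apply: IH => s sn sA; apply: H; rewrite /= ?sn // sA andbT.
exact: xA.
Qed.
Lemma wsum0 A n : wsum A n (fun=> 0) = 0.
Proof. by elim: n => //= n IH; rewrite big1. Qed.
Lemma wsum_ge0 A n f :
  (forall s, size s = n -> all (mem A) s -> 0 <= f s) -> 0 <= wsum A n f.
Proof. by move=> H; rewrite -(wsum0 A n); apply: ler_wsum. Qed.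
Lemma wsumZ A n c f : wsum A n (fun s => c * f s) = c * wsum A n f.
Proof. by elim: n f => //= n IH f; rewrite mulr_sumr; apply: eq_bigr => x _; rewrite IH. Qed.
Lemma wsumZr A n c f : wsum A n (fun s => f s * c) = wsum A n f * c.
Proof. by rewrite mulrC -wsumZ; apply: eq_wsum => s _ _; rewrite mulrC. Qed.
Lemma wsum_add A n f g : wsum A n (fun s => f s + g s) = wsum A n f + wsum A n g.
Proof. by elim: n f g => //= n IH f g; rewrite -big_split; apply: eq_bigr => x _; rewrite IH. Qed.
Lemma wsum_sum A n (I : Type) (r : seq I) (P : pred I) (F : I -> seq V -> R) :
  wsum A n (fun s => \sum_(i <- r | P i) F i s) = \sum_(i <- r | P i) wsum A n (F i).
Proof.
elim: n F => //= n IH F; rewrite exchange_big /=; apply: eq_bigr => x _; exact: IH.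
Qed.
Lemma wsumC A n c : wsum A n (fun=> c) = #|A|%:R ^+ n * c.
Proof.
elim: n => [|n IH] /=; first by rewrite expr0 mul1r.
by rewrite IH sumr_const -[LHS]mulr_natl exprS mulrA.
Qed.
Lemma wsum_exch A B a b (h : seq V -> seq V -> R) :
  wsum A a (fun s => wsum B b (fun t => h s t)) = wsum B b (fun t => wsum A a (fun s => h s t)).
Proof.
elim: a h => //= a IH h; rewrite wsum_sum; apply: eq_bigr => x _; exact: IH.
Qed.
Lemma wsum_rot A n j f : wsum A n (fun s => f (rot j s)) = wsum A n f.
Proof.
case: (leqP j n) => jn; last by apply: eq_wsum => s sn _; rewrite rot_oversize // sn ltnW.
rewrite -(subnKC jn) wsumD [RHS](_ : _ = wsum A (n - j + j) f); last by rewrite addnC.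
rewrite wsumD wsum_exch; apply: eq_wsum => t tn _; apply: eq_wsum => s sn _.
by congr f; rewrite -sn rot_size_cat.
Qed.
Lemma wsum_tuple n f : wsum [set: V] n f = \sum_(t : n.-tuple V) f t.
Proof.
elim: n f => [|n IH] f /=.
  by rewrite (big_pred1 [tuple]) // => t; apply/esym/eqP; exact: tuple0.
rewrite (eq_bigl xpredT); last by move=> x; rewrite inE.
under eq_bigr do rewrite IH.
rewrite pair_big /= (reindex (fun p : V * n.-tuple V => [tuple of p.1 :: p.2])) //=.
exists (fun t : n.+1.-tuple V => (thead t, [tuple of behead t])) => [[x t] _|t _] /=.
  by congr (_, _); apply: val_inj.
by rewrite -tuple_eta.
Qed.

Lemma card_uniq_tuples_set n (e : {set V}) : #|e| = n ->
  #|[set t : n.-tuple V | uniq t & [set v in t] == e]| = n`!.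
Proof.
move=> en; have := card_uniq_tuples n (mem e); rewrite en ffactnn => <-.
apply: eq_card => t; rewrite !inE andbC; case: (boolP (uniq t)) => ut; rewrite ?andbF ?andbT //.
apply/eqP/allP => [<- v|H]; first by rewrite /= inE.
apply/eqP; rewrite eqEcard; apply/andP; split.
  by apply/fintype.subsetP => v; rewrite inE => /H.
by rewrite en cardsE (card_uniqP ut) size_tuple.
Qed.
Lemma wsum_uniq_set n (f : {set V} -> R) :
  wsum [set: V] n (fun s => (uniq s)%:R * f [set v in s]) = n`!%:R * \sum_(e : {set V} | #|e| == n) f e.
Proof.
rewrite wsum_tuple (bigID (fun t : n.-tuple V => uniq t)) /= [X in _ + X]big1 ?addr0; last first.
  by move=> t /negbTE ->; rewrite mul0r.
rewrite (partition_big (fun t : n.-tuple V => [set v in t]) (fun e : {set V} => #|e| == n)) /=; last first.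
  by move=> t ut; rewrite cardsE (card_uniqP ut) size_tuple.
rewrite mulr_sumr; apply: eq_bigr => e /eqP en.
rewrite (eq_bigr (fun=> f e)); last by move=> t /andP[-> /eqP ->]; rewrite mul1r.
rewrite sumr_const -(card_uniq_tuples_set en) mulr_natl; congr (_ *+ _).
by apply: eq_card => t; rewrite !inE.
Qed.
End Words.

Section Chain.
Variables (R : realType) (V : finType) (l q : nat) (g : seq V -> R).
Let n : R := #|V|%:R.
Let k := (q + l)%N.
Hypothesis V_gt0 : (0 < #|V|)%N.
Hypothesis g_ge0 : forall s, 0 <= g s.
Hypothesis g_perm : forall s t, perm_eq s t -> g s = g t.
Local Notation ws := (wsum [set: V]).

(** Densities are relative to the uniform measure, so a density of words of length [j] has total
    mass [n ^+ j], and a marginal is an average over the other letters. *)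
Definition left_marginal (a : seq V) : R := n ^- q * ws q (fun b => g (a ++ b)).
(** Density of a Markov chain read from right to left: the last [l] letters follow the marginal, and
    [q] letters at a time are put in front with conditional density [g / left_marginal]. Division by
    a vanishing marginal does no harm, since [g] vanishes there too. *)
Fixpoint Pd (t : nat) (y : seq V) : R :=
  if t is t'.+1 then g (take k y) / left_marginal (take l (drop q y)) * Pd t' (drop q y) else left_marginal y.

Let n_gt0 : 0 < n. Proof. by rewrite ltr0n. Qed.
Let nq_neq0 : n ^+ q != 0. Proof. by rewrite expf_neq0 // gt_eqF. Qed.

Lemma gl_ge0 a : 0 <= left_marginal a.
Proof. by rewrite mulr_ge0 ?invr_ge0 ?exprn_ge0 ?(ltW n_gt0) // wsum_ge0. Qed.
Lemma Pd_ge0 t y : 0 <= Pd t y.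
Proof. by elim: t y => [|t IH] y /=; rewrite ?gl_ge0 // !mulr_ge0 ?invr_ge0 ?gl_ge0. Qed.
Lemma ws_ge_term m f (s : seq V) : (forall s, 0 <= f s) -> size s = m -> f s <= ws m f :> R.
Proof.
elim: m f s => [|m IH] f [|x s] //= f0 [sm].
rewrite (bigD1 x) ?inE //=; apply: ler_wpDr.
  by apply: sumr_ge0 => v _; apply: wsum_ge0.
by apply: (IH (fun s => f (x :: s))).
Qed.
Lemma gl_eq0 a b : size b = q -> left_marginal a = 0 -> g (a ++ b) = 0.
Proof.
move=> bq /eqP; rewrite mulf_eq0 invr_eq0 (negbTE nq_neq0) /= => /eqP E.
apply/eqP; rewrite eq_le g_ge0 andbT -E.
exact: (@ws_ge_term q (fun b => g (a ++ b))).
Qed.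
Lemma gl_eq0' a b : size b = q -> left_marginal a = 0 -> g (b ++ a) = 0.
Proof. by move=> bq a0; rewrite (g_perm (_ : perm_eq _ (a ++ b))) ?gl_eq0 // perm_catC. Qed.
Lemma ws_g_left a : ws q (fun b => g (b ++ a)) = n ^+ q * left_marginal a.
Proof.
rewrite mulrA mulfV // mul1r; apply: eq_wsum => b _ _.
by apply: g_perm; rewrite perm_catC.
Qed.

Lemma Pd_cat t a b c : size a = l -> size b = q ->
  Pd t.+1 (b ++ a ++ c) = g (b ++ a) / left_marginal a * Pd t (a ++ c).
Proof.
move=> al bq /=.
have h1 : drop q (b ++ a ++ c) = a ++ c by rewrite -bq drop_size_cat.
have h2 : take l (a ++ c) = a by rewrite -al take_size_cat.
have h3 : take k (b ++ a ++ c) = b ++ a.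
  by rewrite catA (_ : k = size (b ++ a)) ?take_size_cat // size_cat al bq.
by rewrite h1 h2 h3.
Qed.
Lemma Pd_cat' t s c : size s = k ->
  Pd t.+1 (s ++ c) = g s / left_marginal (drop q s) * Pd t (drop q s ++ c).
Proof.
move=> sk; have sa : size (drop q s) = l by rewrite size_drop sk /k addKn.
have sb : size (take q s) = q by rewrite size_takel // sk /k leq_addr.
by have := Pd_cat t c sa sb; rewrite catA cat_take_drop.
Qed.
Lemma gl_drop_eq0 s : size s = k -> left_marginal (drop q s) = 0 -> g s = 0.
Proof.
move=> sk; have sb : size (take q s) = q by rewrite size_takel // sk /k leq_addr.
by move/(gl_eq0' sb); rewrite cat_take_drop.
Qed.

(** The first [l] letters again have density [left_marginal]: the chain is stationary, since by
    symmetry [g] has the same marginal on its first and on its last [l] letters. *)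
Lemma Pd_right t a : size a = l ->
  ws (t * q) (fun c => Pd t (a ++ c)) = n ^+ (t * q) * left_marginal a.
Proof.
elim: t a => [|t IH] a al; first by rewrite /= cats0 expr0 mul1r.
rewrite mulSn wsumD.
rewrite (@eq_wsum _ _ _ q _ (fun b => n ^+ (t * q) * g (a ++ b))); last first.
  move=> b bq _; set y := a ++ b.
  have yk : size y = k by rewrite size_cat al bq addnC.
  have sa : size (drop q y) = l by rewrite size_drop yk /k addKn.
  rewrite (@eq_wsum _ _ _ (t * q) _ (fun c => g y / left_marginal (drop q y) * Pd t (drop q y ++ c))); last first.
    by move=> c _ _; rewrite catA -/y Pd_cat'.
  rewrite wsumZ IH //.
  case: (eqVneq (left_marginal (drop q y)) 0) => [E|E]; last by field.
  by rewrite gl_drop_eq0 // !(mulr0, mul0r).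
by rewrite wsumZ exprD [n ^+ q * _]mulrC -mulrA mulVKf.
Qed.
Lemma Pd_left t y : size y = (l + t * q)%N ->
  ws q (fun b => Pd t.+1 (b ++ y)) = n ^+ q * Pd t y.
Proof.
move=> ys; have al : size (take l y) = l by rewrite size_takel // ys leq_addr.
rewrite (@eq_wsum _ _ _ q _ (fun b => g (b ++ take l y) * ((left_marginal (take l y))^-1 * Pd t y))); last first.
  by move=> b bq _; rewrite -{1}(cat_take_drop l y) Pd_cat // cat_take_drop mulrA.
rewrite wsumZr ws_g_left -[LHS]mulrA; congr (_ * _).
case: (eqVneq (left_marginal (take l y)) 0) => [E|E]; last by rewrite mulVKf.
rewrite E mul0r; case: t ys => [|t] ys /=.
  by move: E; rewrite take_oversize // ys mul0n addn0.
rewrite (_ : take k y = take l y ++ drop l (take k y)); last first.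
  by rewrite -{1}(cat_take_drop l (take k y)) take_takel // /k leq_addl.
rewrite gl_eq0 ?mul0r // size_drop size_takel ?/k ?addnK //.
by rewrite ys mulSn; lia.
Qed.

(** The letters left of the window are summed out by [Pd_left], those right of it by [Pd_right]. *)
Lemma window_marginal t i (phi : seq V -> R) : (i < t)%N ->
  ws (l + t * q) (fun y => Pd t y * phi (take k (drop (i * q) y))) =
  n ^+ (t.-1 * q) * ws k (fun s => g s * phi s).
Proof.
elim: i t => [|i IH] [|t] // it.
  rewrite mulSn addnA [(l + q)%N]addnC -/k wsumD -wsumZ; apply: eq_wsum => s sk _.
  have sa : size (drop q s) = l by rewrite size_drop sk /k addKn.
  have sb : size (take q s) = q by rewrite size_takel // sk /k leq_addr.
  rewrite (@eq_wsum _ _ _ (t * q) _ (fun c => g s / left_marginal (drop q s) * phi s * Pd t (drop q s ++ c))); last first.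
    move=> c _ _; rewrite mul0n drop0 -[in take _ _]sk take_size_cat // Pd_cat' //; ring.
  rewrite wsumZ Pd_right //.
  case: (eqVneq (left_marginal (drop q s)) 0) => [E|E]; last by field.
  by rewrite gl_drop_eq0 // !(mulr0, mul0r).
rewrite mulSn addnCA wsumD wsum_exch.
rewrite (@eq_wsum _ _ _ (l + t * q) _ (fun y => n ^+ q * (Pd t y * phi (take k (drop (i * q) y))))); last first.
  move=> y ys _; rewrite mulrA -Pd_left // -wsumZr; apply: eq_wsum => b bq _.
  by rewrite mulSnr -drop_drop -[in drop q _]bq drop_size_cat.
rewrite wsumZ IH //= mulrA -exprD -mulSn; case: t it {IH} => // t _.
Qed.

Lemma coord_marginal v j : (j < k)%N ->
  ws k (fun s => g s * (nth v s j == v)%:R) = ws k (fun s => g s * (nth v s 0 == v)%:R).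
Proof.
move=> jk; rewrite -[RHS](wsum_rot _ _ j); apply: eq_wsum => s sk _.
rewrite (g_perm (_ : perm_eq (rot j s) s)) ?perm_rot //.
by rewrite /rot nth_cat size_drop sk subn_gt0 jk nth_drop addn0.
Qed.
End Chain.

(** * Counting words with prescribed or repeated letters *)

Section WordCounts.
Variables (R : realType) (V : finType).
Implicit Types (A B U : {set V}) (s t : seq V) (u v w : V).
Local Notation ws := (wsum (R := R)).

Lemma wsum_restrict A B n (f : seq V -> R) :
  ws A n (fun s => (all (mem B) s)%:R * f s) = ws (A :&: B) n f.
Proof.
elim: n f => [|n IH] f /=; first by rewrite mul1r.
rewrite [RHS](eq_bigl (fun x => (x \in A) && (x \in B))); last by move=> x; rewrite inE.
rewrite big_mkcondr; apply: eq_bigr => x _; rewrite -[x \in B]/(mem B x).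
case: (boolP (mem B x)) => xB /=; first exact: IH.
by under eq_wsum do rewrite mul0r; rewrite wsum0.
Qed.

Lemma wsum_uniq_cons A n (x : V) (f : seq V -> R) :
  ws A n (fun s => (uniq (x :: s))%:R * f s) = ws (A :\ x) n (fun s => (uniq s)%:R * f s).
Proof.
have -> : A :\ x = A :&: [set~ x] by apply/setP => v; rewrite !inE andbC.
rewrite -wsum_restrict; apply: eq_wsum => s _ _ /=; rewrite mulrA -natrM mulnb; congr (_%:R * _).
congr (nat_of_bool (_ && _)); apply/idP/allP => [xs v vs|H]; last by apply/negP => /H; rewrite /= !inE eqxx.
by rewrite /= !inE; apply: contraNneq xs => <-.
Qed.

Lemma wsum_uniq_count A n : ws A n (fun s => (uniq s)%:R) = (#|A| ^_ n)%:R.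
Proof.
elim: n A => [|n IH] A /=; first by [].
transitivity (\sum_(x in A) ((#|A|.-1 ^_ n)%:R : R)).
  apply: eq_bigr => x xA; have -> : #|A|.-1 = #|A :\ x| by rewrite [#|A|](cardsD1 x) xA.
  rewrite -IH; have := wsum_uniq_cons A n x (fun=> 1).
  by under eq_wsum do rewrite mulr1; under [X in _ = X -> _]eq_wsum do rewrite mulr1.
by rewrite sumr_const -[LHS]mulr_natl -natrM.
Qed.

Lemma wsum_uniq_cat U a b (f h : seq V -> R) :
  ws U (a + b) (fun s => (uniq s)%:R * (f (take a s) * h (drop a s))) =
  ws U a (fun y => (uniq y)%:R * f y * ws (U :\: [set v in y]) b (fun s => (uniq s)%:R * h s)).
Proof.
rewrite wsumD; apply: eq_wsum => y ya _.
have -> : U :\: [set v in y] = U :&: ~: [set v in y] by apply/setP => v; rewrite !inE andbC.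
rewrite -wsum_restrict -wsumZ; apply: eq_wsum => s _ _.
rewrite -ya take_size_cat // drop_size_cat // cat_uniq.
have -> : ~~ has (mem y) s = all (mem (~: [set v in y])) s.
  by rewrite -all_predC; apply: eq_all => v; rewrite /= !inE.
by case: (uniq y); case: (all _ s); case: (uniq s); rewrite /= !(mulr0, mul0r, mul1r, mulr1).
Qed.

Local Notation wT := (ws [set: V]).
Let n : R := #|V|%:R.

Lemma wT_cons m (f : seq V -> R) : wT m.+1 f = \sum_x wT m (fun s => f (x :: s)).
Proof. by rewrite /=; apply: eq_bigl => x; rewrite inE. Qed.

Lemma wT_delta u (c : R) : \sum_x (x == u)%:R * c = c.
Proof. by rewrite (bigD1 u) //= eqxx mul1r big1 ?addr0 // => x /negbTE ->; rewrite mul0r. Qed.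

Lemma mem_cons_le u x s : (u \in x :: s)%:R <= (x == u)%:R + (u \in s)%:R :> R.
Proof. by rewrite inE eq_sym; case: (x == u); case: (u \in s); rewrite ?addr0 ?add0r //= lerDl. Qed.

Lemma count_mem1 m u : n * wT m (fun s => (u \in s)%:R) <= m%:R * n ^+ m.
Proof.
have n0 : 0 <= n by rewrite ler0n.
elim: m => [|m IH]; first by rewrite /= mulr0 mul0r.
apply: (@le_trans _ _ (n * \sum_x ((x == u)%:R * n ^+ m + wT m (fun s => (u \in s)%:R)))).
  apply: ler_wpM2l => //; rewrite wT_cons; apply: ler_sum => x _.
  have -> : n ^+ m = wT m (fun=> 1) by rewrite wsumC cardsT mulr1.
  rewrite -wsumZ -wsum_add; apply: ler_wsum => s _ _; rewrite mulr1; exact: mem_cons_le.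
rewrite big_split /= wT_delta sumr_const -(mulr_natl (wT _ _)) -/n mulrDr -exprS -natr1 mulrDl mul1r addrC.
by rewrite lerD2r mulrA exprS mulrCA -mulrA; apply: ler_wpM2l.
Qed.

Lemma count_mem2 m u v : u != v ->
  n ^+ 2 * wT m (fun s => (u \in s)%:R * (v \in s)%:R) <= m%:R ^+ 2 * n ^+ m.
Proof.
move=> uv; have n0 : 0 <= n by rewrite ler0n.
elim: m => [|m IH]; first by rewrite /= mulr0 mulr0 expr0n /= mul0r.
set A := wT m (fun s => (u \in s)%:R * (v \in s)%:R) in IH.
apply: (@le_trans _ _ (n ^+ 2 * \sum_x ((x == u)%:R * wT m (fun s => (v \in s)%:R) +
    ((x == v)%:R * wT m (fun s => (u \in s)%:R) + A)))).
  apply: ler_wpM2l; first by rewrite exprn_ge0.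
  rewrite wT_cons; apply: ler_sum => x _.
  rewrite -!wsumZ -!wsum_add; apply: ler_wsum => s _ _; rewrite !inE ![_ == x]eq_sym.
  case: (eqVneq x u) => [->|_]; first by rewrite (negbTE uv) /=; case: (u \in s); case: (v \in s) => /=; lra.
  by case: (x == v); case: (u \in s); case: (v \in s) => /=; lra.
rewrite !big_split /= !wT_delta sumr_const -(mulr_natl A) -/n.
have h1 := count_mem1 m v; have h2 := count_mem1 m u.
set a := wT _ _ in h1 *; set b := wT _ _ in h2 *.
have q1 := ler_wpM2l n0 h1; have q2 := ler_wpM2l n0 h2; have q3 := ler_wpM2l n0 IH.
have N0 : 0 <= n ^+ m by rewrite exprn_ge0.
have nn : 0 <= n * n ^+ m by rewrite mulr_ge0.
have e1 : n ^+ 2 * (a + (b + n * A)) = n * (n * a) + n * (n * b) + n * (n ^+ 2 * A) by ring.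
have e2 : m.+1%:R ^+ 2 * n ^+ m.+1 = n * (m%:R ^+ 2 * n ^+ m) + 2 * (n * (m%:R * n ^+ m)) + n * n ^+ m.
  by rewrite -natr1 [n ^+ m.+1]exprS; ring.
rewrite e1 e2; lra.
Qed.

Lemma count_mem3 m u v w : u != v -> u != w -> v != w ->
  n ^+ 3 * wT m (fun s => (u \in s)%:R * (v \in s)%:R * (w \in s)%:R) <= m%:R ^+ 3 * n ^+ m.
Proof.
move=> uv uw vw; have n0 : 0 <= n by rewrite ler0n.
elim: m => [|m IH]; first by rewrite /= !mulr0 expr0n /= mul0r.
set A := wT m (fun s => (u \in s)%:R * (v \in s)%:R * (w \in s)%:R) in IH.
apply: (@le_trans _ _ (n ^+ 3 * \sum_x ((x == u)%:R * wT m (fun s => (v \in s)%:R * (w \in s)%:R) +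
    ((x == v)%:R * wT m (fun s => (u \in s)%:R * (w \in s)%:R) +
    ((x == w)%:R * wT m (fun s => (u \in s)%:R * (v \in s)%:R) + A))))).
  apply: ler_wpM2l; first by rewrite exprn_ge0.
  rewrite wT_cons; apply: ler_sum => x _.
  rewrite -!wsumZ -!wsum_add; apply: ler_wsum => s _ _; rewrite !inE ![_ == x]eq_sym.
  case: (eqVneq x u) => [->|_].
    by rewrite (negbTE uv) (negbTE uw) /=; case: (u \in s); case: (v \in s); case: (w \in s) => /=; lra.
  case: (eqVneq x v) => [->|_].
    by rewrite (negbTE vw) /=; case: (u \in s); case: (v \in s); case: (w \in s) => /=; lra.
  by case: (x == w); case: (u \in s); case: (v \in s); case: (w \in s) => /=; lra.
rewrite !big_split /= !wT_delta sumr_const -(mulr_natl A) -/n.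
have h1 := count_mem2 m vw; have h2 := count_mem2 m uw; have h3 := count_mem2 m uv.
set a := wT _ _ in h1 *; set b := wT _ _ in h2 *; set c := wT _ _ in h3 *.
have q1 := ler_wpM2l n0 h1; have q2 := ler_wpM2l n0 h2; have q3 := ler_wpM2l n0 h3; have q4 := ler_wpM2l n0 IH.
have nn : 0 <= n * n ^+ m by rewrite mulr_ge0 // exprn_ge0.
have m0 := ler0n R m.
have mm : 0 <= (n * n ^+ m) * m%:R by rewrite mulr_ge0.
have e1 : n ^+ 3 * (a + (b + (c + n * A))) = n * (n ^+ 2 * a) + n * (n ^+ 2 * b) + n * (n ^+ 2 * c) + n * (n ^+ 3 * A) by ring.
have e2 : m.+1%:R ^+ 3 * n ^+ m.+1 = n * (m%:R ^+ 3 * n ^+ m) + 3 * (n * (m%:R ^+ 2 * n ^+ m)) + 3 * (n * n ^+ m * m%:R) + n * n ^+ m.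
  by rewrite -natr1 [n ^+ m.+1]exprS; ring.
rewrite e1 e2; lra.
Qed.

Lemma count_nuniq m : n * wT m (fun s => (~~ uniq s)%:R) <= m%:R ^+ 2 * n ^+ m.
Proof.
have n0 : 0 <= n by rewrite ler0n.
elim: m => [|m IH]; first by rewrite /= mulr0 expr0n /= mul0r.
set A := wT m (fun s => (~~ uniq s)%:R) in IH.
apply: (@le_trans _ _ (n * \sum_x (wT m (fun s => (x \in s)%:R) + A))).
  apply: ler_wpM2l => //; rewrite wT_cons; apply: ler_sum => x _.
  rewrite -wsum_add; apply: ler_wsum => s _ _ /=; rewrite negb_and negbK.
  by case: (x \in s); case: (uniq s) => /=; lra.
rewrite big_split /= sumr_const -(mulr_natl A) -/n mulrDr mulr_sumr.
have q1 : \sum_x n * wT m (fun s => (x \in s)%:R) <= n * (m%:R * n ^+ m).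
  apply: (@le_trans _ _ (\sum_(x : V) (m%:R * n ^+ m))); first by apply: ler_sum => x _; apply: count_mem1.
  by rewrite sumr_const -[leLHS]mulr_natl.
have q2 := ler_wpM2l n0 IH.
have nn : 0 <= n * n ^+ m by rewrite mulr_ge0 // exprn_ge0.
have mm : 0 <= (n * n ^+ m) * m%:R by rewrite mulr_ge0 ?ler0n.
have e2 : m.+1%:R ^+ 2 * n ^+ m.+1 = n * (m%:R ^+ 2 * n ^+ m) + 2 * (n * n ^+ m * m%:R) + n * n ^+ m.
  by rewrite -natr1 [n ^+ m.+1]exprS; ring.
rewrite e2 [n * (m%:R * _)]mulrCA [m%:R * (n * _)]mulrC in q1 *; lra.
Qed.

(** Multiplicity is counted instead of membership, because multiplicities are exact sums over
    coordinates in the degree estimate [pc_D1]. Discarding words with repetitions then changes a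
    degree by [O(n^-2)] only. *)
Lemma count_nuniq_mem m v : n ^+ 2 * wT m (fun s => (~~ uniq s)%:R * (count_mem v s)%:R) <=
  2 * m%:R ^+ 3 * n ^+ m.
Proof.
have n0 : 0 <= n by rewrite ler0n.
elim: m => [|m IH]; first by rewrite /= mul0r mulr0 expr0n /= mulr0 mul0r.
set A := wT m (fun s => (~~ uniq s)%:R * (count_mem v s)%:R) in IH.
have cm : n * wT m (fun s => (count_mem v s)%:R) <= m%:R * n ^+ m.
  elim: m {IH A} => [|m IH]; first by rewrite /= mulr0 mul0r.
  rewrite wT_cons.
  have -> : \sum_x wT m (fun s => (count_mem v (x :: s))%:R) = \sum_x ((x == v)%:R * n ^+ m + wT m (fun s => (count_mem v s)%:R)).
    apply: eq_bigr => x _; have -> : n ^+ m = wT m (fun=> 1) by rewrite wsumC cardsT mulr1.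
    by rewrite -wsumZ -wsum_add; apply: eq_wsum => s _ _; rewrite mulr1 /= natrD.
  rewrite big_split /= wT_delta sumr_const -(mulr_natl (wT _ _)) -/n.
  rewrite -natr1 [n ^+ m.+1]exprS; have := ler_wpM2l n0 IH; lra.
apply: (@le_trans _ _ (n ^+ 2 * \sum_x ((x == v)%:R * (wT m (fun s => (v \in s)%:R) + wT m (fun s => (~~ uniq s)%:R)) +
    (wT m (fun s => (x \in s)%:R * (count_mem v s)%:R) + A)))).
  apply: ler_wpM2l; first by rewrite exprn_ge0.
  rewrite wT_cons; apply: ler_sum => x _.
  rewrite -!wsum_add -wsumZ -wsum_add; apply: ler_wsum => s _ _ /=; rewrite negb_and negbK natrD.
  have c0 := ler0n R (count_mem v s).
  case: (eqVneq x v) => [->|_]; case: (v \in s); case: (x \in s); case: (uniq s) => /=; lra.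
rewrite !big_split /= !wT_delta sumr_const -(mulr_natl A) -/n.
have q3 : \sum_x wT m (fun s => (x \in s)%:R * (count_mem v s)%:R) <= m%:R * wT m (fun s => (count_mem v s)%:R).
  rewrite -wsum_sum -wsumZ; apply: ler_wsum => s sm _; rewrite -mulr_suml.
  apply: ler_wpM2r; first exact: ler0n.
  rewrite -natr_sum ler_nat -sm; apply: leq_trans (card_size s).
  rewrite -sum1_card [leqRHS]big_mkcond /=; apply: leq_sum => x _; by case: ifP.
set b := wT m (fun s => (v \in s)%:R); set c := wT m (fun s => (~~ uniq s)%:R).
set d := \sum_x _ in q3 *; set f := wT m (fun s => (count_mem v s)%:R) in cm q3.
have h1 : n * b <= m%:R * n ^+ m := count_mem1 m v.
have h2 : n * c <= m%:R ^+ 2 * n ^+ m := count_nuniq m.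
have m0 := ler0n R m; have nn : 0 <= n * n ^+ m by rewrite mulr_ge0 // exprn_ge0.
have k1 := ler_wpM2l n0 h1; have k2 := ler_wpM2l n0 h2; have k3 := ler_wpM2l n0 IH.
have k4 : n * (n * d) <= n * (m%:R * (m%:R * n ^+ m)).
  apply: ler_wpM2l => //; apply: (@le_trans _ _ (m%:R * (n * f))); last exact: ler_wpM2l.
  by rewrite mulrCA; apply: ler_wpM2l.
have mm : 0 <= (n * n ^+ m) * m%:R by rewrite mulr_ge0.
have mm2 : 0 <= (n * n ^+ m) * m%:R ^+ 2 by rewrite mulr_ge0 ?exprn_ge0.
have e1 : n ^+ 2 * (b + c + (d + n * A)) = n * (n * b) + n * (n * c) + n * (n * d) + n * (n ^+ 2 * A) by ring.
have e2 : 2 * m.+1%:R ^+ 3 * n ^+ m.+1 = n * (2 * m%:R ^+ 3 * n ^+ m) + 6 * (n * n ^+ m * m%:R ^+ 2) + 6 * (n * n ^+ m * m%:R) + 2 * (n * n ^+ m).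
  by rewrite -natr1 [n ^+ m.+1]exprS; ring.
have e3 : n * (m%:R * (m%:R * n ^+ m)) = n * n ^+ m * m%:R ^+ 2 by ring.
have e4 : n * (m%:R * n ^+ m) = n * n ^+ m * m%:R by ring.
have e5 : n * (m%:R ^+ 2 * n ^+ m) = n * n ^+ m * m%:R ^+ 2 by ring.
rewrite e1 e2; rewrite e3 in k4; rewrite e4 in k1; rewrite e5 in k2; lra.
Qed.
End WordCounts.

Lemma ffact_ge_exp (a b : nat) : ((a - b) ^ b <= a ^_ b)%N.
Proof.
elim: b => [|b IH]; first by rewrite expn0.
rewrite ffactnSr expnSr; apply: leq_mul; last by apply: leq_sub2l.
apply: leq_trans IH; case: b => [|b] //; rewrite leq_exp2r //; exact: leq_sub2l.
Qed.

Lemma leq_double_sub (a b : nat) : (2 * b <= a -> a <= (a - b) * 2)%N.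
Proof. lia. Qed.

(** * Bounds and entropy of the chain *)

Section Pieces.
Variables (R : realType) (V : finType) (l q : nat) (g : seq V -> R) (clo chi : R).
Let n : R := #|V|%:R.
Let k := (q + l)%N.
Hypothesis V_ge : (2 * k <= #|V|)%N.
Hypothesis q_gt0 : (0 < q)%N.
Hypothesis g_ge0 : forall s, 0 <= g s.
Hypothesis g_perm : forall s t, perm_eq s t -> g s = g t.
Hypothesis g_nuniq : forall s, ~~ uniq s -> g s = 0.
Hypothesis clo_gt0 : 0 < clo.
Hypothesis g_lo : forall s, uniq s -> size s = k -> clo <= g s.
Hypothesis g_hi : forall s, g s <= chi.
Local Notation ws := (wsum [set: V]).
Hypothesis g_tot : ws k g = n ^+ k.
Hypothesis g_marg : forall v, n * ws k (fun s => g s * (nth v s 0 == v)%:R) = n ^+ k.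
Local Notation gl := (left_marginal q g).
Local Notation Pd := (Pd l q g).

Let V_gt0 : (0 < #|V|)%N.
Proof. by apply: leq_trans V_ge; rewrite muln_gt0 /k addn_gt0 q_gt0. Qed.
Let n_gt0 : 0 < n. Proof. by rewrite ltr0n. Qed.
Let n_neq0 : n != 0. Proof. by rewrite gt_eqF. Qed.
Let chi_gt0 : 0 < chi.
Proof.
rewrite ltNge; apply/negP => c0; have : ws k g <= 0.
  by rewrite -(wsum0 R [set: V] k); apply: ler_wsum => s _ _; apply: le_trans c0.
by rewrite g_tot leNgt exprn_gt0.
Qed.

Lemma gl_hi a : gl a <= chi.
Proof.
rewrite ler_pdivrMl ?exprn_gt0 //; have -> : n ^+ q * chi = ws q (fun=> chi) by rewrite wsumC cardsT.
exact: ler_wsum.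
Qed.
Lemma gl_nuniq a : ~~ uniq a -> gl a = 0.
Proof.
move=> ua; rewrite /left_marginal (_ : wsum _ _ _ = 0) ?mulr0 // -(wsum0 R [set: V] q).
by apply: eq_wsum => b _ _; apply: g_nuniq; rewrite cat_uniq (negbTE ua).
Qed.
(** At least [(n / 2) ^+ q] continuations of [a] have no repetition, and each of them has [g] at
    least [clo]. *)
Lemma gl_lo a : uniq a -> size a = l -> clo / 2 ^+ q <= gl a.
Proof.
move=> ua al; rewrite -(@ler_pM2l _ (n ^+ q)) ?exprn_gt0 // mulVKf ?expf_neq0 //.
apply: (@le_trans _ _ (ws q (fun b => clo * ((all (mem (~: [set v in a])) b)%:R * (uniq b)%:R)))); last first.
  apply: ler_wsum => b bq _.
  case: (boolP (uniq (a ++ b))) => uab; last first.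
    rewrite (g_nuniq uab) -natrM mulnb; suff -> : all (mem (~: [set v in a])) b && uniq b = false by rewrite mulr0.
    apply: contraNF uab; rewrite cat_uniq ua /= => /andP[/allP H ->]; rewrite andbT.
    by apply/hasPn => x /H; rewrite /= !inE.
  apply: le_trans (g_lo uab _); last by rewrite size_cat al bq addnC.
  by rewrite -natrM mulnb; case: (_ && _); rewrite ?mulr1 ?mulr0 // ltW.
rewrite wsumZ wsum_restrict finset.setTI wsum_uniq_count mulrCA ler_pM2l //.
rewrite -expr_div_n; apply: (@le_trans _ _ (((#|~: [set v in a]| - q) ^ q)%:R)); last by rewrite ler_nat ffact_ge_exp.
rewrite natrX; apply: lerXn2r; rewrite ?nnegrE ?divr_ge0 ?ler0n // ler_pdivrMr //.
rewrite -natrM ler_nat cardsCs finset.setCK cardsE (card_uniqP ua) al -subnDA addnC -/k.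
exact: leq_double_sub.
Qed.
Definition rat : R := chi * 2 ^+ q / clo.
Lemma Pd_hi t y : size y = (l + t * q)%N -> Pd t y <= chi * rat ^+ t.
Proof.
elim: t y => [|t IH] y ys; first by rewrite expr0 mulr1; apply: gl_hi.
rewrite exprS mulrCA /=; set a := take l (drop q y).
have al : size a = l by rewrite size_takel // size_drop ys mulSn; lia.
apply: ler_pM; rewrite ?Pd_ge0 ?mulr_ge0 ?invr_ge0 ?gl_ge0 //; last first.
  by apply: IH; rewrite size_drop ys mulSn; lia.
have r0 : 0 <= rat by rewrite !mulr_ge0 ?invr_ge0 ?exprn_ge0 // ltW.
case: (boolP (uniq a)) => ua; last by rewrite (gl_nuniq ua) invr0 mulr0.
rewrite /rat -mulrA; apply: ler_pM; rewrite ?invr_ge0 ?gl_ge0 //.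
rewrite -[leRHS]invf_div lef_pV2 ?posrE; first exact: gl_lo.
  by apply: lt_le_trans (gl_lo ua al); rewrite divr_gt0 // exprn_gt0.
by rewrite divr_gt0 ?exprn_gt0.
Qed.
Definition plo t : R := clo / 2 ^+ q * (clo / chi) ^+ t.
Lemma plo_gt0 t : 0 < plo t.
Proof. by rewrite mulr_gt0 ?exprn_gt0 ?divr_gt0 ?exprn_gt0. Qed.
Lemma Pd_lo t y : size y = (l + t * q)%N -> Pd t y != 0 -> plo t <= Pd t y.
Proof.
elim: t y => [|t IH] y ys.
  rewrite /plo expr0 mulr1 => gn; apply: gl_lo; last by rewrite ys mul0n addn0.
  by apply: contraNT gn => /gl_nuniq h; rewrite /= h.
rewrite /=; set a := take l (drop q y).
rewrite !mulf_eq0 !negb_or => /andP[/andP[gn glv] Pn].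
rewrite /plo exprS mulrCA; apply: ler_pM.
- by rewrite divr_ge0 // ltW.
- exact: ltW (plo_gt0 t).
- apply: ler_pM; rewrite ?invr_ge0 ?(ltW clo_gt0) ?(ltW chi_gt0) //.
    apply: g_lo; first by apply: contraNT gn => /g_nuniq ->.
    by rewrite size_takel // ys mulSn /k; lia.
  rewrite lef_pV2 ?posrE ?gl_hi //.
  by rewrite lt_def gl_ge0 // andbT -invr_eq0.
- by apply: IH => //; rewrite size_drop ys mulSn; lia.
Qed.
Lemma Pd_uniq t y : size y = (l + t * q)%N -> uniq y -> Pd t y != 0.
Proof.
elim: t y => [|t IH] y ys uy.
  rewrite gt_eqF //; apply: lt_le_trans (gl_lo uy _); rewrite ?divr_gt0 ?exprn_gt0 //.
  by rewrite ys mul0n addn0.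
rewrite /=; set a := take l (drop q y).
have al : size a = l by rewrite size_takel // size_drop ys mulSn; lia.
have ua : uniq a by rewrite take_uniq // drop_uniq.
rewrite !mulf_neq0 ?invr_eq0 //.
- rewrite gt_eqF //; apply: lt_le_trans (g_lo _ _); rewrite ?take_uniq //.
  by rewrite size_takel // ys mulSn /k; lia.
- by rewrite gt_eqF //; apply: lt_le_trans (gl_lo ua al); rewrite divr_gt0 ?exprn_gt0.
- by apply: IH; rewrite ?drop_uniq // size_drop ys mulSn; lia.
Qed.

(** Relative entropies of [g] and of its marginal with respect to the uniform measure, hence
    nonnegative. *)
Definition eg : R := n ^- k * ws k (fun s => g s * ln (g s)).
Definition el : R := n ^- l * ws l (fun s => gl s * ln (gl s)).

Lemma ws_gl (phi : seq V -> R) : ws k (fun s => g s * phi (drop q s)) = n ^+ q * ws l (fun a => gl a * phi a).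
Proof.
rewrite /k wsumD wsum_exch -wsumZ; apply: eq_wsum => a _ _.
rewrite mulrA -(ws_g_left q V_gt0 g_perm) -wsumZr; apply: eq_wsum => b bq _.
by rewrite -bq drop_size_cat.
Qed.
Lemma gl_tot : ws l gl = n ^+ l.
Proof.
have := ws_gl (fun=> 1); rewrite (@eq_wsum _ _ _ k _ g); last by move=> s _ _; rewrite mulr1.
rewrite g_tot /k exprD => h; apply: (mulfI (_ : n ^+ q != 0)); first by rewrite expf_neq0.
by rewrite h; congr (_ * _); apply: eq_wsum => s _ _; rewrite mulr1.
Qed.
Lemma xlnx_ge (x : R) : 0 <= x -> x - 1 <= x * ln x.
Proof.
rewrite le_eqVlt => /orP[/eqP<-|x0]; first by rewrite mul0r sub0r oppr_le0.
have := ler_wpM2l (ltW x0) (ln_ge_1subV x0).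
by rewrite mulrBr mulr1 mulfV ?gt_eqF.
Qed.
Lemma entropy_ge0 j (f : seq V -> R) : (forall s, 0 <= f s) -> ws j f = n ^+ j ->
  0 <= n ^- j * ws j (fun s => f s * ln (f s)).
Proof.
move=> f0 ft; rewrite mulr_ge0 ?invr_ge0 ?exprn_ge0 ?(ltW n_gt0) //.
apply: (@le_trans _ _ (ws j (fun s => f s + -1))); last by apply: ler_wsum => s _ _; apply: xlnx_ge.
by rewrite wsum_add ft wsumC cardsT mulrN1 subrr.
Qed.
Lemma el_ge0 : 0 <= el.
Proof. by apply: entropy_ge0; [move=> s; apply: gl_ge0 | exact: gl_tot]. Qed.
Lemma eg_ge0 : 0 <= eg.
Proof. exact: entropy_ge0. Qed.

(** Chain rule: each transition contributes the relative entropy of [g] minus that of the marginal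
    on which it conditions. *)
Lemma Pd_entropy t : ws (l + t * q) (fun y => Pd t y * ln (Pd t y)) =
  n ^+ (l + t * q) * (t%:R * (eg - el) + el).
Proof.
elim: t => [|t IH].
  by rewrite mul0n addn0 mul0r add0r /el mulVKf ?expf_neq0.
rewrite (@eq_wsum _ _ _ _ _ (fun y => Pd t.+1 y * ln (g (take k (drop (0 * q) y))) +
   (- (Pd t.+1 y * ln (gl (drop q (take k (drop (0 * q) y))))) + Pd t.+1 y * ln (Pd t (drop q y))))); last first.
  move=> y ys _; rewrite mul0n drop0.
  have -> : drop q (take k y) = take l (drop q y) by rewrite take_drop addnC.
  rewrite -mulrN -!mulrDr; case: (eqVneq (Pd t.+1 y) 0) => [->|]; first by rewrite !mul0r.
  rewrite /= !mulf_eq0 !negb_or => /andP[/andP[gn glv] Pn]; congr (_ * _).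
  have p1 : 0 < g (take k y) by rewrite lt_def gn g_ge0.
  have p2 : 0 < gl (take l (drop q y)) by rewrite lt_def gl_ge0 // andbT -invr_eq0.
  have p3 : 0 < Pd t (drop q y) by rewrite lt_def Pn Pd_ge0.
  by rewrite lnM ?posrE ?divr_gt0 // ln_div ?posrE //; ring.
rewrite !wsum_add; under [X in _ + (X + _)]eq_wsum do rewrite -mulN1r.
have wm := window_marginal l q V_gt0 g_ge0 g_perm _ (ltn0Sn t); rewrite -/k in wm.
rewrite wsumZ (wm (fun s => ln (g s))) (wm (fun s => ln (gl (drop q s)))) (ws_gl (fun a => ln (gl a))).
have -> : ws (l + t.+1 * q) (fun y => Pd t.+1 y * ln (Pd t (drop q y))) = n ^+ q * ws (l + t * q) (fun y => Pd t y * ln (Pd t y)).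
  rewrite mulSn addnCA wsumD wsum_exch -wsumZ; apply: eq_wsum => y ys _.
  rewrite mulrA -Pd_left // -wsumZr; apply: eq_wsum => b bq _.
  by rewrite -[in drop q _]bq drop_size_cat.
rewrite IH.
have -> : ws k (fun s => g s * ln (g s)) = n ^+ k * eg by rewrite /eg mulVKf ?expf_neq0.
have -> : ws l (fun s => gl s * ln (gl s)) = n ^+ l * el by rewrite /el mulVKf ?expf_neq0.
rewrite -[t.+1%:R]natr1 mulSn /k /= !exprD; ring.
Qed.

Lemma Pd_tot t : (0 < t)%N -> ws (l + t * q) (Pd t) = n ^+ (l + t * q).
Proof.
case: t => // t _; have := window_marginal l q V_gt0 g_ge0 g_perm (fun=> 1) (ltn0Sn t).
rewrite (@eq_wsum _ _ _ _ _ (Pd t.+1)); last by move=> s _ _; rewrite mulr1.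
rewrite (@eq_wsum _ _ _ _ (fun s => g s * 1) g); last by move=> s _ _; rewrite mulr1.
by move=> ->; rewrite g_tot -exprD /k; congr (_ ^+ _); rewrite mulSn /=; lia.
Qed.

Lemma Pd_coord t v j : (j < l + t.+1 * q)%N ->
  n * ws (l + t.+1 * q) (fun y => Pd t.+1 y * (nth v y j == v)%:R) = n ^+ (l + t.+1 * q).
Proof.
(* [i] is a window covering position [j] and [o] the offset in it; beyond the last start, the last
   window is taken. *)
move=> jl; pose i := minn (j %/ q) t; pose o := (j - i * q)%N.
have it : (i < t.+1)%N by rewrite ltnS geq_minr.
have iq : (i * q <= j)%N.
  by apply: leq_trans (leq_divM j q); rewrite leq_mul2r geq_minl orbT.
have ok : (o < k)%N.
  rewrite /o /i /k; case: (leqP (j %/ q) t) => h.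
    rewrite {1}(divn_eq j q) addKn; apply: leq_trans (ltn_pmod j q_gt0) _.
    exact: leq_addr.
  rewrite ltn_subLR; last by apply: leq_trans iq; rewrite /i (minn_idPr (ltnW h)).
  by apply: leq_trans jl _; rewrite mulSn; lia.
rewrite (@eq_wsum _ _ _ _ _ (fun y => Pd t.+1 y * (fun s => (nth v s o == v)%:R) (take k (drop (i * q) y)))); last first.
  by move=> y _ _; rewrite nth_take // nth_drop /o subnKC.
have wm := window_marginal l q V_gt0 g_ge0 g_perm (fun s => (nth v s o == v)%:R) it; rewrite -/k in wm.
rewrite wm (coord_marginal g_perm v ok) mulrCA g_marg -exprD /k; congr (_ ^+ _).
by rewrite mulSn /=; lia.
Qed.
End Pieces.

Lemma nat_above (R : realType) (x : R) : exists n0 : nat, forall n : nat, (n0 <= n)%N -> x <= n%:R.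
Proof.
exists (Num.bound `|x|) => n h; apply: le_trans (ler_norm x) _.
by apply: le_trans (ltW (archi_boundP (normr_ge0 x))) _; rewrite ler_nat.
Qed.

Lemma nat_above_all (R : realType) (xs : seq R) :
  exists n0 : nat, forall n : nat, (n0 <= n)%N -> all (fun x => x <= n%:R) xs.
Proof.
elim: xs => [|x xs [n1 h1]]; first by exists 0%N.
have [n2 h2] := nat_above x; exists (maxn n1 n2) => n; rewrite geq_max => /andP[a b].
by rewrite /= h2 ?h1.
Qed.

(** Absorbs the division by a total weight [f] that is only known to be at least [1 - dl]. *)
Lemma quotient_loss (R : realType) (A B dl f : R) : 0 <= A -> 0 <= B -> 0 <= dl -> dl <= 1 / 2 -> 1 - dl <= f ->
  (- A - dl * (2 * A + 2 * B)) * f <= - A - B * dl.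
Proof.
move=> A0 B0 d0 d1 f1; have h := mulr_ge0 d0 A0; have h' := mulr_ge0 d0 B0.
have e : 0 <= 1 - 2 * dl by lra.
have f2 : 0 <= f - (1 - dl) by lra.
have c : 0 <= A + dl * (2 * A + 2 * B) by lra.
have := mulr_ge0 c f2; have := mulr_ge0 h e; have := mulr_ge0 h' e; lra.
Qed.

(** * Weighted counts of sequences of pieces *)

Section PieceCount.
Variables (R : realType) (V : finType) (m : nat) (p W : seq V -> R).
Variables (plo ph B A eps : R).
Let n : R := #|V|%:R.
Local Notation ws := (wsum [set: V]).
Hypothesis V_gt0 : (0 < #|V|)%N.
Hypothesis m_gt0 : (0 < m)%N.
Hypothesis p_ge0 : forall y, 0 <= p y.
Hypothesis p_hi : forall y, size y = m -> p y <= ph.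
Hypothesis plo_gt0 : 0 < plo.
Hypothesis p_lo : forall y, size y = m -> uniq y -> plo <= p y.
Hypothesis W_gt0 : forall y, 0 < W y.
Hypothesis psi_B : forall y, size y = m -> `|ln (W y) - ln (p y)| <= B.
Hypothesis p_tot : ws m p = n ^+ m.
Hypothesis p_coord : forall v j, (j < m)%N -> n * ws m (fun y => p y * (nth v y j == v)%:R) = n ^+ m.
Hypothesis A_ge0 : 0 <= A.
Hypothesis p_ent : - (n ^+ m * A) <= ws m (fun y => p y * (ln (W y) - ln (p y))).
Hypothesis eps_gt0 : 0 < eps.
Hypothesis eps_large : 2 * m%:R <= eps * n.

Definition pc_sp (y : m.-tuple V) : {set V} := [set v in y].
(** Pieces are drawn with density [p] and rewarded by [W / p], so that weight times reward is the
    normalised [W], whatever [p] is. Hence [pc_Om] counts sequences of disjoint pieces by the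
    product of their [W], followed by an arbitrary ordering of the remaining vertices. The density
    [p] only steers the process. *)
Definition pc_F (y : m.-tuple V) : R := n ^- m * ((uniq y)%:R * p y).
Definition pc_psi (y : m.-tuple V) : R := (uniq y)%:R * (ln (W y) - ln (p y)).
Definition pc_Om (U : {set V}) j : R := n ^- (j * m) *
  wsum U #|U| (fun s => (uniq s)%:R * \prod_(i < j) W (take m (drop (i * m) s))).
(** One constant for all hypotheses of the potential argument: the three degree bounds, the initial
    variance, and the reciprocal of the least total weight on a set of [eps * n] vertices. *)
Definition pc_K : R := 1 + ph * m%:R + ph * m%:R ^+ 2 + ph * m%:R ^+ 3 + 9 * ph ^+ 2 * m%:R ^+ 6 +
  (plo * (eps / 2) ^+ m)^-1.

Let n_gt0 : 0 < n. Proof. by rewrite ltr0n. Qed.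
Let n_neq0 : n != 0. Proof. by rewrite gt_eqF. Qed.
Let nm_gt0 j : 0 < n ^+ j. Proof. exact: exprn_gt0. Qed.
Let ph_ge0 : 0 <= ph.
Proof.
have /card_gt0P[v _] := V_gt0.
by apply: le_trans (p_ge0 (nseq m v)) (p_hi _); rewrite size_nseq.
Qed.
Let m0 : 0 <= m%:R :> R. Proof. exact: ler0n. Qed.

Lemma pc_spE (y : m.-tuple V) v : (v \in pc_sp y) = (v \in (y : seq V)).
Proof. by rewrite inE. Qed.
Lemma pc_sum (h : seq V -> R) : \sum_y pc_F y * h y = n ^- m * ws m (fun s => (uniq s)%:R * p s * h s).
Proof.
rewrite wsum_tuple mulr_sumr; apply: eq_bigr => y _; by rewrite /pc_F !mulrA.
Qed.
Lemma pc_sum_le (h : seq V -> R) (c : R) j : (forall s, 0 <= h s) -> 0 <= c -> n ^+ j * ws m h <= c * n ^+ m ->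
  \sum_y pc_F y * h y <= ph * c / n ^+ j.
Proof.
move=> h0 c0 hc; rewrite pc_sum.
have h1 : ws m (fun s => (uniq s)%:R * p s * h s) <= ph * ws m h.
  rewrite -wsumZ; apply: ler_wsum => s sm _; apply: ler_wpM2r => //.
  by case: (uniq s); rewrite ?mul1r ?mul0r ?p_hi.
rewrite ler_pdivlMr // -mulrA ler_pdivrMl //.
apply: le_trans (ler_wpM2r (ltW (nm_gt0 j)) h1) _.
rewrite -mulrA [ws m h * _]mulrC [leRHS]mulrCA; apply: ler_wpM2l => //.
by rewrite [leRHS]mulrC.
Qed.

Lemma pc_F_ge0 y : 0 <= pc_F y.
Proof. by rewrite mulr_ge0 ?invr_ge0 ?exprn_ge0 ?ler0n // mulr_ge0 ?ler0n. Qed.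
Lemma pc_F_card y : pc_F y != 0 -> #|pc_sp y| = m.
Proof.
rewrite /pc_F; case: (boolP (uniq y)) => [uy _|]; last by rewrite mul0r mulr0 eqxx.
by rewrite /pc_sp cardsE (card_uniqP uy) size_tuple.
Qed.
Lemma pc_psi_le y : `|pc_psi y| <= B.
Proof.
rewrite /pc_psi; have := psi_B (size_tuple y); case: (uniq y); rewrite ?mul1r // mul0r normr0.
by apply: le_trans.
Qed.
Let K_terms : [/\ 0 <= ph * m%:R, 0 <= ph * m%:R ^+ 2, 0 <= ph * m%:R ^+ 3, 0 <= 9 * ph ^+ 2 * m%:R ^+ 6
  & 0 < (plo * (eps / 2) ^+ m)^-1].
Proof.
split; rewrite ?mulr_ge0 ?exprn_ge0 //.
by rewrite invr_gt0 mulr_gt0 ?exprn_gt0 ?divr_gt0.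
Qed.
Lemma pc_K_ge1 : 1 <= pc_K.
Proof. by case: K_terms => *; rewrite /pc_K; lra. Qed.
Lemma pc_deg1 v : \sum_y pc_F y * (v \in pc_sp y)%:R <= pc_K / n.
Proof.
under eq_bigr do rewrite pc_spE.
apply: le_trans (@pc_sum_le (fun s => (v \in s)%:R) m%:R 1 _ _ _) _ => //; first by rewrite expr1 count_mem1.
by rewrite expr1 ler_pM2r ?invr_gt0 //; case: K_terms => *; rewrite /pc_K; lra.
Qed.
Lemma pc_deg2 u v : u != v ->
  \sum_y pc_F y * ((u \in pc_sp y)%:R * (v \in pc_sp y)%:R) <= pc_K / n ^+ 2.
Proof.
move=> uv; under eq_bigr do rewrite !pc_spE.
apply: le_trans (@pc_sum_le (fun s => (u \in s)%:R * (v \in s)%:R) (m%:R ^+ 2) 2 _ _ _) _.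
- by move=> s; rewrite mulr_ge0 ?ler0n.
- by rewrite exprn_ge0.
- exact: count_mem2.
by rewrite ler_pM2r ?invr_gt0 //; case: K_terms => *; rewrite /pc_K; lra.
Qed.
Lemma pc_deg3 u v w : u != v -> u != w -> v != w ->
  \sum_y pc_F y * ((u \in pc_sp y)%:R * (v \in pc_sp y)%:R * (w \in pc_sp y)%:R) <= pc_K / n ^+ 3.
Proof.
move=> uv uw vw; under eq_bigr do rewrite !pc_spE.
apply: le_trans (@pc_sum_le (fun s => (u \in s)%:R * (v \in s)%:R * (w \in s)%:R) (m%:R ^+ 3) 3 _ _ _) _.
- by move=> s; rewrite !mulr_ge0 ?ler0n.
- by rewrite exprn_ge0.
- exact: count_mem3.
by rewrite ler_pM2r ?invr_gt0 //; case: K_terms => *; rewrite /pc_K; lra.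
Qed.

Lemma pc_fw_sum U (h : seq V -> R) :
  \sum_y fw pc_sp pc_F U y * h y = n ^- m * wsum U m (fun s => (uniq s)%:R * p s * h s).
Proof.
rewrite -[U in RHS]finset.setTI -wsum_restrict wsum_tuple mulr_sumr; apply: eq_bigr => y _.
rewrite /fw /pc_F; have -> : pc_sp y \subset U = all (mem U) y.
  by apply/fintype.subsetP/allP => s v vy; apply: s; rewrite ?inE in vy *.
ring.
Qed.
Lemma pc_FUE U : FU pc_sp pc_F U = n ^- m * wsum U m (fun s => (uniq s)%:R * p s).
Proof.
rewrite /FU; under eq_bigr do rewrite -[fw _ _ _ _]mulr1.
by rewrite (pc_fw_sum U (fun=> 1)); congr (_ * _); apply: eq_wsum => s _ _; rewrite mulr1.
Qed.
Lemma pc_FU_ge (U : {set V}) : eps * n <= #|U|%:R -> pc_K^-1 <= FU pc_sp pc_F U.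
Proof.
move=> Ug; rewrite pc_FUE.
apply: (@le_trans _ _ (plo * (eps / 2) ^+ m)).
  rewrite -[leRHS]invrK lef_pV2 ?posrE ?invr_gt0 ?mulr_gt0 ?exprn_gt0 ?divr_gt0 //.
    by case: K_terms => *; rewrite /pc_K; lra.
  exact: lt_le_trans pc_K_ge1.
rewrite ler_pdivlMl //.
apply: (@le_trans _ _ (plo * wsum U m (fun s => (uniq s)%:R))); last first.
  rewrite -wsumZ; apply: ler_wsum => s sm _; case: (boolP (uniq s)) => us; rewrite ?mul1r ?mul0r ?mulr1 ?mulr0 //.
  exact: p_lo.
rewrite wsum_uniq_count mulrCA; apply: ler_wpM2l; first exact: ltW.
rewrite -exprMn; apply: (@le_trans _ _ (((#|U| - m) ^ m)%:R)); last by rewrite ler_nat ffact_ge_exp.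
have mU : (m <= #|U|)%N by rewrite -(ler_nat R); apply: le_trans Ug; apply: le_trans eps_large; rewrite ler_peMl // ler1n.
rewrite natrX; apply: lerXn2r; rewrite ?nnegrE ?ler0n ?mulr_ge0 ?(ltW n_gt0) ?divr_ge0 ?(ltW eps_gt0) //.
by rewrite natrB // lerBrDr; apply: le_trans Ug; move: eps_large; lra.
Qed.

Definition pc_dl : R := ph * m%:R ^+ 2 / n.
Let dl_ge0 : 0 <= pc_dl.
Proof. by rewrite /pc_dl !mulr_ge0 ?invr_ge0 ?exprn_ge0 ?(ltW n_gt0). Qed.
Lemma pc_nuniq_le (h : seq V -> R) (c : R) : 0 <= c -> (forall s, size s = m -> `|h s| <= c) ->
  `|n ^- m * ws m (fun s => (~~ uniq s)%:R * p s * h s)| <= c * pc_dl.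
Proof.
move=> c0 hc; have np : 0 <= n ^- m by rewrite invr_ge0 ltW.
have key : forall e : R, `|e| = 1 -> e * ws m (fun s => (~~ uniq s)%:R * p s * h s) <= ph * c * ws m (fun s => (~~ uniq s)%:R).
  move=> e e1; rewrite -!wsumZ; apply: ler_wsum => s sm _; case: (uniq s); rewrite /= ?mulr0 ?mul0r ?mulr0 ?mul1r ?mulr1 //.
  apply: le_trans (ler_norm _) _; rewrite !normrM e1 mul1r; apply: ler_pM => //; last exact: hc.
  by rewrite ger0_norm ?p_hi.
rewrite normrM (ger0_norm np) ler_pdivrMl //.
have nu := count_nuniq R V m; rewrite -/n in nu.
apply: (@le_trans _ _ (ph * c * ws m (fun s => (~~ uniq s)%:R))).
  rewrite ler_norml; apply/andP; split.
    by have := key (-1); rewrite normrN1 mulN1r => /(_ erefl); rewrite lerNl.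
  by have := key 1; rewrite normr1 mul1r; apply.
rewrite /pc_dl (_ : n ^+ m * _ = ph * c * (m%:R ^+ 2 * n ^+ m / n)); last by ring.
by apply: ler_wpM2l; rewrite ?mulr_ge0 // ler_pdivlMr // mulrC.
Qed.
Lemma pc_split (h : seq V -> R) : n ^- m * ws m (fun s => (uniq s)%:R * p s * h s) =
  n ^- m * ws m (fun s => p s * h s) - n ^- m * ws m (fun s => (~~ uniq s)%:R * p s * h s).
Proof.
apply/eqP; rewrite eq_sym subr_eq -mulrDr -wsum_add; apply/eqP; congr (_ * _); apply: eq_wsum => s _ _.
by case: (uniq s); rewrite /= !(mul1r, mul0r) ?addr0 ?add0r.
Qed.
Lemma pc_FU_bnd : 1 - pc_dl <= FU pc_sp pc_F [set: V] <= 1.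
Proof.
rewrite pc_FUE (@eq_wsum _ _ _ _ _ (fun s => (uniq s)%:R * p s * 1)); last by move=> s; rewrite mulr1.
apply/andP; split.
  rewrite pc_split; under [X in _ * X - _]eq_wsum do rewrite mulr1.
  rewrite p_tot mulVf ?gt_eqF // lerD2l lerN2.
  apply: le_trans (ler_norm _) _; rewrite -[leRHS]mul1r; apply: pc_nuniq_le => //.
  by move=> s _; rewrite normr1.
rewrite ler_pdivrMl // mulr1 -p_tot; apply: ler_wsum => s _ _.
by rewrite mulr1; case: (uniq s); rewrite ?mul1r ?mul0r.
Qed.
(** Every coordinate of a word with density [p] is uniform, so the degree would be exactly [m / n]
    if words with repetitions were kept. *)
Lemma pc_D1 v : `|D1 pc_sp pc_F [set: V] v - m%:R / n| <= 2 * ph * m%:R ^+ 3 / n ^+ 2.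
Proof.
have -> : D1 pc_sp pc_F [set: V] v = n ^- m * ws m (fun s => (uniq s)%:R * p s * (count_mem v s)%:R).
  rewrite -pc_fw_sum; apply: eq_bigr => y _; rewrite pc_spE /fw /pc_F.
  by case: (boolP (uniq y)) => uy; rewrite ?mul0r ?mulr0 ?mul0r // count_uniq_mem.
rewrite pc_split (_ : n ^- m * ws m (fun s => p s * (count_mem v s)%:R) = m%:R / n); last first.
  rewrite (@eq_wsum _ _ _ _ _ (fun s => \sum_(j < m) p s * (nth v s j == v)%:R)); last first.
    move=> s sm _; rewrite -mulr_sumr -natr_sum; congr (_ * _%:R).
    rewrite -sum1_count (big_nth v) big_mkord sm [LHS]big_mkcond /=; apply: eq_bigr => j _.
    by case: (_ == _).
  rewrite wsum_sum (eq_bigr (fun=> n ^+ m / n)); last first.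
    by move=> j _; rewrite -(@p_coord v j (ltn_ord j)) mulrAC mulfV // mul1r.
  by rewrite sumr_const card_ord -(mulr_natl (n ^+ m / n)) mulrCA mulKf // gt_eqF.
rewrite addrAC subrr add0r normrN ger0_norm; last first.
  apply: mulr_ge0; first by rewrite invr_ge0 ltW.
  apply: wsum_ge0 => s _ _.
  by rewrite !mulr_ge0 ?ler0n.
rewrite ler_pdivrMl //; have := count_nuniq_mem R m v; rewrite -/n => nu.
apply: (@le_trans _ _ (ph * ws m (fun s => (~~ uniq s)%:R * (count_mem v s)%:R))).
  rewrite -wsumZ; apply: ler_wsum => s sm _; rewrite mulrAC [leRHS]mulrC; apply: ler_wpM2l; last exact: p_hi.
  by rewrite mulr_ge0 ?ler0n.
rewrite (_ : n ^+ m * _ = ph * (2 * m%:R ^+ 3 * n ^+ m / n ^+ 2)); last by ring.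
by apply: ler_wpM2l => //; rewrite ler_pdivlMr // mulrC.
Qed.
Lemma pc_SU : SU pc_sp pc_F m [set: V] <= pc_K / n ^+ 3.
Proof.
have Rdb v : `|Rd pc_sp pc_F m [set: V] v| <= 3 * ph * m%:R ^+ 3 / n ^+ 2.
  rewrite /Rd cardsT -/n; have /andP[f1 f2] := pc_FU_bnd; set f := FU _ _ _ in f1 f2 *.
  rewrite (_ : D1 _ _ _ _ - _ = (D1 pc_sp pc_F [set: V] v - m%:R / n) + m%:R / n * (1 - f)); last by ring.
  apply: le_trans (ler_normD _ _) _.
  have h1 := pc_D1 v.
  have mn : 0 <= m%:R / n by rewrite divr_ge0 // ltW.
  have h2 : `|m%:R / n * (1 - f)| <= m%:R / n * pc_dl.
    rewrite normrM (ger0_norm mn); apply: ler_wpM2l => //; rewrite ger0_norm; lra.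
  have -> : 3 * ph * m%:R ^+ 3 / n ^+ 2 = 2 * ph * m%:R ^+ 3 / n ^+ 2 + m%:R / n * pc_dl.
    by rewrite /pc_dl; field.
  exact: lerD.
apply: (@le_trans _ _ (\sum_(v in [set: V]) (3 * ph * m%:R ^+ 3 / n ^+ 2) ^+ 2)).
  apply: ler_sum => v _; rewrite -real_normK ?num_real //; apply: lerXn2r; rewrite ?nnegrE //.
  by rewrite !mulr_ge0 ?invr_ge0 ?exprn_ge0 // ltW.
rewrite sumr_const cardsT -[leLHS]mulr_natl -/n.
rewrite (_ : n * _ = 9 * ph ^+ 2 * m%:R ^+ 6 / n ^+ 3); last by field.
rewrite ler_pM2r ?invr_gt0 //; by case: K_terms => *; rewrite /pc_K; lra.
Qed.
Lemma pc_GU : - A - B * pc_dl <= GU pc_sp pc_F pc_psi [set: V].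
Proof.
have B0 : 0 <= B.
  have /card_gt0P[v _] := V_gt0; apply: le_trans (psi_B (size_nseq m v)) => //.
have -> : GU pc_sp pc_F pc_psi [set: V] = n ^- m * ws m (fun s => (uniq s)%:R * p s * (ln (W s) - ln (p s))).
  rewrite -pc_fw_sum; apply: eq_bigr => y _; rewrite /fw /pc_F /pc_psi.
  by case: (uniq y); rewrite ?mul1r // !(mul0r,mulr0).
rewrite pc_split; apply: lerB.
  by rewrite ler_pdivlMl // mulrN.
by apply: le_trans (ler_norm _) _; apply: pc_nuniq_le.
Qed.

(** Holds with equality: the first piece is split off the ordering. *)
Lemma pc_OmS (U : {set V}) j N0 : #|U| = (N0 + j.+1 * m)%N ->
  \sum_y fw pc_sp pc_F U y * (expR (pc_psi y) * pc_Om (U :\: pc_sp y) j) <= pc_Om U j.+1.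
Proof.
move=> cU; pose b := (N0 + j * m)%N.
have cU' : #|U| = (m + b)%N by rewrite cU /b mulSn addnCA.
rewrite le_eqVlt; apply/orP; left; apply/eqP.
rewrite /pc_Om cU'.
rewrite [in RHS](@eq_wsum _ _ _ _ _ (fun s => (uniq s)%:R * (W (take m s) *
   (fun s => \prod_(i < j) W (take m (drop (i * m) s))) (drop m s)))); last first.
  move=> s _ _; rewrite big_ord_recl mul0n drop0; congr (_ * (_ * _)); apply: eq_bigr => i _.
  by rewrite drop_drop lift0 mulSn addnC.
rewrite (wsum_uniq_cat U m b W (fun s => \prod_(i < j) W (take m (drop (i * m) s)))) mulSn exprD invfM -[RHS]mulrA -wsumZ.
rewrite -[in RHS](finset.setTI U) -wsum_restrict wsum_tuple mulr_sumr finset.setTI.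
apply: eq_bigr => y _; rewrite /fw /pc_F.
have -> : pc_sp y \subset U = all (mem U) y.
  by apply/fintype.subsetP/allP => s v vy; apply: s; rewrite ?inE in vy *.
case: (boolP (all (mem U) y)) => yU; last by rewrite !(mul0r, mulr0).
case: (boolP (uniq y)) => uy; last by rewrite !(mul0r, mulr0).
rewrite /pc_psi uy !mul1r.
have py : 0 < p y by apply: lt_le_trans plo_gt0 (p_lo _ _); rewrite ?size_tuple.
rewrite expRD expRN !lnK ?posrE //.
have -> : #|U :\: pc_sp y| = b.
  have cy : #|pc_sp y| = m by rewrite /pc_sp cardsE (card_uniqP uy) size_tuple.
  apply: (@addnI m); rewrite -cU' -(cardsID (pc_sp y) U) (finset.setIidPr _); first by rewrite cy.
  by apply/fintype.subsetP => v; rewrite inE => /(allP yU).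
rewrite /pc_sp; field.
by rewrite !expf_neq0 ?gt_eqF.
Qed.
Lemma pc_Om0 (U : {set V}) : pc_Om U 0 = #|U| `!%:R.
Proof.
rewrite /pc_Om mul0n expr0 invr1 mul1r -ffactnn -(wsum_uniq_count R U); apply: eq_wsum => s _ _.
by rewrite big_ord0 mulr1.
Qed.

Lemma pc_main (d : R) T N0 : 0 < d -> 4 * m%:R ^+ 2 * pc_K ^+ 2 <= n -> pc_dl <= 1 / 2 ->
  eps * n <= N0%:R -> #|V| = (N0 + T * m)%N ->
  N0`!%:R * expR (- (T%:R * A) - ph * m%:R * (2 + 2 * A + 2 * B) - n - n * errc V m pc_K eps B d - Hc m pc_K B d * pc_K / n)
   <= pc_Om [set: V] T.
Proof.
move=> d0 nl dl1 eN cV.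
have B0 : 0 <= B.
  have /card_gt0P[v _] := V_gt0; apply: le_trans (psi_B (size_nseq m v)) => //.
have N0f : 0 < N0`!%:R :> R by rewrite ltr0n fact_gt0.
apply: le_trans (potential_main pc_F_ge0 pc_F_card pc_K_ge1 eps_gt0 V_gt0 pc_psi_le pc_deg1 pc_deg2 pc_deg3 pc_FU_ge nl m_gt0
   N0f eN _ (fun U j => @pc_OmS U j N0) B0 d0 cV pc_SU); last by move=> U cU; rewrite pc_Om0 cU.
apply: ler_wpM2l; rewrite ?ler0n // ler_expR.
do 3 apply: lerB => //.
have /andP[f1 f2] := pc_FU_bnd; set f := FU _ _ _ in f1 f2 *.
have f0 : 0 < f by lra.
have lf : - (2 * pc_dl) <= ln f.
  apply: le_trans (ln_ge_1subV f0); rewrite lerBrDr -lerBrDl opprK -[leLHS]mul1r ler_pdivrMr //; nra.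
have gf : - A - pc_dl * (2 * A + 2 * B) <= gU pc_sp pc_F pc_psi [set: V].
  rewrite /gU -/f ler_pdivlMr //; apply: le_trans pc_GU.
  exact: quotient_loss.
have Td : T%:R * pc_dl <= ph * m%:R.
  rewrite /pc_dl mulrA ler_pdivrMr // (_ : T%:R * _ = ph * m%:R * (T%:R * m%:R)); last by ring.
  apply: ler_wpM2l; first by rewrite mulr_ge0.
  by rewrite -natrM ler_nat cV leq_addl.
have h1 := ler_wpM2l (ler0n R T) (lerD lf gf).
apply: le_trans h1.
have c0 : 0 <= 2 + 2 * A + 2 * B by have := A_ge0; lra.
have := ler_wpM2r c0 Td; lra.
Qed.
End PieceCount.

(** * The softened entropy maximiser *)

Section ExtremeValue.
Variable R : realType.

Lemma sum_continuous (T : topologicalType) (I : Type) (r : seq I) (f : I -> T -> R) :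
  (forall i, continuous (f i)) -> continuous (fun x => \sum_(i <- r) f i x).
Proof.
move=> fc v; elim: r => [|i r IH].
  rewrite (_ : (fun _ => _) = (fun=> 0)); first exact: cvg_cst.
  by apply: boolp.funext => u; rewrite big_nil.
rewrite (_ : (fun _ => _) = (fun u => f i u + \sum_(i <- r) f i u)); last first.
  by apply: boolp.funext => u; rewrite big_cons.
by apply: cvgD; [exact: fc | exact: IH].
Qed.

Lemma linear_rV_continuous N (a : 'I_N -> R) :
  continuous (fun v : 'rV[R]_N => \sum_i a i * v ord0 i).
Proof.
apply: sum_continuous => i v.
by apply: continuousM; [exact: cst_continuous | exact: coord_continuous].
Qed.

(** Extreme value theorem on a box cut by linear equations. With coordinates as linear forms and the
    vertex conditions as equations it gives the softened maximiser; with vertex degrees as forms and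
    no equation it gives the best approximate matching. *)
Lemma linear_opt (I J C : finType) (a : J -> I -> R) (phi : J -> R -> R)
    (b : C -> I -> R) (d : C -> R) (B : R) (x0 : I -> R) :
  (forall j, continuous (phi j)) ->
  (forall i, 0 <= x0 i <= B) -> (forall c, \sum_i b c i * x0 i = d c) ->
  exists x : I -> R, [/\ forall i, 0 <= x i <= B, forall c, \sum_i b c i * x i = d c &
    forall y : I -> R, (forall i, 0 <= y i <= B) -> (forall c, \sum_i b c i * y i = d c) ->
      \sum_j phi j (\sum_i a j i * y i) <= \sum_j phi j (\sum_i a j i * x i)].
Proof.
move=> phic x00 x0c; pose N := #|I|.
pose val (v : 'rV[R]_N) i := v ord0 (enum_rank i).
pose vec (x : I -> R) : 'rV[R]_N := \row_j x (enum_val j).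
have vecK x i : val (vec x) i = x i by rewrite /val /vec mxE enum_rankK.
have linE (h : I -> R) v : \sum_i h i * val v i = \sum_(j < N) h (enum_val j) * v ord0 j.
  rewrite (reindex (@enum_rank I)); last first.
    by exists enum_val => i _; rewrite ?enum_valK ?enum_rankK.
  by apply: eq_bigr => i _; rewrite enum_rankK.
pose box : set 'rV[R]_N := [set v | forall j, `[0, B]%classic (v ord0 j)]%classic.
pose con : set 'rV[R]_N := (\bigcap_(c : C) ((fun v => \sum_i b c i * val v i) @^-1` [set x | x = d c]))%classic.
have cc : closed con.
  apply: closed_bigI => c _; apply: preimage_closed; last exact: closed_eq.
  move=> v _; rewrite (_ : (fun _ => _) = (fun v : 'rV[R]_N => \sum_(j < N) b c (enum_val j) * v ord0 j)).
    exact: linear_rV_continuous.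
  by apply: boolp.funext => u; rewrite linE.
have cA : compact (box `&` con)%classic.
  apply: compact_closedI => //; apply: (@rV_compact R N (fun=> `[0, B]%classic)) => _.
  exact: segment_compact.
pose f v := \sum_j phi j (\sum_i a j i * val v i).
have fc : continuous f.
  apply: sum_continuous => j v.
  rewrite (_ : (fun x => _) = phi j \o (fun v : 'rV[R]_N => \sum_(i < N) a j (enum_val i) * v ord0 i)); last first.
    by apply: boolp.funext => u; rewrite /= linE.
  by apply: continuous_comp; [exact: linear_rV_continuous | exact: phic].
have inA x : (forall i, 0 <= x i <= B) -> (forall c, \sum_i b c i * x i = d c) -> (box `&` con)%classic (vec x).
  move=> x1 x2; split=> [j|c _] /=; first by rewrite mxE in_itv /= x1.
  by rewrite -x2; apply: eq_bigr => i _; rewrite vecK.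
have [|v] := @EVT_max_rV R N f (box `&` con)%classic _ cA (continuous_subspaceT fc).
  by exists (vec x0); apply: inA.
rewrite inE => -[vb vc] vmax; exists (val v); split.
- by move=> i; have := vb (enum_rank i); rewrite /= in_itv.
- by move=> c; apply: (vc c).
- move=> y y1 y2; have := vmax (vec y); rewrite inE => /(_ (inA _ y1 y2)).
  by rewrite /f; under eq_bigr do under eq_bigr do rewrite vecK.
Qed.

Lemma xlnx_continuous : continuous (fun x : R => x * ln x).
Proof.
move=> x; have [x0|x0|x0] := ltgtP x 0.
- apply/cvgrPdist_lt => e e0; near=> y.
  have y0 : y < 0 by near: y; exact: lt_nbhsl.
  by rewrite !ln0 ?(ltW x0) ?(ltW y0) // !mulr0 subrr normr0.
- by apply: cvgM; [exact: cvg_id | exact: continuous_ln].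
- rewrite /continuous_at x0 mul0r; apply/cvgrPdist_lt => e e0.
  have e2 : 0 < (e / 4) ^+ 2 by rewrite exprn_gt0 // divr_gt0.
  near=> y.
  rewrite sub0r normrN; have [y0|y0] := lerP y 0; first by rewrite ln0 // mulr0 normr0.
  have yd : y < (e / 4) ^+ 2 by near: y; exact: lt_nbhsl.
  have y1 : y < 1 by near: y; apply: lt_nbhsl; exact: ltr01.
  (* With [y = s^2], the bound [|ln s| <= s + 1/s] gives [|y ln y| <= 2 s^3 + 2 s]. *)
  pose s := Num.sqrt y; have s0 : 0 < s by rewrite sqrtr_gt0.
  have sy : y = s ^+ 2 by rewrite sqr_sqrtr // ltW.
  have se : s < e / 4.
    rewrite ltNge; apply/negP => h; move: yd; rewrite sy ltNge; apply/negP/negPn.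
    by apply: lerXn2r; rewrite // nnegrE ltW // divr_gt0.
  have s1 : s <= 1.
    rewrite leNgt; apply/negP => h; move: y1; rewrite sy; nra.
  have ls : `|ln s| <= s + s^-1.
    have h1 := ln_le_subr1 s0; have h2 := ln_ge_1subV s0.
    have sv : 0 < s^-1 by rewrite invr_gt0.
    rewrite ler_norml; apply/andP; split; lra.
  rewrite sy lnXn // normrM normrMn (ger0_norm (sqr_ge0 s)).
  apply: (@le_lt_trans _ _ (s ^+ 2 * ((s + s^-1) *+ 2))).
    by apply: ler_wpM2l; rewrite ?sqr_ge0 // lerMn2r.
  have -> : s ^+ 2 * ((s + s^-1) *+ 2) = 2 * s ^+ 3 + 2 * s by field; rewrite gt_eqF.
  nra.
Unshelve. all: by end_near. Qed.
End ExtremeValue.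

Section SoftOptimum.
Variables (R : realType) (V : finType) (k : nat) (E : {set {set V}}) (kappa : R).
Implicit Types (x y : {set V} -> R) (e f : {set V}) (a b v : V).
Hypothesis kappa0 : 0 < kappa.
Hypothesis kappa1 : kappa <= 1.
Hypothesis k_gt0 : (0 < k)%N.

Definition ksets : {set {set V}} := [set e : {set V} | #|e| == k].
Definition wt e : R := if e \in E then 1 else kappa.
(** Entropy in natural logarithms, minus the price [- ln kappa] per unit of weight on non-edges. *)
Definition soft_value x : R := \sum_(e in ksets) x e * (ln (wt e) - ln (x e)).

Lemma wt_gt0 e : 0 < wt e. Proof. by rewrite /wt; case: ifP. Qed.
Lemma wt_le1 e : wt e <= 1. Proof. by rewrite /wt; case: ifP. Qed.
Lemma wt_ge e : kappa <= wt e. Proof. by rewrite /wt; case: ifP. Qed.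

Lemma pfm_le1 x e : perfect_fractional_matching ksets x -> e \in ksets -> x e <= 1.
Proof.
move=> [x0 x1] ek; have /card_gt0P[v ve] : (0 < #|e|)%N by move: ek; rewrite inE => /eqP ->.
rewrite -(x1 v) (bigD1 e) ?ek //=; apply: ler_wpDr => //.
by apply: sumr_ge0 => f /andP[/andP[fk _] _]; apply: x0.
Qed.

Lemma soft_opt_exists x0 : perfect_fractional_matching ksets x0 ->
  exists X, perfect_fractional_matching ksets X /\
    forall y, perfect_fractional_matching ksets y -> soft_value y <= soft_value X.
Proof.
move=> px0.
pose cut (x : {set V} -> R) e : R := if e \in ksets then x e else 0.
pose phi (e : {set V}) (u : R) : R := if e \in ksets then u * ln (wt e) - u * ln u else 0.
pose a (e f : {set V}) : R := (f == e)%:R.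
pose b (v : V) (e : {set V}) : R := ((e \in ksets) && (v \in e))%:R.
have asum e (x : {set V} -> R) : \sum_f a e f * x f = x e.
  rewrite (bigD1 e) //= /a eqxx mul1r big1 ?addr0 // => f /negbTE ->.
  by rewrite mul0r.
have bsum v (x : {set V} -> R) : \sum_e b v e * x e = \sum_(e in ksets | v \in e) x e.
  by rewrite [RHS]big_mkcond; apply: eq_bigr => e _; rewrite /b; case: ifP; rewrite ?mul1r ?mul0r.
have cutP x : perfect_fractional_matching ksets x ->
    (forall e, 0 <= cut x e <= 1) /\ (forall v, \sum_e b v e * cut x e = 1).
  move=> px; split=> [e|v].
    rewrite /cut; case: ifP => ek; last by rewrite lexx ler01.
    by rewrite (pfm_le1 px ek) andbT; case: px => + _; apply.
  rewrite bsum -[RHS](proj2 px v); apply: eq_bigr => e /andP[ek _].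
  by rewrite /cut ek.
have phic e : continuous (phi e).
  move=> u; rewrite /phi; case: (e \in ksets); last exact: cvg_cst.
  apply: cvgB; last exact: xlnx_continuous.
  by apply: cvgM; [exact: cvg_id | exact: cvg_cst].
have val x : \sum_e phi e (\sum_f a e f * cut x f) = soft_value x.
  rewrite /soft_value [RHS]big_mkcond; apply: eq_bigr => e _.
  by rewrite asum /phi /cut; case: (e \in ksets) => //; rewrite mulrBr.
have [X [X1 X2 Xm]] := @linear_opt R _ _ _ a phi b (fun=> 1) 1 (cut x0) phic (proj1 (cutP _ px0)) (proj2 (cutP _ px0)).
have pX : perfect_fractional_matching ksets X.
  by split=> [e _|v]; [have /andP[] := X1 e | rewrite -bsum].
exists X; split=> // y py.
rewrite -(val y); apply: le_trans (Xm _ (proj1 (cutP _ py)) (proj2 (cutP _ py))) _.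
rewrite /soft_value [leRHS]big_mkcond; apply: ler_sum => e _.
by rewrite asum /phi; case: (e \in ksets) => //; rewrite mulrBr.
Qed.

Lemma xlnx_tangent (u v : R) : 0 <= u -> 0 < v -> u * ln v - u * ln u <= v - u.
Proof.
move=> u0 v0; case: (ltgtP u 0) u0 => // [u0 _|-> _]; last by rewrite !mul0r subrr subr0 ltW.
have := ln_le_subr1 (divr_gt0 v0 u0); rewrite ln_div ?posrE // => h.
have := ler_wpM2l (ltW u0) h.
by rewrite mulrBr mulrBr mulr1 mulrCA mulfV ?gt_eqF // mulr1.
Qed.

Lemma sum_delta (A : {set V}) (c : {set V} -> R) : A \in ksets ->
  \sum_(e in ksets) (e == A)%:R * c e = c A.
Proof.
move=> Ak; rewrite (bigD1 A) //= eqxx mul1r big1 ?addr0 // => e /andP[_ /negbTE ->].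
by rewrite mul0r.
Qed.

Lemma small_shift (p r s t K d : R) : 0 <= p <= 1 -> 0 <= r <= 1 -> 0 <= s <= 1 -> 0 <= t <= 1 ->
  0 <= K <= 1 -> 0 < d <= 1 -> p * r * K - s * t = 6 * d -> (s + d) * (t + d) < (p - d) * (r - d) * K.
Proof.
move=> /andP[p0 p1] /andP[r0 r1] /andP[s0 s1] /andP[t0 t1] /andP[K0 K1] /andP[d0 d1] h.
have q1 : (s + d) * (t + d) <= s * t + 3 * d by nra.
have Kp : K * p <= 1 by rewrite mulr_ile1.
have Kr : K * r <= 1 by rewrite mulr_ile1.
have q2 : d * (K * p + K * r) <= 2 * d by nra.
have q3 : 0 <= d ^+ 2 * K by rewrite mulr_ge0 ?sqr_ge0.
have -> : (p - d) * (r - d) * K = p * r * K - d * (K * p + K * r) + d ^+ 2 * K by ring.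
lra.
Qed.

Definition tw a b e := b |: (e :\ a).

Variable X : {set V} -> R.
Hypothesis pX : perfect_fractional_matching ksets X.
Hypothesis optX : forall y, perfect_fractional_matching ksets y -> soft_value y <= soft_value X.

Lemma card_tw a b e : a \in e -> b \notin e -> #|tw a b e| = #|e|.
Proof. by move=> ae be; rewrite cardsU1 !inE (negbTE be) andbF (cardsD1 a e) ae. Qed.

(** Moving a little weight from [e] and [f] to [tw a b e] and [tw b a f] preserves all degrees. If
    the inequality failed, the move would raise the softened value: the logarithms of the four
    weights favour it by more than [- 2 ln kappa], and the factors [wt] cost at most that. *)
Lemma exchange a b e f : a != b -> e \in ksets -> f \in ksets ->
  a \in e -> b \notin e -> b \in f -> a \notin f ->
  X e * X f * kappa ^+ 2 <= X (tw a b e) * X (tw b a f).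
Proof.
move=> ab ek fk ae be bf af.
have e1k : tw a b e \in ksets by rewrite inE card_tw //; move: ek; rewrite inE.
have f1k : tw b a f \in ksets by rewrite inE card_tw //; move: fk; rewrite inE.
have X0 g : g \in ksets -> 0 <= X g by case: pX => + _; apply.
have X1 g : g \in ksets -> X g <= 1 by apply: pfm_le1.
case: (eqVneq (tw a b e) f) => [ef|ef].
  have -> : tw b a f = e.
    rewrite -ef; apply/setP => v; rewrite !inE.
    case: (eqVneq v a) => [->|va] //=; case: (eqVneq v b) => [->|vb] //=.
    by rewrite (negbTE be).
  rewrite ef [X in _ <= X]mulrC -[leRHS]mulr1; apply: ler_wpM2l; first by rewrite mulr_ge0 ?X0.
  by rewrite exprn_ile1 // ltW.
rewrite leNgt; apply/negP => H.
set e1 := tw a b e in ef e1k H; set f1 := tw b a f in f1k H.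
have e1e : e1 != e by apply: contraNneq be => <-; rewrite !inE eqxx.
have f1f : f1 != f by apply: contraNneq af => <-; rewrite !inE eqxx.
have e_f : e != f by apply: contraNneq af => <-.
have f1e1 : f1 != e1.
  apply/eqP => h; have := ab; have : a \in e1 by rewrite -h !inE eqxx.
  by rewrite !inE eqxx /= orbF => /eqP ->; rewrite eqxx.
have f1e : f1 != e.
  apply: contra_neq ef => h; rewrite /e1 -h; apply/setP => v; rewrite !inE.
  case: (eqVneq v b) => [->|vb] //=; case: (eqVneq v a) => [->|va] //=.
  by rewrite (negbTE af).
pose gap := X e * X f * kappa ^+ 2 - X e1 * X f1.
have gap0 : 0 < gap by rewrite subr_gt0.
(* The move changes the two products by at most [3 * dl] and [2 * dl], so a sixth of the gap keeps
   the inequality strict. *)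
pose dl := gap / 6.
have dl0 : 0 < dl by rewrite divr_gt0.
have k2 : kappa ^+ 2 <= 1 by rewrite exprn_ile1 // ltW.
have k20 : 0 < kappa ^+ 2 by rewrite exprn_gt0.
have [xe0 xf0 xe10 xf10] := And4 (X0 _ ek) (X0 _ fk) (X0 _ e1k) (X0 _ f1k).
have [xe1 xf1 xe11 xf11] := And4 (X1 _ ek) (X1 _ fk) (X1 _ e1k) (X1 _ f1k).
have xx0 : 0 <= X e1 * X f1 by rewrite mulr_ge0.
have ge : gap <= X e.
  have : X e * (X f * kappa ^+ 2) <= X e by rewrite ler_piMr // mulr_ile1 // ltW.
  by rewrite /gap mulrA; lra.
have gf : gap <= X f.
  have : X f * (X e * kappa ^+ 2) <= X f by rewrite ler_piMr // mulr_ile1 // ltW.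
  by rewrite /gap mulrA [X f * X e]mulrC; lra.
have d1 : dl < X e by rewrite /dl; lra.
have d2 : dl < X f by rewrite /dl; lra.
have g6 : gap = 6 * dl by rewrite /dl; field.
have Hd : (X e1 + dl) * (X f1 + dl) < (X e - dl) * (X f - dl) * kappa ^+ 2.
  apply: small_shift => //; rewrite ?xe0 ?xf0 ?xe10 ?xf10 //; first by rewrite (ltW k20).
  by rewrite dl0 /=; lra.
pose ch (g : {set V}) : R := (g == e1)%:R + (g == f1)%:R - (g == e)%:R - (g == f)%:R.
pose Y g := X g + dl * ch g.
have che1 : ch e1 = 1 by rewrite /ch eqxx (negbTE e1e) (negbTE ef) (eq_sym e1 f1) (negbTE f1e1) /=; lra.
have chf1 : ch f1 = 1 by rewrite /ch eqxx (negbTE f1f) (negbTE f1e1) (negbTE f1e) /=; lra.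
have che : ch e = -1 by rewrite /ch eqxx (negbTE e_f) (eq_sym e f1) (eq_sym e e1) (negbTE f1e) (negbTE e1e) /=; lra.
have chf : ch f = -1 by rewrite /ch eqxx (eq_sym f e1) (eq_sym f f1) (eq_sym f e) (negbTE f1f) (negbTE ef) (negbTE e_f) /=; lra.
have ch0 g : g != e1 -> g != f1 -> g != e -> g != f -> ch g = 0.
  by rewrite /ch => /negbTE -> /negbTE -> /negbTE -> /negbTE -> /=; lra.
have Yc g : g \in ksets -> (Y g = X g) \/ (0 < Y g).
  move=> gk; rewrite /Y.
  case: (eqVneq g e1) => [->|n1]; first by rewrite che1; right; lra.
  case: (eqVneq g f1) => [->|n2]; first by rewrite chf1; right; lra.
  case: (eqVneq g e) => [->|n3]; first by rewrite che; right; lra.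
  case: (eqVneq g f) => [->|n4]; first by rewrite chf; right; lra.
  by left; rewrite ch0 // mulr0 addr0.
have pY : perfect_fractional_matching ksets Y.
  split=> [g gk|v]; first by case: (Yc g gk) => [->|/ltW //]; apply: X0.
  rewrite big_split /= (proj2 pX v) -mulr_sumr.
  rewrite (_ : \sum_(_ in _ | _) ch _ = 0) ?mulr0 ?addr0 //.
  have S A : A \in ksets -> \sum_(g in ksets | v \in g) (g == A)%:R = (v \in A)%:R :> R.
    move=> Ak; rewrite big_mkcondr /= -(sum_delta (fun g => (v \in g)%:R) Ak).
    by apply: eq_bigr => g _; case: (v \in g); rewrite ?mulr1 ?mulr0.
  rewrite /ch !sumrB big_split /= !S // !inE.
  case: (eqVneq v a) => [->|va] /=.
    by rewrite ae (negbTE af) (negbTE ab) /=; lra.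
  case: (eqVneq v b) => [->|vb] /=; first by rewrite bf (negbTE be) /=; lra.
  lra.
have := optX pY; rewrite leNgt => /negP; apply.
rewrite -subr_gt0 -sumrB.
(* By concavity the gain is at least the derivative at [Y] applied to the displacement. The
   derivative at [X] would not do, as [X] may vanish at the sets that receive weight. *)
pose c g := ln (wt g) - ln (Y g) - 1.
apply: (@lt_le_trans _ _ (\sum_(g in ksets) (Y g - X g) * c g)); last first.
  apply: ler_sum => g gk; case: (Yc g gk) => [->|Y0]; first by rewrite !subrr mul0r.
  have := xlnx_tangent (X0 _ gk) Y0; rewrite /c; lra.
rewrite (eq_bigr (fun g => dl * ((g == e1)%:R * c g + (g == f1)%:R * c g - (g == e)%:R * c g - (g == f)%:R * c g))); last first.
  by move=> g _; rewrite /Y /ch; ring.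
rewrite -mulr_sumr !sumrB big_split /= !sum_delta //; apply: mulr_gt0 => //.
rewrite /c /Y che1 chf1 che chf !mulrN1 !mulr1.
have p1 : 0 < X e - dl by lra. have p2 : 0 < X f - dl by lra.
have p3 : 0 < X e1 + dl by lra. have p4 : 0 < X f1 + dl by lra.
have : ln ((X e1 + dl) * (X f1 + dl)) < ln ((X e - dl) * (X f - dl) * kappa ^+ 2).
  by rewrite ltr_ln ?posrE ?mulr_gt0 // exprn_gt0.
rewrite !lnM ?posrE ?mulr_gt0 ?exprn_gt0 // => h.
have w1 : ln kappa <= ln (wt e1) by rewrite ler_ln ?posrE ?wt_gt0 // wt_ge.
have w2 : ln kappa <= ln (wt f1) by rewrite ler_ln ?posrE ?wt_gt0 // wt_ge.
have w3 : ln (wt e) <= 0 by apply: ln_le0; apply: wt_le1.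
have w4 : ln (wt f) <= 0 by apply: ln_le0; apply: wt_le1.
lra.
Qed.

(** Sum [exchange] over all [f] that contain [b] but not [a]. As all degrees are one, these have the
    same total weight as the sets that contain [a] but not [b], onto which [tw b a] maps them
    bijectively, so the two totals cancel. *)
Lemma exchange_sum a b e : a != b -> e \in ksets -> a \in e -> b \notin e ->
  X e * kappa ^+ 2 <= X (tw a b e).
Proof.
move=> ab ek ae be.
have X0 g : g \in ksets -> 0 <= X g by case: pX => + _; apply.
pose c := \sum_(f in ksets | (b \in f) && (a \notin f)) X f.
pose c' := \sum_(f in ksets | (a \in f) && (b \notin f)) X f.
have cod u v : \sum_(f in ksets | (u \in f) && (v \notin f)) X f =
    1 - \sum_(f in ksets | (u \in f) && (v \in f)) X f.
  rewrite -(proj2 pX u) [X in X - _](bigID (fun f : {set V} => v \in f)) /=.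
  rewrite [X in X + _ - _](eq_bigl (fun f => (f \in ksets) && ((u \in f) && (v \in f)))); last by move=> f; rewrite andbA.
  rewrite addrC addKr; apply: eq_bigl => f; by rewrite andbA.
have cc : c = c'.
  rewrite /c /c' !cod; congr (_ - _); apply: eq_bigl => f; by rewrite [(b \in f) && _]andbC.
have cE : c' = \sum_(f in ksets | (b \in f) && (a \notin f)) X (tw b a f).
  rewrite /c' (reindex_onto (tw b a) (tw a b)) /=; last first.
    move=> f /andP[_ /andP[af bf]]; apply/setP => v; rewrite !inE.
    case: (eqVneq v a) => [->|va] //=; case: (eqVneq v b) => [->|vb] //=.
    by rewrite (negbTE bf).
  apply: eq_bigl => f; apply/idP/idP.
    case/andP=> /andP[fk /andP[_]] h1 /eqP h2.
    have bf : b \in f by rewrite -h2 !inE eqxx.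
    have af : a \notin f by rewrite -h2 !inE eqxx /= orbF.
    by rewrite bf af !andbT; move: fk; rewrite !inE card_tw.
  case/andP=> fk /andP[bf af]; apply/andP; split.
    apply/and3P; split; first by rewrite inE card_tw //; move: fk; rewrite inE.
      by rewrite !inE eqxx.
    by rewrite !inE eqxx /= orbF eq_sym.
  apply/eqP/setP => v; rewrite !inE.
  case: (eqVneq v b) => [->|vb] //=; case: (eqVneq v a) => [->|va] //=.
  by rewrite (negbTE af).
have H : X e * kappa ^+ 2 * c <= X (tw a b e) * c.
  rewrite {2}cc cE /c !mulr_sumr; apply: ler_sum => f /andP[fk /andP[bf af]].
  by rewrite mulrAC; apply: exchange.
have c0 : 0 <= c by apply: sumr_ge0 => f /andP[fk _]; apply: X0.
(* If the common total is zero then so is [X e], which is one of its terms. *)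
case: (ltgtP c 0) c0 => // [c0 _|c0 _]; first by rewrite -(ler_pM2r c0).
suff -> : X e = 0 by rewrite mul0r X0 // inE card_tw //; move: ek; rewrite inE.
apply/eqP; rewrite eq_le X0 // andbT -c0 cc /c' (bigD1 e) ?ek ?ae ?be //=.
by apply: ler_wpDr => //; apply: sumr_ge0 => f /andP[/andP[fk _] _]; apply: X0.
Qed.

(** A [k]-set is turned into any other by at most [k] exchanges of one vertex, each costing
    [kappa ^+ 2]. *)
Lemma soft_opt_ratio e f : e \in ksets -> f \in ksets -> X e * kappa ^+ (2 * k) <= X f.
Proof.
move=> ek fk.
have X0 g : g \in ksets -> 0 <= X g by case: pX => + _; apply.
have kf : #|f| == k by move: fk; rewrite inE.
suff H j g : g \in ksets -> (#|g :\: f| <= j)%N -> X g * kappa ^+ (2 * j) <= X f.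
  apply: H => //; apply: leq_trans (subset_leq_card (finset.subsetDl _ _)) _.
  by move: ek; rewrite inE => /eqP ->.
elim: j g => [|j IH] g gk.
  have kg : #|g| == k by move: gk; rewrite inE.
  rewrite leqn0 cards_eq0 finset.setD_eq0 => gf; rewrite muln0 expr0 mulr1.
  suff -> : g = f by [].
  by apply/eqP; rewrite eqEcard gf (eqP kg) (eqP kf) leqnn.
move=> gj; have kg : #|g| == k by move: gk; rewrite inE.
case: (boolP (g \subset f)) => [gf|].
  by apply: le_trans (IH g gk _); [|by move: gf; rewrite -finset.setD_eq0 => /eqP ->; rewrite cards0];
     apply: ler_wpM2l; [exact: X0 | apply: ler_wiXn2l; rewrite ?(ltW kappa0) // leq_mul2l leqnSn orbT].
case/subsetPn=> a ag af.
have : ~~ (f \subset g).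
  apply/negP => fg; have /eqP fg' : f == g.
    by rewrite eqEcard fg (eqP kg) (eqP kf) leqnn.
  by move: af; rewrite fg' ag.
case/subsetPn=> b bf bg.
have ab : a != b by apply: contraNneq af => ->.
have g1k : tw a b g \in ksets by rewrite inE card_tw //; move: gk; rewrite inE.
have g1j : (#|tw a b g :\: f| <= j)%N.
  have -> : tw a b g :\: f = (g :\: f) :\ a.
    apply/setP => v; rewrite !inE; case: (eqVneq v b) => [->|vb] /=; first by rewrite bf !andbF.
    by case: (v == a); rewrite /= ?andbF.
  by move: gj; rewrite (cardsD1 a (g :\: f)) !inE ag af.
apply: le_trans (IH _ g1k g1j); rewrite mulnS exprD mulrA.
by apply: ler_wpM2r; rewrite ?exprn_ge0 ?(ltW kappa0) // exchange_sum.
Qed.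
End SoftOptimum.

(** * Bounded fractional matchings *)

Lemma uphalf_bounds (a : nat) : (a <= 2 * uphalf a <= a + 1)%N.
Proof. by rewrite uphalf_half; have := odd_double_half a; case: (odd a); lia. Qed.
Lemma pred_neq (a : nat) : (2 <= a)%N -> a.-1 = a -> False.
Proof. by case: a => [|a] //=; lia. Qed.

Lemma notin_link (V : finType) (k : nat) (E : {set {set V}}) (S : {set V}) (b : V) :
  (2 <= k)%N -> is_kuniform k E -> #|S| = k.-1 -> b |: S \in E -> b \notin S.
Proof.
move=> k2 Ek cS bE; apply/negP => bS; have := Ek _ bE.
have -> : b |: S = S by apply/finset.setUidPr; rewrite finset.sub1set.
by rewrite cS => /(pred_neq k2).
Qed.

Section BoundedMatching.
Variables (R : realType) (V : finType).
Implicit Types (S H : {set V}) (r : V -> R).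

Lemma ler_sum_subset (T : finType) (P Q : pred T) (f : T -> R) :
  (forall i, Q i -> 0 <= f i) -> (forall i, P i -> Q i) ->
  \sum_(i | P i) f i <= \sum_(i | Q i) f i.
Proof.
move=> f0 PQ; rewrite [leRHS](bigID P) /= (eq_bigl P); last first.
  by move=> i; rewrite andbC; case: (boolP (P i)) => // /PQ ->.
by rewrite lerDl; apply: sumr_ge0 => i /andP[/f0].
Qed.

Lemma top_set r h : (h <= #|V|)%N ->
  exists2 H : {set V}, #|H| = h & forall u v, u \in H -> v \notin H -> r v <= r u.
Proof.
elim: h => [|h IH] hV; first by exists finset.set0; rewrite ?cards0 // => u v; rewrite inE.
have [H cH Hr] := IH (ltnW hV).
have /card_gt0P[v0 v0H] : (0 < #|~: H|)%N by rewrite cardsCs finset.setCK cH subn_gt0.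
pose w := [arg max_(v > v0 | v \in ~: H) r v]%O.
have [wH wmax] : w \in ~: H /\ forall v, v \in ~: H -> r v <= r w.
  by rewrite /w; case: arg_maxP => // i iH im; split=> // v vH; apply: im.
exists (w |: H); first by rewrite cardsU1; move: wH; rewrite inE => ->; rewrite cH.
move=> u v; rewrite !inE negb_or => /orP[/eqP->|uH] /andP[vw vH].
  by apply: wmax; rewrite inE.
exact: Hr.
Qed.

Lemma sum_subsets r H j :
  \sum_(S : {set V} | (S \subset H) && (#|S| == j.+1)) \sum_(v in S) r v =
  'C(#|H|.-1, j)%:R * \sum_(v in H) r v.
Proof.
rewrite (exchange_big_dep (fun v => v \in H)) /=; last first.
  by move=> S v /andP[/fintype.subsetP sH _] /sH.
rewrite mulr_sumr; apply: eq_bigr => v vH; rewrite sumr_const -[LHS]mulr_natl; congr (_%:R * _).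
have <- : #|H :\ v| = #|H|.-1 by rewrite [#|H|](cardsD1 v) vH.
rewrite -(cards_draws (H :\ v) j).
rewrite -[RHS](@card_in_imset _ _ (fun S => v |: S)); last first.
  move=> S T; rewrite ![_ \in finset _]inE => /andP[/fintype.subsetP sS _] /andP[/fintype.subsetP sT _] e.
  apply/setP => u; case: (eqVneq u v) => [->|uv].
    have -> : (v \in S) = false by apply/negP => /sS; rewrite !inE eqxx.
    by apply/esym/negP => /sT; rewrite !inE eqxx.
  by have /setP/(_ u) := e; rewrite !inE (negbTE uv).
apply: eq_card => S; apply/idP/imsetP.
  rewrite unfold_in => /andP[/andP[SH cS] vS]; exists (S :\ v); last by rewrite finset.setD1K.
  rewrite inE; apply/andP; split; first by apply: finset.setSD.
  by move: cS; rewrite (cardsD1 v) vS.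
case=> T; rewrite inE => /andP[/fintype.subsetP TH cT] ->; rewrite unfold_in !inE eqxx /= andbT.
have vT : v \notin T by apply/negP => /TH; rewrite !inE eqxx.
rewrite cardsU1 vT (eqP cT) eqxx andbT; apply/fintype.subsetP => u; rewrite !inE.
by case/orP=> [/eqP->//|/TH]; rewrite !inE => /andP[].
Qed.

Variables (k : nat) (E : {set {set V}}) (gamma : R).
Let n : R := #|V|%:R.
Hypothesis k_ge2 : (2 <= k)%N.
Hypothesis Ek : is_kuniform k E.
Hypothesis gamma0 : 0 < gamma.
Hypothesis gamma1 : gamma <= 1 / 2.
Hypothesis codeg : forall S, #|S| = k.-1 -> (1 / 2 + gamma) * n <= (codegree E S)%:R.

Lemma subset_of_card (B : {set V}) j : (j <= #|B|)%N -> exists2 A : {set V}, A \subset B & #|A| = j.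
Proof.
rewrite -bin_gt0 -(cards_draws B j) => /card_gt0P[A]; rewrite inE => /andP[AB /eqP Aj].
by exists A.
Qed.

(** Dual certificate for a fractional matching with bounded weights. Let [H] consist of the [h]
    vertices with largest [r]. The edges formed by a (k-1)-subset of [H] and a vertex outside have
    large [r]-sum on average; adding up over all these subsets counts each edge at most [k]
    times. *)
Lemma dirac_dual r h : (0 < h)%N -> (k.-1 <= h)%N -> h%:R <= gamma / 2 * n ->
  'C(h, k.-1)%:R * \sum_v r v <= k%:R * \sum_(e in E) Num.max 0 (\sum_(v in e) r v).
Proof.
move=> h0 kh hn.
have phi0 (e : {set V}) : 0 <= Num.max 0 (\sum_(v in e) r v) by rewrite le_max lexx.
have RHS0 : 0 <= k%:R * \sum_(e in E) Num.max 0 (\sum_(v in e) r v).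
  by rewrite mulr_ge0 ?ler0n // sumr_ge0.
have C0 : 0 <= 'C(h, k.-1)%:R :> R by rewrite ler0n.
case: (leP (\sum_v r v) 0) => [s0|s0]; first by apply: le_trans RHS0; rewrite mulr_ge0_le0.
have h1 : 1 <= h%:R :> R by rewrite ler1n.
have n_ge : 2 <= gamma * n by lra.
have n0 : 0 <= n by rewrite ler0n.
have gn := ler_wpM2r n0 gamma1.
have n4 : 4 <= n by lra.
have hV : (h <= #|V|)%N by rewrite -(ler_nat R) -/n; lra.
have [H cH Hr] := top_set r hV.
have /card_gt0P[u1 u1H] : (0 < #|H|)%N by rewrite cH.
pose u0 := [arg min_(u < u1 | u \in H) r u]%O.
have [u0H u0min] : u0 \in H /\ forall u, u \in H -> r u0 <= r u.
  by rewrite /u0; case: arg_minP => // i iH im; split=> // v vH; apply: im.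
pose rho := r u0.
have rhoH : h%:R * rho <= \sum_(v in H) r v.
  rewrite -cH mulr_natl -sumr_const; exact: ler_sum.
have rhoC v : v \notin H -> r v <= rho by apply: Hr.
pose nu := uphalf #|V|.
have nuE : n <= 2 * nu%:R /\ 2 * nu%:R <= n + 1 :> R.
  have : (#|V| <= 2 * nu <= #|V| + 1)%N by apply: uphalf_bounds.
  by rewrite -!(ler_nat R) natrD natrM => /andP[].
case: nuE => nu1 nu2.
set sg := \sum_(v in H) r v; set ou := \sum_(v in ~: H) r v.
have tot : \sum_v r v = sg + ou.
  rewrite (bigID (mem H)) /=; congr (_ + _); apply: eq_bigl => v; by rewrite inE.
have hnu : h%:R + nu%:R <= n by lra.
(* Exactly [nu] neighbours outside [H] are used, about half of all vertices. The vertices outside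
   [H] left over have [r] at most [rho], the least value on [H]. *)
have key S : S \subset H -> #|S| = k.-1 ->
    nu%:R * \sum_(v in S) r v + ou - (n - h%:R - nu%:R) * rho <=
    \sum_(b | b |: S \in E) Num.max 0 (\sum_(v in b |: S) r v).
  move=> SH cS; have cN := codeg cS.
  pose NS := [set v | v |: S \in E] :\: H.
  have cNS : (nu <= #|NS|)%N.
    rewrite -(ler_nat R); apply: (@le_trans _ _ ((1 / 2 + gamma) * n - h%:R)); first by lra.
    rewrite lerBlDr; apply: le_trans cN _; rewrite /codegree -natrD ler_nat addnC -cH.
    by rewrite -(cardsID H) leq_add2r subset_leq_card // finset.subsetIr.
  have [A AN cA] := subset_of_card cNS.
  have AH : A \subset ~: H by apply: fintype.subset_trans AN _; apply/fintype.subsetP => v; rewrite !inE => /andP[].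
  apply: (@le_trans _ _ (\sum_(b in A) Num.max 0 (\sum_(v in b |: S) r v))); last first.
    apply: ler_sum_subset => [i _|i iA]; first exact: phi0.
    by have := fintype.subsetP AN _ iA; rewrite !inE => /andP[].
  apply: (@le_trans _ _ (\sum_(b in A) (\sum_(v in S) r v + r b))); last first.
    apply: ler_sum => b bA; rewrite le_max; apply/orP; right.
    have bE : b |: S \in E by have := fintype.subsetP AN _ bA; rewrite !inE => /andP[].
    have bS : b \notin S := notin_link k_ge2 Ek cS bE.
    by rewrite big_setU1 //= addrC.
  rewrite big_split /= sumr_const cA -(mulr_natl (\sum_(v in S) r v)) -addrA lerD2l lerBlDr.
  rewrite /ou (bigID (mem A)) /= lerD //.
    rewrite le_eqVlt; apply/orP; left; apply/eqP; apply: eq_bigl => v.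
    by apply/andP/idP => [[]//|vA]; split=> //; apply: (fintype.subsetP AH).
  apply: (@le_trans _ _ (\sum_(v in ~: H :\: A) rho)).
    rewrite (eq_bigl (fun v => v \in ~: H :\: A)); last by move=> v; rewrite !inE andbC.
    by apply: ler_sum => v; rewrite !inE => /andP[_ /rhoC].
  rewrite sumr_const -[leLHS]mulr_natl.
  suff -> : #|~: H :\: A|%:R = n - h%:R - nu%:R :> R by [].
  apply/eqP; rewrite eq_sym !subr_eq -!natrD; apply/eqP; congr _%:R.
  have := cardsID A (~: H); rewrite (finset.setIidPr AH) => hc.
  by rewrite -cH -cA [(_ + #|A|)%N]addnC hc addnC cardsC.
have tot1 : \sum_(S : {set V} | (S \subset H) && (#|S| == k.-1))
    \sum_(b | b |: S \in E) Num.max 0 (\sum_(v in b |: S) r v) <= k%:R * \sum_(e in E) Num.max 0 (\sum_(v in e) r v).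
  apply: (@le_trans _ _ (\sum_(b : V) \sum_(S : {set V} | (b |: S \in E) && (#|S| == k.-1)) Num.max 0 (\sum_(v in b |: S) r v))).
    rewrite (exchange_big_dep xpredT) //=; apply: ler_sum => b _.
    by apply: ler_sum_subset => // S /andP[/andP[_ ->] ->].
  apply: (@le_trans _ _ (\sum_(b : V) \sum_(e in E | b \in e) Num.max 0 (\sum_(v in e) r v))); last first.
    rewrite (exchange_big_dep (fun e => e \in E)) //=; last by move=> b e _ /andP[].
    rewrite mulr_sumr; apply: ler_sum => e eE.
    rewrite (eq_bigl (fun b => b \in e)); last by move=> b; rewrite eE.
    by rewrite sumr_const (Ek eE) -[leLHS]mulr_natl.
  apply: ler_sum => b _.
  rewrite (eq_bigl (fun S => S \in [set S : {set V} | (b |: S \in E) && (#|S| == k.-1)])); last by move=> S; rewrite inE.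
  rewrite -(@big_imset _ _ _ _ _ (fun S => b |: S) _ (fun e => Num.max 0 (\sum_(v in e) r v))) /=; last first.
    have bN S : S \in [set S : {set V} | (b |: S \in E) && (#|S| == k.-1)] -> b \notin S.
      by rewrite inE => /andP[bE /eqP cS]; apply: (notin_link k_ge2 Ek cS bE).
    move=> S T /bN bS /bN bT e; apply/setP => u; case: (eqVneq u b) => [->|ub].
      by rewrite (negbTE bS) (negbTE bT).
    by have /setP/(_ u) := e; rewrite !inE (negbTE ub).
  apply: ler_sum_subset => // e /imsetP[S]; rewrite inE => /andP[bE _] ->.
  by rewrite bE !inE eqxx.
apply: le_trans tot1; set c := 'C(h, k.-1)%:R.
apply: (@le_trans _ _ (\sum_(S : {set V} | (S \subset H) && (#|S| == k.-1))
   (nu%:R * \sum_(v in S) r v + (ou - (n - h%:R - nu%:R) * rho)))); last first.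
  by apply: ler_sum => S /andP[SH /eqP cS]; rewrite addrA; apply: key.
rewrite big_split /= -mulr_sumr.
have -> : \sum_(S : {set V} | (S \subset H) && (#|S| == k.-1)) \sum_(v in S) r v = 'C(h.-1, k.-2)%:R * sg.
  by rewrite -[in RHS]cH -sum_subsets prednK // -subn1 subn_gt0.
rewrite sumr_const (_ : #|_| = 'C(h, k.-1)); last first.
  by rewrite -cH -(cards_draws H k.-1); apply: eq_card => S; rewrite inE.
rewrite -(mulr_natl (ou - (n - h%:R - nu%:R) * rho)) -/c tot.
have cE : h%:R * 'C(h.-1, k.-2)%:R = (k%:R - 1) * c.
  have -> : k%:R - 1 = k.-1%:R :> R by rewrite -[in LHS](prednK (_ : 0 < k)%N) ?(ltnW k_ge2) // -natr1 addrK.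
  have k1' : (0 < k.-1)%N by rewrite -subn1 subn_gt0.
  by rewrite /c -!natrM -[in LHS](prednK h0) mul_bin_diag (prednK h0) (prednK k1').
have k1 : 1 <= k%:R - 1 :> R by rewrite lerBrDr -(natrD _ 1 1) ler_nat.
set rb := sg / h%:R; have sgE : sg = h%:R * rb by rewrite /rb mulrC divfK // gt_eqF // (lt_le_trans _ h1).
have rho_rb : rho <= rb by rewrite /rb ler_pdivlMr ?(lt_le_trans _ h1) // mulrC.
have ou_le : ou <= (n - h%:R) * rho.
  apply: (@le_trans _ _ (\sum_(v in ~: H) rho)); first by apply: ler_sum => v; rewrite inE => /rhoC.
  by rewrite sumr_const -[leLHS]mulr_natl cardsCs finset.setCK cH natrB.
have rb0 : 0 < rb.
  rewrite ltNge; apply/negP => rb_le; move: s0; rewrite tot sgE ltNge => /negP; apply.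
  have : (n - h%:R) * rho <= 0 by nra.
  nra.
rewrite (_ : nu%:R * (_ * sg) = nu%:R * (k%:R - 1) * rb * c); last first.
  rewrite sgE; transitivity (nu%:R * (h%:R * 'C(h.-1, k.-2)%:R) * rb); first by ring.
  by rewrite cE; ring.
(* Here [n - nu <= nu], available because codegrees exceed one half, and [k >= 2] enter. *)
have q : h%:R * rb + (n - h%:R - nu%:R) * rho <= nu%:R * (k%:R - 1) * rb.
  have q0 : nu%:R * rb <= nu%:R * (k%:R - 1) * rb.
    by rewrite -mulrA; apply: ler_wpM2l; rewrite ?ler0n // ler_peMl // ltW.
  case: (leP 0 rho) => [r0|r0]; nra.
rewrite sgE; nra.
Qed.

(** Minimise the sum of the squares of the residuals [r v = 1 - deg y v] over all weights in the
    box. Optimality forces weight [cap] on edges with positive residual sum and zero on those with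
    negative one. Hence the sum of the [r v ^+ 2] equals the sum of the [r v] minus [cap * Q], which
    is nonpositive by [dirac_dual], and all residuals vanish. *)
Lemma dirac_pfm h (cap : R) : (0 < h)%N -> (k.-1 <= h)%N -> h%:R <= gamma / 2 * n ->
  k%:R / 'C(h, k.-1)%:R <= cap ->
  exists2 x : {set V} -> R, perfect_fractional_matching E x & forall e, 0 <= x e <= cap.
Proof.
move=> h0 kh hn capE.
have cap0 : 0 <= cap by apply: le_trans capE; rewrite divr_ge0 ?ler0n.
pose a (v : V) (e : {set V}) : R := ((e \in E) && (v \in e))%:R.
pose phi (v : V) (u : R) : R := - ((1 - u) * (1 - u)).
have phic v : continuous (phi v).
  move=> u; apply: cvgN; apply: cvgM; (apply: cvgB; [exact: cvg_cst | exact: cvg_id]).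
have [||y [y1 _ ym]] := @linear_opt R _ V void a phi (fun=> fun=> 0) (fun=> 0) cap (fun=> 0) phic.
- by move=> e; rewrite lexx.
- by case.
pose deg x v := \sum_e a v e * x e.
have degE x v : deg x v = \sum_(e in E | v \in e) x e.
  by rewrite [RHS]big_mkcond; apply: eq_bigr => e _; rewrite /a; case: ifP; rewrite ?mul1r ?mul0r.
pose r v := 1 - deg y v.
have opt z : (forall e, 0 <= z e <= cap) -> \sum_v r v ^+ 2 <= \sum_v (1 - deg z v) ^+ 2.
  move=> z1; have := ym z z1 (fun c => match c with end).
  by rewrite !sumrN lerN2; under eq_bigr do rewrite -expr2; under [leRHS]eq_bigr do rewrite -expr2.
have pert e t : e \in E -> 0 <= y e + t <= cap -> 0 <= t * (k%:R * t - 2 * \sum_(v in e) r v).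
  move=> eE te; have := opt (fun f => y f + t * (f == e)%:R).
  have dz v : deg (fun f => y f + t * (f == e)%:R) v = deg y v + t * (v \in e)%:R.
    rewrite /deg; under eq_bigr do rewrite mulrDr.
    rewrite big_split /=; congr (_ + _); rewrite (bigD1 e) //= eqxx mulr1 /a eE big1 ?addr0 1?mulrC //.
    by move=> f /negbTE ->; rewrite !mulr0.
  have -> : \sum_v (1 - deg (fun f => y f + t * (f == e)%:R) v) ^+ 2 =
     \sum_v r v ^+ 2 + t * (k%:R * t - 2 * \sum_(v in e) r v).
    rewrite (eq_bigr (fun v => r v ^+ 2 + (if v \in e then t ^+ 2 - 2 * t * r v else 0))); last first.
      by move=> v _; rewrite dz /r; case: (v \in e); rewrite ?mulr1 ?mulr0 /=; ring.
    rewrite big_split /=; congr (_ + _).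
    rewrite -big_mkcond sumrB sumr_const (Ek eE) -mulr_sumr -(mulr_natl (t ^+ 2)); ring.
  rewrite lerDl; apply=> f; case: (eqVneq f e) => [->|_]; first by rewrite mulr1.
  by rewrite mulr0 addr0.
have k0 : 0 < k%:R :> R by rewrite ltr0n (ltnW k_ge2).
have kkt e : e \in E -> y e * \sum_(v in e) r v = cap * Num.max 0 (\sum_(v in e) r v).
  move=> eE; have /andP[ye0 ye1] := y1 e; set re := \sum_(v in e) r v.
  case: (eqVneq re 0) => [->|rne]; first by rewrite maxxx !mulr0.
  move: rne; rewrite neq_lt => /orP[re0|re0].
  - rewrite (max_idPl (ltW re0)) mulr0.
    suff -> : y e = 0 by rewrite mul0r.
    apply/eqP; rewrite eq_le ye0 andbT leNgt; apply/negP => yp.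
    (* Changing the weight of [e] by [t] changes the objective by [t * (k * t - 2 * re)]; its
       minimiser [re / k] is clipped to keep the weight nonnegative. *)
    pose t := Num.max (- y e) (re / k%:R).
    have t0 : t < 0 by rewrite /t gt_max oppr_lt0 yp /= pmulr_llt0 // invr_gt0.
    have t1 : - y e <= t by rewrite /t le_max lexx.
    have t2 : re <= k%:R * t.
      by rewrite mulrC -ler_pdivrMr // /t le_max lexx orbT.
    have := @pert e t eE; rewrite -/re => /(_ _); have -> : 0 <= y e + t <= cap by apply/andP; split; lra.
    move=> /(_ isT); rewrite leNgt => /negP; apply; rewrite nmulr_rlt0 //; lra.
  - rewrite (max_idPr (ltW re0)).
    suff -> : y e = cap by [].
    apply/eqP; rewrite eq_le ye1 leNgt; apply/negP => yp.
    pose t := Num.min (cap - y e) (re / k%:R).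
    have t0 : 0 < t by rewrite /t lt_min subr_gt0 yp /= divr_gt0.
    have t1 : t <= cap - y e by rewrite /t ge_min lexx.
    have t2 : k%:R * t <= re.
      by rewrite mulrC -ler_pdivlMr // /t ge_min lexx orbT.
    have := @pert e t eE; rewrite -/re => /(_ _); have -> : 0 <= y e + t <= cap by apply/andP; split; lra.
    move=> /(_ isT); rewrite leNgt => /negP; apply; rewrite pmulr_rlt0 //; lra.
have c0 : 0 < 'C(h, k.-1)%:R :> R by rewrite ltr0n bin_gt0.
have dual := dirac_dual r h0 kh hn.
set Q := \sum_(e in E) _ in dual.
have Q0 : 0 <= Q by apply: sumr_ge0 => e _; rewrite le_max lexx.
have sumr_le : \sum_v r v <= cap * Q.
  apply: le_trans (ler_wpM2r Q0 capE); rewrite mulrAC ler_pdivlMr //; by rewrite mulrC.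
have sq : \sum_v r v ^+ 2 <= 0.
  rewrite (eq_bigr (fun v => r v - r v * deg y v)); last by move=> v _; rewrite /r; ring.
  rewrite sumrB subr_le0; apply: le_trans sumr_le _; rewrite le_eqVlt; apply/orP; left; apply/eqP.
  rewrite /Q mulr_sumr; under [RHS]eq_bigr do rewrite degE mulr_sumr.
  rewrite (exchange_big_dep (fun e => e \in E)) /=; last by move=> v e _ /andP[].
  apply: eq_bigr => e eE; rewrite -kkt // mulr_sumr.
  rewrite (eq_bigl (fun v => v \in e)); last by move=> v; rewrite eE.
  by apply: eq_bigr => v _; rewrite mulrC.
have r0 v : r v = 0.
  apply/eqP; rewrite -sqrf_eq0 eq_le sqr_ge0 andbT; apply: le_trans sq.
  by rewrite (bigD1 v) //= lerDl; apply: sumr_ge0 => u _; rewrite sqr_ge0.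
exists y => //; split=> [e _|v]; first by have /andP[] := y1 e.
by rewrite -degE; have := r0 v; rewrite /r => /eqP; rewrite subr_eq0 => /eqP.
Qed.
End BoundedMatching.

Section Chernoff.
Variable R : realType.
(** Exponential moment of the number of hits, with parameter [s = d / 2]. Estimating each factor by
    [1 + u <= expR u] makes only the total size of the sets [B i] matter. *)
Lemma chernoff_count (N : nat) (T : finType) (B : 'I_N -> {set T}) (beta d : R) :
  (0 < #|T|)%N -> 0 < d -> beta + d <= 1 -> 0 <= beta ->
  \sum_i #|B i|%:R <= beta * N%:R * #|T|%:R ->
  #|[set tau : {ffun 'I_N -> T} | (beta + d) * N%:R <= #|[set i | tau i \in B i]|%:R]|%:R
    <= #|T|%:R ^+ N * expR (- (d ^+ 2 / 4) * N%:R) :> R.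
Proof.
move=> T0 d0 bd1 b0 Bs; set s := d / 2; have s0 : 0 < s by rewrite divr_gt0.
have T0' : 0 < #|T|%:R :> R by rewrite ltr0n.
set A := [set tau | _]; set bd := beta + d in bd1 A *.
have E1 : \sum_(tau : {ffun 'I_N -> T}) \prod_i (1 + s * (tau i \in B i)%:R) <=
    #|T|%:R ^+ N * expR (s * beta * N%:R) :> R.
  rewrite -(bigA_distr_bigA (fun i t => 1 + s * (t \in B i)%:R)).
  apply: (@le_trans _ _ (\prod_(i < N) (#|T|%:R * expR (s * #|B i|%:R / #|T|%:R)))).
    apply: ler_prod => i _; apply/andP; split.
      by apply: sumr_ge0 => t _; rewrite addr_ge0 // mulr_ge0 ?ler0n // ltW.
    have -> : \sum_t (1 + s * (t \in B i)%:R) = #|T|%:R * (1 + s * #|B i|%:R / #|T|%:R).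
      rewrite big_split /= sumr_const -mulr_sumr.
      have -> : \sum_t (t \in B i)%:R = #|B i|%:R :> R.
        by rewrite -sum1_card natr_sum [RHS]big_mkcond; apply: eq_bigr => v _; case: ifP.
      by rewrite mulrDr mulr1 [#|T|%:R * _]mulrC divfK // gt_eqF.
    by apply: ler_wpM2l; rewrite ?ler0n // expR_ge1Dx.
  rewrite big_split /= prodr_const card_ord; apply: ler_wpM2l; first by rewrite exprn_ge0 // ltW.
  rewrite -expR_sum ler_expR -mulr_suml -mulr_sumr ler_pdivrMr //.
  have := ler_wpM2l (ltW s0) Bs; lra.
have lns : s - s ^+ 2 <= ln (1 + s).
  have p : 0 < 1 + s by lra.
  apply: le_trans (ln_ge_1subV p).
  have -> : 1 - (1 + s)^-1 = s / (1 + s) by field; rewrite gt_eqF.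
  rewrite ler_pdivlMr //; nra.
have E2 : #|A|%:R * expR (bd * N%:R * (s - s ^+ 2)) <=
    \sum_(tau : {ffun 'I_N -> T}) \prod_i (1 + s * (tau i \in B i)%:R) :> R.
  rewrite mulr_natl -sumr_const.
  apply: (@le_trans _ _ (\sum_(tau in A) \prod_i (1 + s * (tau i \in B i)%:R))); last first.
    rewrite [leRHS](bigID (mem A)) /= lerDl; apply: sumr_ge0 => t _; apply: prodr_ge0 => i _.
    by rewrite addr_ge0 // mulr_ge0 ?ler0n // ltW.
  apply: ler_sum => tau; rewrite inE => tA.
  have -> : \prod_i (1 + s * (tau i \in B i)%:R) = (1 + s) ^+ #|[set i | tau i \in B i]|.
    rewrite -prodr_const [RHS]big_mkcond /=; apply: eq_bigr => i _; rewrite inE.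
    by case: ifP; rewrite ?mulr1 ?mulr0 ?addr0.
  have p : 0 < 1 + s by lra.
  rewrite -[X in _ <= X ^+ _]lnK ?posrE // -expRM_natl ler_expR.
  have p2 : 0 <= bd * N%:R by rewrite mulr_ge0 ?ler0n // /bd; lra.
  apply: (@le_trans _ _ (bd * N%:R * ln (1 + s))); first exact: ler_wpM2l.
  by apply: ler_wpM2r => //; apply: ln_ge0; lra.
have E3 := le_trans E2 E1.
rewrite -(ler_pM2r (expR_gt0 (bd * N%:R * (s - s ^+ 2)))); apply: le_trans E3 _.
rewrite -[leRHS]mulrA -expRD; apply: ler_wpM2l; first by rewrite exprn_ge0 // ltW.
rewrite ler_expR.
have N0 : 0 <= N%:R :> R by rewrite ler0n.
suff : s * beta <= - (d ^+ 2 / 4) + bd * (s - s ^+ 2) by move/(ler_wpM2r N0); lra.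
have -> : beta = bd - d by rewrite /bd; ring.
have := mulr_ge0 (sqr_ge0 d) (_ : 0 <= 1 - bd); rewrite subr_ge0 => /(_ bd1); rewrite /s; lra.
Qed.
End Chernoff.

(** * Orderings with few bad windows *)

Lemma wsum_nth (R : realType) (V : finType) a (v : V) j : (j < a)%N ->
  #|V|%:R * wsum [set: V] a (fun t => (nth v t j == v)%:R) = #|V|%:R ^+ a :> R.
Proof.
elim: a j => [|a IH] [|j] // ja.
  rewrite wT_cons exprS /=; congr (#|V|%:R * _).
  rewrite (eq_bigr (fun x => (x == v)%:R * #|V|%:R ^+ a)) ?wT_delta //.
  by move=> x _; rewrite wsumC cardsT mulrC.
rewrite wT_cons /=; rewrite (eq_bigr (fun=> #|V|%:R ^+ a / #|V|%:R)); last first.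
  move=> x _; rewrite -(IH j) // mulrAC mulfV ?mul1r // pnatr_eq0 -lt0n.
  by apply/card_gt0P; exists v.
rewrite sumr_const -(mulr_natl (_ / _)) exprS mulrCA [X in _ * X]mulrCA mulfV ?mulr1 //.
by rewrite pnatr_eq0 -lt0n; apply/card_gt0P; exists v.
Qed.

Lemma ln_abs_le (R : realType) (a b x : R) : 0 < a -> a <= x -> x <= b -> `|ln x| <= `|ln a| + `|ln b|.
Proof.
move=> a0 ax xb; have x0 : 0 < x := lt_le_trans a0 ax; have b0 := lt_le_trans x0 xb.
have h1 : ln a <= ln x by rewrite ler_ln ?posrE.
have h2 : ln x <= ln b by rewrite ler_ln ?posrE.
have := ler_norm (ln b); have := ler_norm (- ln a); rewrite normrN => *.
have := normr_ge0 (ln a); have := normr_ge0 (ln b); move=> *.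
rewrite ler_norml; apply/andP; split; lra.
Qed.

Section ChainPieces.
Variables (R : realType) (V : finType) (l q t' : nat) (g w : seq V -> R) (clo chi kap : R).
Let n : R := #|V|%:R.
Let k := (q + l)%N.
Let t := t'.+1.
Let M0 := (l + t * q)%N.
Let m := (q * (t + l))%N.
Hypothesis V_ge : (2 * k <= #|V|)%N.
Hypothesis q_gt0 : (0 < q)%N.
Hypothesis g_ge0 : forall s, 0 <= g s.
Hypothesis g_perm : forall s t, perm_eq s t -> g s = g t.
Hypothesis g_nuniq : forall s, ~~ uniq s -> g s = 0.
Hypothesis clo_gt0 : 0 < clo.
Hypothesis g_lo : forall s, uniq s -> size s = k -> clo <= g s.
Hypothesis g_hi : forall s, g s <= chi.
Local Notation ws := (wsum [set: V]).
Hypothesis g_tot : ws k g = n ^+ k.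
Hypothesis g_marg : forall v, n * ws k (fun s => g s * (nth v s 0 == v)%:R) = n ^+ k.
Hypothesis kap_gt0 : 0 < kap.
Hypothesis w_bnd : forall s, kap <= w s <= 1.
Local Notation Pd := (Pd l q g).

(** A piece carries [t] windows in a chain of [M0 = l + t q] letters, followed by
    [m - M0 = l (q - 1)] uniform letters. The padding makes [m] a multiple of [q], so the windows of
    every piece start at multiples of [q] in the whole ordering. *)
Definition cp_p (y : seq V) : R := Pd t (take M0 y).
Definition cp_W (y : seq V) : R := \prod_(i < t) w (take k (drop (i * q) y)).
Definition cp_ew : R := n ^- k * ws k (fun s => g s * ln (w s)).
Definition cp_v : R := eg l q g - cp_ew.
Definition cp_B : R := t%:R * - ln kap + (`|ln (plo q clo chi t)| + `|ln (chi * rat q clo chi ^+ t)|).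

Let V_gt0 : (0 < #|V|)%N.
Proof. by apply: leq_trans V_ge; rewrite muln_gt0 /k addn_gt0 q_gt0. Qed.
Let n_gt0 : 0 < n. Proof. by rewrite ltr0n. Qed.
Let n_neq0 : n != 0. Proof. by rewrite gt_eqF. Qed.
Let M0m : (M0 <= m)%N.
Proof. by rewrite /M0 /m mulnDr addnC mulnC leq_add2l leq_pmull. Qed.
Let w_gt0 s : 0 < w s. Proof. by have /andP[h _] := w_bnd s; apply: lt_le_trans h. Qed.

Lemma cp_take (y : seq V) : size y = m -> size (take M0 y) = (l + t * q)%N.
Proof. by move=> ym; rewrite size_takel // ym. Qed.
Lemma cp_p_ge0 y : 0 <= cp_p y.
Proof. exact: Pd_ge0 V_gt0 g_ge0 _ _. Qed.
Lemma cp_p_hi y : size y = m -> cp_p y <= chi * rat q clo chi ^+ t.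
Proof. move=> ym; apply: (Pd_hi V_ge) => //; exact: cp_take. Qed.
Lemma cp_plo_gt0 : 0 < plo q clo chi t.
Proof. exact: (plo_gt0 V_ge). Qed.
Lemma cp_p_lo0 y : size y = m -> cp_p y != 0 -> plo q clo chi t <= cp_p y.
Proof. move=> ym; apply: (Pd_lo V_ge) => //; exact: cp_take. Qed.
Lemma cp_p_lo y : size y = m -> uniq y -> plo q clo chi t <= cp_p y.
Proof.
move=> ym uy; apply: cp_p_lo0 => //; apply: (Pd_uniq V_ge q_gt0 g_nuniq clo_gt0 g_lo g_hi g_tot (cp_take ym)).
by rewrite take_uniq.
Qed.
Lemma cp_W_gt0 y : 0 < cp_W y.
Proof. by apply: prodr_gt0. Qed.
Lemma ln_prod (I : Type) (r : seq I) (f : I -> R) : (forall i, 0 < f i) ->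
  ln (\prod_(i <- r) f i) = \sum_(i <- r) ln (f i).
Proof.
move=> f0; elim: r => [|i r IH]; first by rewrite !big_nil ln1.
by rewrite !big_cons lnM ?posrE ?IH // prodr_gt0.
Qed.
Lemma cp_lnw s : ln kap <= ln (w s) <= 0.
Proof.
have /andP[h1 h2] := w_bnd s; apply/andP; split; first by rewrite ler_ln ?posrE.
exact: ln_le0.
Qed.
Lemma cp_psi_B y : size y = m -> `|ln (cp_W y) - ln (cp_p y)| <= cp_B.
Proof.
move=> ym; apply: le_trans (ler_normB _ _) _; apply: lerD.
  rewrite ln_prod //; apply: le_trans (ler_norm_sum _ _ _) _.
  rewrite mulr_natl -[t in leRHS]card_ord -sumr_const; apply: ler_sum => i _.
  by have /andP[h1 h2] := cp_lnw (take k (drop (i * q) y)); rewrite ler0_norm // lerN2.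
case: (eqVneq (cp_p y) 0) => [->|p0]; first by rewrite ln0 // normr0 addr_ge0.
exact: ln_abs_le cp_plo_gt0 (cp_p_lo0 ym p0) (cp_p_hi ym).
Qed.
Let m_split : m = (M0 + (m - M0))%N. Proof. by rewrite subnKC. Qed.
Lemma cp_ws (h : seq V -> R) : (forall y, size y = m -> h y = h (take M0 y)) ->
  ws m (fun y => cp_p y * h y) = n ^+ (m - M0) * ws M0 (fun y => Pd t y * h y).
Proof.
move=> hh; rewrite {1}m_split wsumD -wsumZ; apply: eq_wsum => s sM _.
transitivity (ws (m - M0) (fun=> Pd t s * h s)); last by rewrite wsumC cardsT.
apply: eq_wsum => u um _; rewrite (hh (s ++ u)) /cp_p; last by rewrite size_cat sM um -m_split.
by rewrite -sM take_size_cat.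
Qed.
Lemma cp_tot : ws m cp_p = n ^+ m.
Proof.
have := @cp_ws (fun=> 1) (fun _ _ => erefl).
rewrite (@eq_wsum _ _ _ m _ cp_p); last by move=> s _ _; rewrite mulr1.
move=> ->; rewrite (@eq_wsum _ _ _ _ _ (Pd t)); last by move=> s _ _; rewrite mulr1.
by rewrite (Pd_tot V_ge q_gt0 g_ge0 g_perm clo_gt0 g_hi g_tot) // -exprD -/M0 addnC -m_split.
Qed.
Lemma cp_coord v j : (j < m)%N -> n * ws m (fun y => cp_p y * (nth v y j == v)%:R) = n ^+ m.
Proof.
move=> jm; case: (ltnP j M0) => jM.
  rewrite (@cp_ws (fun y => (nth v y j == v)%:R)); last by move=> y _; rewrite nth_take.
  by rewrite mulrCA (Pd_coord V_ge q_gt0 g_ge0 g_perm clo_gt0 g_hi g_tot g_marg) // -exprD -/M0 addnC -m_split.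
rewrite {1}m_split wsumD (@eq_wsum _ _ _ _ _ (fun s => Pd t s * ws (m - M0) (fun u => (nth v u (j - M0) == v)%:R))); last first.
  move=> s sM _; rewrite -wsumZ; apply: eq_wsum => u um _; rewrite /cp_p -sM take_size_cat // nth_cat.
  by rewrite sM ltnNge jM.
rewrite wsumZr mulrCA wsum_nth; last by rewrite ltn_sub2r // (leq_ltn_trans jM).
by rewrite (Pd_tot V_ge q_gt0 g_ge0 g_perm clo_gt0 g_hi g_tot) // -exprD -/M0 -m_split.
Qed.
(** By [Pd_entropy] the exact value exceeds this bound by a positive factor times [(t - 1) * el],
    and relative entropies are nonnegative. *)
Lemma cp_ent : - (n ^+ m * (t%:R * cp_v)) <= ws m (fun y => cp_p y * (ln (cp_W y) - ln (cp_p y))).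
Proof.
pose h y := ln (cp_W y) - ln (cp_p y).
have hE : ws m (fun y => cp_p y * h y) = n ^+ (m - M0) * ws M0 (fun y => Pd t y * h y).
  apply: cp_ws => y ym; rewrite /h /cp_p take_takel //; congr (ln _ - _).
  apply: eq_bigr => i _; congr (w _).
  rewrite !take_drop take_takel //.
  have : (i * q <= t' * q)%N by rewrite leq_mul2r -ltnS ltn_ord orbT.
  by rewrite /M0 /k /t mulSn => h'; lia.
rewrite hE (@eq_wsum _ _ _ M0 _ (fun y => (\sum_(i < t) Pd t y * ln (w (take k (drop (i * q) y)))) + -1 * (Pd t y * ln (Pd t y)))); last first.
  by move=> y yM _; rewrite /h /cp_p take_oversize ?yM // ln_prod // mulrBr mulr_sumr mulN1r.
rewrite wsum_add wsumZ wsum_sum (Pd_entropy V_ge) //.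
rewrite (eq_bigr (fun=> n ^+ M0 * cp_ew)); last first.
  move=> i _; have wm := window_marginal l q V_gt0 g_ge0 g_perm (fun s => ln (w s)) (ltn_ord i); rewrite -/k in wm.
  rewrite /M0 wm /cp_ew mulrA; congr (_ * _).
  have eM : (l + t * q = t' * q + k)%N by rewrite /k /t mulSn; ring.
  by rewrite eM exprD mulfK ?expf_neq0.
rewrite sumr_const card_ord -(mulr_natl (n ^+ M0 * cp_ew)).
rewrite {1}m_split exprD /cp_v -/M0.
have el0 : 0 <= el l q g := el_ge0 V_ge q_gt0 g_ge0 g_perm g_tot.
have t1 : 1 <= t%:R :> R by rewrite ler1n.
have nn : 0 <= n ^+ (m - M0) * n ^+ M0 by rewrite mulr_ge0 // exprn_ge0 // ltW.
have : 0 <= n ^+ (m - M0) * n ^+ M0 * ((t%:R - 1) * el l q g).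
  by apply: mulr_ge0 => //; apply: mulr_ge0 => //; lra.
lra.
Qed.
Lemma cp_ew_le0 : cp_ew <= 0.
Proof.
rewrite /cp_ew pmulr_rle0 ?invr_gt0 ?exprn_gt0 // -(wsum0 R [set: V] k); apply: ler_wsum => s _ _.
by rewrite mulr_ge0_le0 //; have /andP[] := cp_lnw s.
Qed.
Lemma cp_v_ge0 : 0 <= cp_v.
Proof.
have e0 := eg_ge0 V_ge q_gt0 g_ge0 g_tot.
by have := cp_ew_le0; rewrite /cp_v; move: e0; lra.
Qed.

Variables (eps : R).
Hypothesis eps_gt0 : 0 < eps.
Let ph := chi * rat q clo chi ^+ t.
Let K := pc_K m (plo q clo chi t) ph eps.
Lemma cp_main (d : R) T N0 : 2 * m%:R <= eps * n -> 0 < d -> 4 * m%:R ^+ 2 * K ^+ 2 <= n -> 2 * (ph * m%:R ^+ 2) <= n ->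
  eps * n <= N0%:R -> #|V| = (N0 + T * m)%N ->
  N0`!%:R * n ^+ (T * m) * expR (- (T%:R * (t%:R * cp_v)) - ph * m%:R * (2 + 2 * (t%:R * cp_v) + 2 * cp_B) - n
     - n * errc V m K eps cp_B d - Hc m K cp_B d * K / n) <=
  ws #|V| (fun s => (uniq s)%:R * \prod_(i < T) cp_W (take m (drop (i * m) s))).
Proof.
move=> el d0 nl dl eN cV.
have m0 : (0 < m)%N by rewrite /m muln_gt0 q_gt0.
have A0 : 0 <= t%:R * cp_v by rewrite mulr_ge0 ?cp_v_ge0.
have dl' : pc_dl V m ph <= 1 / 2 by rewrite /pc_dl ler_pdivrMr // -/n; move: dl; lra.
have := pc_main V_gt0 m0 cp_p_ge0 cp_p_hi cp_plo_gt0 cp_p_lo cp_W_gt0 cp_psi_B cp_tot cp_coord A0 cp_ent eps_gt0 el d0 nl dl' eN cV.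
by rewrite -/n /pc_Om cardsT ler_pdivlMl ?exprn_gt0 // mulrCA mulrA.
Qed.
End ChainPieces.

(** Uniform form of [cp_main]: the constants depend only on the bounds for [g], [w] and [cp_v], so
    one threshold serves all densities. *)
Lemma chain_count (R : realType) (l q t' : nat) (clo chi kap eps err v0 : R) :
  (0 < q)%N -> 0 < clo -> 0 <= chi -> 0 < kap -> kap <= 1 -> 0 < eps -> 0 < err ->
  exists n0 : nat, forall (V : finType) (g w : seq V -> R),
  (n0 <= #|V|)%N -> (2 * (q + l) <= #|V|)%N ->
  (forall s, 0 <= g s) -> (forall s t, perm_eq s t -> g s = g t) -> (forall s, ~~ uniq s -> g s = 0) ->
  (forall s, uniq s -> size s = (q + l)%N -> clo <= g s) -> (forall s, g s <= chi) ->
  wsum [set: V] (q + l) g = #|V|%:R ^+ (q + l) ->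
  (forall v, #|V|%:R * wsum [set: V] (q + l) (fun s => g s * (nth v s 0 == v)%:R) = #|V|%:R ^+ (q + l)) ->
  (forall s, kap <= w s <= 1) -> cp_v l q g w <= v0 ->
  forall N0 T, eps * #|V|%:R <= N0%:R -> #|V| = (N0 + T * (q * (t'.+1 + l)))%N ->
  N0`!%:R * #|V|%:R ^+ (T * (q * (t'.+1 + l))) *
    expR (- (T%:R * (t'.+1%:R * cp_v l q g w)) - #|V|%:R - err * #|V|%:R) <=
  wsum [set: V] #|V| (fun s => (uniq s)%:R *
    \prod_(i < T) cp_W l q t' w (take (q * (t'.+1 + l)) (drop (i * (q * (t'.+1 + l))) s))).
Proof.
move=> q0 clo0 chi0 kap0 kap1 eps0 err0.
pose m := (q * (t'.+1 + l))%N; pose t := t'.+1; pose ph := chi * rat q clo chi ^+ t.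
pose B := cp_B q t' clo chi kap; pose K := pc_K m (plo q clo chi t) ph eps.
have B0 : 0 <= B.
  rewrite /B /cp_B addr_ge0 ?addr_ge0 // mulr_ge0 ?ler0n // oppr_ge0; exact: ln_le0.
have ph0 : 0 <= ph.
  by rewrite /ph mulr_ge0 // exprn_ge0 // /rat !mulr_ge0 // ?invr_ge0 ?exprn_ge0 // ltW.
(* Makes the linear error [2 * B * K ^+ 3 * d] at most [err / 2]. Once [d] is fixed, [D] collects
   the losses that stay bounded as [n] grows. *)
pose d := err / (2 * (2 * B * K ^+ 3 + 1)).
pose D := CF m K + CG m K B + Hc m K B d * CS2 m K eps + Hc m K B d * `|K| + ph * m%:R * (2 + 2 * (t%:R * v0) + 2 * B).
have [n1 h1] := nat_above_all [:: 1; 2 * m%:R / eps; 4 * m%:R ^+ 2 * K ^+ 2; 2 * (ph * m%:R ^+ 2); D / (err / 2)].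
exists n1 => V g w nV Vk g0 gp gu glo ghi gt gm wb vle N0 T eN cV.
have := h1 _ nV; rewrite /= andbT => /andP[n0] /and4P[{}h1 h2 h3 h4].
rewrite ler_pdivrMr // [leRHS]mulrC in h1.
rewrite ler_pdivrMr ?divr_gt0 // in h4.
have v_ge0 := cp_v_ge0 Vk q0 g0 gt kap0 wb.
have K1 : 1 <= K.
  rewrite /K /pc_K; have : 0 <= (plo q clo chi t * (eps / 2) ^+ m)^-1.
    rewrite invr_ge0 mulr_ge0 ?exprn_ge0 ?divr_ge0 ?(ltW eps0) // /plo mulr_ge0 ?exprn_ge0 ?divr_ge0 ?exprn_ge0 // ltW //.
  have m0 : 0 <= m%:R :> R by rewrite ler0n.
  have := mulr_ge0 ph0 m0; have := mulr_ge0 ph0 (exprn_ge0 2 m0); have := mulr_ge0 ph0 (exprn_ge0 3 m0).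
  have := mulr_ge0 (mulr_ge0 (ler0n R 9) (exprn_ge0 2 ph0)) (exprn_ge0 6 m0); lra.
have K0 : 0 <= K by lra.
have bk : 0 <= 2 * B * K ^+ 3 by apply: mulr_ge0; [apply: mulr_ge0 | apply: exprn_ge0].
have d0 : 0 < d by rewrite /d divr_gt0 //; lra.
have main := cp_main Vk q0 g0 gp gu clo0 glo ghi gt gm kap0 wb eps0 h1 d0 h2 h3 eN cV.
apply: le_trans main; apply: ler_wpM2l; first by rewrite mulr_ge0 ?ler0n // exprn_ge0 ?ler0n.
rewrite ler_expR -/m -/t -/ph -/K -/B.
have nn : 0 < #|V|%:R :> R by lra.
set n : R := #|V|%:R in n0 h1 h2 h3 h4 nn *.
have eE : n * errc V m K eps B d = CF m K + CG m K B + 2 * B * K ^+ 3 * d * n + Hc m K B d * CS2 m K eps.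
  by rewrite /errc -/n; field; rewrite gt_eqF.
have dE : 2 * B * K ^+ 3 * d <= err / 2.
  rewrite /d mulrA ler_pdivrMr; last by lra.
  nra.
have H0 : 0 <= Hc m K B d.
  rewrite /Hc; apply: mulr_ge0; last exact: expR_ge0.
  by apply: addr_ge0; [apply: exprn_ge0 | apply: divr_ge0 => //; apply: ltW].
have e2 : Hc m K B d * K / n <= Hc m K B d * `|K|.
  rewrite ler_pdivrMr //; apply: (@le_trans _ _ (Hc m K B d * `|K| * 1)).
    by rewrite mulr1 ler_wpM2l // ler_norm.
  by apply: ler_wpM2l => //; rewrite mulr_ge0.
have e3 : ph * m%:R * (2 + 2 * (t%:R * cp_v l q g w) + 2 * B) <= ph * m%:R * (2 + 2 * (t%:R * v0) + 2 * B).
  apply: ler_wpM2l; first by rewrite mulr_ge0.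
  by rewrite lerD2r lerD2l; apply: ler_wpM2l => //; apply: ler_wpM2l.
have e4 := ler_wpM2r (ltW nn) dE.
move: h4; rewrite eE /D; move: e2 e3 e4; lra.
Qed.

(** * The density given by the softened maximiser *)

Section SoftDensity.
Variables (R : realType) (V : finType) (l q : nat) (E : {set {set V}}) (kap : R) (X : {set V} -> R).
Let k := (q + l)%N.
Let n : R := #|V|%:R.
Local Notation ws := (wsum [set: V]).
Hypothesis q_gt0 : (0 < q)%N.
Hypothesis V_ge : (2 * k <= #|V|)%N.
Hypothesis kap_gt0 : 0 < kap.
Hypothesis kap_le1 : kap <= 1.
Hypothesis pX : perfect_fractional_matching (ksets V k) X.
Hypothesis X_ratio : forall e f, e \in ksets V k -> f \in ksets V k -> X e * kap ^+ (2 * k) <= X f.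

(** Normalisation: a perfect fractional matching has total weight [n / k] and a [k]-set has [k!]
    orderings, so the words receive total mass [n ^+ k]. *)
Definition sd_c : R := n ^+ k.-1 / (k.-1)`!%:R.
Definition sd_g (s : seq V) : R := if uniq s && (size s == k) then sd_c * X [set v in s] else 0.
Definition sd_w (s : seq V) : R := wt E kap [set v in s].

Let k_gt0 : (0 < k)%N. Proof. by rewrite /k addn_gt0 q_gt0. Qed.
Let V_gt0 : (0 < #|V|)%N. Proof. by apply: leq_trans V_ge; rewrite muln_gt0. Qed.
Let n_gt0 : 0 < n. Proof. by rewrite ltr0n. Qed.
Let n_neq0 : n != 0. Proof. by rewrite gt_eqF. Qed.
Let c_gt0 : 0 < sd_c.
Proof. by rewrite divr_gt0 ?exprn_gt0 // ltr0n fact_gt0. Qed.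
Let X_ge0 e : e \in ksets V k -> 0 <= X e. Proof. by case: pX => + _; apply. Qed.
Lemma sd_kset s : uniq s -> size s = k -> [set v in s] \in ksets V k.
Proof. by move=> us sk; rewrite inE cardsE (card_uniqP us) sk. Qed.
Lemma sd_g_ge0 s : 0 <= sd_g s.
Proof.
rewrite /sd_g; case: ifP => // /andP[us /eqP sk]; rewrite mulr_ge0 ?(ltW c_gt0) //.
by apply: X_ge0; apply: sd_kset.
Qed.
Lemma sd_g_perm s t : perm_eq s t -> sd_g s = sd_g t.
Proof.
move=> st; rewrite /sd_g (perm_uniq st) (perm_size st); case: ifP => // _; congr (_ * X _).
by apply/setP => v; rewrite !inE (perm_mem st).
Qed.
Lemma sd_g_nuniq s : ~~ uniq s -> sd_g s = 0.
Proof. by rewrite /sd_g => /negbTE ->. Qed.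
Lemma sd_sum (phi : {set V} -> R) :
  ws k (fun s => sd_g s * phi [set v in s]) = k%:R * n ^+ k.-1 * \sum_(e in ksets V k) X e * phi e.
Proof.
rewrite (@eq_wsum _ _ _ _ _ (fun s => (uniq s)%:R * (fun e => sd_c * (X e * phi e)) [set v in s])); last first.
  by move=> s sk _; rewrite /sd_g sk eqxx andbT; case: (uniq s); rewrite ?mul1r ?mul0r // mulrA.
rewrite (wsum_uniq_set k (fun e => sd_c * (X e * phi e))) -mulr_sumr mulrA; congr (_ * _); last by apply: eq_bigl => e; rewrite inE.
rewrite /sd_c -[in k`!](prednK k_gt0) factS prednK // natrM -mulrA; congr (_ * _).
by rewrite mulrCA mulfV ?mulr1 // pnatr_eq0 -lt0n fact_gt0.
Qed.
Lemma sd_sumX : k%:R * \sum_(e in ksets V k) X e = n.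
Proof.
case: pX => _ Xv; transitivity (\sum_v \sum_(e in ksets V k | v \in e) X e); last first.
  by rewrite (eq_bigr (fun=> 1)) ?sumr_const // => v _; apply: Xv.
rewrite (exchange_big_dep (fun e => e \in ksets V k)) /=; last by move=> v e _ /andP[].
rewrite mulr_sumr; apply: eq_bigr => e ek; rewrite (eq_bigl (fun v => v \in e)); last by move=> v; rewrite ek.
by rewrite sumr_const; move: ek; rewrite inE => /eqP ->; rewrite mulr_natl.
Qed.
Let nk : n ^+ k = n * n ^+ k.-1. Proof. by rewrite -exprS prednK. Qed.
Lemma sd_tot : ws k sd_g = n ^+ k.
Proof.
have := sd_sum (fun=> 1); rewrite (@eq_wsum _ _ _ _ _ sd_g); last by move=> s _ _; rewrite mulr1.
by move=> ->; under eq_bigr do rewrite mulr1; rewrite mulrAC sd_sumX nk.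
Qed.
Lemma sd_marg v : n * ws k (fun s => sd_g s * (nth v s 0 == v)%:R) = n ^+ k.
Proof.
have kn : k%:R != 0 :> R by rewrite pnatr_eq0 -lt0n.
apply: (mulfI kn); rewrite mulrCA.
have -> : k%:R * ws k (fun s => sd_g s * (nth v s 0 == v)%:R) = ws k (fun s => sd_g s * (v \in s)%:R).
  transitivity (\sum_(j < k) ws k (fun s => sd_g s * (nth v s j == v)%:R)).
    rewrite (eq_bigr (fun=> ws k (fun s => sd_g s * (nth v s 0 == v)%:R))).
      by rewrite sumr_const card_ord mulr_natl.
    by move=> j _; rewrite (coord_marginal sd_g_perm v (ltn_ord j)).
  rewrite -wsum_sum; apply: eq_wsum => s sk _; rewrite -mulr_sumr.
  case: (boolP (uniq s)) => us; last by rewrite sd_g_nuniq ?mul0r.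
  congr (_ * _); rewrite -natr_sum -count_uniq_mem //; congr _%:R.
  rewrite -sum1_count (big_nth v) big_mkord sk [RHS]big_mkcond /=; apply: eq_bigr => j _.
  by case: (_ == _).
rewrite (@eq_wsum _ _ _ _ _ (fun s => sd_g s * (fun e : {set V} => (v \in e)%:R) [set u in s])); last by move=> s _ _; rewrite inE.
rewrite (sd_sum (fun e : {set V} => (v \in e)%:R)) nk; case: pX => _ Xv.
rewrite (_ : \sum_(e in _) _ = 1) ?mulr1; first by rewrite mulrCA.
rewrite -[RHS](Xv v) [RHS]big_mkcondr; apply: eq_bigr => e _.
by case: (v \in e); rewrite ?mulr1 ?mulr0.
Qed.
Let kk_gt0 : 0 < kap ^+ (2 * k). Proof. exact: exprn_gt0. Qed.
Lemma sd_g_ratio s t : uniq s -> size s = k -> sd_g t * kap ^+ (2 * k) <= sd_g s.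
Proof.
move=> us sk; rewrite {1}/sd_g; case: ifP => [/andP[ut /eqP tk]|]; last by rewrite mul0r sd_g_ge0.
by rewrite /sd_g us sk eqxx -mulrA ler_pM2l //; apply: X_ratio; apply: sd_kset.
Qed.
(** The average of [sd_g] over all words is one, and no value exceeds [sd_g s / kap ^+ (2 * k)]. *)
Lemma sd_g_lo s : uniq s -> size s = k -> kap ^+ (2 * k) <= sd_g s.
Proof.
move=> us sk; rewrite -(@ler_pM2l _ (n ^+ k)) ?exprn_gt0 // -[n ^+ k in leLHS]sd_tot -wsumZr.
apply: (@le_trans _ _ (ws k (fun=> sd_g s))); last by rewrite wsumC cardsT.
by apply: ler_wsum => t _ _; apply: sd_g_ratio.
Qed.
(** The same comparison in the other direction, as at least [(n / 2) ^+ k] words are free of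
    repetitions. *)
Lemma sd_g_hi s : sd_g s <= 2 ^+ k / kap ^+ (2 * k).
Proof.
rewrite {1}/sd_g; case: ifP => [/andP[us /eqP sk]|_]; last by rewrite divr_ge0 ?exprn_ge0 // ltW.
rewrite -[leLHS](_ : sd_g s = _); last by rewrite /sd_g us sk eqxx.
rewrite ler_pdivlMr // -(@ler_pM2r _ ((#|V| ^_ k)%:R)); last by rewrite ltr0n ffact_gt0 (leq_trans _ V_ge) // leq_pmull.
apply: (@le_trans _ _ (n ^+ k)).
  rewrite -sd_tot -[#|V|]cardsT -(wsum_uniq_count R [set: V]) -wsumZ; apply: ler_wsum => t tk _.
  by case: (boolP (uniq t)) => ut; rewrite ?mulr1 ?mulr0 ?sd_g_ge0 //; apply: sd_g_ratio.
apply: (@le_trans _ _ (2 ^+ k * ((#|V| - k) ^ k)%:R)); last first.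
  by rewrite ler_pM2l ?exprn_gt0 // ler_nat ffact_ge_exp.
rewrite natrX -exprMn; apply: lerXn2r; rewrite ?nnegrE ?(ltW n_gt0) ?mulr_ge0 ?ler0n //.
by rewrite -natrM ler_nat mulnC leq_double_sub.
Qed.
(** Maximising the softened value amounts to minimising the cost per window; hence the optimum costs
    at most as much as the given matching. *)
Lemma sd_v : cp_v l q sd_g sd_w = ln sd_c - k%:R / n * soft_value k E kap X.
Proof.
have Xp e : e \in ksets V k -> 0 < X e.
  move=> ek; have ek' : #|e| = k by move: ek; rewrite inE => /eqP.
  have := @sd_g_lo (enum e) (enum_uniq _) _; rewrite -cardE ek' => /(_ erefl) h.
  have := lt_le_trans kk_gt0 h; rewrite /sd_g enum_uniq -cardE ek' eqxx /= pmulr_rgt0 //.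
  by rewrite (_ : [set v in enum e] = e) //; apply/setP => v; rewrite inE mem_enum.
rewrite /cp_v /eg /cp_ew -/n -/k -mulrBr.
rewrite (_ : ws k (fun s => sd_g s * ln (sd_g s)) - ws k (fun s => sd_g s * ln (sd_w s)) =
   ws k (fun s => sd_g s * (fun e => ln sd_c + (ln (X e) - ln (wt E kap e))) [set v in s])); last first.
  apply/eqP; rewrite subr_eq -wsum_add; apply/eqP; apply: eq_wsum => s sk _; rewrite -mulrDr.
  case: (boolP (uniq s)) => us; last by rewrite sd_g_nuniq // !mul0r.
  congr (_ * _); rewrite {1}/sd_g us sk eqxx /= lnM ?posrE ?Xp ?sd_kset // /sd_w; ring.
rewrite (sd_sum (fun e => ln sd_c + (ln (X e) - ln (wt E kap e)))) nk.
rewrite (_ : \sum_(e in ksets V k) _ = ln sd_c * (\sum_(e in ksets V k) X e) - soft_value k E kap X); last first.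
  rewrite /soft_value mulr_sumr -sumrB; apply: eq_bigr => e _; ring.
have kn : k%:R != 0 :> R by rewrite pnatr_eq0 -lt0n.
have -> : \sum_(e in ksets V k) X e = n / k%:R by rewrite -[in RHS]sd_sumX mulrAC mulfV ?mul1r.
field; by rewrite !(n_neq0, kn, expf_neq0).
Qed.
End SoftDensity.

(** * Stirling estimates *)

Section Factorials.
Variable R : realType.
Lemma fact_lb (n : nat) : n%:R ^+ n <= n`!%:R * expR n%:R :> R.
Proof.
case: n => [|n]; first by rewrite expr0 fact0 mul1r expR0.
have := @expR_ge1Dxn R n.+1%:R n (ler0n _ _) => h.
rewrite mulrC -ler_pdivrMr ?ltr0n ?fact_gt0 //; apply: le_trans h; by rewrite lerDr.
Qed.
Lemma fact_ub (n : nat) : (0 < n)%N -> n`!%:R * expR n%:R <= expR 1 * n%:R ^+ n.+1 :> R.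
Proof.
elim: n => // -[_ _|n IH _]; first by rewrite mul1r expr1n mulr1.
rewrite factS natrM -[X in expR X]natr1 expRD.
have n0 : 0 < n.+1%:R :> R by rewrite ltr0n.
have n0' : 0 < n.+2%:R :> R by rewrite ltr0n.
have h := IH isT.
apply: (@le_trans _ _ (n.+2%:R * expR 1 * (expR 1 * n.+1%:R ^+ n.+2))).
  rewrite (_ : _ * _ = n.+2%:R * expR 1 * (n.+1`!%:R * expR n.+1%:R)); last by ring.
  by apply: ler_wpM2l => //; rewrite mulr_ge0 ?expR_ge0 ?ltW.
rewrite [n.+2%:R ^+ n.+3]exprS (_ : _ * (_ * _) = expR 1 * (n.+2%:R * (expR 1 * n.+1%:R ^+ n.+2))); last by ring.
apply: ler_wpM2l; rewrite ?expR_ge0 //; apply: ler_wpM2l; first exact: ltW.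
rewrite -[n.+1%:R]lnK ?posrE // -[n.+2%:R in leRHS]lnK ?posrE // -!expRM_natl -expRD ler_expR.
have := @ln_ge_1subV R (n.+2%:R / n.+1%:R) (divr_gt0 n0' n0); rewrite ln_div ?posrE // invf_div => hl.
have e : 1 - n.+1%:R / n.+2%:R = n.+2%:R^-1 :> R.
  by rewrite -[n.+2%:R]natr1 in n0' *; field; rewrite gt_eqF.
rewrite e in hl; have := ler_wpM2l (ltW n0') hl; rewrite mulfV ?gt_eqF //; lra.
Qed.
(** [N] is the number of vertices left uncovered. Replacing [N!] by [n^N] costs at most
    [N (1 - ln e1)] in the exponent, which is small as [N] is at most [2 * e1 * n]. *)
Lemma stirling_split (n N M : nat) (e1 : R) : (0 < n)%N -> n = (N + M)%N -> 0 < e1 -> e1 <= 1 ->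
  e1 * n%:R <= N%:R -> N%:R <= 2 * e1 * n%:R ->
  n`!%:R * expR (- 1 - ln n%:R - 2 * e1 * (1 - ln e1) * n%:R) <= N`!%:R * n%:R ^+ M * expR (- n%:R).
Proof.
move=> n0 nE e0 e1' eN Ne.
have nn : 0 < n%:R :> R by rewrite ltr0n.
have ub := fact_ub n0.
have lb := fact_lb N.
have le1 : ln e1 <= 0 by apply: ln_le0.
apply: (@le_trans _ _ (n%:R ^+ n * expR (- n%:R) * expR (- (2 * e1 * (1 - ln e1) * n%:R)))).
  rewrite expRD mulrA; apply: ler_wpM2r; rewrite ?expR_ge0 //.
  rewrite -(@ler_pM2r _ (expR n%:R)) ?expR_gt0 // -[leRHS]mulrA [expR (- n%:R) * _]mulrC expRxMexpNx_1 mulr1.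
  rewrite expRD mulrAC (_ : expR (- ln _) = n%:R^-1) ?expRN ?lnK ?posrE // mulrA ler_pdivrMr // mulrC mulrA.
  rewrite -[leLHS]mulrA ler_pdivrMl ?expR_gt0 //; apply: le_trans ub _.
  by rewrite exprSr.
apply: (@le_trans _ _ ((e1 * n%:R) ^+ N * expR (- N%:R) * n%:R ^+ M * expR (- n%:R))); last first.
  apply: ler_wpM2r; rewrite ?expR_ge0 //; apply: ler_wpM2r; rewrite ?exprn_ge0 ?ler0n //.
  rewrite expRN ler_pdivrMr ?expR_gt0 //; apply: le_trans lb.
  by apply: lerXn2r; rewrite ?nnegrE ?ler0n // mulr_ge0 // ltW.
rewrite exprMn {2}nE exprD (_ : _ * _ * expR (- N%:R) * _ * _ = n%:R ^+ N * n%:R ^+ M * expR (- n%:R) * (e1 ^+ N * expR (- N%:R))); last by ring.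
rewrite ler_pM2l ?mulr_gt0 ?exprn_gt0 ?expR_gt0 //.
rewrite -[X in X ^+ _]lnK ?posrE // -expRM_natl -expRD ler_expR.
have c : 0 <= 1 - ln e1 by lra.
have := ler_wpM2r c Ne; lra.
Qed.
Lemma small_entropy (err : R) : 0 < err -> exists2 e1 : R, 0 < e1 <= 1 / 4 &
  2 * e1 <= err /\ 2 * e1 * (1 - ln e1) <= err.
Proof.
move=> e0; pose h := Num.min (1 / 2) (err / 6).
have h0 : 0 < h by rewrite lt_min; apply/andP; split; lra.
have h1 : h <= 1 / 2 by rewrite ge_min lexx.
have h2 : h <= err / 6 by rewrite ge_min lexx orbT.
have l1 : - ln h <= h^-1 - 1 by have := ln_ge_1subV h0; lra.
have hh : h * h^-1 = 1 by rewrite mulfV // gt_eqF.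
(* A square, since [- ln h <= 1 / h - 1] bounds [- h^2 ln (h^2)] only by a multiple of [h]. *)
exists (h * h); first by apply/andP; split; nra.
split; first by nra.
rewrite lnM ?posrE //.
have := ler_wpM2l (ltW (mulr_gt0 h0 h0)) l1; rewrite mulrBr mulr1 -[h * h / h]mulrA hh mulr1; nra.
Qed.
Lemma ln_sublinear (err n : R) : 0 < err -> 0 < n -> 2 * ln (2 / err) / err <= n -> 1 + ln n <= err * n.
Proof.
move=> e0 n0; rewrite ler_pdivrMr // => h.
have p : 0 < err * n / 2 by rewrite divr_gt0 // mulr_gt0.
have := ln_le_subr1 p.
have -> : err * n / 2 = n / (2 / err) by field; rewrite gt_eqF.
rewrite ln_div ?posrE ?divr_gt0 //.
have -> : n / (2 / err) = err * n / 2 by field; rewrite gt_eqF.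
lra.
Qed.
End Factorials.

Definition nbad (V : finType) (k q : nat) (E : {set {set V}}) (s : seq V) : nat :=
  #|[set i : 'I_(#|V| %/ q) | window k s (i * q) \notin E]|.
(** The cost [v(x)] per window, in natural logarithms, whereas [matching_entropy] is in base two. *)
Definition mvalue (R : realType) (V : finType) (k : nat) (E : {set {set V}}) (x : {set V} -> R) : R :=
  ln (#|V|%:R ^+ k.-1 / (k.-1)`!%:R) - k%:R / #|V|%:R * \sum_(e in E) x e * ln (x e)^-1.

Lemma window_drop (V : finType) k (s : seq V) p : (p + k <= size s)%N ->
  window k s p = [set v in take k (drop p s)].
Proof.
move=> h; rewrite /window /rot takel_cat // size_drop leq_subRL //.
by apply: leq_trans h; rewrite leq_addr.
Qed.

Section PieceWindows.
Variables (R : realType) (V : finType) (l q t' : nat) (E : {set {set V}}) (kap : R) (T : nat).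
Let k := (q + l)%N.
Let t := t'.+1.
Let m := (q * (t + l))%N.
Hypothesis q_gt0 : (0 < q)%N.
Hypothesis T_le : (T * m <= #|V|)%N.
Variable s : seq V.
Hypothesis size_s : size s = #|V|.

Definition pw_bad : {set 'I_T * 'I_t} :=
  [set p : 'I_T * 'I_t | [set v in take k (drop (p.2 * q) (take m (drop (p.1 * m) s)))] \notin E].
Lemma pw_prod : \prod_(i < T) cp_W l q t' (sd_w E kap) (take m (drop (i * m) s)) = kap ^+ #|pw_bad| :> R.
Proof.
rewrite /cp_W pair_bigA /= -prodr_const [RHS]big_mkcond /=; apply: eq_bigr => p _.
by rewrite inE /sd_w /wt; case: (_ \in E).
Qed.
Let Tq : (T * (t + l) <= #|V| %/ q)%N.
Proof. by rewrite leq_divRL // -mulnA [((t + l) * q)%N]mulnC. Qed.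
Let idx_lt (p : 'I_T * 'I_t) : (p.1 * (t + l) + p.2 < #|V| %/ q)%N.
Proof.
apply: leq_trans Tq; apply: (@leq_trans (p.1.+1 * (t + l))); last by rewrite leq_mul2r ltn_ord orbT.
by rewrite mulSn addnC ltn_add2r; apply: leq_trans (ltn_ord p.2) _; rewrite leq_addr.
Qed.
Let idx p : 'I_(#|V| %/ q) := Ordinal (idx_lt p).
Let idx_inj : injective idx.
Proof.
move=> [i j] [i' j'] /(congr1 val) /= h.
have lt (o : 'I_t) : (o < t + l)%N by apply: leq_trans (ltn_ord o) _; rewrite leq_addr.
have ei : val i = val i'.
  have := congr1 (fun x => x %/ (t + l))%N h.
  by rewrite !divnMDl ?addn_gt0 // !divn_small // !addn0.
have ej : val j = val j' by move/eqP: h; rewrite [nat_of_ord i]ei eqn_add2l => /eqP.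
by congr pair; apply: val_inj.
Qed.
(** Every start that is not one of the [t] controlled windows of a piece is given up and counted as
    bad. *)
Lemma pw_nbad : (nbad k q E s + T * t <= #|pw_bad| + #|V| %/ q)%N.
Proof.
rewrite /nbad; set A := [set i | _].
have sub : A \subset (idx @: pw_bad) :|: ~: (idx @: [set: 'I_T * 'I_t]).
  apply/fintype.subsetP => a aA; rewrite inE; apply/orP.
  case: (boolP (a \in idx @: [set: 'I_T * 'I_t])) => [/imsetP[p _ ap]|h]; last by right; rewrite inE.
  left; apply/imsetP; exists p => //; move: aA; rewrite !inE ap /= => h.
  rewrite window_drop in h.
    rewrite take_drop take_takel; last first.
      rewrite /k /m; apply: (@leq_trans (q + l + t' * q)); first by rewrite leq_add2l leq_mul2r -ltnS ltn_ord orbT.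
      by rewrite /t mulnDr mulnS [(q * t')%N]mulnC -addnA [(l + _)%N]addnC addnA leq_add2l leq_pmull.
    rewrite -take_drop drop_drop; move: h; congr (~~ ([set v in take k (drop _ s)] \in E)).
    by rewrite mulnDl addnC -mulnA [((t + l) * q)%N]mulnC.
  rewrite size_s; apply: leq_trans T_le; apply: (@leq_trans (p.1.+1 * m)); last by rewrite leq_mul2r ltn_ord orbT.
  rewrite mulSn mulnDl -mulnA [((t + l) * q)%N]mulnC -/m addnAC [leqRHS]addnC -addnA leq_add2l.
  apply: (@leq_trans (k + t' * q)); first by rewrite leq_add2l leq_mul2r -ltnS ltn_ord orbT.
  by rewrite /k /m /t mulnDr mulnS [(q * t')%N]mulnC -addnA [(l + _)%N]addnC addnA leq_add2l leq_pmull.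
have := subset_leq_card sub => /leq_trans h.
have c1 := h _ (leq_card_setU _ _).
have cC : #|~: (idx @: [set: 'I_T * 'I_t])| = (#|V| %/ q - T * t)%N.
  by rewrite cardsCs finset.setCK (card_imset _ idx_inj) cardsT card_prod !card_ord.
rewrite (card_imset _ idx_inj) cC in c1.
have le : (T * t <= #|V| %/ q)%N by apply: leq_trans Tq; rewrite leq_mul2l leq_addr orbT.
by rewrite -[X in (_ <= _ + X)%N](subnK le) addnA leq_add2r.
Qed.
End PieceWindows.

(** Orderings are weighted by [kap] to the number of bad windows inside pieces. The chain count
    bounds the total weight from below; orderings with many bad windows carry at most half of this
    bound, so the others carry the rest, each with weight at most one. *)
Theorem almost_count (R : realType) (l q : nat) (v0 eps : R) : (0 < q)%N -> 0 < eps ->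
  exists n0 : nat, forall (V : finType) (E : {set {set V}}) (x : {set V} -> R),
  is_kuniform (q + l) E -> (n0 <= #|V|)%N -> (q %| #|V|)%N ->
  perfect_fractional_matching E x -> mvalue (q + l) E x <= v0 ->
  #|V| `!%:R * expR (- (#|V|%:R / q%:R * mvalue (q + l) E x) - eps * #|V|%:R) <=
  #|[set s : #|V|.-tuple V | uniq s && ((nbad (q + l) q E s)%:R <= eps * #|V|%:R)]|%:R.
Proof.
move=> q0 eps0; set k := (q + l)%N.
have k0 : (0 < k)%N by rewrite addn_gt0 q0.
pose err := eps / 4; have err0 : 0 < err by rewrite divr_gt0.
(* Chosen so that [err * lam] exceeds the exponent [|v0| + 3 * err] of the lower bound by one. *)
pose lam := (`|v0| + 3 * err + 1) / err.
have lam0 : 0 < lam by rewrite divr_gt0 //; have := normr_ge0 v0; lra.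
pose kap := expR (- lam); have kap0 : 0 < kap := expR_gt0 _.
have kap1 : kap <= 1 by rewrite -expR0 ler_expR oppr_le0 ltW.
(* As [l <= err * t], the positions of a piece that start no controlled window are at most a
   proportion [err]. *)
have [t' ht] := nat_above (l%:R / err); have {}ht := ht t'.+1 (leqnSn t').
pose t := t'.+1; pose m := (q * (t + l))%N.
have [e1 /andP[e10 e11] [e12 e13]] := small_entropy err0.
have kk0 : 0 < kap ^+ (2 * k) by rewrite exprn_gt0.
have chi0 : 0 <= 2 ^+ k / kap ^+ (2 * k) by rewrite divr_ge0 ?exprn_ge0 // ltW.
have [n1 h1] := chain_count l t' v0 q0 kk0 chi0 kap0 kap1 e10 err0.
have [n2 h2] := nat_above_all [:: n1%:R; (2 * k)%:R; (m%:R + 1) / e1; 2; err^-1; 2 * ln (2 / err) / err].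
exists n2 => V E x Ek nV qV px vx.
have := h2 _ nV; rewrite /= andbT !ler_nat => /and3P[hn1 hk] /and4P[hm hn2 herr hln].
set n : R := #|V|%:R in vx hm herr hln *.
have n0 : 0 < n by rewrite ltr0n (leq_trans _ hn2).
have Eks : E \subset ksets V k by apply/fintype.subsetP => e eE; rewrite inE (Ek _ eE).
pose x' e := if e \in E then x e else 0.
have px' : perfect_fractional_matching (ksets V k) x'.
  case: px => xp xs; split=> [e _|v]; first by rewrite /x'; case: ifP => // /xp.
  rewrite -[RHS](xs v) [LHS](bigID (mem E)) /= [X in _ + X]big1 ?addr0; last first.
    by move=> e /andP[_ /negbTE eE]; rewrite /x' eE.
  apply: eq_big => [e|e /andP[_ eE]]; last by rewrite /x' eE.
  rewrite andbAC; case: (boolP (e \in E)) => [eE|]; last by rewrite andbF.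
  by rewrite (fintype.subsetP Eks).
have [X [pX optX]] := soft_opt_exists E kap k0 px'.
have ratio := soft_opt_ratio kap0 kap1 k0 pX optX.
have softx : soft_value k E kap x' = \sum_(e in E) x e * ln (x e)^-1.
  rewrite /soft_value (bigID (mem E)) /= [X in _ + X]big1 ?addr0; last first.
    by move=> e /andP[_ /negbTE eE]; rewrite /x' eE mul0r.
  apply: eq_big => [e|e /andP[_ eE]].
    by case: (boolP (e \in E)) => [eE|]; rewrite ?andbF // andbT (fintype.subsetP Eks).
  rewrite /x' /wt eE ln1 sub0r; case: (ltP 0 (x e)) => xe; first by rewrite lnV ?posrE.
  by rewrite !ln0 ?oppr0 // invr_le0.
pose g := sd_g l q X; pose w := sd_w E kap.
have wb s : kap <= w s <= 1 by rewrite /w /sd_w wt_ge // wt_le1.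
(* The optimum is compared with [x'], whose softened value is the entropy of [x] because it gives
   non-edges no weight. *)
have vsle : cp_v l q g w <= mvalue k E x.
  rewrite (sd_v E q0 hk kap0 pX ratio) /mvalue lerD2l lerN2 -/k -/n; apply: ler_wpM2l.
    by rewrite divr_ge0 ?ler0n // ltW.
  by rewrite -softx; apply: optX.
have gtot := sd_tot q0 pX.
have gge0 := sd_g_ge0 q0 hk pX.
have vs0 : 0 <= cp_v l q g w := cp_v_ge0 hk q0 gge0 gtot kap0 wb.
set v := mvalue k E x in vx vsle *.
(* More than [e1 * n] vertices stay uncovered, as the potential argument requires; the remainder
   modulo [m] is added to them. *)
pose c := (Num.truncn (e1 * n)).+1.
have /andP[c1 c2] := truncn_itv (ltW (mulr_gt0 e10 n0)); rewrite -/c in c2.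
have c3 : c%:R <= e1 * n + 1 by rewrite -natr1 lerD2r.
have n2' : 2 <= n by rewrite (ler_nat _ 2).
have cV : (c <= #|V|)%N by rewrite -(ler_nat R); apply: le_trans c3 _; rewrite -/n; nra.
have m0 : (0 < m)%N by rewrite muln_gt0 q0.
pose T := ((#|V| - c) %/ m)%N; pose N0 := (c + (#|V| - c) %% m)%N.
have VE : #|V| = (N0 + T * m)%N by rewrite /N0 -addnA [(_ %% _ + _)%N]addnC -divn_eq subnKC.
have N1 : e1 * n <= N0%:R by apply: le_trans (ltW c2) _; rewrite ler_nat leq_addr.
have N2 : N0%:R <= 2 * e1 * n.
  apply: (@le_trans _ _ (c%:R + m%:R)); first by rewrite -natrD ler_nat leq_add2l ltnW // ltn_pmod.
  move: hm; rewrite ler_pdivrMr // => hm; move: hm c3; clear; lra.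
have main := h1 V g w hn1 hk gge0 (sd_g_perm l q X) (sd_g_nuniq l q X) (sd_g_lo q0 hk pX ratio) (sd_g_hi q0 hk kap0 pX ratio) gtot
   (sd_marg q0 pX) wb (le_trans vsle vx) N0 T N1 VE.
have V0 : (0 < #|V|)%N by rewrite -(ltr0n R).
have e1le : e1 <= 1 by move: e11; clear; lra.
have st := stirling_split V0 VE e10 e1le N1 N2.
set S := wsum _ _ _ in main.
have Ttn : T%:R * t%:R * q%:R <= n.
  rewrite -!natrM ler_nat VE -mulnA [(t * q)%N]mulnC; apply: leq_trans (leq_addl _ _).
  by rewrite leq_mul2l leq_mul2l leq_addr !orbT.
have q1 : 1 <= q%:R :> R by rewrite ler1n.
have qp : 0 < q%:R :> R by apply: lt_le_trans q1.
have Tt2 : T%:R * t%:R <= n / q%:R by rewrite ler_pdivlMr.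
have L1 : #|V| `!%:R * expR (- (n / q%:R * v) - 3 * err * n) <= S.
  apply: le_trans main.
  rewrite [leRHS](_ : _ = N0`!%:R * n ^+ (T * m) * expR (- n) * expR (- (T%:R * (t%:R * cp_v l q g w)) - err * n)); last first.
    by rewrite -[RHS]mulrA -expRD; congr (_ * expR _); rewrite -/n -/t; ring.
  apply: (@le_trans _ _ (#|V| `!%:R * expR (- 1 - ln n - 2 * e1 * (1 - ln e1) * n) * expR (- (T%:R * (t%:R * cp_v l q g w)) - err * n))); last first.
    by apply: ler_wpM2r; rewrite ?expR_ge0.
  rewrite -[leRHS]mulrA -expRD; apply: ler_wpM2l; rewrite ?ler0n // ler_expR.
  have := ln_sublinear err0 n0 hln; have := ler_wpM2r (ltW n0) e13.
  have a1 : T%:R * (t%:R * cp_v l q g w) <= n / q%:R * v.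
    rewrite mulrA; apply: ler_pM => //; by rewrite mulr_ge0 ?ler0n.
  move: a1; clear; lra.
pose A := [set s : #|V|.-tuple V | uniq s && ((nbad k q E s)%:R <= eps * n)].
have Tm : (T * m <= #|V|)%N by rewrite VE leq_addl.
have lossT : n / q%:R - T%:R * t%:R <= 2 * err * n.
  have tp : 0 < t%:R :> R by rewrite ltr0n.
  have b1 : T%:R * q%:R * l%:R <= n * err.
    have lt : l%:R <= t%:R * err by rewrite -ler_pdivrMr.
    apply: (@le_trans _ _ (T%:R * q%:R * (t%:R * err))); first by rewrite ler_wpM2l // mulr_ge0 ?ler0n.
    by rewrite mulrA; apply: ler_wpM2r; [apply: ltW | rewrite mulrAC].
  have nE : n = N0%:R + T%:R * (q%:R * (t%:R + l%:R)) by rewrite {1}/n VE natrD natrM natrM natrD.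
  have qe : q%:R * (n / q%:R - T%:R * t%:R) = N0%:R + T%:R * q%:R * l%:R.
    rewrite mulrBr mulrCA mulfV ?gt_eqF // mulr1 {1}nE; ring.
  apply: (@le_trans _ _ (q%:R * (n / q%:R - T%:R * t%:R))).
    by rewrite ler_peMl // subr_ge0.
  rewrite qe; have := ler_wpM2r (ltW n0) e12; move: N2 b1; clear; lra.
have U1 : S <= #|A|%:R + #|V| `!%:R * expR (- (err * lam * n)).
  rewrite /S (_ : #|A|%:R = \sum_(s : #|V|.-tuple V) (s \in A)%:R); last first.
    by rewrite -sum1_card natr_sum [LHS]big_mkcond; apply: eq_bigr => s _; case: (s \in A).
  rewrite -[in #|V| `!%:R]ffactnn -[X in (X ^_ _)%:R]cardsT -(wsum_uniq_count R [set: V]) -wsumZr !wsum_tuple -big_split /=.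
  apply: ler_sum => s _; case: (boolP (uniq s)) => us; last by rewrite !mul0r addr0 ler0n.
  rewrite !mul1r (pw_prod l q t' E kap T s).
  case: (boolP (s \in A)) => sA.
    by rewrite -[leLHS]addr0; apply: lerD; rewrite ?expR_ge0 // exprn_ile1 // ltW.
  rewrite add0r; move: sA; rewrite inE us /= -ltNge => nb.
  have := pw_nbad E q0 Tm (size_tuple s); rewrite -(ler_nat R) !natrD natrM -/k -/t.
  have nq : n = (#|V| %/ q)%:R * q%:R by rewrite -natrM divnK.
  have -> : (#|V| %/ q)%:R = n / q%:R :> R by rewrite nq mulfK // gt_eqF.
  set b := #|pw_bad l q t' E T s| => bb.
  rewrite /kap -expRM_natl ler_expR.
  have b2 : err * n <= b%:R by move: (mulr_ge0 (ltW err0) (ltW n0)) nb bb lossT; rewrite (_ : eps = 4 * err) ?/err; [clear; lra | by rewrite mulrC divfK].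
  have := ler_wpM2l (ltW lam0) b2; clear; lra.
have half : expR (- 1) <= 1 / 2 :> R.
  rewrite expRN -div1r ler_pdivrMr ?expR_gt0 //; have := @expR_ge1Dx R 1; clear; lra.
set F := #|V| `!%:R * _ in L1.
have F0 : 0 <= F by rewrite mulr_ge0 ?ler0n ?expR_ge0.
have qv : n / q%:R * v <= n * `|v0|.
  have := ler_norm v0; have vv : v <= `|v0| := le_trans vx (ler_norm v0).
  move=> _; apply: (@le_trans _ _ (n / q%:R * `|v0|)).
    by apply: ler_wpM2l => //; rewrite divr_ge0 // ltW.
  by apply: ler_wpM2r => //; rewrite ler_pdivrMr // ler_peMr // ltW.
have U2 : #|V| `!%:R * expR (- (err * lam * n)) <= F * (1 / 2).
  apply: (@le_trans _ _ (F * expR (- 1))); last exact: ler_wpM2l.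
  rewrite /F -[leRHS]mulrA -expRD; apply: ler_wpM2l; rewrite ?ler0n // ler_expR.
  rewrite /lam mulrCA mulfV ?gt_eqF // mulr1; move: qv n2'; clear; lra.
have U3 : F * expR (- 1) <= #|A|%:R.
  have := ler_wpM2l F0 half; move: (le_trans L1 U1) U2; clear; lra.
apply: le_trans U3; rewrite /F -[leRHS]mulrA -expRD; apply: ler_wpM2l; rewrite ?ler0n // ler_expR.
have en : 1 <= err * n by move: herr; rewrite -[X in X <= _]mul1r ler_pdivrMr // mulrC.
rewrite (_ : eps = 4 * err); last by rewrite /err mulrC divfK.
move: en; clear; lra.
Qed.

(** * Tight paths *)

Section Blowup.
Variable R : realType.
Local Notation ws := (wsum (R := R)).

Lemma wsum_pigeonhole (V : finType) (A : {set V}) n (f : seq V -> R) (c : R) : 0 < c -> (0 < #|A|)%N ->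
  c * #|A|%:R ^+ n <= ws A n f -> exists s, [/\ size s = n, all (mem A) s & c / 2 <= f s].
Proof.
move=> c0 A0 h; apply: contrapT => no; move: h; apply/negP; rewrite -ltNge.
apply: (@le_lt_trans _ _ (ws A n (fun=> c / 2))).
  apply: ler_wsum => s sn sA; rewrite leNgt; apply/negP => h; apply: no; exists s; split=> //.
  exact: ltW.
by rewrite wsumC mulrC ltr_pM2r ?exprn_gt0 ?ltr0n //; lra.
Qed.

(** Union bound over the [n] positions: a given letter of a word lies in [B] with proportion at most
    [b / |A|]. *)
Lemma wsum_remove (V : finType) (A B : {set V}) n (b : R) (f : seq V -> R) :
  #|A :&: B|%:R <= b -> (forall s, 0 <= f s <= 1) ->
  #|A|%:R * ws A n f <= #|A|%:R * ws (A :\: B) n f + n%:R * b * #|A|%:R ^+ n.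
Proof.
move=> hb; have b0 : 0 <= b by apply: le_trans hb; rewrite ler0n.
have a0 : 0 <= #|A|%:R :> R by rewrite ler0n.
have ub m (g : seq V -> R) : (forall s, 0 <= g s <= 1) -> ws A m g <= #|A|%:R ^+ m.
  move=> g1; rewrite -[leRHS]mulr1 -wsumC; apply: ler_wsum => s _ _; by have /andP[] := g1 s.
elim: n f => [|n IH] f f1 /=; first by rewrite !mul0r addr0.
rewrite [\sum_(x in A) _](bigID (mem B)) /= mulrDr.
have e1 : \sum_(x in A | x \in B) ws A n (fun s => f (x :: s)) <= b * #|A|%:R ^+ n.
  apply: (@le_trans _ _ (\sum_(x in A :&: B) #|A|%:R ^+ n)).
    rewrite (eq_bigl (fun x => x \in A :&: B)); last by move=> x; rewrite inE.
    by apply: ler_sum => x _; apply: ub.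
  by rewrite sumr_const -[leLHS]mulr_natl ler_wpM2r ?exprn_ge0.
have e2 : #|A|%:R * \sum_(x in A | x \notin B) ws A n (fun s => f (x :: s)) <=
   #|A|%:R * \sum_(x in A :\: B) ws (A :\: B) n (fun s => f (x :: s)) + n%:R * b * #|A|%:R ^+ n.+1.
  rewrite (eq_bigl (fun x => x \in A :\: B)); last by move=> x; rewrite inE andbC.
  rewrite !mulr_sumr; apply: (@le_trans _ _ (\sum_(x in A :\: B)
    (#|A|%:R * ws (A :\: B) n (fun s => f (x :: s)) + n%:R * b * #|A|%:R ^+ n))).
    by apply: ler_sum => x _; apply: IH.
  rewrite big_split /= lerD2l sumr_const -[leLHS]mulr_natl exprS mulrCA mulrA mulrA -[leRHS]mulrA.
  rewrite -[leLHS]mulrA; apply: ler_wpM2l; first by rewrite mulr_ge0 ?ler0n.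
  by apply: ler_wpM2r; rewrite ?exprn_ge0 // ler_nat subset_leq_card // finset.subsetDl.
have e3 := ler_wpM2l a0 e1.
rewrite -[n.+1%:R]natr1 [_ ^+ n.+1]exprS in e2 *; move: e2 e3; lra.
Qed.

(** Erdős' theorem on complete partite subhypergraphs, by induction on [N]. Counting words [w]
    against [a]-tuples of first letters compatible with [w] yields an [a]-tuple that serves a
    positive proportion of the words. Its letters are then removed from [A], to make the classes
    disjoint. *)
Lemma blowup (a N : nat) (c : R) : 0 < c -> exists M : nat, forall (V : finType) (A : {set V}) (P : pred (seq V)),
  (M <= #|A|)%N -> c * #|A|%:R ^+ N <= ws A N (fun w => (P w)%:R) ->
  exists gs : seq (seq V), [/\ size gs = N, all (fun t => size t == a) gs, uniq (flatten gs),
    {subset flatten gs <= A} & forall w, all2 (fun v t => v \in t) w gs -> P w].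
Proof.
elim: N c => [|N IH] c c0.
  exists 0%N => V A P _ /=; rewrite expr0 mulr1 => h; exists [::]; split=> // -[] // _.
  by apply: contraTT h => /negbTE ->; rewrite -ltNge.
pose C0 := (c / 4) ^+ a * (c / 2).
have C00 : 0 < C0 by rewrite mulr_gt0 ?exprn_gt0 ?divr_gt0.
have [M hM] := IH (C0 / 4) (divr_gt0 C00 (ltr0n _ 4)).
have [n1 h1] := nat_above_all [:: 1; 4 * a%:R / c; 4 * (N%:R * a%:R) / C0; (M + a)%:R].
exists n1 => V A P nA hP.
have := h1 _ nA; rewrite /= andbT => /and4P[A1 A2 A3 A4].
have A0 : (0 < #|A|)%N by rewrite -(ler1n R).
have A0' : 0 < #|A|%:R :> R by rewrite ltr0n.
rewrite ler_pdivrMr // in A2; rewrite ler_pdivrMr // in A3; rewrite ler_nat in A4.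
pose D (w : seq V) := A :&: [set v | P (v :: w)].
pose f t w : R := (all (fun v => P (v :: w)) t)%:R.
have swap : ws A N (fun w => (#|D w| ^_ a)%:R) = ws A a (fun t => (uniq t)%:R * ws A N (f t)).
  transitivity (ws A N (fun w => ws A a (fun t => (uniq t)%:R * f t w))).
    apply: eq_wsum => w _ _; rewrite -(wsum_uniq_count R (D w)) -wsum_restrict; apply: eq_wsum => t _ _.
    rewrite mulrC; congr (_ * _%:R); congr nat_of_bool; apply: eq_all => v; by rewrite /= inE.
  by rewrite wsum_exch; apply: eq_wsum => t _ _; rewrite wsumZ.
have dsum : c * #|A|%:R ^+ N.+1 <= ws A N (fun w => #|D w|%:R).
  apply: le_trans hP _; rewrite /= -wsum_sum; apply: ler_wsum => w _ _.
  rewrite -sum1_card natr_sum le_eqVlt; apply/orP; left; apply/eqP.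
  rewrite big_mkcond [RHS]big_mkcond /=; apply: eq_bigr => v _; rewrite !inE.
  by case: (v \in A); case: (P _).
(* A linear minorant of the falling factorial replaces convexity; it is nonpositive for words of
   small degree. *)
have lowd w : (c / 4 * #|A|%:R) ^+ a * (#|D w|%:R / #|A|%:R - c / 2) <= (#|D w| ^_ a)%:R.
  have p0 : 0 <= c / 4 * #|A|%:R by rewrite mulr_ge0 ?divr_ge0 // ltW.
  case: (lerP (c / 2) (#|D w|%:R / #|A|%:R)) => h; last first.
    by apply: (@le_trans _ _ 0); rewrite ?ler0n // mulr_ge0_le0 ?exprn_ge0 // subr_le0 ltW.
  rewrite ler_pdivlMr // in h.
  have aD : (a <= #|D w|)%N by rewrite -(ler_nat R); lra.
  apply: (@le_trans _ _ (((#|D w| - a) ^ a)%:R)); last by rewrite ler_nat ffact_ge_exp.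
  apply: (@le_trans _ _ ((c / 4 * #|A|%:R) ^+ a)).
    rewrite ler_piMr ?exprn_ge0 // lerBlDr; apply: (@le_trans _ _ 1); last by lra.
    by rewrite ler_pdivrMr // mul1r ler_nat subset_leq_card // finset.subsetIl.
  by rewrite natrX; apply: lerXn2r; rewrite ?nnegrE ?ler0n // natrB //; lra.
have big : C0 * #|A|%:R ^+ N * #|A|%:R ^+ a <= ws A a (fun t => (uniq t)%:R * ws A N (f t)).
  rewrite -swap; apply: (@le_trans _ _ (ws A N (fun w => (c / 4 * #|A|%:R) ^+ a * (#|D w|%:R / #|A|%:R - c / 2)))).
    rewrite wsumZ wsum_add wsumZr wsumC exprMn /C0.
    have : c * #|A|%:R ^+ N <= ws A N (fun w => #|D w|%:R) / #|A|%:R.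
      by rewrite ler_pdivlMr // -mulrA -exprSr.
    set W := _ / _ => hW.
    rewrite [leLHS](_ : _ = (c / 4) ^+ a * #|A|%:R ^+ a * (c * #|A|%:R ^+ N + #|A|%:R ^+ N * - (c / 2))); last by field.
    by apply: ler_wpM2l; [rewrite mulr_ge0 // exprn_ge0 ?divr_ge0 // ltW | rewrite lerD2r].
  by apply: ler_wsum.
have CA : 0 < C0 * #|A|%:R ^+ N by rewrite mulr_gt0 ?exprn_gt0.
have [t [ta tA ht]] := wsum_pigeonhole CA A0 big.
have ut : uniq t.
  by apply: contraTT ht => /negbTE ->; rewrite mul0r -ltNge divr_gt0.
rewrite ut mul1r in ht.
pose A' := A :\: [set v in t].
have cAt : #|A :&: [set v in t]|%:R <= a%:R :> R.
  rewrite ler_nat -ta; apply: leq_trans (card_size t).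
  by apply: subset_leq_card; apply/fintype.subsetP => v; rewrite !inE => /andP[].
have f01 s : 0 <= f t s <= 1 by rewrite /f; case: (all _ _); rewrite lexx ler01.
have rem := wsum_remove N cAt f01.
have hA' : C0 / 4 * #|A'|%:R ^+ N <= ws A' N (fun w => (all (fun v => P (v :: w)) t)%:R).
  apply: (@le_trans _ _ (C0 / 4 * #|A|%:R ^+ N)).
    apply: ler_wpM2l; first by rewrite divr_ge0 // ltW.
    apply: lerXn2r; rewrite ?nnegrE ?ler0n // ler_nat subset_leq_card //.
    exact: finset.subsetDl.
  have nN : 0 <= #|A|%:R ^+ N :> R by rewrite exprn_ge0 ?ler0n.
  have r1 := ler_wpM2l (ltW A0') ht; have r2 := ler_wpM2r nN A3.
  rewrite -(ler_pM2l A0'); move: (le_trans r1 rem) r2; lra.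
have cA' : (M <= #|A'|)%N.
  rewrite -(leq_add2r a); apply: leq_trans A4 _; rewrite -(cardsID [set v in t] A) addnC leq_add2l.
  by rewrite -(ler_nat R).
have [gs [gN ga gu gA gP]] := hM V A' _ cA' hA'.
exists (t :: gs); split.
- by rewrite /= gN.
- by rewrite /= ta eqxx.
- rewrite /= cat_uniq ut gu andbT /=; apply/hasPn => v /gA; by rewrite !inE => /andP[].
- move=> v /=; rewrite mem_cat => /orP[/(allP tA) //|/gA]; by rewrite inE => /andP[].
- case=> // v w /= /andP[vt wg]; by have /allP/(_ v vt) := gP w wg.
Qed.
End Blowup.

Section Tight.
Variables (V : finType) (k : nat) (E : {set {set V}}).
Implicit Types (s t u w X Y Z : seq V).

(** The list contains the starts of complete windows only, so a word shorter than [k] is tight. *)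
Definition tight s := all (fun i => [set v in take k (drop i s)] \in E) (iota 0 ((size s).+1 - k)).
Lemma tightP s : reflect (forall i, (i + k <= size s)%N -> [set v in take k (drop i s)] \in E) (tight s).
Proof.
apply: (iffP allP) => [h i ik|h i]; first by apply: h; rewrite mem_iota add0n leq_subRL ?addnS; lia.
by rewrite mem_iota add0n => /andP[_ ik]; apply: h; lia.
Qed.
(** No window meets both [X] and [Z], as [k - 1] letters lie between them. *)
Lemma tight_glue X Y Z : (k.-1 <= size Y)%N -> tight (X ++ Y) -> tight (Y ++ Z) -> tight (X ++ Y ++ Z).
Proof.
move=> kY /tightP h1 /tightP h2; apply/tightP => i; rewrite !size_cat => ik.
case: (leqP (i + k) (size X + size Y)) => h.
  have := h1 i; rewrite size_cat => /(_ h) H.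
  move: H; rewrite catA [drop i ((X ++ Y) ++ Z)]drop_cat size_cat; case: ltnP => hi; last first.
    have -> : k = 0%N by lia.
    by rewrite !take0.
  by rewrite takel_cat // size_drop size_cat; lia.
have iX : (size X <= i)%N by lia.
rewrite drop_cat ltnNge iX /=; apply: h2; rewrite size_cat; lia.
Qed.
Lemma tight_rev s : tight (rev s) = tight s.
Proof.
suff H t : tight t -> tight (rev t) by apply/idP/idP => /H //; rewrite revK.
move=> /tightP h; apply/tightP => i; rewrite size_rev => ik.
have := h (size t - i - k)%N; rewrite (_ : (size t - i - k + k <= size t)%N); last by lia.
move=> /(_ isT); congr (_ \in E); apply/setP => v; rewrite !inE.
rewrite drop_rev take_rev mem_rev size_takel ?leq_subr // take_drop; congr (_ \in drop _ (take _ _)).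
by rewrite subnKC // leq_subRL //; lia.
Qed.
Lemma tight_path X Xs : all (fun Y => k.-1 <= size Y)%N Xs -> path.path (fun Y Z => tight (Y ++ Z)) X Xs -> Xs != [::] ->
  tight (X ++ flatten Xs).
Proof.
elim: Xs X => // Y [|Z Xs] IH X /=; first by rewrite cats0 => _ /andP[].
move=> /andP[sY sZ] /andP[XY YZ] _; apply: tight_glue => //.
exact: IH.
Qed.
Lemma tight_cons_ext u x w : size u = k.-1 -> (0 < k)%N -> [set v in rcons u x] \in E ->
  tight (behead (rcons u x) ++ w) -> tight (u ++ x :: w).
Proof.
move=> uk k0 eE /tightP h; apply/tightP => i ik.
have e : u ++ x :: w = rcons u x ++ w by rewrite -cats1 -catA.
case: i ik => [|i] ik; first by rewrite drop0 e take_size_cat // size_rcons uk prednK.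
have := h i; rewrite size_cat size_behead size_rcons /= => H.
rewrite e; case er : (rcons u x) => [|a r]; first by move: er; case: (u).
move: H; rewrite er /=; apply; move: ik; rewrite size_cat /=; lia.
Qed.
End Tight.

(** * The connecting lemma *)

Lemma card_set_seq (V : finType) (s : seq V) : #|[set v in s]| = size s -> uniq s.
Proof. by move=> h; apply/card_uniqP; rewrite -h cardsE. Qed.
Lemma set_seq_perm (V : finType) (s t : seq V) : perm_eq s t -> [set v in s] = [set v in t].
Proof. by move=> h; apply/setP => v; rewrite !inE (perm_mem h). Qed.
Lemma set_rcons (V : finType) (s : seq V) x : [set v in rcons s x] = x |: [set v in s].
Proof. by apply/setP => v; rewrite !inE mem_rcons inE. Qed.

Lemma nth_flatten_inj (T : eqType) (x0 : T) (gs : seq (seq T)) a i j r r' :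
  all (fun t => size t == a) gs -> uniq (flatten gs) -> (i < size gs)%N -> (j < size gs)%N ->
  (r < a)%N -> (r' < a)%N -> nth x0 (nth [::] gs i) r = nth x0 (nth [::] gs j) r' -> i = j /\ r = r'.
Proof.
have mj (hs : seq (seq T)) i' s : all (fun t => size t == a) hs -> (i' < size hs)%N -> (s < a)%N ->
    nth x0 (nth [::] hs i') s \in flatten hs.
  move=> ha ih sa; apply/flattenP; exists (nth [::] hs i'); rewrite ?mem_nth //.
  by have /allP/(_ _ (mem_nth [::] ih))/eqP -> := ha.
move=> ga; elim: gs ga i j => // t gs IH /= /andP[/eqP ta ga] [|i] [|j]; rewrite cat_uniq => /and3P[ut /hasPn d ug] //= ig jg ra ra' e.
- by split=> //; apply/eqP; rewrite -(nth_uniq x0 _ _ ut) ?ta // e.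
- by have := d _ (mj gs j r' ga jg ra'); rewrite -e mem_nth ?ta.
- by have := d _ (mj gs i r ga ig ra); rewrite e mem_nth ?ta.
- by have [-> ->] := IH ga i j ug ig jg ra ra' e.
Qed.

Section Zok.
Variables (V : finType) (k : nat) (E : {set {set V}}).

(** The letters of [w] are put in front of [zs] one by one; each time the missing first letters are
    taken from [x] and from [y], and both words must be edges. Thus one word can gradually replace
    [x] from the back, or [y], through edges only. *)
Fixpoint zok (x y zs w : seq V) : bool :=
  if w is v :: w' then
    [&& [set u in take (k.-1 - size zs) x ++ v :: zs] \in E,
        [set u in take (k.-1 - size zs) y ++ v :: zs] \in E & zok x y (v :: zs) w']
  else true.

Lemma zokP (x y zs w : seq V) : (size zs + size w <= k)%N -> zok x y zs w -> forall j, (k - size zs - size w <= j < k - size zs)%N ->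
  [set u in take j x ++ drop (j - (k - size zs - size w)) (rev w ++ zs)] \in E /\
  [set u in take j y ++ drop (j - (k - size zs - size w)) (rev w ++ zs)] \in E.
Proof.
elim: w zs => [|v w IH] zs /=; first by move=> _ _ j; lia.
move=> sz /and3P[xE yE /IH H] j jk; rewrite rev_cons cat_rcons.
have {}H := H ltac:(by rewrite /= addSnnS).
have e : (k - size (v :: zs) - size w = k - size zs - (size w).+1)%N by rewrite /=; lia.
rewrite e in H.
case: (ltnP j (k - size (v :: zs))) => h; first by apply: H; rewrite h andbT; case/andP: jk.
have jE : j = (k.-1 - size zs)%N by move: jk h; rewrite /=; lia.
have dE : drop (j - (k - size zs - (size w).+1)) (rev w ++ v :: zs) = v :: zs.
  have -> : (j - (k - size zs - (size w).+1) = size (rev w))%N by rewrite size_rev; lia.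
  by rewrite drop_size_cat.
by rewrite dE jE.
Qed.
End Zok.

Section Extension.
Variables (R : realType) (V : finType) (k : nat) (E : {set {set V}}) (A D : {set V}) (gam : R).
Hypothesis k_ge2 : (2 <= k)%N.
Hypothesis Ek : is_kuniform k E.
Hypothesis gam0 : 0 < gam.
Hypothesis gam1 : gam <= 1 / 2.
Hypothesis AD : A \subset D.
Hypothesis codeg : forall X : {set V}, #|X| = k.-1 -> X \subset D ->
  (1 / 2 + gam) * #|A|%:R <= #|A :&: [set v | v |: X \in E]|%:R.
Local Notation ws := (wsum (R := R)).
Local Notation c := (2 * gam * #|A|%:R).
Let k_gt0 : (0 < k)%N. Proof. exact: ltnW. Qed.
Let c_ge0 : 0 <= c. Proof. by rewrite !mulr_ge0 ?ler0n // ltW. Qed.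

Lemma nbr1 (X : {set V}) : #|X| = k.-1 -> X \subset D -> c <= #|A :&: [set v | v |: X \in E]|%:R.
Proof.
move=> cX XD; apply: le_trans (codeg cX XD); apply: ler_wpM2r; rewrite ?ler0n //; move: gam1; lra.
Qed.
(** Inclusion-exclusion: two neighbourhoods of density [1/2 + gam] in [A] share a proportion
    [2 * gam]. *)
Lemma nbr2 (X Y : {set V}) : #|X| = k.-1 -> X \subset D -> #|Y| = k.-1 -> Y \subset D ->
  c <= #|A :&: [set v | (v |: X \in E) && (v |: Y \in E)]|%:R.
Proof.
move=> cX XD cY YD; have h1 := codeg cX XD; have h2 := codeg cY YD.
set B := A :&: [set v | v |: X \in E] in h1; set C := A :&: [set v | v |: Y \in E] in h2.
have -> : A :&: [set v | (v |: X \in E) && (v |: Y \in E)] = B :&: C.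
  by apply/setP => v; rewrite !inE; case: (v \in A).
have h3 : #|B :|: C|%:R <= #|A|%:R :> R.
  by rewrite ler_nat subset_leq_card //; apply/fintype.subsetP => v; rewrite !inE => /orP[] /andP[].
have := cardsUI B C => /(congr1 (fun n => n%:R : R)); rewrite !natrD; move: h1 h2 h3; lra.
Qed.

Lemma ext_count m (u : seq V) : size u = k.-1 -> uniq u -> {subset u <= D} ->
  c ^+ m <= ws A m (fun w => (tight k E (u ++ w))%:R).
Proof.
elim: m u => [|m IH] u uk uu uD /=.
  rewrite expr0 cats0 (_ : tight k E u) //; apply/tightP => i; rewrite uk => h; exfalso.
  by move: h; rewrite leqNgt => /negP; apply; apply: leq_trans (leq_addl _ _); rewrite -subn1 ltn_subrL.
have cu : #|[set v in u]| = k.-1 by rewrite cardsE (card_uniqP uu).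
have uD' : [set v in u] \subset D by apply/fintype.subsetP => v; rewrite inE => /uD.
rewrite exprS; apply: (@le_trans _ _ (\sum_(x in A :&: [set v | v |: [set v in u] \in E]) c ^+ m)).
  rewrite sumr_const -[leRHS]mulr_natl; apply: ler_wpM2r; first exact: exprn_ge0.
  exact: nbr1.
rewrite [leRHS](bigID (fun x => x |: [set v in u] \in E)) /=; apply: ler_wpDr.
  by apply: sumr_ge0 => x _; apply: wsum_ge0 => *; rewrite ler0n.
rewrite (eq_bigl (fun x => (x \in A) && (x |: [set v in u] \in E))); last by move=> x; rewrite !inE.
apply: ler_sum => x /andP[xA xE].
have xE' : [set v in rcons u x] \in E by rewrite set_rcons.
have ux : uniq (rcons u x) by apply: card_set_seq; rewrite (Ek xE') size_rcons uk prednK.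
apply: le_trans (IH (behead (rcons u x)) _ _ _) _.
- by rewrite size_behead size_rcons uk.
- by case: (rcons u x) ux => //= a r /andP[].
- by move=> v /mem_behead; rewrite mem_rcons inE => /orP[/eqP ->|/uD //]; apply: (fintype.subsetP AD).
apply: ler_wsum => w _ _; case: (boolP (tight k E (behead _ ++ w))) => [h|_]; last by rewrite ler0n.
by rewrite tight_cons_ext.
Qed.

Lemma zok_count m (x y zs : seq V) : size x = k -> size y = k -> {subset x <= D} -> {subset y <= D} -> {subset zs <= D} ->
  (size zs + m <= k)%N ->
  [set u in take (k - size zs) x ++ zs] \in E -> [set u in take (k - size zs) y ++ zs] \in E ->
  c ^+ m <= ws A m (fun w => (zok k E x y zs w)%:R).
Proof.
elim: m zs => [|m IH] zs xk yk xD yD zD zm xE yE //=.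
have zk : (size zs < k)%N by apply: leq_trans zm; rewrite addnS ltnS leq_addr.
have sub (a : seq V) : size a = k -> {subset a <= D} -> [set u in take (k - size zs) a ++ zs] \in E ->
    let X := [set u in take (k.-1 - size zs) a ++ zs] in #|X| = k.-1 /\ X \subset D.
  move=> ak aD aE /=.
  have e : (k - size zs = (k.-1 - size zs).+1)%N by lia.
  have ua : uniq (take (k - size zs) a ++ zs).
    by apply: card_set_seq; rewrite (Ek aE) size_cat size_takel ?ak ?leq_subr // subnK // ltnW.
  split.
    rewrite cardsE; have /card_uniqP -> : uniq (take (k.-1 - size zs) a ++ zs).
      apply: subseq_uniq ua; apply: cat_subseq => //; rewrite e.
      by rewrite -(take_takel a (leqnSn (k.-1 - size zs))); apply: take_subseq.
    by rewrite size_cat size_takel ?ak; lia.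
  by apply/fintype.subsetP => v; rewrite inE mem_cat => /orP[/mem_take/aD|/zD].
have [cX XD] := sub x xk xD xE; have [cY YD] := sub y yk yD yE.
set X := [set u in _] in cX XD; set Y := [set u in _] in cY YD.
have swp v (a : seq V) : [set u in a ++ v :: zs] = v |: [set u in a ++ zs].
  by apply/setP => u; rewrite !inE !mem_cat !inE; do !case: (_ \in _); case: (_ == _).
rewrite exprS; apply: (@le_trans _ _ (\sum_(v in A :&: [set v | (v |: X \in E) && (v |: Y \in E)]) c ^+ m)).
  rewrite sumr_const -[leRHS]mulr_natl; apply: ler_wpM2r; first exact: exprn_ge0.
  exact: nbr2.
rewrite [leRHS](bigID (fun v => (v |: X \in E) && (v |: Y \in E))) /=; apply: ler_wpDr.
  by apply: sumr_ge0 => v _; apply: wsum_ge0 => *; rewrite ler0n.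
rewrite (eq_bigl (fun v => (v \in A) && ((v |: X \in E) && (v |: Y \in E)))); last by move=> v; rewrite !inE.
apply: ler_sum => v /and3P[vA vX vY].
have e : (k - (size zs).+1 = k.-1 - size zs)%N by rewrite -add1n subnDA subn1.
apply: le_trans (IH (v :: zs) xk yk xD yD _ _ _ _) _.
- by move=> u; rewrite inE => /orP[/eqP ->|/zD //]; apply: (fintype.subsetP AD).
- by rewrite /= addSnnS.
- by rewrite /= e swp.
- by rewrite /= e swp.
by apply: ler_wsum => w _ _; rewrite !swp vX vY.
Qed.

End Extension.

Lemma all2_nth (S T : Type) (p : S -> T -> bool) x0 y0 (s : seq S) (t : seq T) :
  size s = size t -> (forall i, (i < size t)%N -> p (nth x0 s i) (nth y0 t i)) -> all2 p s t.
Proof.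
elim: s t => [|x s IH] [|y t] //= [st] h; have := h 0%N isT => /= ->.
by apply: IH => // i it; apply: (h i.+1).
Qed.

Section Rounds.
Variables (V : finType) (k : nat) (E : {set {set V}}) (S T : seq V) (gs : seq (seq V)) (x0 : V).
Hypothesis k_gt0 : (0 < k)%N.
Hypothesis gN : size gs = (k + (k + k))%N.
Hypothesis ga : all (fun t => size t == (2 * k)%N) gs.
(** A pattern of [3 k] letters: [x] continues [S], [y] continues the reversal of [T], and [z] links
    [x] with the reversal of [y]. The blow-up [gs] provides [2 k] interchangeable vertices for each
    letter. *)
Definition rd_P (w : seq V) : bool :=
  [&& tight k E (S ++ take k w), tight k E (rev T ++ take k (drop k w)) &
      zok k E (take k w) (rev (take k (drop k w))) [::] (drop k (drop k w))].
Hypothesis gP : forall w, all2 (fun v (t : seq V) => v \in t) w gs -> rd_P w.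
Local Notation g i := (nth [::] gs i).

(** The path has [2 k] rounds of [k] vertices. Round [r] takes its first [rd_j r] positions from the
    classes of [x] if [r < k] and of [y] otherwise, and the rest from those of [z]. As [rd_j] falls
    from [k] to 1 and then climbs back to [k], consecutive rounds differ in the class of one
    position only. Round [r] uses the [r]-th vertex of each class, so no vertex occurs twice. *)
Definition rd_j r := (if r < k then k - r else r - k + 1)%N.
Definition rd_idx r p := (if p < rd_j r then (if r < k then p else k + (k.-1 - p)) else k + (k + (k.-1 - p)))%N.
Definition rd_elem r p := nth x0 (g (rd_idx r p)) r.
Definition rd_word r := mkseq (rd_elem r) k.

Lemma rd_sz i : (i < k + (k + k))%N -> size (g i) = (2 * k)%N.
Proof. by move=> ik; have /allP/(_ _ (mem_nth [::] (_ : i < size gs)%N))/eqP := ga; rewrite gN => /(_ ik). Qed.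
Lemma rd_idx_lt r p : (p < k)%N -> (rd_idx r p < k + (k + k))%N.
Proof. move=> pk; rewrite /rd_idx; case: ifP => _; [case: ifP => _|]; lia. Qed.
Lemma rd_idx_inj r p p' : (p < k)%N -> (p' < k)%N -> rd_idx r p = rd_idx r p' -> p = p'.
Proof. by move=> pk pk'; rewrite /rd_idx; case: ifP => _; case: ifP => _; try (case: ifP => _); lia. Qed.

Hypothesis sS : size S = k.-1.
Hypothesis sT : size T = k.-1.

Lemma rd_full (h : nat -> V) : (forall i, (i < k + (k + k))%N -> h i \in g i) ->
  [/\ tight k E (S ++ mkseq h k), tight k E (rev T ++ mkseq (fun i => h (k + i)%N) k) &
   forall j, (j <= k)%N ->
   [set u in take j (mkseq h k) ++ drop j (mkseq (fun p => h (k + (k + (k.-1 - p)))%N) k)] \in E /\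
   [set u in take j (mkseq (fun p => h (k + (k.-1 - p))%N) k) ++ drop j (mkseq (fun p => h (k + (k + (k.-1 - p)))%N) k)] \in E].
Proof.
move=> hg; have := gP (_ : all2 _ (mkseq h (k + (k + k))) gs).
move=> /(_ _)/and3P H; have {H} [] := H _.
  apply: (@all2_nth _ _ _ x0 [::]); rewrite ?size_mkseq ?gN // => i ik.
  by rewrite nth_mkseq //; apply: hg.
have e1 : take k (mkseq h (k + (k + k))) = mkseq h k.
  by rewrite /mkseq -map_take take_iota (minn_idPl _) // leq_addr.
have e2 : take k (drop k (mkseq h (k + (k + k)))) = mkseq (fun i => h (k + i)%N) k.
  apply: (@eq_from_nth _ x0); first by rewrite size_mkseq size_takel // size_drop size_mkseq; lia.
  rewrite size_takel ?size_drop ?size_mkseq => [i ik|]; last by lia.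
  by rewrite nth_take // nth_drop !nth_mkseq //; lia.
have e3 : drop k (drop k (mkseq h (k + (k + k)))) = mkseq (fun i => h (k + (k + i))%N) k.
  apply: (@eq_from_nth _ x0); first by rewrite size_mkseq !size_drop size_mkseq; lia.
  rewrite !size_drop size_mkseq => i ik.
  by rewrite !nth_drop !nth_mkseq //; lia.
rewrite e1 e2 e3 => tS tT /zokP H.
have revm (f : nat -> V) : rev (mkseq f k) = mkseq (fun p => f (k.-1 - p)%N) k.
  apply: (@eq_from_nth _ x0); rewrite ?size_rev ?size_mkseq // => i ik.
  rewrite nth_rev ?size_mkseq // !nth_mkseq //; last by lia.
  by congr f; lia.
split=> // j jk; case: (ltnP j k) => jk'.
  have := H _ j; rewrite size_mkseq add0n subn0 subnn leq0n jk' cats0 subn0 => /(_ (leqnn _) isT).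
  by rewrite !revm.
have -> : j = k by apply/eqP; rewrite eqn_leq jk.
rewrite !take_oversize ?drop_oversize ?size_mkseq // !cats0; split.
  move/tightP: tS => /(_ (size S)); rewrite size_cat size_mkseq leqnn => /(_ isT).
  by rewrite drop_size_cat // take_oversize // size_mkseq.
move/tightP: tT => /(_ (size (rev T))); rewrite size_cat size_mkseq leqnn => /(_ isT).
rewrite drop_size_cat // take_oversize ?size_mkseq //; congr (_ \in E).
by rewrite -(revm (fun i => h (k + i)%N)); apply/setP => v; rewrite !inE mem_rev.
Qed.

(** [w] is completed to a transversal of all classes, and every transversal satisfies [rd_P]. *)
Lemma rd_box r w : (r < 2 * k)%N -> size w = k -> (forall p, (p < k)%N -> nth x0 w p \in g (rd_idx r p)) ->
  [set v in w] \in E.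
Proof.
move=> rk wk hw.
pose h i := (if i < k then (if (r < k) && (i < rd_j r) then nth x0 w i else nth x0 (g i) 0)
  else if i < k + k then (let p := k.-1 - (i - k) in if (k <= r) && (p < rd_j r) then nth x0 w p else nth x0 (g i) 0)
  else (let p := k.-1 - (i - k - k) in if rd_j r <= p then nth x0 w p else nth x0 (g i) 0))%N.
have jk : (rd_j r <= k)%N by rewrite /rd_j; case: ifP; lia.
have hg i : (i < k + (k + k))%N -> h i \in g i.
  move=> ik; have d : nth x0 (g i) 0 \in g i by rewrite mem_nth // rd_sz // muln_gt0.
  rewrite /h; case: ltnP => i1; last case: ltnP => i2.
  - case: ifP => // /andP[rk' ij]; have := hw i i1; by rewrite /rd_idx ij rk'.
  - case: ifP => // /andP[rk' ij]; have := hw (k.-1 - (i - k))%N; rewrite /rd_idx ij [(r < k)%N]ltnNge rk' /=.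
    have -> : (k + (k.-1 - (k.-1 - (i - k))) = i)%N by lia.
    by apply; lia.
  - case: leqP => // ij; have := hw (k.-1 - (i - k - k))%N; rewrite /rd_idx [(_ < rd_j r)%N]ltnNge ij /=.
    have -> : (k + (k + (k.-1 - (k.-1 - (i - k - k)))) = i)%N by lia.
    by apply; lia.
have [_ _ /(_ _ jk)[h1 h2]] := rd_full hg.
have zpart p : (rd_j r <= p < k)%N -> h (k + (k + (k.-1 - p)))%N = nth x0 w p.
  move=> /andP[jp pk]; rewrite /h !ltnNge leq_addr leq_add2l leq_addr /=.
  have -> : (k.-1 - (k + (k + (k.-1 - p)) - k - k) = p)%N by lia.
  by rewrite jp.
case: (ltnP r k) => rk'.
  rewrite (_ : take _ _ ++ _ = w) // in h1; apply: (@eq_from_nth _ x0).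
    by rewrite size_cat size_takel ?size_drop ?size_mkseq // subnKC.
  rewrite size_cat size_takel ?size_drop ?size_mkseq // subnKC // => p pk.
  rewrite nth_cat size_takel ?size_mkseq //; case: ltnP => pj.
    by rewrite nth_take // nth_mkseq // /h pk rk' pj.
  by rewrite nth_drop subnKC // nth_mkseq // zpart // pj.
rewrite (_ : take _ _ ++ _ = w) // in h2; apply: (@eq_from_nth _ x0).
  by rewrite size_cat size_takel ?size_drop ?size_mkseq // subnKC.
rewrite size_cat size_takel ?size_drop ?size_mkseq // subnKC // => p pk.
rewrite nth_cat size_takel ?size_mkseq //; case: ltnP => pj.
  rewrite nth_take // nth_mkseq // /h ltnNge leq_addr /= ltn_add2l (_ : k.-1 - p < k)%N; last by lia.
  have -> : (k.-1 - (k + (k.-1 - p) - k) = p)%N by lia.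
  by rewrite rk' pj.
by rewrite nth_drop subnKC // nth_mkseq // zpart // pj.
Qed.

Lemma rd_elem_in r p : (r < 2 * k)%N -> (p < k)%N -> rd_elem r p \in g (rd_idx r p).
Proof. by move=> rk pk; rewrite /rd_elem mem_nth // rd_sz // rd_idx_lt. Qed.

(** A window across rounds [r] and [r + 1] is, up to order, a prefix of the later round and a suffix
    of the earlier. Since the rounds differ in the class of one position only, its classes are those
    of round [r] or those of round [r + 1]. *)
Lemma rd_mix r i : (r.+1 < 2 * k)%N -> (i <= k)%N -> [set v in take i (rd_word r.+1) ++ drop i (rd_word r)] \in E.
Proof.
move=> rk ik.
have sz : size (take i (rd_word r.+1) ++ drop i (rd_word r)) = k.
  by rewrite size_cat size_takel ?size_drop ?size_mkseq // subnKC.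
have nt p : (p < k)%N -> nth x0 (take i (rd_word r.+1) ++ drop i (rd_word r)) p =
    if (p < i)%N then rd_elem r.+1 p else rd_elem r p.
  move=> pk; rewrite nth_cat size_takel ?size_mkseq //; case: ltnP => pi.
    by rewrite nth_take // nth_mkseq.
  by rewrite nth_drop subnKC // nth_mkseq.
have j1 : (r < k.-1)%N -> rd_j r = (rd_j r.+1).+1.
  by move=> h; rewrite /rd_j !ifT; lia.
have j2 : (k <= r)%N -> rd_j r.+1 = (rd_j r).+1.
  by move=> h; rewrite /rd_j !ifF; lia.
case: (ltnP r k.-1) => rk1; [|case: (leqP k r) => rk2].
- have e := j1 rk1; have a1 : (r < k)%N by lia. have a2 : (r.+1 < k)%N by lia.
  case: (leqP i (rd_j r.+1)) => ij.
    apply: (@rd_box r) => //; first exact: ltnW.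
    move=> p pk; rewrite nt //; case: ltnP => pi; last by apply: rd_elem_in => //; apply: ltnW.
    have := rd_elem_in rk pk; rewrite /rd_idx a1 a2 e ltnS.
    by rewrite (leq_trans pi ij) (ltnW (leq_trans pi ij)).
  apply: (@rd_box r.+1) => //.
  move=> p pk; rewrite nt //; case: ltnP => pi; first exact: rd_elem_in.
  have f1 : (p < rd_j r.+1)%N = false by rewrite ltnNge (leq_trans (ltnW ij) pi).
  have f2 : (p < rd_j r)%N = false by rewrite e ltnNge (leq_trans ij pi).
  by have := rd_elem_in (ltnW rk) pk; rewrite /rd_idx f1 f2.
- have e := j2 rk2; have a1 : (r < k)%N = false by lia. have a2 : (r.+1 < k)%N = false by lia.
  case: (leqP i (rd_j r)) => ij.
    apply: (@rd_box r) => //; first exact: ltnW.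
    move=> p pk; rewrite nt //; case: ltnP => pi; last by apply: rd_elem_in => //; apply: ltnW.
    have := rd_elem_in rk pk; rewrite /rd_idx a1 a2 e ltnS.
    by rewrite (leq_trans pi ij) (ltnW (leq_trans pi ij)).
  apply: (@rd_box r.+1) => //.
  move=> p pk; rewrite nt //; case: ltnP => pi; first exact: rd_elem_in.
  have f1 : (p < rd_j r)%N = false by rewrite ltnNge (leq_trans (ltnW ij) pi).
  have f2 : (p < rd_j r.+1)%N = false by rewrite e ltnNge (leq_trans ij pi).
  by have := rd_elem_in (ltnW rk) pk; rewrite /rd_idx f1 f2.
have rE : r = k.-1 by lia.
have ja : rd_j r = 1%N by rewrite /rd_j ifT; lia.
have jb : rd_j r.+1 = 1%N by rewrite /rd_j ifF; lia.
case: i ik sz nt => [|i] ik sz nt.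
  apply: (@rd_box r) => //; first exact: ltnW.
  by move=> p pk; rewrite nt //=; apply: rd_elem_in => //; apply: ltnW.
apply: (@rd_box r.+1) => // p pk; rewrite nt //; case: ltnP => pi; first exact: rd_elem_in.
have := rd_elem_in (ltnW rk) pk; rewrite /rd_idx ja jb.
by case: p pi pk.
Qed.

Lemma rd_tight r : (r.+1 < 2 * k)%N -> tight k E (rd_word r ++ rd_word r.+1).
Proof.
move=> rk; apply/tightP => i; rewrite size_cat !size_mkseq leq_add2r => ik.
have := rd_mix rk ik; congr (_ \in E).
have -> : take k (drop i (rd_word r ++ rd_word r.+1)) = drop i (rd_word r) ++ take i (rd_word r.+1).
  rewrite drop_cat size_mkseq; case: ltnP => h.
    rewrite take_cat size_drop size_mkseq ifF; last by lia.
    by congr (_ ++ take _ _); lia.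
  have -> : i = k by lia.
  rewrite subnn drop0 [drop _ _]drop_oversize ?size_mkseq //.
apply: set_seq_perm; by rewrite perm_catC.
Qed.

Lemma rd_first : tight k E (S ++ rd_word 0).
Proof.
have [|h _ _] := @rd_full (fun i => nth x0 (g i) 0).
  by move=> i ik; rewrite mem_nth // rd_sz // muln_gt0.
move: h; congr (tight k E (S ++ _)); apply: (@eq_from_nth _ x0); rewrite ?size_mkseq // => i ik.
by rewrite !nth_mkseq // /rd_elem /rd_idx /rd_j k_gt0 subn0 ik.
Qed.
Lemma rd_last : tight k E (rd_word (2 * k).-1 ++ T).
Proof.
have kk : ((2 * k).-1 < 2 * k)%N by lia.
have [|_ h _] := @rd_full (fun i => nth x0 (g i) (2 * k).-1).
  by move=> i ik; rewrite mem_nth // rd_sz.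
rewrite -tight_rev rev_cat; move: h; congr (tight k E (_ ++ _)); apply: (@eq_from_nth _ x0); rewrite ?size_rev ?size_mkseq // => i ik.
rewrite nth_rev ?size_mkseq // !nth_mkseq //; last by lia.
rewrite /rd_elem /rd_idx /rd_j.
have -> : ((2 * k).-1 < k)%N = false by lia.
have -> : ((2 * k).-1 - k + 1 = k)%N by lia.
have -> : (k - i.+1 < k)%N by lia.
by congr (nth x0 (g _) _); lia.
Qed.

Definition rd_c := [seq rd_elem r p | r <- iota 0 (2 * k), p <- iota 0 k].
Lemma rd_c_size : size rd_c = (2 * k * k)%N.
Proof. by rewrite size_allpairs !size_iota. Qed.
Lemma rd_c_uniq : uniq (flatten gs) -> uniq rd_c.
Proof.
move=> ug; apply: allpairs_uniq; rewrite ?iota_uniq // => -[r p] [r' p'].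
move=> /allpairsP[[a b] /= [ai bi [-> ->]]] /allpairsP[[a' b'] /= [ai' bi' [-> ->]]] /= e.
rewrite !mem_iota !add0n in ai bi ai' bi'; move: ai bi ai' bi' => /andP[_ ai] /andP[_ bi] /andP[_ ai'] /andP[_ bi'].
have i1 : (rd_idx a b < size gs)%N by rewrite gN rd_idx_lt.
have i2 : (rd_idx a' b' < size gs)%N by rewrite gN rd_idx_lt.
have [e1 e2] := nth_flatten_inj ga ug i1 i2 ai ai' e.
by rewrite e2 in e1 *; rewrite (rd_idx_inj bi bi' e1).
Qed.
Lemma rd_c_tight : tight k E (S ++ rd_c ++ T).
Proof.
have -> : rd_c ++ T = flatten (rcons (mkseq rd_word (2 * k)) T).
  by rewrite flatten_rcons.
apply: tight_path; last by rewrite -size_eq0 size_rcons.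
  rewrite all_rcons sT leqnn /=; apply/allP => w /mapP[r _ ->]; by rewrite size_mkseq leq_pred.
apply/(path.pathP [::]) => i; rewrite size_rcons size_mkseq => ik.
rewrite nth_rcons size_mkseq; case: ltnP => ik1; last first.
  have -> : (i == 2 * k)%N by apply/eqP; lia.
  have -> : i = (2 * k).-1.+1 by lia.
  rewrite [nth _ _ _]/= nth_rcons size_mkseq ifT; last by lia.
  rewrite nth_mkseq; last by lia.
  exact: rd_last.
rewrite nth_mkseq //; case: i ik ik1 => [|i] ik ik1 /=; first exact: rd_first.
rewrite nth_rcons size_mkseq ifT; last by lia.
rewrite nth_mkseq; last by lia.
exact: rd_tight.
Qed.
Lemma rd_c_sub : {subset rd_c <= flatten gs}.
Proof.
move=> v /allpairsP[[r p] /= [ri pi ->]]; rewrite !mem_iota !add0n in ri pi.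
apply/flattenP; exists (g (rd_idx r p)); last by apply: rd_elem_in.
by rewrite mem_nth // gN rd_idx_lt.
Qed.
End Rounds.

(** Extending letter by letter gives at least [(2 gam |A|)^(3k)] words with [rd_P], a positive
    proportion; [blowup] then provides the vertices for the rounds. *)
Lemma connect_tight (R : realType) (k : nat) (gam : R) : (2 <= k)%N -> 0 < gam -> gam <= 1 / 2 ->
  exists M : nat, forall (V : finType) (E : {set {set V}}) (A : {set V}) (S T : seq V),
  is_kuniform k E -> (M <= #|A|)%N -> size S = k.-1 -> size T = k.-1 -> uniq S -> uniq T ->
  (forall X : {set V}, #|X| = k.-1 -> X \subset A :|: [set v in S] :|: [set v in T] ->
     (1 / 2 + gam) * #|A|%:R <= #|A :&: [set v | v |: X \in E]|%:R) ->
  exists c, [/\ size c = (2 * k * k)%N, uniq c, {subset c <= A} & tight k E (S ++ c ++ T)].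
Proof.
move=> k2 g0 g1; have k0 : (0 < k)%N by apply: ltnW.
pose N := (k + (k + k))%N; pose d := (2 * gam) ^+ N.
have d0 : 0 < d by rewrite exprn_gt0 // mulr_gt0.
have [M hM] := blowup (2 * k) N d0; exists M.+1 => V E A S T Ek MA sS sT uS uT codeg.
have /card_gt0P[x0 _] : (0 < #|A|)%N by apply: leq_ltn_trans MA.
set D := _ :|: _ in codeg.
have AD : A \subset D by apply/fintype.subsetP => v vA; rewrite !inE vA.
have SD : {subset S <= D} by move=> v vS; rewrite !inE vS orbT.
have TD : {subset rev T <= D} by move=> v; rewrite mem_rev => vS; rewrite !inE vS orbT.
have cnt : d * #|A|%:R ^+ N <= wsum A N (fun w => (rd_P k E S T w)%:R).
  rewrite /N wsumD.
  set c := 2 * gam * #|A|%:R.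
  have c0 : 0 <= c by rewrite !mulr_ge0 ?ler0n // ltW.
  have -> : d * #|A|%:R ^+ (k + (k + k)) = c ^+ k * (c ^+ k * c ^+ k) by rewrite /d /N -exprMn -/c !exprD.
  have c1 : c ^+ k <= wsum A k (fun w => (tight k E (S ++ w))%:R) by apply: (ext_count k2 Ek g0 g1 AD codeg).
  have c2 : c ^+ k <= wsum A k (fun w => (tight k E (rev T ++ w))%:R).
    by apply: (ext_count k2 Ek g0 g1 AD codeg); rewrite ?size_rev ?rev_uniq.
  apply: le_trans (ler_wpM2r (mulr_ge0 (exprn_ge0 k c0) (exprn_ge0 k c0)) c1) _.
  rewrite -wsumZr; apply: ler_wsum => x xk xA; rewrite wsumD.
  case: (boolP (tight k E (S ++ x))) => tx; last first.
    by rewrite mul0r; apply: wsum_ge0 => *; apply: wsum_ge0 => *; rewrite ler0n.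
  rewrite mul1r; apply: le_trans (ler_wpM2r (exprn_ge0 k c0) c2) _.
  rewrite -wsumZr; apply: ler_wsum => y yk yA.
  case: (boolP (tight k E (rev T ++ y))) => ty; last first.
    by rewrite mul0r; apply: wsum_ge0 => *; rewrite ler0n.
  have zc : c ^+ k <= wsum A k (fun w => (zok k E x (rev y) [::] w)%:R).
    apply: (zok_count k2 Ek g0 g1 AD codeg) => //.
    - by rewrite size_rev.
    - by move=> v /(allP xA); apply: (fintype.subsetP AD).
    - by move=> v; rewrite mem_rev => /(allP yA); apply: (fintype.subsetP AD).
    - rewrite subn0 take_oversize ?xk // cats0.
      move/tightP: tx => /(_ (size S)); rewrite size_cat xk leqnn => /(_ isT).
      by rewrite drop_size_cat // take_oversize // xk.
    - rewrite subn0 take_oversize ?size_rev ?yk // cats0.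
      move/tightP: ty => /(_ (size (rev T))); rewrite size_cat yk leqnn => /(_ isT).
      rewrite drop_size_cat // take_oversize ?yk //; congr (_ \in E).
      by apply/setP => v; rewrite !inE mem_rev.
  rewrite mul1r; apply: le_trans zc _; apply: ler_wsum => z zk zA.
  by rewrite /rd_P (take_size_cat _ xk) (drop_size_cat _ xk) (take_size_cat _ yk) (drop_size_cat _ yk) tx ty.
have [gs [gN ga gu gA gP]] := hM V A _ (ltnW MA) cnt.
exists (rd_c k gs x0); split.
- exact: rd_c_size.
- by eapply rd_c_uniq; eassumption.
- by move=> v /(rd_c_sub k0 gN ga)/gA.
- by eapply rd_c_tight; eassumption.
Qed.

(** * Absorption *)

Lemma nat_a1 (a b c d : nat) : (0 < a -> a <= d - (b + c) -> a + b <= d)%N.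
Proof. lia. Qed.
Lemma nat_a2 (m a b c i x : nat) : (m + a + (b + c) <= i + x -> i <= c -> m <= x)%N.
Proof. lia. Qed.
Lemma nat_a3 (a b c : nat) : (a + (b + (b + c)) = a + 2 * b + c)%N.
Proof. lia. Qed.

Section Rich.
Variables (R : realType) (V : finType) (k : nat) (E : {set {set V}}).
Implicit Types (A D Z : {set V}) (g : R) (s x y w : seq V).
Hypothesis k_ge2 : (2 <= k)%N.
Hypothesis Ek : is_kuniform k E.
Let k_gt0 : (0 < k)%N. Proof. exact: ltnW. Qed.

(** [A] supplies new vertices, while [D] contains the sets to be extended. They differ because the
    ends of a path may lie outside the set from which it is built. *)
Definition rich A D g := forall X : {set V}, #|X| = k.-1 -> X \subset D ->
  (1 / 2 + g) * #|A|%:R <= #|A :&: [set v | v |: X \in E]|%:R.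

Lemma rich_sub A D A' D' g : rich A D g -> A' \subset A -> D' \subset D -> 0 <= g ->
  2 * #|A :\: A'|%:R <= g * #|A|%:R -> rich A' D' (g / 2).
Proof.
move=> rA sA sD g0 h X cX XD; have := rA X cX (fintype.subset_trans XD sD).
set N := [set v | _] => hN.
have c1 : #|A|%:R = #|A'|%:R + #|A :\: A'|%:R :> R.
  by rewrite -natrD -(cardsID A' A) (finset.setIidPr sA).
have c2 : #|A :&: N|%:R <= #|A' :&: N|%:R + #|A :\: A'|%:R :> R.
  rewrite -natrD ler_nat -(cardsID A' (A :&: N)); apply: leq_add; apply: subset_leq_card; apply/fintype.subsetP => v; rewrite !inE.
    by move=> /andP[/andP[_ ->] ->].
  by move=> /andP[-> /andP[-> _]].
have a0 : 0 <= #|A :\: A'|%:R :> R by rewrite ler0n.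
have := mulr_ge0 g0 a0; move: h; rewrite c1 in hN *; move: hN c2; lra.
Qed.

Definition lastk s := drop (size s - k.-1) s.
Lemma lastk_size s : (k.-1 <= size s)%N -> size (lastk s) = k.-1.
Proof. by move=> h; rewrite size_drop subKn. Qed.
Lemma lastk_cat s : s = take (size s - k.-1) s ++ lastk s.
Proof. by rewrite cat_take_drop. Qed.
Lemma tight_short s : (size s < k)%N -> tight k E s.
Proof. by move=> sk; apply/tightP => i ik; move: (leq_trans (leq_addl i k) ik); rewrite leqNgt sk. Qed.
Lemma tight_one s : size s = k -> [set v in s] \in E -> tight k E s.
Proof.
move=> sk sE; apply/tightP => i; rewrite sk -[leqRHS]add0n leq_add2r leqn0 => /eqP ->.
by rewrite drop0 take_oversize ?sk.
Qed.
Lemma tight_rcons s v : (k.-1 <= size s)%N -> tight k E s -> [set u in rcons (lastk s) v] \in E -> tight k E (rcons s v).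
Proof.
move=> sk ts vE; rewrite -cats1 [s]lastk_cat -catA; apply: tight_glue.
- by rewrite lastk_size.
- by rewrite -lastk_cat.
- by rewrite cats1; apply: tight_one => //; rewrite size_rcons lastk_size // prednK.
Qed.
Lemma last_ext A D g (F : {set V}) s1 s2 : rich A D g -> uniq s1 -> uniq s2 -> (k.-1 <= size s1)%N -> (k.-1 <= size s2)%N ->
  {subset s1 <= D} -> {subset s2 <= D} -> #|F|%:R < 2 * g * #|A|%:R ->
  exists v, [/\ v \in A, v \notin F, [set u in rcons (lastk s1) v] \in E & [set u in rcons (lastk s2) v] \in E].
Proof.
move=> rA u1 u2 z1 z2 d1 d2 hF.
have pr s : uniq s -> (k.-1 <= size s)%N -> {subset s <= D} -> #|[set v in lastk s]| = k.-1 /\ [set v in lastk s] \subset D.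
  move=> us zs ds; rewrite cardsE (card_uniqP (drop_uniq _ us)) lastk_size //; split=> //.
  by apply/fintype.subsetP => v; rewrite inE => /mem_drop/ds.
have [c1 D1] := pr _ u1 z1 d1; have [c2 D2] := pr _ u2 z2 d2.
have := nbr2 rA c1 D1 c2 D2; set N := _ :&: _ => hN.
have /card_gt0P[v] : (0 < #|N :\: F|)%N.
  rewrite lt0n; apply/negP => /eqP e; have := lt_le_trans hF hN; rewrite ltr_nat ltnNge => /negP; apply.
  by apply: subset_leq_card; rewrite -finset.setD_eq0 -cards_eq0 e.
by rewrite !inE => /andP[vF /and3P[vA v1 v2]]; exists v; rewrite !set_rcons.
Qed.

Lemma uniq_in_set A j : (j <= #|A|)%N -> exists s, [/\ size s = j, uniq s & {subset s <= A}].
Proof.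
move=> jA; exists (take j (enum A)); split; rewrite ?take_uniq ?enum_uniq //.
- by rewrite size_takel // -cardE.
- by move=> v /mem_take; rewrite mem_enum.
Qed.

Lemma card_seq_le (s : seq V) : (#|[set v in s]| <= size s)%N.
Proof. by rewrite cardsE; apply: card_size. Qed.

(** [x] is chosen to form an edge with [z]. Then [y] grows letter by letter, each time by a common
    neighbour of the last [k - 1] letters of [x ++ y] and of [x ++ z :: y]. *)
Lemma absorber A D g z : rich A D g -> A \subset D -> z \in D -> z \notin A -> 0 < g -> (k <= #|A|)%N ->
  (2 * k)%:R < 2 * g * #|A|%:R ->
  exists x y, [/\ size x = k.-1 /\ size y = k.-1, uniq (x ++ y), {subset x ++ y <= A}, tight k E (x ++ y) & tight k E (x ++ z :: y)].
Proof.
move=> rA AD zD zA g0 kA big.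
have [u [us uu uA]] := @uniq_in_set A k.-2 (leq_trans (leq_trans (leq_pred _) (leq_pred _)) kA).
have k1 : (k.-2.+1 = k.-1)%N by rewrite prednK // -subn1 subn_gt0.
have zu : z \notin u by apply/negP => /uA; rewrite (negbTE zA).
have uzu : uniq (z :: u) by rewrite /= zu.
have dzu : {subset z :: u <= D}.
  by move=> v; rewrite inE => /orP[/eqP -> //|/uA]; apply: (fintype.subsetP AD).
have szu : (k.-1 <= size (z :: u))%N by rewrite /= us k1.
have hF : #|[set v in u]|%:R < 2 * g * #|A|%:R.
  apply: le_lt_trans big; rewrite ler_nat; apply: leq_trans (card_seq_le u) _.
  by rewrite us; apply: leq_trans (leq_pred _) (leq_trans (leq_pred _) (leq_pmull _ _)).
have [v [vA vF vE _]] := last_ext rA uzu uzu szu szu dzu dzu hF.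
have lk : lastk (z :: u) = z :: u by rewrite /lastk /= us k1 subnn drop0.
pose x := rcons u v.
have sx : size x = k.-1 by rewrite size_rcons us k1.
have ux : uniq x by rewrite rcons_uniq uu andbT; move: vF; rewrite inE.
have xA : {subset x <= A} by move=> w; rewrite mem_rcons inE => /orP[/eqP -> //|/uA].
have zx : z \notin x by apply/negP => /xA; rewrite (negbTE zA).
have txz : tight k E (x ++ [:: z]).
  apply: tight_one; first by rewrite size_cat sx addn1 prednK.
  rewrite lk in vE; move: vE; congr (_ \in E); apply/setP => w; rewrite !inE mem_cat /x /= inE !mem_rcons !inE.
  by rewrite orbC.
suff H j : (j <= k.-1)%N -> exists y, [/\ size y = j, uniq (x ++ y), {subset x ++ y <= A}, tight k E (x ++ y) & tight k E (x ++ z :: y)].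
  by have [y [yk yu yA t1 t2]] := H _ (leqnn _); exists x, y; split.
elim: j => [|j IH] jk.
  exists [::]; rewrite !cats0; split=> //; apply: tight_short; by rewrite sx prednK.
have [y [ys yu yA t1 t2]] := IH (ltnW jk).
have zy : z \notin x ++ y by apply/negP => /yA; rewrite (negbTE zA).
have d1 : {subset x ++ y <= D} by move=> w /yA; apply: (fintype.subsetP AD).
have pz : perm_eq (x ++ z :: y) (z :: (x ++ y)) by rewrite perm_catC /= perm_cons perm_catC.
have u2 : uniq (x ++ z :: y) by rewrite (perm_uniq pz) /= zy.
have d2 : {subset x ++ z :: y <= D}.
  by move=> w; rewrite (perm_mem pz) inE => /orP[/eqP -> //|/d1].
have s1 : (k.-1 <= size (x ++ y))%N by rewrite size_cat sx leq_addr.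
have s2 : (k.-1 <= size (x ++ z :: y))%N by rewrite size_cat sx leq_addr.
have hF2 : #|[set v in x ++ y]|%:R < 2 * g * #|A|%:R.
  apply: le_lt_trans big; rewrite ler_nat; apply: leq_trans (card_seq_le _) _.
  by rewrite size_cat sx ys mul2n -addnn leq_add ?leq_pred //; apply: leq_trans (ltnW jk) (leq_pred k).
have [v' [vA' vF' e1 e2]] := last_ext rA yu u2 s1 s2 d1 d2 hF2.
exists (rcons y v'); split.
- by rewrite size_rcons ys.
- by rewrite -rcons_cat rcons_uniq yu andbT; move: vF'; rewrite inE.
- by move=> w; rewrite -rcons_cat mem_rcons inE => /orP[/eqP -> //|/yA].
- by rewrite -rcons_cat; apply: tight_rcons.
- by rewrite -rcons_cons -rcons_cat; apply: tight_rcons.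
Qed.

Variable M : nat.
Variable g1 : R.
Hypothesis g1_gt0 : 0 < g1.
Hypothesis connectM : forall A S T, (M <= #|A|)%N -> size S = k.-1 -> size T = k.-1 -> uniq S -> uniq T ->
  rich A (A :|: [set v in S] :|: [set v in T]) (g1 / 2) ->
  exists c, [/\ size c = (2 * k * k)%N, uniq c, {subset c <= A} & tight k E (S ++ c ++ T)].

Definition acost := (2 * k * k + 2 * k.-1)%N.

(* [A] is the ambient set and [F] the part of it already used. *)
Lemma absorb_chain A D (F : {set V}) (S zs : seq V) : rich A D g1 -> A \subset D ->
  size S = k.-1 -> uniq S -> {subset S <= D} -> {subset zs <= D} -> {in zs, forall z, z \notin A} ->
  (M + 2 * k <= #|A :\: F| - size zs * acost)%N ->
  (2 * k)%:R < g1 * (#|A :\: F|%:R - (size zs * acost)%:R) ->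
  2 * (#|A :&: F|%:R + (size zs * acost)%:R) <= g1 * #|A|%:R ->
  exists base T1, [/\ size base = (size zs * acost)%N, uniq base, {subset base <= A :\: F}, [/\ size T1 = k.-1, uniq T1 & {subset T1 <= D}] &
    forall keep : pred V, exists r c, [/\ S ++ r = c ++ T1, perm_eq r (base ++ [seq v <- zs | keep v]) & tight k E (S ++ r)]].
Proof.
move=> rA AD; elim: zs F S => [|z zs IH] F S sS uS SD zD zA hM hk hF.
  exists [::], S; split=> // keep; exists [::], [::]; rewrite cats0; split=> //.
  by apply: tight_short; rewrite sS prednK.
pose A1 := A :\: F.
have A1A : A1 \subset A by apply: finset.subsetDl.
have cost0 : ((size (z :: zs) * acost)%:R = acost%:R + (size zs * acost)%:R :> R) by rewrite /= mulSn natrD.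
have p0 : 0 <= (size zs * acost)%:R :> R by rewrite ler0n.
have p1 : 0 <= acost%:R :> R by rewrite ler0n.
have AA1 : A :\: A1 = A :&: F by rewrite finset.setDDr finset.setDv finset.set0U.
have rA1 : rich A1 D (g1 / 2).
  apply: rich_sub rA A1A _ (ltW g1_gt0) _ => //; rewrite AA1.
  by apply: le_trans hF; rewrite cost0; lra.
have zD1 : z \in D by apply: zD; rewrite inE eqxx.
have zA1 : z \notin A1 by apply/negP => /(fintype.subsetP A1A); apply/negP; apply: zA; rewrite inE eqxx.
have hMa : (M + 2 * k + acost <= #|A1|)%N.
  apply: (@nat_a1 _ _ (size zs * acost)); first by rewrite addn_gt0 muln_gt0 k_gt0 orbT.
  by move: hM; rewrite /= mulSn -/A1.
have [x [y [[sx sy] uxy xyA t1 t2]]] : exists x y, [/\ size x = k.-1 /\ size y = k.-1, uniq (x ++ y), {subset x ++ y <= A1}, tight k E (x ++ y) & tight k E (x ++ z :: y)].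
  apply: (absorber rA1) => //.
  - exact: fintype.subset_trans AD.
  - by rewrite divr_gt0.
  - by apply: leq_trans hMa; rewrite mul2n -addnn -!addnA addnCA leq_addr.
  - rewrite (mulrC g1) mulrA mulfV // mul1r; apply: lt_le_trans hk _; apply: ler_wpM2l; first exact: ltW.
    by rewrite cost0 -/A1; lra.
pose A2 := A1 :\: [set v in x ++ y].
have A2A : A2 \subset A by apply: fintype.subset_trans A1A; apply: finset.subsetDl.
have cxy : (#|A1 :&: [set v in x ++ y]| <= 2 * k.-1)%N.
  apply: leq_trans (subset_leq_card (finset.subsetIr _ _)) _; apply: leq_trans (card_seq_le _) _.
  by rewrite size_cat sx sy addnn mul2n.
have acE : acost%:R = (2 * k * k)%:R + (2 * k.-1)%:R :> R by rewrite /acost natrD.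
have q1 : 0 <= (2 * k * k)%:R :> R by rewrite ler0n.
have AA2 : (#|A :\: A2| <= #|A :&: F| + 2 * k.-1)%N.
  rewrite -AA1; apply: (@leq_trans #|(A :\: A1) :|: (A1 :&: [set v in x ++ y])|).
    apply: subset_leq_card; apply/fintype.subsetP => v; rewrite !inE.
    by case: (v \in A); case: (v \in F); case: (v \in x ++ y).
  by apply: leq_trans (leq_card_setU _ _) _; rewrite leq_add2l.
have ux : uniq x by move: uxy; rewrite cat_uniq => /and3P[].
have uy : uniq y by move: uxy; rewrite cat_uniq => /and3P[].
have xD : {subset x <= D}.
  by move=> v vx; apply: (fintype.subsetP AD); apply: (fintype.subsetP A1A); apply: xyA; rewrite mem_cat vx.
have yD : {subset y <= D}.
  by move=> v vx; apply: (fintype.subsetP AD); apply: (fintype.subsetP A1A); apply: xyA; rewrite mem_cat vx orbT.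
have MA2 : (M <= #|A2|)%N.
  by have h := hMa; rewrite -(cardsID [set v in x ++ y] A1) -/A2 /acost in h; apply: nat_a2 h cxy.
have [|c1 [sc1 uc1 c1A tc1]] := connectM MA2 sS sx uS ux.
  apply: rich_sub rA A2A _ (ltW g1_gt0) _.
    apply/fintype.subsetP => v; rewrite !inE => /orP[/orP[/andP[_ /andP[_ vA]]|/SD //]|/xD //].
    exact: (fintype.subsetP AD).
  have : #|A :\: A2|%:R <= #|A :&: F|%:R + (2 * k.-1)%:R :> R by rewrite -natrD ler_nat.
  move: hF; rewrite cost0 acE; lra.
pose F' := F :|: [set v in c1 ++ x ++ y].
have uall : uniq (c1 ++ x ++ y).
  rewrite cat_uniq uc1 uxy andbT /=; apply/hasPn => v vxy; apply/negP => /c1A.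
  by rewrite !inE vxy.
have allA1 : {subset c1 ++ x ++ y <= A1}.
  move=> v; rewrite mem_cat => /orP[/c1A|/xyA //]; by rewrite inE => /andP[].
have call : #|[set v in c1 ++ x ++ y]| = acost.
  by rewrite cardsE (card_uniqP uall) !size_cat sc1 sx sy addnn -mul2n.
have AF' : A :\: F' = A1 :\: [set v in c1 ++ x ++ y].
  by apply/setP => v; rewrite !inE negb_or; case: (v \in A); case: (v \in F); rewrite ?andbF ?andbT.
have cAF' : (#|A :\: F'| + acost = #|A1|)%N.
  rewrite AF' -[RHS](cardsID [set v in c1 ++ x ++ y] A1) addnC; congr (_ + _)%N.
  by rewrite (finset.setIidPr _) ?call //; apply/fintype.subsetP => v; rewrite inE => /allA1.
have cAF'R : #|A1|%:R = #|A :\: F'|%:R + acost%:R :> R by rewrite -natrD cAF'.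
have [|||||base [T1 [sb ub bA T1s IHr]]] := IH F' y sy uy yD.
- by move=> v vz; apply: zD; rewrite inE vz orbT.
- by move=> v vz; apply: zA; rewrite inE vz orbT.
- by move: hM; rewrite /= mulSn -/A1 -cAF' subnDA addnK.
- by move: hk; rewrite -/A1 cAF'R cost0; congr (_ < _ * _); lra.
- have : (#|A :&: F'| <= #|A :&: F| + acost)%N.
    rewrite -call; apply: (@leq_trans #|(A :&: F) :|: [set v in c1 ++ x ++ y]|); last exact: leq_card_setU.
    apply: subset_leq_card; apply/fintype.subsetP => v; rewrite !inE.
    by case: (v \in A).
  rewrite -(ler_nat R) natrD => h; move: hF; rewrite cost0; lra.
exists (c1 ++ x ++ y ++ base), T1; split.
- by rewrite !size_cat sc1 sx sy sb mulSn; apply: nat_a3.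
- rewrite !catA cat_uniq -!catA uall ub andbT /=; apply/hasPn => v /bA; rewrite AF' !inE => /andP[]//.
- move=> v; rewrite !catA mem_cat -!catA => /orP[/allA1 //|/bA]; by rewrite AF' inE => /andP[].
- by [].
(* [base] and [T1] are fixed before [keep]: with or without [z], the absorber begins with [x] and
   ends with [y], so both versions fit between [c1] and the rest. *)
move=> keep; have [r' [c' [e1 e2 e3]]] := IHr keep.
pose zz := if keep z then [:: z] else [::].
exists (c1 ++ x ++ zz ++ y ++ r'), (S ++ c1 ++ x ++ zz ++ c'); split.
- by rewrite -!catA e1.
- rewrite /= -/zz; have -> : (if keep z then z :: [seq v <- zs | keep v] else [seq v <- zs | keep v]) = zz ++ [seq v <- zs | keep v].
    by rewrite /zz; case: (keep z).
  rewrite -!catA perm_cat2l perm_cat2l perm_catCA perm_cat2l.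
  apply: (@perm_trans _ (zz ++ base ++ [seq v <- zs | keep v])); first by rewrite perm_cat2l.
  by rewrite perm_catCA.
- have g2 : tight k E (x ++ zz ++ y) by rewrite /zz; case: (keep z).
  have := @tight_glue V k E (x ++ zz) y r'; rewrite -!catA => /(_ _ g2 e3) h3.
  have {}h3 := h3 ltac:(by rewrite sy).
  have := @tight_glue V k E (S ++ c1) x (zz ++ y ++ r'); rewrite -!catA => /(_ _ tc1 h3); apply.
  by rewrite sx.
Qed.

(** Each link spends [2 k k] fresh vertices of the reservoir [Z], recorded in [F]. A piece is
    entered through its first and left through its last [k - 1] letters, which may overlap. *)
Lemma piece_chain Z D (F : {set V}) T1 T (ps : seq (seq V)) : rich Z D g1 -> Z \subset D ->
  size T = k.-1 -> uniq T -> {subset T <= D} ->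
  size T1 = k.-1 -> uniq T1 -> {subset T1 <= D} ->
  (forall p, p \in ps -> [/\ (k.-1 <= size p)%N, uniq p, {subset p <= D} & tight k E p]) ->
  (M + size ps * (2 * k * k) <= #|Z :\: F|)%N ->
  2 * (#|Z :&: F|%:R + (size ps * (2 * k * k))%:R) <= g1 * #|Z|%:R ->
  exists us c, [/\ uniq us, {subset us <= Z :\: F}, perm_eq c (flatten ps ++ us) & tight k E (T1 ++ c ++ T)].
Proof.
move=> rZ ZD sT uT TD; elim: ps F T1 => [|p ps IH] F T1 sT1 uT1 T1D hp hM hF.
  have [||c [sc uc cA tc]] := @connectM (Z :\: F) T1 T _ sT1 sT uT1 uT.
  - by move: hM; rewrite mul0n addn0.
  - apply: rich_sub rZ (finset.subsetDl _ _) _ (ltW g1_gt0) _.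
      apply/fintype.subsetP => v; rewrite !inE => /orP[/orP[/andP[_ vA]|/T1D //]|/TD //].
      exact: (fintype.subsetP ZD).
    rewrite finset.setDDr finset.setDv finset.set0U; move: hF; rewrite mul0n addr0.
    by [].
  by exists c, c.
have [sp up pD tp] := hp p (mem_head _ _).
have spT : size (take k.-1 p) = k.-1 by rewrite size_takel.
pose q := (2 * k * k)%N.
have qE : (size (p :: ps) * q)%:R = q%:R + (size ps * q)%:R :> R by rewrite /= mulSn natrD.
have q0 : 0 <= q%:R :> R by rewrite ler0n.
have q1 : 0 <= (size ps * q)%:R :> R by rewrite ler0n.
have ZZ : Z :\: (Z :\: F) = Z :&: F by rewrite finset.setDDr finset.setDv finset.set0U.
have [||c1 [sc uc cA tc]] := @connectM (Z :\: F) T1 (take k.-1 p) _ sT1 spT uT1 (take_uniq _ up).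
- by apply: leq_trans hM; rewrite leq_addr.
- apply: rich_sub rZ (finset.subsetDl _ _) _ (ltW g1_gt0) _.
    apply/fintype.subsetP => v; rewrite !inE => /orP[/orP[/andP[_ vA]|/T1D //]|/mem_take/pD //].
    exact: (fintype.subsetP ZD).
  by rewrite ZZ; move: hF; rewrite -/q qE; lra.
pose F' := F :|: [set v in c1].
have cc : #|[set v in c1]| = q by rewrite cardsE (card_uniqP uc) sc.
have ZF' : Z :\: F' = (Z :\: F) :\: [set v in c1].
  by apply/setP => v; rewrite !inE negb_or; case: (v \in Z); case: (v \in F); rewrite ?andbF ?andbT.
have cZ : (#|Z :\: F'| + q = #|Z :\: F|)%N.
  rewrite ZF' -[RHS](cardsID [set v in c1] (Z :\: F)) addnC; congr (_ + _)%N.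
  by rewrite (finset.setIidPr _) ?cc //; apply/fintype.subsetP => v; rewrite inE => /cA.
have [||||||us [c [uus usZ pc tcc]]] := IH F' (lastk p).
- exact: lastk_size.
- exact: drop_uniq.
- by move=> v /mem_drop/pD.
- by move=> p' hp'; apply: hp; rewrite inE hp' orbT.
- by move: hM; rewrite -cZ /= mulSn -/q addnCA addnC leq_add2r.
- have : (#|Z :&: F'| <= #|Z :&: F| + q)%N.
    rewrite -cc; apply: (@leq_trans #|(Z :&: F) :|: [set v in c1]|); last exact: leq_card_setU.
    apply: subset_leq_card; apply/fintype.subsetP => v; rewrite !inE.
    by case: (v \in Z).
  rewrite -(ler_nat R) natrD => h; move: hF; rewrite -/q qE; lra.
exists (c1 ++ us), (c1 ++ p ++ c); split.
- rewrite cat_uniq uc uus andbT /=; apply/hasPn => v /usZ; by rewrite ZF' !inE => /andP[].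
- move=> v; rewrite mem_cat => /orP[/cA //|/usZ]; by rewrite ZF' inE => /andP[].
- rewrite perm_catCA /= -catA perm_cat2l; apply: (@perm_trans _ (c1 ++ flatten ps ++ us)); first by rewrite perm_cat2l.
  by rewrite perm_catCA.
- have h3 : tight k E (p ++ c ++ T).
    rewrite [p](lastk_cat) -catA; apply: tight_glue => //; last by rewrite -lastk_cat.
    by rewrite lastk_size.
  have := @tight_glue V k E (T1 ++ c1) (take k.-1 p) (drop k.-1 p ++ c ++ T).
  rewrite !catA -!catA !(catA (take _ _)) cat_take_drop => H; apply: H => //; by rewrite spT.
Qed.
End Rich.

(** * Cutting an ordering into tight pieces *)

Section Cut.
Variables (V : finType) (k : nat) (E : {set {set V}}).
Hypothesis k_ge2 : (2 <= k)%N.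

(** Unlike in [nbad], windows do not wrap around, so cutting a word creates no bad windows. *)
Definition nb (s : seq V) : nat :=
  \sum_(0 <= i < size s) ((i + k <= size s) && ([set v in take k (drop i s)] \notin E)).
Lemma nb_cat s1 s2 : (nb s1 + nb s2 <= nb (s1 ++ s2))%N.
Proof.
rewrite /nb size_cat (big_cat_nat (leq0n _) (leq_addr (size s2) (size s1))) /=; apply: leq_add.
  rewrite !big_nat; apply: leq_sum => i /andP[_ i1].
  case: (boolP (i + k <= size s1)%N) => //= ik; rewrite (leq_trans ik (leq_addr _ _)) /=.
  by rewrite drop_cat i1 takel_cat // size_drop leq_subRL // ltnW.
rewrite -[X in (_ <= \sum_(X <= i < _) _)%N]add0n big_addn addKn !big_nat; apply: leq_sum => i _.
by rewrite [(i + size s1)%N]addnC -addnA leq_add2l drop_cat ltnNge leq_addr /= addKn.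
Qed.
Lemma nb_tight s : ~~ tight k E s -> (0 < nb s)%N.
Proof.
move=> h; rewrite lt0n; apply: contra h => /eqP h; apply/tightP => i ik.
have ks : (i < size s)%N by apply: leq_trans ik; rewrite -addn1 leq_add2l ltnW.
move: h; rewrite /nb (bigD1_seq i) ?iota_uniq //=; last by rewrite mem_index_iota.
by rewrite ik /=; case: (_ \in E).
Qed.
(** A tight block of length [m' (k - 1)] is kept whole; any other contains a bad window and is cut
    into [m'] words of [k - 1] letters, which are tight for lack of windows. *)
Lemma cut_pieces m' B (s : seq V) : (0 < m')%N -> size s = (B * (m' * k.-1))%N ->
  exists ps : seq (seq V), [/\ flatten ps = s, (size ps <= B + nb s * m')%N &
   forall p, p \in ps -> (k.-1 <= size p)%N /\ tight k E p].
Proof.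
move=> m0; elim: B s => [|B IH] s; first by move/size0nil ->; exists [::].
rewrite mulSn => ss; set m := (m' * k.-1)%N in ss IH.
have s1 : size (take m s) = m by rewrite size_takel // ss leq_addr.
have s2 : size (drop m s) = (B * m)%N by rewrite size_drop ss addKn.
have [ps [f1 f2 f3]] := IH _ s2.
have nbs := nb_cat (take m s) (drop m s); rewrite cat_take_drop in nbs.
case: (boolP (tight k E (take m s))) => t.
  exists (take m s :: ps); split=> /=.
  - by rewrite f1 cat_take_drop.
  - rewrite addSn ltnS; apply: leq_trans f2 _; rewrite leq_add2l leq_mul2r.
    by rewrite (leq_trans (leq_addl _ _) nbs) orbT.
  - by move=> p; rewrite inE => /orP[/eqP -> |/f3 //]; rewrite s1; split=> //; rewrite leq_pmull.
have sm : sumn (nseq m' k.-1) = m by rewrite sumn_nseq mulnC.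
exists (reshape (nseq m' k.-1) (take m s) ++ ps); split.
- by rewrite flatten_cat f1 reshapeKr ?cat_take_drop // sm s1.
- rewrite size_cat size_reshape size_nseq.
  have := nb_tight t => nt; apply: (@leq_trans (m' + (B + nb (drop m s) * m'))); first by rewrite leq_add2l.
  rewrite addnCA addSn -addnS leq_add2l -mulSn ltnW // ltnS leq_mul2r; apply/orP; right.
  by apply: leq_trans nbs; rewrite -add1n leq_add2r.
- move=> p; rewrite mem_cat => /orP[hp|/f3 //].
  have : size p = k.-1.
    have sh : shape (reshape (nseq m' k.-1) (take m s)) = nseq m' k.-1 by apply: reshapeKl; rewrite sm s1.
    have : size p \in shape (reshape (nseq m' k.-1) (take m s)) by apply: map_f.
    by rewrite sh mem_nseq => /andP[_ /eqP].
  move=> sp; rewrite sp; split=> //; apply: tight_short; by rewrite sp prednK // ltnW.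
Qed.
End Cut.

Section AlmostOrder.
Variables (R : realType) (k : nat) (gam : R).
Hypothesis k_ge2 : (2 <= k)%N.
Hypothesis gam0 : 0 < gam.
Hypothesis gam1 : gam <= 1 / 2.
Let k_gt0 : (0 < k)%N. Proof. exact: ltnW. Qed.

(** [dirac_pfm] with [h] a fixed proportion of [n] gives weights at most a constant times [n^(1-k)].
    The entropy is then so large that the powers of [n] cancel in [mvalue]. *)
Lemma dirac_mvalue : exists n0 : nat, forall (V : finType) (E : {set {set V}}), is_kuniform k E -> (n0 <= #|V|)%N ->
  (forall S : {set V}, #|S| = k.-1 -> (1 / 2 + gam) * #|V|%:R <= (codegree E S)%:R) ->
  exists2 x : {set V} -> R, perfect_fractional_matching E x & mvalue k E x <= ln (k%:R * (8 / gam) ^+ k.-1).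
Proof.
have [n0 hn] := nat_above_all [:: 1; 8 / gam; 8 * k%:R / gam].
exists n0 => V E Ek nV codeg; have := hn _ nV; rewrite /= andbT => /and3P[n1 n2 n3].
set n : R := #|V|%:R in n1 n2 n3 *.
have np : 0 < n by lra.
rewrite ler_pdivrMr // in n2; rewrite ler_pdivrMr // in n3.
have gn0 : 0 <= gam / 2 * n by rewrite !mulr_ge0 ?(ltW np) ?invr_ge0 ?(ltW gam0).
have /andP[h1 h2] := truncn_itv gn0.
set h := Num.truncn (gam / 2 * n) in h1 h2; have {}h2 : gam / 2 * n < h%:R + 1 by rewrite natr1.
have k1 : 1 <= k%:R :> R by rewrite ler1n.
have kh : (k <= h)%N by rewrite -(ler_nat R); lra.
have kh' : (k.-1 <= h)%N by apply: leq_trans kh; apply: leq_pred.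
have h0 : (0 < h)%N by apply: leq_trans kh.
have C0 : 0 < 'C(h, k.-1)%:R :> R by rewrite ltr0n bin_gt0.
have [x px xb] := dirac_pfm k_ge2 Ek gam1 codeg h0 kh' h1 (lexx _).
set cap := k%:R / 'C(h, k.-1)%:R in xb.
have cap0 : 0 < cap by rewrite divr_gt0 // ltr0n.
exists x => //.
have sumx : k%:R * \sum_(e in E) x e = n.
  case: px => _ Xv; transitivity (\sum_v \sum_(e in E | v \in e) x e); last first.
    by rewrite (eq_bigr (fun=> 1)) ?sumr_const // => v _; apply: Xv.
  rewrite (exchange_big_dep (fun e => e \in E)) /=; last by move=> v e _ /andP[].
  rewrite mulr_sumr; apply: eq_bigr => e ek; rewrite (eq_bigl (fun v => v \in e)); last by move=> v; rewrite ek.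
  by rewrite sumr_const (Ek _ ek) mulr_natl.
have ent : (\sum_(e in E) x e) * - ln cap <= \sum_(e in E) x e * ln (x e)^-1.
  rewrite mulr_suml; apply: ler_sum => e eE; have /andP[x0 x1] := xb e.
  move: x0; rewrite le_eqVlt => /orP[/eqP <-|x0]; first by rewrite !mul0r.
  by apply: ler_wpM2l; rewrite ?(ltW x0) // lnV ?posrE // lerN2 ler_ln ?posrE.
have nk : 0 < n ^+ k.-1 / (k.-1)`!%:R by rewrite divr_gt0 ?exprn_gt0 // ltr0n fact_gt0.
rewrite /mvalue -/n.
have e1 : k%:R / n * ((\sum_(e in E) x e) * - ln cap) = - ln cap.
  by rewrite mulrA [k%:R / n * _]mulrAC sumx mulfV ?mul1r // gt_eqF.
have := ler_wpM2l (_ : 0 <= k%:R / n) ent; rewrite e1 => H.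
have {}H := H (divr_ge0 (ler0n _ _) (ltW np)).
apply: (@le_trans _ _ (ln (n ^+ k.-1 / (k.-1)`!%:R) + ln cap)); first by move: H; lra.
have kp : 0 < k%:R * (8 / gam) ^+ k.-1 by rewrite mulr_gt0 ?exprn_gt0 ?divr_gt0 // ltr0n.
have lp := mulr_gt0 nk cap0.
rewrite -lnM ?posrE // ler_ln ?posrE //.
rewrite /cap; have f0 : 0 < (k.-1)`!%:R :> R by rewrite ltr0n fact_gt0.
rewrite (_ : _ / _ * (_ / _) = k%:R * (n ^+ k.-1 / ('C(h, k.-1) * (k.-1)`!)%:R)); last first.
  by rewrite natrM; field; rewrite !gt_eqF.
apply: ler_wpM2l; rewrite ?ler0n // bin_ffact.
have ff : (gam * n / 8) ^+ k.-1 <= (h ^_ k.-1)%:R.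
  apply: (@le_trans _ _ (((h - k.-1) ^ k.-1)%:R)); last by rewrite ler_nat ffact_ge_exp.
  rewrite natrX; apply: lerXn2r; rewrite ?nnegrE ?ler0n //.
    by rewrite !mulr_ge0 ?(ltW np) ?(ltW gam0).
  rewrite natrB // lerBrDr; apply: (@le_trans _ _ (gam * n / 8 + k%:R)); first by rewrite lerD2l ler_nat leq_pred.
  lra.
have p8 : 0 < gam * n / 8 by rewrite divr_gt0 // mulr_gt0.
rewrite ler_pdivrMr; last by apply: lt_le_trans ff; rewrite exprn_gt0.
apply: (@le_trans _ _ ((8 / gam) ^+ k.-1 * (gam * n / 8) ^+ k.-1)).
  rewrite -exprMn (_ : 8 / gam * _ = n) //; field; by rewrite gt_eqF.
by apply: ler_wpM2l ff; rewrite exprn_ge0 // divr_ge0 // ltW.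
Qed.

(** The hypergraph induced on [W] is transported to the subtype of [W]. With [q = 1] every window
    counts, and one of the many orderings is enough. *)
Lemma almost_order (eps : R) : 0 < eps -> exists n0 : nat, forall (V : finType) (E : {set {set V}}) (W : {set V}),
  is_kuniform k E -> (n0 <= #|W|)%N -> rich k E W W gam ->
  exists2 s : seq V, perm_eq s (enum W) & (nb k E s)%:R <= eps * #|W|%:R.
Proof.
move=> eps0; have [n1 h1] := dirac_mvalue.
have [n2 h2] := almost_count k.-1 (ln (k%:R * (8 / gam) ^+ k.-1)) (ltn0Sn 0) eps0.
rewrite add1n prednK // in h2.
exists (maxn 1 (maxn n1 n2)) => V E W Ek; rewrite !geq_max => /and3P[W1 W2 W3] rW.
pose T := {v : V | v \in W}.
have cT : #|{: T}| = #|W| by rewrite card_sig; apply: eq_card => v; rewrite inE.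
pose ET := [set e : {set T} | val @: e \in E].
have ETk : is_kuniform k ET.
  by move=> e; rewrite inE => /Ek <-; rewrite card_imset //; apply: val_inj.
have codeg (S : {set T}) : #|S| = k.-1 -> (1 / 2 + gam) * #|{: T}|%:R <= (codegree ET S)%:R.
  move=> cS; rewrite cT; have cS' : #|val @: S| = k.-1 by rewrite card_imset //; apply: val_inj.
  apply: le_trans (rW _ cS' _) _.
    by apply/fintype.subsetP => v /imsetP[u _ ->]; apply: valP.
  rewrite ler_nat /codegree -(card_imset _ (val_inj (sT := T))); apply: subset_leq_card.
  apply/fintype.subsetP => v; rewrite !inE => /andP[vW vE]; apply/imsetP; exists (Sub v vW) => //.
  by rewrite !inE imsetU1.
rewrite -cT in W2 W3.
have [x px vx] := h1 T ET ETk W2 codeg.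
have := h2 T ET x ETk W3 (dvd1n _) px vx; set Sx := [set s | _] => cnt.
have /card_gt0P[s] : (0 < #|Sx|)%N.
  rewrite -(ltr0n R); apply: lt_le_trans cnt; rewrite mulr_gt0 ?expR_gt0 // ltr0n fact_gt0.
rewrite inE => /andP[us bs].
have ss : size s = #|W| by rewrite size_tuple cT.
exists (map val s).
  have um : uniq (map val s) by rewrite (map_inj_uniq val_inj).
  apply: uniq_perm; rewrite ?enum_uniq //.
  have ws : {subset map val s <= enum W} by move=> v /mapP[u _ ->]; rewrite mem_enum; apply: valP.
  have sz : (size (enum W) <= size (map val s))%N by rewrite size_map -cardE ss.
  by have [_ e] := uniq_min_size um ws sz.
rewrite -cT; apply: le_trans bs; rewrite ler_nat /nbad /nb size_map size_tuple divn1.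
rewrite -sum1_card big_mkord [leqRHS]big_mkcond /=; apply: leq_sum => i _; rewrite inE muln1.
case: (boolP (i + k <= #|{: T}|)%N) => //= ik.
rewrite window_drop ?size_tuple // -map_drop -map_take inE.
have -> : [set v in map val (take k (drop i s))] = val @: [set v in take k (drop i s)].
  by apply/setP => v; rewrite inE; apply/mapP/imsetP => -[u uu ->]; exists u; rewrite ?inE // in uu *.
by case: (_ \in E).
Qed.
End AlmostOrder.

Lemma poly_lt_exp (R : realType) (a c : R) (j : nat) : 0 < c -> 0 <= a ->
  exists n0 : nat, forall n : nat, (n0 <= n)%N -> (a * n%:R) ^+ j < expR (c * n%:R).
Proof.
move=> c0 a0; have [n0 h] := nat_above_all [:: 1; a ^+ j * (j.+1)`!%:R / c ^+ j.+1].
exists n0 => n /h; rewrite /= andbT => /andP[n1 hn].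
have np : 0 < n%:R :> R by lra.
have cn : 0 <= c * n%:R by rewrite mulr_ge0 ?ler0n // ltW.
apply: lt_le_trans (expR_ge1Dxn j cn); rewrite addrC; apply: (@le_lt_trans _ _ ((c * n%:R) ^+ j.+1 / (j.+1)`!%:R)); last by rewrite ltrDl.
rewrite ler_pdivlMr ?ltr0n ?fact_gt0 // !exprMn [n%:R ^+ j.+1]exprSr.
rewrite ler_pdivrMr ?exprn_gt0 // in hn.
have := ler_wpM2l (exprn_ge0 j (ltW np)) hn; lra.
Qed.

(** Cut [I] into [z] blocks of [h] vertices and take a random vertex from each. Chernoff's bound
    treats one set [X], with exponentially small failure in [z], and [Q] has only polynomially
    many. *)
Lemma reservoir (R : realType) (k h : nat) (gam a : R) : 0 < gam -> gam <= 1 / 4 -> (0 < h)%N -> 0 <= a ->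
  exists z0 : nat, forall z : nat, (z0 <= z)%N -> forall (V : finType) (E : {set {set V}}) (I : seq V) (Q : {set V}),
  size I = (z * h)%N -> uniq I -> #|Q|%:R <= a * z%:R ->
  (forall X : {set V}, #|X| = k.-1 -> X \subset Q ->
     #|[set v in I] :\: [set v | v |: X \in E]|%:R <= (1 / 2 - 3 / 4 * gam) * z%:R * h%:R) ->
  exists Z : {set V}, [/\ Z \subset [set v in I], #|Z| = z &
    forall X : {set V}, #|X| = k.-1 -> X \subset Q -> (1 / 2 + gam / 2) * z%:R <= #|Z :&: [set v | v |: X \in E]|%:R].
Proof.
move=> g0 g1 h0 a0.
have c0 : 0 < (gam / 4) ^+ 2 / 4 by rewrite divr_gt0 ?exprn_gt0 ?divr_gt0.
have [n0 hn] := poly_lt_exp k.-1 c0 a0; exists n0.+1 => z zn V E I Q sI uI cQ hX.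
have z0 : (0 < z)%N by apply: leq_ltn_trans zn.
have /card_gt0P[x0 _] : (0 < #|V|)%N.
  apply: leq_trans (_ : 0 < size I)%N _; first by rewrite sI muln_gt0 z0.
  by rewrite -(card_uniqP uI); apply: max_card.
pose vtx (p : 'I_z * 'I_h) := nth x0 I (p.1 * h + p.2).
have plt (p : 'I_z * 'I_h) : (p.1 * h + p.2 < size I)%N.
  rewrite sI; apply: (@leq_trans (p.1.+1 * h)); last by rewrite leq_mul2r ltn_ord orbT.
  by rewrite mulSn addnC ltn_add2r.
have vinj : injective vtx.
  move=> [i t] [i' t'] /eqP; rewrite /vtx nth_uniq ?plt //= => /eqP e.
  have ei : val i = val i'.
    by have := congr1 (fun x => x %/ h)%N e; rewrite !divnMDl // !divn_small // !addn0.
  have et : val t = val t' by move/eqP: e; rewrite [nat_of_ord i]ei eqn_add2l => /eqP.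
  by congr pair; apply: val_inj.
pose N (X : {set V}) := [set v | v |: X \in E].
pose B X i := [set t : 'I_h | vtx (i, t) \notin N X].
pose Xs := [set X : {set V} | (X \subset Q) & (#|X| == k.-1)].
(* [beta] is the proportion of [I] that [X] may miss and [d] the tolerated excess; their sum is
   [1/2 - gam/2]. *)
pose beta := 1 / 2 - 3 / 4 * gam; pose d := gam / 4.
have d0 : 0 < d by rewrite divr_gt0.
have bd : beta + d <= 1 by rewrite /beta /d; lra.
have b0 : 0 <= beta by rewrite /beta; lra.
have ch X : X \in Xs -> #|[set tau : {ffun 'I_z -> 'I_h} | (beta + d) * z%:R <= #|[set i | tau i \in B X i]|%:R]|%:R
    <= h%:R ^+ z * expR (- (d ^+ 2 / 4) * z%:R) :> R.
  rewrite inE => /andP[XQ /eqP cX].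
  have T0 : (0 < #|'I_h|)%N by rewrite card_ord.
  have := @chernoff_count R z _ (B X) beta d T0 d0 bd b0; rewrite card_ord; apply.
  apply: le_trans (hX X cX XQ); rewrite -natr_sum ler_nat.
  have -> : (\sum_i #|B X i| = #|[set p : 'I_z * 'I_h | vtx p \notin N X]|)%N.
    rewrite -sum1_card (eq_bigl (fun p => xpredT p.1 && (vtx (p.1, p.2) \notin N X))); last by case=> i t; rewrite inE.
    rewrite -(pair_big_dep xpredT (fun i t => vtx (i, t) \notin N X) (fun _ _ => 1%N)) /=.
    by apply: eq_bigr => i _; rewrite -sum1_card; apply: eq_bigl => t; rewrite inE.
  rewrite -(card_imset _ vinj); apply: subset_leq_card; apply/fintype.subsetP => v /imsetP[p]; rewrite inE => pN ->.
  rewrite !inE mem_nth ?plt // andbT; move: pN; by rewrite inE.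
pose bad X := [set tau : {ffun 'I_z -> 'I_h} | (beta + d) * z%:R <= #|[set i | tau i \in B X i]|%:R :> R].
have : exists tau, tau \notin \bigcup_(X in Xs) bad X.
  apply: contrapT => no; have all : \bigcup_(X in Xs) bad X = [set: {ffun 'I_z -> 'I_h}].
    by apply/setP => tau; rewrite inE; apply: contrapT => /negP ht; apply: no; exists tau.
  have : #|[set: {ffun 'I_z -> 'I_h}]|%:R <= \sum_(X in Xs) (#|bad X|%:R : R).
    rewrite -all -natr_sum ler_nat.
    apply: (big_ind2 (fun (A : {set _}) b => #|A| <= b)%N) => //; first by rewrite cards0.
    by move=> A1 b1 A2 b2 h1 h2; apply: leq_trans (leq_card_setU _ _) (leq_add h1 h2).
  apply/negP; rewrite -ltNge cardsT card_ffun !card_ord natrX.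
  apply: (@le_lt_trans _ _ (\sum_(X in Xs) h%:R ^+ z * expR (- (d ^+ 2 / 4) * z%:R))); first by apply: ler_sum => X /ch.
  rewrite sumr_const -(mulr_natl (_ * _)) mulrCA -[ltRHS]mulr1 ltr_pM2l ?exprn_gt0 ?ltr0n //.
  rewrite mulNr expRN ltr_pdivrMr ?expR_gt0 // mul1r.
  apply: le_lt_trans (hn z (ltnW zn)).
  rewrite /Xs cards_draws; apply: (@le_trans _ _ ((#|Q| ^ k.-1)%:R)).
    rewrite ler_nat; apply: leq_trans (_ : #|Q| ^_ k.-1 <= _)%N; last first.
      by elim: (k.-1) => // j IH; rewrite ffactnSr expnSr leq_mul // leq_subr.
    by rewrite -bin_ffact leq_pmulr // fact_gt0.
  by rewrite natrX; apply: lerXn2r; rewrite ?nnegrE ?ler0n // mulr_ge0 ?ler0n.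
move=> [tau ht]; have vt : injective (fun i => vtx (i, tau i)) by move=> i i' /vinj [].
exists [set vtx (i, tau i) | i : 'I_z]; split.
- by apply/fintype.subsetP => v /imsetP[i _ ->]; rewrite inE mem_nth ?plt.
- by rewrite card_imset // card_ord.
move=> X cX XQ; have nb : tau \notin bad X.
  apply: contra ht => hb; apply/bigcupP; exists X => //; by rewrite inE XQ cX eqxx.
rewrite inE -ltNge in nb.
have -> : #|[set vtx (i, tau i) | i : 'I_z] :&: [set v | v |: X \in E]| = #|[set i | tau i \notin B X i]|.
  rewrite -(card_imset _ vt); apply: eq_card => v; rewrite inE; apply/andP/imsetP.
    by move=> [/imsetP[i _ ->] hv]; exists i => //; rewrite !inE negbK; move: hv; rewrite inE.
  by move=> [i]; rewrite !inE negbK => hi ->; split; [apply/imsetP; exists i | exact: hi].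
have : #|[set i | tau i \in B X i]|%:R + #|[set i | tau i \notin B X i]|%:R = z%:R :> R.
  rewrite -natrD -[z in RHS]card_ord -(cardsC [set i | tau i \in B X i]); congr (_ + _)%:R.
  by apply: eq_card => i; rewrite !inE.
move: nb; rewrite /beta /d; lra.
Qed.

(** * Tight Hamilton paths with prescribed ends *)

Lemma leq_nat_sub (a b c : nat) : (b + a <= c -> a <= c - b)%N.
Proof. lia. Qed.
Lemma nat_sub_mul (z h ac : nat) : (z * h - z - z * ac = z * (h - 1 - ac))%N.
Proof. by rewrite !mulnBr muln1. Qed.

Lemma nat_Bm (a b c d : nat) : (0 < d -> a * b * c <= a * (c * d) * b)%N.
Proof. by move=> d0; rewrite -!mulnA leq_mul2l (mulnC b) leq_mul2l leq_pmull ?orbT. Qed.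

(** The path runs from [S] through absorbers for all reservoir vertices to [T1], then through the
    pieces, linked by part of the reservoir, to [T]. Reservoir vertices not spent on links are
    absorbed, so nothing is left over. Some arbitrarily large length [g] is enough, as the switching
    fixes it once and for all. *)
Theorem ham_path (R : realType) (k : nat) (gam : R) : (2 <= k)%N -> 0 < gam -> gam <= 1 / 4 ->
  forall g0 : nat, exists2 g : nat, (g0 <= g)%N & forall (V : finType) (E : {set {set V}}) (S I T : seq V),
  is_kuniform k E -> uniq (S ++ I ++ T) -> size S = k.-1 -> size I = g -> size T = k.-1 ->
  (forall X : {set V}, #|X| = k.-1 -> X \subset [set v in S ++ I ++ T] ->
     (1 / 2 + gam) * (g + 2 * k.-1)%:R <= #|[set v in S ++ I ++ T] :&: [set v | v |: X \in E]|%:R) ->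
  exists2 c, perm_eq c I & tight k E (S ++ c ++ T).
Proof.
move=> k2 ga0 ga1 g0; have k0 : (0 < k)%N := ltnW k2.
have k10 : (0 < k.-1)%N by rewrite -subn1 subn_gt0.
pose g1 : R := gam / 2; have g10 : 0 < g1 by rewrite divr_gt0.
have g11 : g1 <= 1 by rewrite /g1; lra.
have g1h : g1 / 2 <= 1 / 2 by rewrite /g1; lra.
have g12 : 0 < g1 / 2 by rewrite divr_gt0.
have [M hM] := connect_tight k2 g12 g1h.
pose ac := acost k.
(* The reservoir is a small fraction [1 / h] of [I], and its absorbers use at most half of the
   rest. *)
have [h [h2 H1 H2 H3]] : exists h : nat, [/\ 2 <= h%:R :> R, 2 * ac%:R <= (h%:R - 1) * g1, 8 <= h%:R * gam & 2 * ac%:R <= h%:R - 1 :> R].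
  have [h hh] := nat_above_all [:: 2 * ac%:R / g1 + 1; 8 / gam; 2 * ac%:R + 1; 2]; exists h.
  have := hh h (leqnn h); rewrite /= andbT => /and4P[H1 H2 H3 H4]; split=> //; first by rewrite -ler_pdivrMr //; lra.
    by rewrite -ler_pdivrMr.
  by lra.
(* Long blocks keep the number of pieces, hence the number of links, small compared with the
   reservoir. *)
have [m [m0 hm]] : exists m : nat, (0 < m)%N /\ 8 * k%:R ^+ 2 * h%:R <= m%:R * g1.
  have [m hm] := nat_above (8 * k%:R ^+ 2 * h%:R / g1); exists m.+1; split=> //.
  by rewrite -ler_pdivrMr //; apply: hm.
have kR : 1 <= k%:R :> R by rewrite ler1n.
have hp : 0 < h%:R :> R by lra.
have h0 : (0 < h)%N by rewrite -(ltr0n R).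
have mp : 0 < m%:R :> R by rewrite ltr0n.
have k2p : 0 < k%:R ^+ 2 :> R by rewrite exprn_gt0 //; lra.
(* Likewise for the additional pieces caused by bad windows. *)
have [eps eps0 epsE] : exists2 eps : R, 0 < eps & eps * (8 * k%:R ^+ 2 * h%:R * m%:R) = g1.
  have dp : 0 < 8 * k%:R ^+ 2 * h%:R * m%:R :> R.
    by apply: mulr_gt0 => //; apply: mulr_gt0 => //; apply: mulr_gt0.
  by exists (g1 / (8 * k%:R ^+ 2 * h%:R * m%:R)); [exact: divr_gt0 | rewrite divfK // gt_eqF].
have [nW hW] := almost_order k2 g12 g1h eps0.
have a0 : 0 <= (h + 2 * k)%:R :> R by rewrite ler0n.
have [z0 hz] := reservoir k ga0 ga1 h0 a0.
have [z1 hz1] := nat_above_all [:: 1; z0%:R; g0%:R; 2 * nW%:R; 2 * (M + 2 * k)%:R; 2 * (2 * k)%:R / g1 + 1; 8 * (2 * k)%:R / gam].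
have mk0 : (0 < m * k.-1)%N by rewrite muln_gt0 m0.
(* A multiple of [m * k.-1], so that the vertices left for the pieces fill whole blocks in
   [cut_pieces]. *)
have [z [z1z zE]] : exists z : nat, (z1 <= z)%N /\ z = (z1 * (m * k.-1))%N.
  by exists (z1 * (m * k.-1))%N; split=> //; rewrite leq_pmulr.
have := hz1 z z1z; rewrite /= andbT !(ler_nat _ z0) (ler_nat _ g0) => /and4P[Z1 Z2 Z3] /and4P[Z4 Z5 Z6 Z7].
have zp : 0 < z%:R :> R by apply: lt_le_trans Z1.
have zn0 : (0 < z)%N by rewrite -(ltr0n R).
have Z6' : (2 * k)%:R < g1 * (z%:R / 2).
  have : 2 * (2 * k)%:R / g1 < z%:R by move: Z6; clear; lra.
  by rewrite ltr_pdivrMr //; clear; lra.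
have Z7' : 8 * (2 * k)%:R <= z%:R * gam by rewrite -ler_pdivrMr.
have k2R : (2 * k)%:R = 2 * k%:R :> R by rewrite natrM.
have kk : k.-1%:R <= k%:R :> R by rewrite ler_nat leq_pred.
have M2kE : (M + 2 * k)%:R = M%:R + 2 * k%:R :> R by rewrite natrD k2R.
have M2k : 2 * (M%:R + 2 * k%:R) <= z%:R :> R by rewrite -M2kE.
exists (z * h)%N; first by apply: leq_trans Z3 _; rewrite leq_pmulr.
move=> V E S I T Ek uQ sS sI sT codeg.
pose Q := [set v in S ++ I ++ T].
have uI : uniq I by move: uQ; rewrite !cat_uniq => /and3P[_ _ /and3P[]].
have uS : uniq S by move: uQ; rewrite !cat_uniq => /and3P[].
have uT : uniq T by move: uQ; rewrite !cat_uniq => /and3P[_ _ /and3P[]].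
have SQ : {subset S <= Q} by move=> v vS; rewrite inE mem_cat vS.
have TQ : {subset T <= Q} by move=> v vS; rewrite inE !mem_cat vS !orbT.
have IQ : [set v in I] \subset Q by apply/fintype.subsetP => v; rewrite !inE !mem_cat => ->; rewrite orbT.
have cQ : #|Q|%:R = z%:R * h%:R + 2 * k.-1%:R :> R.
  by rewrite cardsE (card_uniqP uQ) !size_cat sS sI sT !natrD natrM; clear; lra.
have cI : #|[set v in I]|%:R = z%:R * h%:R :> R by rewrite cardsE (card_uniqP uI) sI natrM.
have {}codeg (X : {set V}) : #|X| = k.-1 -> X \subset Q ->
    (1 / 2 + gam) * (z%:R * h%:R) <= #|Q :&: [set v | v |: X \in E]|%:R /\
    (1 / 2 + gam) * (z%:R * h%:R + 2 * k.-1%:R) <= #|Q :&: [set v | v |: X \in E]|%:R.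
  move=> cX XQ; have := codeg X cX XQ; rewrite natrD natrM natrM => H; split=> //.
  apply: le_trans H; apply: ler_wpM2l; first by move: ga0; clear; lra.
  by rewrite lerDl mulr_ge0 ?ler0n.
have zh : 0 <= z%:R * h%:R :> R by rewrite mulr_ge0 ?ler0n.
have zh8 : 8 * z%:R <= z%:R * h%:R * gam by rewrite -mulrA [leLHS]mulrC; apply: ler_wpM2l; rewrite ?ler0n.
have zh2 : 2 * z%:R <= z%:R * h%:R :> R by rewrite [leLHS]mulrC; apply: ler_wpM2l; rewrite ?ler0n.
have zac : 2 * (z%:R * ac%:R) <= z%:R * h%:R - z%:R :> R.
  by have := ler_wpM2l (ltW zp) H3; clear; lra.
have zac1 : 2 * (z%:R * ac%:R) <= g1 * (z%:R * h%:R - z%:R) :> R.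
  by have := ler_wpM2l (ltW zp) H1; clear; lra.
have k1R : 0 <= k.-1%:R :> R by rewrite ler0n.
have [||Z [ZI cZ rZ]] := hz z Z2 V E I Q sI uI.
- have -> : (h + 2 * k)%:R = h%:R + 2 * k%:R :> R by rewrite natrD k2R.
  have kz : k%:R <= k%:R * z%:R :> R by rewrite ler_peMr // ler0n.
  by rewrite cQ; move: zp kz kk; clear; lra.
- move=> X cX XQ; have [_ H] := codeg X cX XQ.
  have : #|Q :&: [set v | v |: X \in E]|%:R + #|[set v in I] :\: [set v | v |: X \in E]|%:R <= #|Q|%:R :> R.
    rewrite -natrD ler_nat -[leqRHS](cardsID [set v | v |: X \in E]) leq_add2l subset_leq_card //.
    exact: finset.setSD.
  have zhg : z%:R * gam <= z%:R * gam * h%:R by rewrite ler_peMr ?mulr_ge0 ?ler0n ?(ltW ga0) //; move: h2; clear; lra.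
  have := mulr_ge0 (ltW ga0) k1R.
  rewrite cQ; move: zp k1R kR H Z7' zhg kk; rewrite k2R; clear; lra.
pose A0 := [set v in I] :\: Z.
have ZQ : Z \subset Q := fintype.subset_trans ZI IQ.
have A0Q : A0 \subset Q by apply: fintype.subset_trans IQ; apply: finset.subsetDl.
have cA0n : #|A0| = (z * h - z)%N.
  by rewrite cardsD (finset.setIidPr ZI) cZ cardsE (card_uniqP uI) sI.
have zlezh : (z <= z * h)%N by rewrite leq_pmulr.
have cA0 : #|A0|%:R = z%:R * h%:R - z%:R :> R by rewrite cA0n natrB // natrM.
have richZ : rich k E Z Q g1 by move=> X cX XQ; rewrite cZ; apply: rZ.
have richA : rich k E A0 Q g1.
  move=> X cX XQ; have [H _] := codeg X cX XQ.
  have : #|Q :&: [set v | v |: X \in E]|%:R <= #|A0 :&: [set v | v |: X \in E]|%:R + (2 * k.-1%:R + z%:R) :> R.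
    rewrite -natrM -!natrD ler_nat -cZ.
    apply: (@leq_trans #|(A0 :&: [set v | v |: X \in E]) :|: ([set v in S ++ T] :|: Z)|).
      apply: subset_leq_card; apply/fintype.subsetP => v; rewrite !inE !mem_cat.
      by case: (v \in S); case: (v \in I); case: (v \in T); case: (v \in Z); case: (v |: X \in E).
    apply: leq_trans (leq_card_setU _ _) _; rewrite leq_add2l; apply: leq_trans (leq_card_setU _ _) _.
    by rewrite leq_add2r; apply: leq_trans (card_seq_le _) _; rewrite size_cat sS sT addnn -mul2n.
  have zk : 4 * k%:R <= z%:R :> R by have := ler0n R M; move: zp M2k; clear; lra.
  have := mulr_ge0 (ltW ga0) (ltW zp).
  rewrite cA0 /g1; move: zp H zh8 zk kk; clear; lra.
have hM' (A : {set V}) (S' T' : seq V) : (M <= #|A|)%N -> size S' = k.-1 -> size T' = k.-1 -> uniq S' -> uniq T' ->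
    rich k E A (A :|: [set v in S'] :|: [set v in T']) (g1 / 2) ->
    exists c, [/\ size c = (2 * k * k)%N, uniq c, {subset c <= A} & tight k E (S' ++ c ++ T')].
  by move=> *; apply: hM.
have sZ : size (enum Z) = z by rewrite -cardE.
have acn : (z * ac)%:R = z%:R * ac%:R :> R by rewrite natrM.
have zA : {in enum Z, forall v, v \notin A0} by move=> v; rewrite mem_enum !inE => ->.
have zQ : {subset enum Z <= Q} by move=> v; rewrite mem_enum; apply: (fintype.subsetP ZQ).
have [|||base [T1 [sb ub bA [sT1 uT1 T1Q] IHr]]] := absorb_chain k2 g10 hM' (F := finset.set0) richA A0Q sS uS SQ zQ zA.
- rewrite finset.setD0 sZ -/ac; apply: leq_nat_sub; rewrite -(ler_nat R) [leLHS](natrD _ (z * ac)) acn cA0 M2kE; move: zp zac M2k zh2; clear; lra.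
- rewrite finset.setD0 sZ -/ac acn cA0; apply: lt_le_trans Z6' _; apply: ler_wpM2l; first exact: ltW.
  by move: zp zac zh2; clear; lra.
- by rewrite finset.setI0 cards0 sZ -/ac acn cA0 add0r.
rewrite finset.setD0 in bA; rewrite sZ -/ac in sb.
pose W := A0 :\: [set v in base].
have bA' : [set v in base] \subset A0 by apply/fintype.subsetP => v; rewrite inE => /bA.
have cb : #|[set v in base]| = (z * ac)%N by rewrite cardsE (card_uniqP ub).
have cWn : #|W| = (z * (h - 1 - ac))%N by rewrite cardsD (finset.setIidPr bA') cb cA0n nat_sub_mul.
have cW : #|W|%:R = z%:R * h%:R - z%:R - z%:R * ac%:R :> R.
  by rewrite -acn -cb -cA0 -(cardsID [set v in base] A0) (finset.setIidPr bA') natrD addrAC subrr add0r.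
have WA : W \subset A0 by apply: finset.subsetDl.
have WQ : W \subset Q := fintype.subset_trans WA A0Q.
have richW : rich k E W W (g1 / 2).
  apply: rich_sub richA WA WQ (ltW g10) _.
  by rewrite finset.setDDr finset.setDv finset.set0U (finset.setIidPr bA') cb acn cA0.
have nWW : (nW <= #|W|)%N by rewrite -(ler_nat R) cW; move: zp Z4 zac zh2; clear; lra.
have [s ps_s nbs] := hW V E W Ek nWW richW.
have us : uniq s by rewrite (perm_uniq ps_s) enum_uniq.
have sW v : (v \in s) = (v \in W) by rewrite (perm_mem ps_s) mem_enum.
pose B := (z1 * (h - 1 - ac))%N.
have ss : size s = (B * (m * k.-1))%N by rewrite (perm_size ps_s) -cardE cWn zE /B mulnAC.
have [ps [fps szp hps]] := cut_pieces E k2 m0 ss.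
have Bm : B%:R * m%:R <= z%:R * h%:R :> R.
  apply: (@le_trans _ _ #|W|%:R); last by rewrite cW; have := mulr_ge0 (ltW zp) (ler0n R ac); move: zp; clear; lra.
  by rewrite -natrM ler_nat cWn zE; apply: nat_Bm.
have szR : (size ps * (2 * k * k))%:R <= g1 * z%:R / 2.
  have W1 : #|W|%:R <= z%:R * h%:R :> R by rewrite cW; have := mulr_ge0 (ltW zp) (ler0n R ac); move: zp; clear; lra.
  have p1 : (size ps)%:R <= B%:R + (nb k E s)%:R * m%:R :> R by rewrite -natrM -natrD ler_nat.
  have p2 : (nb k E s)%:R * m%:R <= eps * (z%:R * h%:R) * m%:R.
    by apply: ler_wpM2r; rewrite ?ler0n //; apply: le_trans nbs _; apply: ler_wpM2l => //; apply: ltW.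
  have p3 : B%:R * (8 * k%:R ^+ 2) <= z%:R * g1.
    rewrite -(ler_pM2r hp); apply: (@le_trans _ _ (B%:R * (m%:R * g1))).
      by rewrite -mulrA; apply: ler_wpM2l; rewrite ?ler0n.
    by have := ler_wpM2r (ltW g10) Bm; clear; lra.
  have p4 : eps * (z%:R * h%:R) * m%:R * (8 * k%:R ^+ 2) = z%:R * g1 by rewrite -epsE; ring.
  have -> : (size ps * (2 * k * k))%:R = (size ps)%:R * (2 * k%:R ^+ 2) :> R by rewrite !natrM; ring.
  have p5 : (size ps)%:R * (8 * k%:R ^+ 2) <= (B%:R + eps * (z%:R * h%:R) * m%:R) * (8 * k%:R ^+ 2).
    by apply: ler_wpM2r; [rewrite mulr_ge0 // ltW | move: p1 p2; clear; lra].
  move: zp p3 p4 p5; clear; lra.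
have hpp p : p \in ps -> [/\ (k.-1 <= size p)%N, uniq p, {subset p <= Q} & tight k E p].
  move=> pin; have [h3 h4] := hps p pin; split=> //.
    move: us; rewrite -fps; case/splitPr: pin => p1 p2; rewrite flatten_cat /= !cat_uniq.
    by case/and3P=> _ _ /and3P[].
  move=> v vp; apply: (fintype.subsetP WQ); rewrite -sW -fps; apply/flattenP; by exists p.
have [||uz [c2 [uuz uzZ pc2 tc2]]] := piece_chain g10 hM' (F := finset.set0) richZ ZQ sT uT TQ sT1 uT1 T1Q hpp.
- rewrite finset.setD0 cZ -(ler_nat R) natrD; have := ler_wpM2r (ltW zp) g11; move: zp szR M2k kR; clear; lra.
- by rewrite finset.setI0 cards0 add0r cZ; move: zp szR; clear; lra.
rewrite finset.setD0 in uzZ; rewrite fps in pc2.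
(* Only now, when the links are known, is it decided which reservoir vertices are absorbed. *)
have [r [c' [e1 e2 e3]]] := IHr (fun v => v \notin uz).
exists (r ++ c2); last first.
  rewrite -catA catA e1 -catA; apply: tight_glue => //; last by rewrite -e1.
  by rewrite sT1.
pose L := (base ++ [seq v <- enum Z | v \notin uz]) ++ (s ++ uz).
have pL : perm_eq (r ++ c2) L by apply: perm_cat.
apply: (perm_trans pL); apply: uniq_perm => //.
  rewrite /L !cat_uniq ub us uuz (filter_uniq _ (enum_uniq _)) /= !andbT; apply/and3P; split.
  - apply/hasPn => v; rewrite mem_filter mem_enum => /andP[_ vZ]; apply/negP => /bA.
    by rewrite !inE vZ.
  - apply/hasPn => v; rewrite mem_cat => /orP[|vu].
      rewrite sW !inE mem_cat => /and3P[vb vZ _]; rewrite (negbTE vb) /= mem_filter mem_enum (negbTE vZ) andbF //.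
    rewrite mem_cat mem_filter vu /= orbF; apply/negP => /bA; have := uzZ v vu; by rewrite !inE => ->.
  - apply/hasPn => v vu; rewrite sW !inE; have := uzZ v vu => ->; by rewrite andbF.
move=> v; rewrite /L !mem_cat mem_filter mem_enum sW !inE.
case: (boolP (v \in Z)) => vZ.
  rewrite andbT !andbF /= (_ : v \in base = false) /=; last by apply/negP => /bA; rewrite !inE vZ.
  by rewrite orNb; have := fintype.subsetP ZI _ vZ; rewrite inE => ->.
rewrite andbF orbF /= (_ : v \in uz = false) ?orbF; last by apply/negP => /uzZ; rewrite (negbTE vZ).
case: (boolP (v \in base)) => vb //=.
by have := bA v vb; rewrite !inE => /andP[_ ->].
Qed.

(** * Switching *)

Section CondChernoff.
Variables (R : realType) (N : nat) (T : finType).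
Local Notation F := {ffun 'I_N -> T}.
Definition mixf (C : {set 'I_N}) (t r : F) : F := [ffun i => if i \in C then t i else r i].

(* Exchanging the coordinates outside [C] between two independent samples is an involution, which
   replaces a set [B] depending on the coordinates in [C] by a fixed one. *)
Lemma cond_chernoff (C : {set 'I_N}) (B : F -> 'I_N -> {set T}) (beta d : R) :
  (0 < #|T|)%N -> 0 < d -> beta + d <= 1 -> 0 <= beta ->
  (forall t r : F, {in C, t =1 r} -> B t = B r) ->
  (forall (t : F) i, #|B t i|%:R <= beta * #|T|%:R) ->
  #|[set t : F | (beta + d) * N%:R <= #|[set i | (i \notin C) && (t i \in B t i)]|%:R]|%:R
    <= #|T|%:R ^+ N * expR (- (d ^+ 2 / 4) * N%:R) :> R.
Proof.
move=> T0 d0 bd b0 Bc Bs; set A := [set t | _].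
have T0' : 0 < #|T|%:R :> R by rewrite ltr0n.
pose P := [set p : F * F | mixf C p.1 p.2 \in A].
have cP : #|P| = (#|A| * #|{: F}|)%N.
  pose sw (p : F * F) := (mixf C p.1 p.2, mixf C p.2 p.1).
  have swK : involutive sw.
    by move=> [t r]; congr pair; apply/ffunP => i; rewrite !ffunE /=; case: ifP; rewrite ?ffunE // => ->.
  have -> : P = sw @^-1: finset.setX A [set: F].
    by apply/setP => -[t r]; rewrite !inE andbT.
  rewrite on_card_preimset; last by exists sw => p _; apply: swK.
  by rewrite cardsX cardsT.
have ub : #|P|%:R <= #|{: F}|%:R * (#|T|%:R ^+ N * expR (- (d ^+ 2 / 4) * N%:R)) :> R.
  have -> : #|P| = (\sum_(t : F) #|[set r : F | mixf C t r \in A]|)%N.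
    rewrite -sum1_card (eq_bigl (fun p => xpredT p.1 && (mixf C p.1 p.2 \in A))); last by case=> t r; rewrite inE.
    rewrite -(pair_big_dep xpredT (fun t r => mixf C t r \in A) (fun _ _ => 1%N)) /=.
    by apply: eq_bigr => t _; rewrite -sum1_card; apply: eq_bigl => r; rewrite inE.
  rewrite natr_sum; apply: (@le_trans _ _ (\sum_(t : F) (#|T|%:R ^+ N * expR (- (d ^+ 2 / 4) * N%:R)))); last first.
    by rewrite sumr_const -(mulr_natl (_ * _)).
  apply: ler_sum => t _.
  have Bsum : \sum_i #|B t i|%:R <= beta * N%:R * #|T|%:R.
    apply: le_trans (ler_sum _ (fun i _ => Bs t i)) _.
    by rewrite sumr_const card_ord -(mulr_natl (_ * _)) mulrA [N%:R * _]mulrC.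
  apply: le_trans (chernoff_count T0 d0 bd b0 Bsum); rewrite ler_nat; apply: subset_leq_card.
  apply/fintype.subsetP => r; rewrite !inE => h; apply: le_trans h _; rewrite ler_nat; apply: subset_leq_card.
  apply/fintype.subsetP => i; rewrite !inE ffunE => /andP[/negbTE -> h].
  by rewrite -(Bc (mixf C t r)) // => j jC; rewrite ffunE jC.
move: ub; rewrite cP natrM mulrC ler_pM2l // ltr0n card_ffun expn_gt0 T0 //.
Qed.
End CondChernoff.

Section Collisions.
Variables (N n : nat).
Local Notation F := {ffun 'I_N -> 'I_n}.
(** Such a set has at most one point on each line in direction [i]. *)
Lemma coord_determined (i : 'I_N) (S : {set F}) :
  (forall t r : F, t \in S -> r \in S -> (forall j, j != i -> t j = r j) -> t i = r i) -> (n * #|S| <= n ^ N)%N.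
Proof.
move=> det.
pose upd (p : 'I_n * F) : F := [ffun j => if j == i then p.1 else p.2 j].
have inj : {in finset.setX [set: 'I_n] S &, injective upd}.
  move=> [x t] [y r]; rewrite !inE /= => tS rS e.
  have exy : x = y by have := congr1 (fun f : F => f i) e; rewrite !ffunE eqxx.
  have etr j : j != i -> t j = r j by move=> /negbTE ji; have := congr1 (fun f : F => f j) e; rewrite !ffunE ji.
  congr pair => //; apply/ffunP => j; case: (eqVneq j i) => [->|]; last exact: etr.
  exact: det.
have := card_in_imset inj; rewrite cardsX cardsT card_ord => <-.
by apply: leq_trans (max_card _) _; rewrite card_ffun !card_ord.
Qed.
End Collisions.

Section Positions.
Variable n : nat.
Hypothesis n_gt0 : (0 < n)%N.
Definition sh (a : 'I_n) (j : nat) : 'I_n := Ordinal (ltn_pmod (a + j) n_gt0).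
Lemma sh_inj a j j' : (j < n)%N -> (j' < n)%N -> sh a j = sh a j' -> j = j'.
Proof.
move=> jn jn' /(congr1 val) /= /eqP; rewrite eqn_modDl !modn_small // => /eqP //.
Qed.
Lemma sh_injl a a' j : sh a j = sh a' j -> a = a'.
Proof.
move=> /(congr1 val) /= /eqP; rewrite eqn_modDr !modn_small // => /eqP h; exact: val_inj.
Qed.
Lemma sh_add a i j : sh (sh a i) j = sh a (i + j).
Proof. by apply: val_inj; rewrite /= modnDml addnA. Qed.
Lemma sh_bij j : bijective (fun a => sh a j).
Proof. by apply: injF_bij => a a'; apply: sh_injl. Qed.
End Positions.

Lemma nat_g1 (k t j : nat) : (0 < k -> j < k -> k.-1 + t - j + j = k.-1 + t)%N. Proof. lia. Qed.
Lemma nat_g2 (k t j g : nat) : (0 < k -> t < g -> k.-1 + t - j + k <= g + 2 * k.-1)%N. Proof. lia. Qed.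
Lemma nat_g3 (k u g : nat) : (k.-1 <= u -> u - k.-1 < g -> k.-1 + (u - k.-1) = u)%N. Proof. lia. Qed.
Lemma nat_g4 (k u g : nat) : (u < g + 2 * k.-1 -> k.-1 <= u -> g <= u - k.-1 -> u - k.-1 - g < k.-1)%N. Proof. lia. Qed.
Lemma nat_g5 (k u g : nat) : (k.-1 <= u -> g <= u - k.-1 -> k.-1 + g + (u - k.-1 - g) = u)%N. Proof. lia. Qed.
Lemma nat_g6 (k t g : nat) : (t < g -> k.-1 + t < g + 2 * k.-1)%N. Proof. lia. Qed.
Lemma nat_g7 (k t g : nat) : (t < k.-1 -> k.-1 + g + t < g + 2 * k.-1)%N. Proof. lia. Qed.
Lemma nat_g8 (k t g : nat) : (t < k.-1 -> t < g + 2 * k.-1)%N. Proof. lia. Qed.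
Lemma nat_g9 (k t : nat) : (k.-1 + t < k.-1 -> False)%N. Proof. lia. Qed.
Lemma nat_diag (g x t : nat) : (x < g -> t < g -> ((x + t) %% g + g - x) %% g = t)%N.
Proof.
move=> xg tg; case: (ltnP (x + t) g) => h.
  rewrite (modn_small h); have -> : (x + t + g - x = t + g)%N by lia.
  by rewrite modnDr modn_small.
have -> : ((x + t) %% g = x + t - g)%N by rewrite -{1}(subnK h) modnDr modn_small //; lia.
have -> : (x + t - g + g - x = t)%N by lia.
by rewrite modn_small.
Qed.

Section Refill.
Variables (V : finType) (E : {set {set V}}) (k g : nat).
Local Notation n := #|V|.
Hypotheses (n_gt0 : (0 < n)%N) (k_gt0 : (0 < k)%N).
Local Notation shn := (sh n_gt0).
Local Notation G := (g + 2 * k.-1)%N.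

Definition cwin (f : {ffun 'I_n -> V}) (p : 'I_n) : {set V} := [set f (shn p (val j)) | j : 'I_k].

Variables (f : {ffun 'I_n -> V}) (a : {ffun 'I_g -> 'I_n}).
Definition blkS (i : 'I_g) := mkseq (fun t => f (shn (a i) t)) k.-1.
(** The [i]-th transversal takes from block [j] the middle vertex with index [i - j] modulo [g].
    This is a cyclic Latin square, so the transversals partition the middles of all blocks. *)
Definition blkI (i : 'I_g) := [seq f (shn (a j) (k.-1 + (i + g - j) %% g)) | j <- enum 'I_g].
Definition blkT (i : 'I_g) := mkseq (fun t => f (shn (a i) (k.-1 + g + t))) k.-1.
Definition spread := [forall x : 'I_g, forall j : 'I_G, forall y : 'I_g, forall j' : 'I_G,
  (shn (a x) j == shn (a y) j') ==> (x == y) && (j == j')].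

Lemma spreadP : spread -> forall x y j j', (j < G)%N -> (j' < G)%N -> shn (a x) j = shn (a y) j' -> x = y /\ j = j'.
Proof.
move=> /forallP sp x y j j' jG jG' e.
have /forallP/(_ y)/forallP/(_ (Ordinal jG'))/implyP /= := forallP (sp x) (Ordinal jG).
by rewrite e eqxx => /(_ isT) /andP[/eqP -> /eqP[->]].
Qed.

Lemma size_blkI i : size (blkI i) = g.
Proof. by rewrite size_map -cardE card_ord. Qed.

Lemma blk_uniq i : spread -> injective f -> uniq (blkS i ++ blkI i ++ blkT i).
Proof.
move=> /spreadP sp fi.
have mg (z : nat) : (z %% g < g)%N by rewrite ltn_pmod // (leq_ltn_trans (leq0n i)).
have mG (z : nat) := @nat_g6 k _ g (mg z).
rewrite !cat_uniq; apply/and5P; split.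
- rewrite map_inj_in_uniq ?iota_uniq // => t t'; rewrite !mem_iota /= !add0n => h h' /fi /sp.
  by case; rewrite ?nat_g8.
- apply/hasPn => v; rewrite mem_cat => /orP[/mapP[j _ ->]|/mapP[t + ->]].
    apply/negP => /mapP[t]; rewrite mem_iota /= add0n => tk /fi /sp [] //; first exact: nat_g8.
    by move=> _ e; apply: (@nat_g9 k ((i + g - j) %% g)); rewrite e.
  rewrite mem_iota /= add0n => tk; apply/negP => /mapP[t']; rewrite mem_iota /= add0n => tk' /fi /sp [].
  + exact: nat_g7.
  + exact: nat_g8.
  by move=> _ e; apply: (@nat_g9 k (g + t)); rewrite addnA e.
- rewrite map_inj_in_uniq ?enum_uniq // => j j' _ _ /fi /sp [] //.
- apply/hasPn => v /mapP[t]; rewrite mem_iota /= add0n => tk ->; apply/negP => /mapP[j _ /fi /sp []] //.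
    exact: nat_g7.
  move=> _; rewrite -addnA => /addnI e; have := mg (i + g - j)%N; rewrite -e ltnNge leq_addr //.
- rewrite map_inj_in_uniq ?iota_uniq // => t t'; rewrite !mem_iota /= !add0n => h h' /fi /sp [].
  + exact: nat_g7.
  + exact: nat_g7.
  by move=> _ /addnI.
Qed.

Definition midp (p : 'I_n) := [exists x : 'I_g * 'I_g, p == shn (a x.1) (k.-1 + x.2)].

(** The middle of block [i] receives a tight path on the [i]-th transversal between the unchanged
    ends. A window that meets a middle lies within the block, as the ends have [k - 1] vertices, so
    it is an edge now; the other windows do not change. The fourth conclusion lets [f] be recovered
    from [f'] and a map of the middle positions. *)
Lemma refill : spread -> injective f ->
  (forall i, exists2 c, perm_eq c (blkI i) & tight k E (blkS i ++ c ++ blkT i)) ->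
  exists f' : {ffun 'I_n -> V}, [/\ injective f', (forall p, ~~ midp p -> f' p = f p),
    (forall p, cwin f' p \notin E -> cwin f p \notin E),
    (forall x : 'I_g * 'I_g, exists y : 'I_g * 'I_g, f (shn (a x.1) (k.-1 + x.2)) = f' (shn (a y.1) (k.-1 + y.2))) &
    (forall (p : 'I_n) x, p = shn (a x) k.-1 -> cwin f' p \in E)].
Proof.
move=> spd fi ex; have sp := spreadP spd.
have /boolp.choice[c hc] : forall i, exists c, perm_eq c (blkI i) /\ tight k E (blkS i ++ c ++ blkT i).
  by move=> i; have [c] := ex i; exists c.
have sc i : size (c i) = g by rewrite (perm_size (hc i).1) size_blkI.
pose f' : {ffun 'I_n -> V} := [ffun p => if [pick x : 'I_g * 'I_g | p == shn (a x.1) (k.-1 + x.2)] is Some x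
  then nth (f p) (c x.1) x.2 else f p].
have f'N p : ~~ midp p -> f' p = f p.
  rewrite ffunE => h; case: pickP => // x hx; case/negP: h; apply/existsP; by exists x.
have f'M (x t : 'I_g) d : f' (shn (a x) (k.-1 + t)) = nth d (c x) t.
  rewrite ffunE; case: pickP => [[y t'] /= /eqP /sp [] | /(_ (x, t))]; rewrite ?nat_g6 ?eqxx //=.
  by move=> <- /addnI <-; apply: set_nth_default; rewrite sc.
have fT : f @: [set: _] = [set: _].
  by apply/eqP; rewrite eqEcard finset.subsetT (card_imset _ fi) !cardsT card_ord leqnn.
have f'R (x : 'I_g * 'I_g) : exists y : 'I_g * 'I_g, f (shn (a x.1) (k.-1 + x.2)) = f' (shn (a y.1) (k.-1 + y.2)).
  case: x => x t /=; have g0 : (0 < g)%N by apply: leq_ltn_trans (ltn_ord x).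
  pose i : 'I_g := Ordinal (ltn_pmod (x + t) g0).
  have : f (shn (a x) (k.-1 + t)) \in c i.
    rewrite (perm_mem (hc i).1); apply/mapP; exists x; first by rewrite mem_enum.
    by rewrite nat_diag.
  move=> /(nthP (f (a x)))[s]; rewrite sc => sg <-; exists (i, Ordinal sg).
  by rewrite /= (f'M _ (Ordinal sg) (f (a x))).
have f'i : injective f'.
  have fs v : v \in f @: [set: _] by rewrite fT.
  have : #|f' @: [set: _]| == #|[set: 'I_n]|.
    suff -> : f' @: [set: _] = [set: _] by rewrite !cardsT card_ord.
    apply/setP => v; rewrite !inE; have /imsetP[p _ ->] := fs v.
    case: (boolP (midp p)) => [/existsP[[x t] /= /eqP ->]|np].
      by have [y ->] := f'R (x, t); apply: imset_f.
    by rewrite -f'N //; apply: imset_f.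
  by move=> /imset_injP h x y; apply: h.
have f'E x u d : (u < G)%N -> f' (shn (a x) u) = nth d (blkS x ++ c x ++ blkT x) u.
  move=> uG; rewrite nth_cat size_mkseq; case: ltnP => uk.
    rewrite nth_mkseq // f'N //; apply/existsP => -[[y t] /= /eqP /sp []] //; first exact: nat_g6.
    by move=> _ e; apply: (@nat_g9 k t); rewrite -e.
  rewrite nth_cat sc; case: ltnP => ug.
    by rewrite -(f'M x (Ordinal ug)) /= (nat_g3 uk ug).
  rewrite nth_mkseq ?nat_g4 // nat_g5 // f'N //; apply/existsP => -[[y t] /= /eqP /sp []] //; first exact: nat_g6.
  move=> _ e; have := ltn_ord t; rewrite ltnNge; case/negP; move: ug; rewrite e addnC addnK //.
have win x u : (u + k <= G)%N -> cwin f' (shn (a x) u) \in E.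
  move=> uk; have [_ /tightP /(_ u)] := hc x; rewrite !size_cat !size_mkseq sc.
  have -> : (k.-1 + (g + k.-1) = G)%N by rewrite mul2n -addnn addnCA.
  move=> /(_ uk); congr (_ \in E); set s := _ ++ _.
  have ss : size s = G by rewrite !size_cat !size_mkseq sc mul2n -addnn addnCA.
  apply/setP => v; rewrite inE; apply/idP/imsetP => [/(nthP v)[j]|[j _ ->]].
    rewrite size_takel ?size_drop ?ss; last by rewrite leq_subRL; [rewrite addnC in uk; rewrite addnC|apply: leq_trans uk; apply: leq_addr].
    move=> jk <-; exists (Ordinal jk) => //=; rewrite sh_add nth_take // nth_drop (f'E _ _ v) //.
    by apply: leq_trans uk; rewrite ltn_add2l.
  have jk : (j < k)%N := ltn_ord j.
  rewrite sh_add (f'E _ _ v); last by apply: leq_trans uk; rewrite ltn_add2l.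
  rewrite -nth_drop -(@nth_take k) //; apply: mem_nth; rewrite size_takel // size_drop ss leq_subRL //.
  by apply: leq_trans uk; apply: leq_addr.
exists f'; split=> //.
  move=> p; apply: contra => WE; case: (boolP (cwin f' p \in E)) => // nW.
  have nm j : (j < k)%N -> ~~ midp (shn p j).
    move=> jk; apply: contra nW => /existsP[[x t] /= /eqP e].
    have : p = shn (a x) (k.-1 + t - j).
      by apply: (@sh_injl _ n_gt0 _ _ j); rewrite sh_add nat_g1.
    by move=> ->; apply: win; apply: nat_g2.
  move: nW; rewrite (_ : cwin f' p = cwin f p) ?WE //.
  by apply: eq_imset => j; rewrite f'N //; apply: nm; apply: ltn_ord.
by move=> p x ->; apply: win; have := k_gt0; have := ltn_ord x; lia.
Qed.
End Refill.

Lemma card_bigcup_sum (I T : finType) (P : pred I) (A : I -> {set T}) :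
  (#|\bigcup_(i | P i) A i| <= \sum_(i | P i) #|A i|)%N.
Proof.
apply: (big_ind2 (fun (B : {set T}) b => #|B| <= b)%N) => //; first by rewrite cards0.
by move=> A1 b1 A2 b2 h1 h2; apply: leq_trans (leq_card_setU _ _) (leq_add h1 h2).
Qed.

(** * Random positions of the blocks *)

Section RandomBlocks.
Variables (R : realType) (V : finType) (E : {set {set V}}) (k g : nat) (i0 : 'I_g) (gam : R).
Local Notation n := #|V|.
Hypothesis (n_gt0 : (0 < n)%N).
Local Notation shn := (sh n_gt0).
Local Notation G := (g + 2 * k.-1)%N.
Local Notation F := {ffun 'I_g -> 'I_n}.
Variables (f : {ffun 'I_n -> V}) (p0 : 'I_n).
(** Block [i0] is placed at the bad window; the other blocks stay random. *)
Definition upd (t : F) : F := [ffun i => if i == i0 then p0 else t i].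

(** If two blocks collide, at least one of them is random, and the colliding places determine its
    position from the other one: a proportion [1 / n] for each pair of places. *)
Lemma spread_count : (G <= n)%N -> (n * #|[set t : F | ~~ spread k n_gt0 (upd t)]| <= (g * G) ^ 2 * n ^ g)%N.
Proof.
move=> Gn.
pose D (z : ('I_g * 'I_G) * ('I_g * 'I_G)) := [set t : F | shn (upd t z.1.1) z.1.2 == shn (upd t z.2.1) z.2.2].
have sub : [set t : F | ~~ spread k n_gt0 (upd t)] \subset \bigcup_(z | z.1.1 != z.2.1) D z.
  apply/fintype.subsetP => t; rewrite inE => /forallPn[x /forallPn[j /forallPn[y /forallPn[j']]]].
  rewrite negb_imply negb_and => /andP[/eqP e ne].
  apply/bigcupP; exists ((x, j), (y, j')); last by rewrite inE /= e.
  rewrite /=; case: (eqVneq x y) ne => //= exy; rewrite exy in e.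
  by have := sh_inj (leq_trans (ltn_ord j) Gn) (leq_trans (ltn_ord j') Gn) e => /val_inj ->; rewrite eqxx.
apply: leq_trans (_ : n * \sum_(z : ('I_g * 'I_G) * ('I_g * 'I_G) | z.1.1 != z.2.1) #|D z| <= _)%N.
  by rewrite leq_mul2l (leq_trans (subset_leq_card sub) (card_bigcup_sum _ _)) orbT.
rewrite big_distrr /=.
apply: (@leq_trans (\sum_(z : ('I_g * 'I_G) * ('I_g * 'I_G) | z.1.1 != z.2.1) n ^ g)%N); last first.
  rewrite sum_nat_const leq_mul2r; apply/orP; right; apply: leq_trans (max_card _) _.
  by rewrite !card_prod !card_ord.
apply: leq_sum => -[[x j] [y j']] /= xy.
case: (eqVneq x i0) => xi.
  apply: (@coord_determined _ _ y) => t r; rewrite !inE /= => /eqP et /eqP er h.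
  have yi : y != i0 by rewrite -xi eq_sym.
  move: et er; rewrite !ffunE xi eqxx (negbTE yi) => -> ; exact: sh_injl.
apply: (@coord_determined _ _ x) => t r; rewrite !inE /= => /eqP et /eqP er h.
move: et er; rewrite !ffunE (negbTE xi); case: eqP => yi et er.
  by apply: (@sh_injl _ n_gt0 _ _ j); rewrite et er.
by apply: (@sh_injl _ n_gt0 _ _ j); rewrite et er h // eq_sym.
Qed.

Hypothesis f_inj : injective f.
Hypotheses (k_ge2 : (2 <= k)%N) (gam_gt0 : 0 < gam) (gam_le : gam <= 1 / 4).
Hypothesis codeg : forall X : {set V}, #|X| = k.-1 -> (1 / 2 + gam) * n%:R <= #|[set v | v |: X \in E]|%:R.

Local Notation J := ('I_k.-1 + 'I_g + 'I_k.-1)%type.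
(** A vertex of the exchanged block [i] is named by its place: left end, block of origin, or right
    end. Naming the members of [X] in this way keeps the number of cases in the union bound
    independent of [n]. *)
Definition qel (a : F) (i : 'I_g) (u : J) : V :=
  match u with
  | inl (inl t) => f (shn (a i) t)
  | inl (inr j) => f (shn (a j) (k.-1 + (i + g - j) %% g))
  | inr t => f (shn (a i) (k.-1 + g + t))
  end.
Definition blk (a : F) i := blkS k n_gt0 f a i ++ blkI k n_gt0 f a i ++ blkT k n_gt0 f a i.

Lemma blk_qel a i v : v \in blk a i -> exists u, v = qel a i u.
Proof.
rewrite !mem_cat => /or3P[] /mapP[t].
- by rewrite mem_iota /= add0n => tk ->; exists (inl (inl (Ordinal tk))).
- by move=> _ ->; exists (inl (inr t)).
- by rewrite mem_iota /= add0n => tk ->; exists (inr (Ordinal tk)).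
Qed.

Definition phX (a : F) i (ph : {ffun 'I_k.-1 -> J}) := [set qel a i (ph t) | t : 'I_k.-1].
(** The blocks whose positions determine [X], and [i0], whose position is not random. The other
    coordinates are independent of [X]. *)
Definition phC i (ph : {ffun 'I_k.-1 -> J}) : {set 'I_g} :=
  i0 |: (i |: [set j : 'I_g | [exists t, ph t == inl (inr j)]]).
Definition phB i ph (t : F) (j : 'I_g) : {set 'I_n} :=
  if #|phX (upd t) i ph| == k.-1
  then [set p | f (shn p (k.-1 + (i + g - j) %% g)) |: phX (upd t) i ph \notin E] else finset.set0.

Lemma phC_card i ph : (#|phC i ph| <= k.+1)%N.
Proof.
have h : (#|[set j : 'I_g | [exists t, ph t == inl (inr j)]]| <= k.-1)%N.
  apply: leq_trans (_ : #|[set odflt i0 (if ph t is inl (inr j) then Some j else None) | t : 'I_k.-1]| <= _)%N.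
    apply: subset_leq_card; apply/fintype.subsetP => j; rewrite inE => /existsP[t /eqP e].
    by apply/imsetP; exists t => //; rewrite e.
  by apply: leq_trans (leq_imset_card _ _) _; rewrite card_ord.
rewrite /phC !cardsU1; apply: (@leq_trans (1 + (1 + k.-1))); last by have := k_ge2; clear; lia.
by do 2!apply: leq_add (leq_b1 _) _.
Qed.

Lemma phX_dep i ph (t r : F) : {in phC i ph, t =1 r} -> phX (upd t) i ph = phX (upd r) i ph.
Proof.
move=> h; have hu j : j \in phC i ph -> upd t j = upd r j.
  by move=> jC; rewrite !ffunE h.
apply: eq_imset => s; rewrite /qel; case e : (ph s) => [[u|j]|u]; rewrite hu // !inE ?eqxx ?orbT //.
by apply/orP; right; apply/orP; right; apply/existsP; exists s; rewrite e.
Qed.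

Lemma phB_card i ph (t : F) j : #|phB i ph t j|%:R <= (1 / 2 - gam) * n%:R.
Proof.
rewrite /phB; case: ifP => [/eqP cX|_]; last first.
  by rewrite cards0 mulr_ge0 ?ler0n //; have := gam_le; lra.
set X := phX _ _ _ in cX *; set c := (_ + _)%N.
have inj : injective (fun p => f (shn p c)) by move=> p p' /f_inj; apply: sh_injl.
have : (#|[set p | f (shn p c) |: X \notin E]| + #|[set v | v |: X \in E]| <= n)%N.
  apply: leq_trans (_ : #|~: [set v | v |: X \in E]| + #|[set v | v |: X \in E]| <= _)%N; last by rewrite addnC cardsC.
  rewrite leq_add2r -(card_imset _ inj); apply: subset_leq_card.
  by apply/fintype.subsetP => v /imsetP[p]; rewrite !inE => h ->.
rewrite -(ler_nat R) natrD; have := codeg cX; lra.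
Qed.

Definition rich_blk (a : F) := [forall i : 'I_g, forall X : {set V},
  (#|X| == k.-1) && (X \subset [set v in blk a i]) ==>
  ((1 / 2 + gam / 2) * G%:R <= #|[set v in blk a i] :&: [set v | v |: X \in E]|%:R :> R)].

Hypothesis g_large : 8 * k%:R <= gam / 4 * g%:R :> R.

(** Union bound over the block [i] and the names [ph] of the members of [X]. Given the blocks in
    [phC], the other middle vertices of the block are independent and uniform, so [cond_chernoff]
    applies. The at most [k + 1] blocks left aside and the two ends are negligible, as [g] is
    large. *)
Lemma rich_count : #|[set t : F | spread k n_gt0 (upd t) && ~~ rich_blk (upd t)]|%:R
  <= g%:R * G%:R ^+ k.-1 * (n%:R ^+ g * expR (- ((gam / 4) ^+ 2 / 4) * g%:R)) :> R.
Proof.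
pose d := gam / 4; pose beta := 1 / 2 - gam.
have d0 : 0 < d by rewrite divr_gt0.
have bd : beta + d <= 1 by rewrite /beta /d; have := gam_gt0; lra.
have b0 : 0 <= beta by rewrite /beta; have := gam_le; lra.
pose D (z : 'I_g * {ffun 'I_k.-1 -> J}) := [set t : F |
  (beta + d) * g%:R <= #|[set i | (i \notin phC z.1 z.2) && (t i \in phB z.1 z.2 t i)]|%:R].
have sub : [set t : F | spread k n_gt0 (upd t) && ~~ rich_blk (upd t)] \subset \bigcup_z D z.
  apply/fintype.subsetP => t; rewrite inE => /andP[spd /forallPn[i /forallPn[X]]].
  rewrite negb_imply => /andP[/andP[/eqP cX /fintype.subsetP XQ] nr].
  have /boolp.choice[ph0 hph] : forall s : 'I_k.-1, exists u, nth (f p0) (enum X) s = qel (upd t) i u.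
    move=> s; apply: blk_qel; have : nth (f p0) (enum X) s \in X.
      by rewrite -mem_enum mem_nth // -cardE cX.
    by move=> /XQ; rewrite inE.
  pose ph := [ffun s => ph0 s].
  have eX : phX (upd t) i ph = X.
    apply/setP => v; apply/imsetP/idP => [[s _ ->]|].
      by rewrite ffunE -hph -mem_enum mem_nth // -cardE cX.
    rewrite -mem_enum => /(nthP (f p0))[s]; rewrite -cardE cX => sk <-.
    by exists (Ordinal sk) => //; rewrite ffunE -hph.
  apply/bigcupP; exists (i, ph) => //; rewrite inE /=; move: nr; rewrite -ltNge => nr.
  rewrite leNgt; apply: contraL nr => lt; rewrite -leNgt.
  set A := [set j | _ ] in lt.
  pose el (j : 'I_g) := f (shn (upd t j) (k.-1 + (i + g - j) %% g)).
  have eli : {in ~: (A :|: phC i ph) &, injective el}.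
    move=> j j' _ _ /f_inj /(spreadP spd) [] //; apply: nat_g6; rewrite ltn_pmod //; exact: leq_ltn_trans (ltn_ord i).
  have : (#|~: (A :|: phC i ph)| <= #|[set v in blk (upd t) i] :&: [set v | v |: X \in E]|)%N.
    rewrite -(card_in_imset eli); apply: subset_leq_card; apply/fintype.subsetP => v /imsetP[j].
    rewrite finset.in_setC finset.in_setU negb_or => /andP[hA hC] ->; rewrite inE hC /= in hA.
    rewrite !inE; apply/andP; split.
      by rewrite !mem_cat; apply/orP; right; apply/orP; left; apply/mapP; exists j; rewrite ?mem_enum.
    move: hA; rewrite /phB eX cX eqxx inE negbK; congr (f (shn _ _) |: X \in E).
    by rewrite ffunE; case: eqP => // e; move: hC; rewrite !inE e eqxx.
  have : (g <= #|A| + k.+1 + #|~: (A :|: phC i ph)|)%N.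
    rewrite -[X in (X <= _)%N]card_ord -(cardsC (A :|: phC i ph)) leq_add2r.
    by apply: leq_trans (leq_card_setU _ _) _; rewrite leq_add2l phC_card.
  have kk : k.-1%:R = k%:R - 1 :> R by rewrite -[in RHS](prednK (ltnW k_ge2)) -natr1 addrK.
  have k1 : k.+1%:R = k%:R + 1 :> R by rewrite natr1.
  have -> : G%:R = g%:R + 2 * k%:R - 2 :> R by rewrite natrD natrM kk; ring.
  move=> h1 h2; have {}h1 : g%:R <= #|A|%:R + k.+1%:R + #|~: (A :|: phC i ph)|%:R :> R by rewrite -!natrD ler_nat.
  have {}h2 : #|~: (A :|: phC i ph)|%:R <= #|[set v in blk (upd t) i] :&: [set v | v |: X \in E]|%:R :> R by rewrite ler_nat.
  have k2 : 2 <= k%:R :> R by rewrite (ler_nat _ 2).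
  have gk : gam * k%:R <= k%:R / 4 by have := ler_wpM2r (ler0n R k) gam_le; lra.
  have := ltW gam_gt0; move: h1 h2 lt k2 gk g_large; rewrite k1 /beta /d; clear; lra.
apply: (@le_trans _ _ (\sum_z #|D z|%:R)).
  by rewrite -natr_sum ler_nat; apply: leq_trans (subset_leq_card sub) (card_bigcup_sum _ _).
apply: (@le_trans _ _ (\sum_(z : 'I_g * {ffun 'I_k.-1 -> J}) (n%:R ^+ g * expR (- (d ^+ 2 / 4) * g%:R)))).
  apply: ler_sum => -[i ph] _; have T0 : (0 < #|'I_n|)%N by rewrite card_ord.
  have := @cond_chernoff R g 'I_n (phC i ph) (phB i ph) beta d T0 d0 bd b0; rewrite card_ord; apply.
    by move=> t r h; apply: boolp.funext => j; rewrite /phB (phX_dep h).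
  by move=> t j; apply: phB_card.
rewrite sumr_const -(mulr_natl (_ * _)) card_prod card_ffun !card_sum !card_ord natrM natrX.
by have -> : (k.-1 + g + k.-1 = G)%N by rewrite mul2n -addnn addnAC addnC.
Qed.
End RandomBlocks.

Lemma card_le_rel (A B : finType) (S : {set A}) (T : {set B}) (Rl : A -> B -> Prop) :
  (forall x, x \in S -> exists y, y \in T /\ Rl x y) ->
  (forall x x' y, x \in S -> x' \in S -> Rl x y -> Rl x' y -> x = x') -> (#|S| <= #|T|)%N.
Proof.
move=> ex inj; case: (finset.set_0Vmem S) => [->|[x0 x0S]]; first by rewrite cards0.
have [y0 _] := ex x0 x0S.
have /boolp.choice[h hh] : forall x, exists y, x \in S -> y \in T /\ Rl x y.
  by move=> x; case: (boolP (x \in S)) => [/ex[y hy]|_]; [exists y | exists y0].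
rewrite -(@card_in_imset _ _ h); first by apply: subset_leq_card; apply/fintype.subsetP => y /imsetP[x /hh[yT _] ->].
by move=> x x' xS xS' e; apply: (inj x x' (h x)) => //; [apply: (hh x xS).2 | rewrite e; apply: (hh x' xS').2].
Qed.

Lemma card_dep (A B : finType) (P : pred A) (Q : A -> pred B) :
  #|[set z : A * B | P z.1 && Q z.1 z.2]| = (\sum_(x | P x) #|[set y | Q x y]|)%N.
Proof.
rewrite -sum1_card (eq_bigl (fun z : A * B => P z.1 && Q z.1 z.2)); last by move=> z; rewrite inE.
rewrite -(pair_big_dep P Q (fun _ _ => 1%N)) /=.
by apply: eq_bigr => x _; rewrite -sum1_card; apply: eq_bigl => y; rewrite inE.
Qed.

Lemma cancel_half (R : realType) (a b x c n K : R) : 0 < x -> a * b * (x / 2) <= c * n * (x * K) -> a * b <= 2 * K * n * c.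
Proof. by move=> x0 h; rewrite -(ler_pM2r x0); lra. Qed.

Lemma cancel_quarter (R : realType) (n a c x : R) : 0 < n -> n * a <= c * x -> 4 * (c * x) <= n * x -> a <= x / 4.
Proof. by move=> n0 h1 h2; rewrite -(ler_pM2l n0); lra. Qed.

Lemma half_left (R : realType) (x a b c : R) : b <= x / 4 -> c <= x / 4 -> x <= a + b + c -> x / 2 <= a.
Proof. lra. Qed.

(** * Repairing one bad window *)

Section Step.
Variables (R : realType) (V : finType) (E : {set {set V}}) (k q g : nat) (i0 : 'I_g) (gam : R).
Local Notation n := #|V|.
Hypothesis (n_gt0 : (0 < n)%N).
Local Notation shn := (sh n_gt0).
Local Notation G := (g + 2 * k.-1)%N.
Local Notation F := {ffun 'I_g -> 'I_n}.
Local Notation FV := {ffun 'I_n -> V}.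

Definition cbad (f : FV) : {set 'I_n} := [set p : 'I_n | (q %| p)%N && (cwin k n_gt0 f p \notin E)].
Definition ord_le b : {set FV} := [set f : FV | injectiveb f && (#|cbad f| <= b)%N].
Definition ord_eq b : {set FV} := [set f : FV | injectiveb f && (#|cbad f| == b)].

Hypotheses (k_ge2 : (2 <= k)%N) (gam_gt0 : 0 < gam) (gam_le : gam <= 1 / 4).
Hypothesis Ek : is_kuniform k E.
Hypothesis codeg : forall X : {set V}, #|X| = k.-1 -> (1 / 2 + gam) * n%:R <= #|[set v | v |: X \in E]|%:R.
Hypothesis g_large : 8 * k%:R <= gam / 4 * g%:R :> R.
Hypothesis g_exp : g%:R * G%:R ^+ k.-1 * expR (- ((gam / 4) ^+ 2 / 4) * g%:R) <= 1 / 4 :> R.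
Hypothesis n_large : (4 * (g * G) ^ 2 <= n)%N.
Hypothesis n_large' : (G <= n)%N.
Hypothesis ham : forall (S I T : seq V), uniq (S ++ I ++ T) -> size S = k.-1 -> size I = g -> size T = k.-1 ->
  (forall X : {set V}, #|X| = k.-1 -> X \subset [set v in S ++ I ++ T] ->
     (1 / 2 + gam / 2) * G%:R <= #|[set v in S ++ I ++ T] :&: [set v | v |: X \in E]|%:R :> R) ->
  exists2 c, perm_eq c I & tight k E (S ++ c ++ T).

Definition good_blk (f : FV) (p0 : 'I_n) (t : F) :=
  spread k n_gt0 (upd i0 p0 t) && rich_blk E k gam n_gt0 f (upd i0 p0 t).

Lemma good_count (f : FV) p0 : injective f -> n%:R ^+ g / 2 <= #|[set t | good_blk f p0 t]|%:R :> R.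
Proof.
move=> fi; have nR : 0 < n%:R :> R by rewrite ltr0n.
have h1 : #|[set t : F | ~~ spread k n_gt0 (upd i0 p0 t)]|%:R <= n%:R ^+ g / 4 :> R.
  have h : n%:R * #|[set t : F | ~~ spread k n_gt0 (upd i0 p0 t)]|%:R <= ((g * G) ^ 2)%:R * n%:R ^+ g :> R.
    by rewrite -natrX -!natrM ler_nat; apply: spread_count.
  have h4 : 4 * ((g * G) ^ 2)%:R <= n%:R :> R by have := n_large; rewrite -(ler_nat R) natrM.
  have : 4 * (((g * G) ^ 2)%:R * n%:R ^+ g) <= n%:R * n%:R ^+ g :> R.
    by rewrite mulrA ler_pM2r ?exprn_gt0.
  exact: cancel_quarter.
have h2 : #|[set t : F | spread k n_gt0 (upd i0 p0 t) && ~~ rich_blk E k gam n_gt0 f (upd i0 p0 t)]|%:R <= n%:R ^+ g / 4 :> R.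
  apply: le_trans (rich_count i0 n_gt0 p0 fi k_ge2 gam_gt0 gam_le codeg g_large) _.
  by rewrite mulrCA; apply: le_trans (ler_wpM2l (ltW (exprn_gt0 g nR)) g_exp) _; rewrite mul1r.
have : (#|[set: F]| <= #|[set t | good_blk f p0 t]| + #|[set t : F | ~~ spread k n_gt0 (upd i0 p0 t)]| +
   #|[set t : F | spread k n_gt0 (upd i0 p0 t) && ~~ rich_blk E k gam n_gt0 f (upd i0 p0 t)]|)%N.
  apply: leq_trans (_ : #|([set t | good_blk f p0 t] :|: [set t : F | ~~ spread k n_gt0 (upd i0 p0 t)]) :|:
    [set t : F | spread k n_gt0 (upd i0 p0 t) && ~~ rich_blk E k gam n_gt0 f (upd i0 p0 t)]| <= _)%N.
    apply: subset_leq_card; apply/fintype.subsetP => t _; rewrite !inE /good_blk.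
    by case: spread => //=; case: rich_blk.
  by apply: leq_trans (leq_card_setU _ _) _; rewrite leq_add2r leq_card_setU.
rewrite cardsT card_ffun !card_ord -(ler_nat R) natrX !natrD; exact: half_left.
Qed.

Local Notation K := ((g * g) ^ (g * g))%N.

(** Double counting: an ordering with [b] bad windows, one of these windows and one of at least
    [n^g / 2] good choices of blocks produce an ordering with fewer bad windows. The old ordering is
    recovered from the new one, the place, the blocks and a map of the [g * g] middle positions, for
    which there are [K] possibilities. *)
Lemma switch_step b : (0 < b)%N ->
  #|ord_eq b|%:R * b%:R <= 2 * K%:R * n%:R * #|ord_le b.-1|%:R :> R.
Proof.
move=> b0; have nR : 0 < n%:R :> R by rewrite ltr0n.
have k0 : (0 < k)%N := ltnW k_ge2.
(* The block starts [k - 1] positions before the bad window, which thus begins at the first vertex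
   of the middle. *)
pose Sfp := [set z : FV * 'I_n | (z.1 \in ord_eq b) && (shn z.2 k.-1 \in cbad z.1)].
pose S := [set z : (FV * 'I_n) * F | (z.1 \in Sfp) && good_blk z.1.1 z.1.2 z.2].
pose PT := {ffun 'I_g * 'I_g -> 'I_g * 'I_g}.
pose T := finset.setX (finset.setX (ord_le b.-1) [set: 'I_n]) (finset.setX [set: F] [set: PT]).
have cSfp : #|Sfp| = (#|ord_eq b| * b)%N.
  rewrite /Sfp (card_dep (fun f => f \in ord_eq b) (fun f p => shn p k.-1 \in cbad f)).
  rewrite -sum_nat_const; apply: eq_bigr => f; rewrite inE => /andP[_ /eqP <-].
  have bij : {on cbad f, bijective (fun p => shn p k.-1)}.
    by have [h h1 h2] := sh_bij n_gt0 k.-1; exists h => p _; [apply: h1 | apply: h2].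
  by rewrite -(on_card_preimset bij).
have lbS : #|Sfp|%:R * (n%:R ^+ g / 2) <= #|S|%:R :> R.
  have -> : #|S| = (\sum_(z in Sfp) #|[set t | good_blk z.1 z.2 t]|)%N.
    exact: (card_dep (fun z => z \in Sfp) (fun z t => good_blk z.1 z.2 t)).
  rewrite natr_sum mulr_natl -sumr_const; apply: ler_sum => -[f p]; rewrite !inE /= => /andP[/andP[/injectiveP fi _] _].
  exact: good_count.
pose Rl (z : (FV * 'I_n) * F) (w : (FV * 'I_n) * (F * PT)) :=
  let a := upd i0 z.1.2 z.2 in
  [/\ w.1.2 = z.1.2, w.2.1 = z.2, (forall p, ~~ midp k n_gt0 a p -> w.1.1 p = z.1.1 p) &
   forall x : 'I_g * 'I_g, z.1.1 (shn (a x.1) (k.-1 + x.2)) = w.1.1 (shn (a (w.2.2 x).1) (k.-1 + (w.2.2 x).2))].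
have ST : (#|S| <= #|T|)%N.
  apply: (card_le_rel (Rl := Rl)).
    move=> [[f p] t]; rewrite !inE /= => /andP[/andP[/andP[fi /eqP cf] /andP[qp bp]] /andP[spd rich]].
    set a := upd i0 p t in spd rich *; have fi' := injectiveP _ fi.
    have ex i : exists2 c, perm_eq c (blkI k n_gt0 f a i) & tight k E (blkS k n_gt0 f a i ++ c ++ blkT k n_gt0 f a i).
      apply: ham; rewrite ?size_mkseq ?size_blkI //; first exact: blk_uniq.
      move=> X cX XQ; have /forallP/(_ X)/implyP := forallP rich i; apply.
      by rewrite cX eqxx.
    have [f' [f'i f'N f'b f'R f'g]] := refill k0 spd fi' ex.
    have /boolp.choice[pi hpi] := f'R.
    exists ((f', p), (t, [ffun x => pi x])); split; last first.
      by split; [| |exact: f'N|move=> x /=; rewrite [LHS]hpi !ffunE].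
    rewrite !inE !andbT /=; apply/andP; split; first exact/injectiveP.
    rewrite -ltnS prednK // -cf; apply: proper_card; apply/properP; split.
      by apply/fintype.subsetP => r; rewrite !inE => /andP[-> /f'b].
    exists (shn p k.-1); first by rewrite inE qp.
    by rewrite inE qp (f'g _ i0) // /a ffunE eqxx.
  move=> [[f p] t] [[f2 p2] t2] [[f' p'] [t' pi]] _ _ [/= <- <- h1 h2] [/= e1 e2]; rewrite -e1 -e2 => h3 h4.
  congr (_, _, _); apply/ffunP => r.
  case: (boolP (midp k n_gt0 (upd i0 p' t') r)) => [/existsP[x /eqP ->]|nm]; first by rewrite h2 h4.
  by rewrite -h1 // h3.
have cT : #|T| = (#|ord_le b.-1| * n * (n ^ g * K))%N.
  by rewrite !cardsX !cardsT !card_ffun !card_prod !card_ord.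
have : #|S|%:R <= #|T|%:R :> R by rewrite ler_nat.
rewrite cT !natrM [(n ^ g)%:R]natrX => h; rewrite cSfp natrM in lbS.
have := le_trans lbS h => {h lbS}; set X := n%:R ^+ g.
have X0 : 0 < X by apply: exprn_gt0.
exact: cancel_half.
Qed.

Lemma switch_iter b : (b <= n)%N ->
  #|ord_le b|%:R * b`!%:R <= #|ord_le 0|%:R * ((2 * K + 1)%:R * n%:R) ^+ b :> R.
Proof.
elim: b => [|b IH] bn; first by rewrite fact0 expr0.
have step := switch_step (ltn0Sn b); rewrite /= in step.
have sp : (#|ord_le b.+1| <= #|ord_le b| + #|ord_eq b.+1|)%N.
  apply: leq_trans (leq_card_setU _ _); apply: subset_leq_card; apply/fintype.subsetP => f.
  by rewrite !inE => /andP[-> /=]; rewrite leq_eqVlt ltnS orbC.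
have h1 : #|ord_le b.+1|%:R * b.+1%:R <= #|ord_le b|%:R * ((2 * K + 1)%:R * n%:R) :> R.
  apply: (@le_trans _ _ ((#|ord_le b|%:R + #|ord_eq b.+1|%:R) * b.+1%:R)).
    by rewrite ler_wpM2r ?ler0n // -natrD ler_nat.
  have s1 : #|ord_le b|%:R * b.+1%:R <= #|ord_le b|%:R * n%:R :> R by apply: ler_wpM2l; rewrite ?ler0n ?ler_nat.
  rewrite mulrDl; apply: le_trans (lerD s1 step) _.
  have -> : (2 * K + 1)%:R = 2 * K%:R + 1 :> R by rewrite natrD natrM.
  by rewrite le_eqVlt; apply/orP; left; apply/eqP; ring.
rewrite factS natrM mulrA; apply: le_trans (ler_wpM2r (ler0n _ _) h1) _.
rewrite mulrAC exprSr mulrA; apply: ler_wpM2r; first by rewrite mulr_ge0 ?ler0n.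
exact: IH (ltnW bn).
Qed.
End Step.

(** The length [g] is chosen so large that Chernoff's exponential beats the polynomial number of
    cases. It depends on [k] and [gam] only, and so does [K]. *)
Theorem switching (R : realType) (k : nat) (gam : R) : (2 <= k)%N -> 0 < gam -> gam <= 1 / 4 ->
  exists K n0 : nat, forall (V : finType) (E : {set {set V}}) (q : nat) (n_gt0 : (0 < #|V|)%N),
  is_kuniform k E -> (n0 <= #|V|)%N ->
  (forall X : {set V}, #|X| = k.-1 -> (1 / 2 + gam) * #|V|%:R <= #|[set v | v |: X \in E]|%:R) ->
  forall b, (b <= #|V|)%N ->
  #|ord_le E k q n_gt0 b|%:R * b`!%:R <= #|ord_le E k q n_gt0 0|%:R * (K%:R * #|V|%:R) ^+ b :> R.
Proof.
move=> k2 ga0 ga1; have k0 := ltnW k2.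
have c0 : 0 < (gam / 4) ^+ 2 / 4 by rewrite divr_gt0 ?exprn_gt0 ?divr_gt0.
have [g1 hg1] := poly_lt_exp k.+1 c0 (ler0n R 4).
have [g2 hg2] := nat_above_all [:: 8 * k%:R / (gam / 4); 2 * k%:R; 1 : R].
have ga2 : 0 < gam / 2 by rewrite divr_gt0.
have ga3 : gam / 2 <= 1 / 4 by lra.
have [g /[!geq_max] /andP[gg1 gg2] ham] := ham_path k2 ga2 ga3 (maxn g1 g2).
have := hg2 g gg2; rewrite /= andbT => /and3P[gl gk g0].
have g0' : (0 < g)%N by rewrite -(ltr_nat R); apply: lt_le_trans g0.
set G := (g + 2 * k.-1)%N.
exists (2 * ((g * g) ^ (g * g)) + 1)%N, (maxn (4 * (g * G) ^ 2) G) => V E q n_gt0 Ek.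
rewrite geq_max => /andP[n1 n2] codeg b bn.
apply: (@switch_iter R V E k q g (Ordinal g0') gam n_gt0 k2 ga0 ga1 codeg) => //.
- by rewrite [leRHS]mulrC -ler_pdivrMr // divr_gt0.
- have GR : G%:R <= 2 * g%:R :> R.
    rewrite -natrM ler_nat mul2n -addnn leq_add2l; move: gk; rewrite -natrM ler_nat; move: k0; clear; lia.
  have := hg1 g gg1; rewrite mulNr expRN -/G => h.
  rewrite ler_pdivrMr ?expR_gt0 //.
  have h2 : g%:R * G%:R ^+ k.-1 * 4 <= (4 * g%:R) ^+ k.+1 :> R.
    have gR : 0 < g%:R :> R by rewrite ltr0n.
    apply: (@le_trans _ _ ((4 * g%:R) * (4 * g%:R) ^+ k.-1)).
      rewrite mulrAC [_ * 4]mulrC; apply: ler_wpM2l; first by rewrite mulr_ge0 ?ler0n.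
      by apply: lerXn2r; rewrite ?nnegrE ?mulr_ge0 ?ler0n //; move: GR gR; clear; lra.
    rewrite -exprS prednK // exprS; apply: ler_peMl; first by apply: exprn_ge0; rewrite mulr_ge0 ?ler0n.
    by move: g0; clear; lra.
  move: h h2; set A := expR _; set B := _ ^+ k.+1; set C := g%:R * _; clear; lra.
- by move=> S I T uS sS sI sT hX; apply: ham.
Qed.

(** * Orderings of a Hamilton cycle *)

Lemma card_ord_lt (k x : nat) : (x <= k)%N -> #|[set t : 'I_k | (t < x)%N]| = x.
Proof.
move=> xk; rewrite -sum1_card (eq_bigl (fun t : 'I_k => (t < x)%N)); last by move=> t; rewrite inE.
by rewrite (big_ord_narrow xk) sum1_card card_ord.
Qed.
Lemma card_ord_ge (k d : nat) : #|[set t : 'I_k | (d <= t)%N]| = (k - d)%N.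
Proof.
case: (leqP d k) => dk.
  have := cardsC [set t : 'I_k | (t < d)%N]; rewrite card_ord_lt // card_ord => e.
  rewrite (_ : [set t : 'I_k | (d <= t)%N] = ~: [set t : 'I_k | (t < d)%N]); first by rewrite -[in RHS]e addKn.
  by apply/setP => t; rewrite !inE -leqNgt.
rewrite (_ : [set t : 'I_k | (d <= t)%N] = finset.set0); first by rewrite cards0; apply/esym/eqP; rewrite subn_eq0 ltnW.
by apply/setP => t; rewrite !inE leqNgt (ltn_trans (ltn_ord t) dk).
Qed.

Lemma nat_c1 (n k d t j : nat) : (2 * k <= n -> 0 < d -> d < n -> t < k -> j < k -> (d + j) %% n = t -> d <= t \/ t + n < k + d)%N.
Proof.
move=> h1 h2 h3 h4 h5; case: (ltnP (d + j) n) => h; first by rewrite modn_small //; lia.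
rewrite -(subnK h) modnDr modn_small; lia.
Qed.
Lemma nat_c2 (n k d : nat) : (2 * k <= n -> k <= d -> k - d = 0)%N. Proof. lia. Qed.

Lemma nat_c3 (n k d t : nat) : (2 * k <= n -> d < k -> (t + n < k + d) = false)%N. Proof. lia. Qed.
Lemma nat_c4 (n p j : nat) : (j < n - p -> p + j < n)%N. Proof. lia. Qed.
Lemma nat_c5 (n p j k : nat) : (n - p <= j -> j < k -> k <= n -> p < n -> j - (n - p) < p)%N. Proof. lia. Qed.
Lemma nat_c6 (n p j k : nat) : (n - p <= j -> j < k -> k <= n -> p < n -> (p + j) %% n = j - (n - p))%N.
Proof.
move=> h1 h2 h3 h4; have h5 : (n <= p + j)%N by lia.
by rewrite -(subnK h5) modnDr modn_small; lia.
Qed.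

Section Windows.
Variables (V : finType) (k l q : nat).
Local Notation n := #|V|.
Local Notation N := (n %/ q)%N.
Hypotheses (n_gt0 : (0 < n)%N) (q_gt0 : (0 < q)%N) (kE : k = (q + l)%N) (qn : (q %| n)%N) (n_big : (2 * k + q <= n)%N).
Local Notation shn := (sh n_gt0).
Local Notation FV := {ffun 'I_n -> V}.
Local Notation cw := (cwin k n_gt0).

Lemma N_q : (N * q = n)%N. Proof. by rewrite divnK. Qed.
Lemma N_ge3 : (3 <= N)%N. Proof. by rewrite leq_divRL //; move: n_big; rewrite kE; lia. Qed.
Lemma N_gt0 : (0 < N)%N. Proof. exact: leq_trans N_ge3. Qed.

Lemma lt_k_n t : (t < k -> t < n)%N. Proof. by move: n_big; clear; lia. Qed.
Lemma lt_k_qn t : (t < k -> q + t < n)%N. Proof. by move: n_big; clear; lia. Qed.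

Lemma cwin_card (f : FV) p : injective f -> #|cw f p| = k.
Proof. by move=> fi; rewrite card_imset ?card_ord // => t t' /fi /(sh_inj (lt_k_n (ltn_ord t)) (lt_k_n (ltn_ord t'))) /val_inj. Qed.

(** The second summand is the overlap the other way round the cycle. *)
Lemma cwin_inter (f : FV) p d : injective f -> (0 < d)%N -> (d < n)%N ->
  #|cw f p :&: cw f (shn p d)| = (k - d + (k + d - n))%N.
Proof.
move=> fi d0 dn; have n2 : (2 * k <= n)%N by apply: leq_trans n_big; apply: leq_addr.
have kn := lt_k_n.
pose h (t : 'I_k) := f (shn p t).
have hi : injective h by move=> t t' /fi /(sh_inj (kn _ (ltn_ord t)) (kn _ (ltn_ord t'))) /val_inj.
have -> : cw f p :&: cw f (shn p d) = h @: [set t : 'I_k | (d <= t)%N || (t + n < k + d)%N].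
  apply/setP => v; rewrite inE; apply/andP/imsetP => [[/imsetP[t _ ->] /imsetP[j _ /fi]]|[t]].
    rewrite sh_add => e; exists t => //; rewrite inE; apply/orP.
    apply: (@nat_c1 n k d t j) => //; have /(congr1 val) /= /eqP := e.
    by rewrite eqn_modDl (modn_small (kn _ (ltn_ord t))) => /eqP.
  rewrite inE => ht ->; split; first exact: imset_f.
  case/orP: ht => ht; apply/imsetP.
    have jk : (t - d < k)%N by apply: leq_ltn_trans (ltn_ord t); apply: leq_subr.
    by exists (Ordinal jk) => //; rewrite sh_add /= subnKC.
  have jk : (t + n - d < k)%N by rewrite ltn_subLR ?[(d + k)%N]addnC //; apply: leq_trans (ltnW dn) (leq_addl _ _).
  exists (Ordinal jk) => //; rewrite sh_add /= subnKC; last by apply: leq_trans (ltnW dn) (leq_addl _ _).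
  by congr (f _); apply: val_inj; rewrite /= addnA modnDr.
rewrite card_imset //; case: (leqP k d) => kd.
  rewrite (nat_c2 n2 kd) add0n -(@card_ord_lt k (k + d - n)); last by rewrite leq_subLR addnC leq_add2r ltnW.
  apply: eq_card => t; rewrite !inE ltn_subRL addnC orbC; case: ltnP => //= _.
  by apply/negbTE; rewrite -ltnNge; apply: leq_trans kd.
have -> : (k + d - n = 0)%N by move: kd n2; clear; lia.
rewrite addn0 -card_ord_ge; apply: eq_card => t; rewrite !inE; case: (d <= t)%N => //=.
exact: nat_c3.
Qed.

Definition st (i : nat) : 'I_n := Ordinal (ltn_pmod (i * q) n_gt0).
Lemma st_add i j : st (i + j) = shn (st i) (j * q).
Proof. by apply: val_inj; rewrite /= modnDml mulnDl. Qed.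
Lemma st_per i : st (i + N) = st i.
Proof. by apply: val_inj; rewrite /= mulnDl N_q modnDr. Qed.
Lemma st_mod i : st (i %% N) = st i.
Proof. by apply: val_inj; rewrite /= muln_modl N_q modn_mod. Qed.
Lemma st_small i : (i < N)%N -> st i = (i * q)%N :> nat.
Proof. by move=> iN; rewrite /= modn_small // -N_q ltn_pmul2r. Qed.

Definition ew (f : FV) i := cw f (st i).

Lemma ew_inter (f : FV) i j : injective f -> (0 < j)%N -> (j < N)%N ->
  #|ew f i :&: ew f (i + j)| = (k - j * q + (k + j * q - n))%N.
Proof.
move=> fi j0 jN; rewrite /ew st_add cwin_inter // ?muln_gt0 ?j0 //.
by rewrite -N_q ltn_pmul2r.
Qed.
Lemma ew_next (f : FV) i : injective f -> #|ew f i :&: ew f i.+1| = l.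
Proof.
move=> fi; rewrite -addn1 ew_inter // ?(leq_trans _ N_ge3) // mul1n.
by have := n_big; rewrite kE addKn; clear; lia.
Qed.
(** The overlap strictly decreases with the cyclic distance until it vanishes, so for [l > 0] only
    neighbouring edges meet in [l] vertices. *)
Lemma ew_inter_l (f : FV) i j : injective f -> (0 < l)%N -> (0 < j)%N -> (j < N)%N ->
  #|ew f i :&: ew f (i + j)| = l -> j = 1%N \/ j = N.-1.
Proof.
move=> fi l0 j0 jN; rewrite ew_inter //; have hN := N_q; have hb := n_big; have N0 := N_gt0; move: hb; rewrite kE => hb e.
have [h|h] : (j * q = 1 * q \/ j * q = N.-1 * q)%N.
  by have -> : (N.-1 * q = n - q)%N; [rewrite -subn1 mulnBl hN mul1n | move: hb e l0; clear; lia].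
- by left; apply/eqP; rewrite -(eqn_pmul2r q_gt0) h.
- by right; apply/eqP; rewrite -(eqn_pmul2r q_gt0) h.
Qed.
Lemma ew_inj (f : FV) i j : injective f -> (i < N)%N -> (j < N)%N -> ew f i = ew f j -> i = j.
Proof.
move=> fi; wlog ij : i j / (i < j)%N.
  move=> h iN jN e; case: (ltngtP i j) => // ij; first exact: h.
  by apply/esym; apply: h.
move=> iN jN e; exfalso.
have d0 : (0 < j - i)%N by rewrite subn_gt0.
have dN : (j - i < N)%N by apply: leq_ltn_trans jN; apply: leq_subr.
have := ew_inter i fi d0 dN; rewrite subnKC ?(ltnW ij) // -e finset.setIid.
rewrite [#|ew f i|](cwin_card _ fi).
set d := ((j - i) * q)%N; have : (0 < d)%N by rewrite muln_gt0 d0.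
have : (d < n)%N by rewrite -N_q ltn_pmul2r.
move: n_big; rewrite kE; move: q_gt0; clear; lia.
Qed.

Definition cyc (f : FV) : {set {set V}} := [set ew f i | i : 'I_N].

Lemma ew_cyc (f : FV) i : ew f i \in cyc f.
Proof.
apply/imsetP; exists (Ordinal (ltn_pmod i N_gt0)) => //=; by rewrite /ew st_mod.
Qed.

Lemma st_onto p : (q %| p)%N -> forall pn : (p < n)%N, Ordinal pn = st (p %/ q).
Proof. by move=> qp pn; apply: val_inj; rewrite /= divnK // modn_small. Qed.

Lemma window_cwin (f : FV) (p : 'I_n) : window k [seq f i | i <- enum 'I_n] p = cw f p.
Proof.
set s := map _ _; have ss : size s = n by rewrite size_map -cardE card_ord.
have kn : (k <= n)%N by move: n_big; clear; lia.
have sn (j : 'I_n) : nth (f p) s j = f j by rewrite (nth_map p) -?cardE ?card_ord // nth_ord_enum.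
have nr j : (j < k)%N -> nth (f p) (rot p s) j = f (shn p j).
  move=> jk; have fs : f (shn p j) = nth (f p) s (shn p j) by rewrite sn.
  rewrite /rot nth_cat size_drop ss; case: ltnP => h.
    rewrite nth_drop fs; congr (nth _ _ _); rewrite /= modn_small //; exact: nat_c4.
  rewrite nth_take; last exact: (nat_c5 h jk kn (ltn_ord p)).
  by rewrite fs; congr (nth _ _ _); rewrite /= (nat_c6 h jk kn (ltn_ord p)).
apply/setP => v; rewrite inE; apply/idP/imsetP => [/(nthP (f p))[j]|[j _ ->]].
  rewrite size_takel ?size_rot ?ss // => jk; rewrite nth_take // nr // => <-; by exists (Ordinal jk).
rewrite -nr ?ltn_ord // -(@nth_take k) ?ltn_ord //; apply: mem_nth; rewrite size_takel ?size_rot ?ss //; exact: ltn_ord.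
Qed.

Lemma cyc_spanning (f : FV) : injective f -> is_spanning_lcycle k l (cyc f).
Proof.
move=> fi.
have sz : size [seq f i | i <- enum 'I_n] == n by rewrite size_map -cardE card_ord.
apply/existsP; exists (Tuple sz); apply/existsP; exists [set p : 'I_n | (q %| p)%N]; apply/and4P; split.
- by rewrite /= map_inj_uniq // enum_uniq.
- apply/eqP/setP => e; apply/imsetP/imsetP => [[i _ ->]|[p]].
    exists (st i); last exact/esym/window_cwin.
    by rewrite inE st_small // dvdn_mull.
  rewrite inE => qp ->; have iN : (p %/ q < N)%N by rewrite ltn_divLR // N_q.
  exists (Ordinal iN) => //; rewrite [LHS]window_cwin /ew /= -(st_onto qp (ltn_ord p)); congr cwin; exact: val_inj.
- set r := (fun _ _ => _).
  (* The definition compares edges in the order of [enum], which for the multiples of [q] is the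
     order along the cycle. *)
  have -> : enum [set p : 'I_n | (q %| p)%N] = [seq st i | i <- iota 0 N].
    apply: (inj_map val_inj).
    have -> : map val (enum [set p : 'I_n | (q %| p)%N]) = [seq p <- iota 0 n | (q %| p)%N].
      rewrite -val_enum_ord filter_map; congr map; rewrite !enumT /enum_mem; apply: eq_filter => p /=; by rewrite inE.
    have -> : map val [seq st i | i <- iota 0 N] = [seq (i * q)%N | i <- iota 0 N].
      by rewrite -map_comp; apply/eq_in_map => i; rewrite mem_iota add0n => /st_small.
    apply: (sorted_eq (leT := leq)) => //.
    + exact: leq_trans.
    + exact: anti_leq.
    + by apply: sorted_filter; [exact: leq_trans | exact: iota_sorted].
    + by apply: (homo_sorted (e := leq)) (iota_sorted _ _) => x y xy; rewrite leq_mul2r xy orbT.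
    apply: uniq_perm.
    + by rewrite filter_uniq // iota_uniq.
    + by rewrite map_inj_uniq ?iota_uniq // => x y /eqP; rewrite eqn_pmul2r // => /eqP.
    move=> p; rewrite mem_filter mem_iota add0n; apply/andP/mapP => [[qp pn]|[i]].
      by exists (p %/ q)%N; rewrite ?divnK // mem_iota add0n ltn_divLR // N_q.
    by rewrite mem_iota add0n => iN ->; rewrite dvdn_mull // -N_q ltn_pmul2r.
  have st0 : st 0 = st N by rewrite -(st_per 0).
  have pth (m a0 : nat) : path.path r (st a0) [seq st i | i <- iota a0.+1 m].
    elim: m a0 => //= m IH a0; rewrite IH andbT /r; have w (p : 'I_n) : window k (Tuple sz) p = cw f p := window_cwin f p.
    by rewrite !w; apply/eqP; apply: ew_next.
  have := N_gt0; case eN : N => [//|N'] _; rewrite /= {2}st0 eN.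
  have e : iota 1 N'.+1 = rcons (iota 1 N') N'.+1 by rewrite -{1}(addn1 N') iotaD add1n /= cats1.
  by have := pth N'.+1 0%N; rewrite e map_rcons.
- apply/eqP/setP => v; rewrite !inE; have fT : f @: [set: 'I_n] = [set: V].
    by apply/eqP; rewrite eqEcard finset.subsetT (card_imset _ fi) !cardsT card_ord leqnn.
  have /imsetP[p _ ->] : v \in f @: [set: 'I_n] by rewrite fT.
  apply/bigcupP; exists (ew f (p %/ q)); first exact: ew_cyc.
  have jk : (p %% q < k)%N by apply: leq_trans (ltn_pmod _ q_gt0) _; rewrite kE leq_addr.
  apply/imsetP; exists (Ordinal jk) => //; congr (f _); apply: val_inj.
  by rewrite /= modnDml -divn_eq modn_small.
Qed.

Local Notation p1 := (k %% q)%N.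
Local Notation p2 := (q - k %% q)%N.

(** As [k = (k %/ q) * q + p1], the edge that starts [k %/ q] edges earlier ends after the first
    [p1] of the [q] vertices between the starts of edges [i] and [i + 1]. *)
Lemma mem_left (f : FV) i t : injective f -> (t < q)%N -> (f (shn (st i) t) \in ew f (i + N - k %/ q)) = (t < p1)%N.
Proof.
move=> fi tq; have qk : (q <= k)%N by rewrite kE leq_addr.
have kq := divn_eq k q; have km := ltn_pmod k q_gt0.
have mN : (k %/ q <= i + N)%N.
  apply: leq_trans (leq_addl _ _); apply: leq_div2r; move: n_big; clear; lia.
have -> : st i = shn (st (i + N - k %/ q)) (k %/ q * q) by rewrite -st_add subnK // st_per.
rewrite sh_add; set j := (i + N - _)%N; set c := (k %/ q * q + t)%N.
have cn : (c < n)%N by rewrite /c; move: n_big kq tq; clear; lia.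
apply/imsetP/idP => [[u _ /fi /sh_inj e]|tp].
  have : c = u by apply: e => //; apply: lt_k_n; apply: ltn_ord.
  rewrite /c => e'; have := ltn_ord u; rewrite -e' {2}kq ltn_add2l //.
have ck : (c < k)%N by rewrite /c {2}kq ltn_add2l.
by exists (Ordinal ck).
Qed.

(** The sequence of edges determines the [q] vertices between consecutive starts and, by [mem_left],
    which [p1] of them come first. Only permutations inside the two groups remain free, whence the
    factor [p1! p2!] for each edge. *)
Lemma ew_local (f f0 : FV) i t : injective f -> injective f0 -> (forall i, ew f i = ew f0 i) -> (t < q)%N ->
  exists t', [/\ (t' < q)%N, f (shn (st i) t) = f0 (shn (st i) t') & (t < p1)%N = (t' < p1)%N].
Proof.
move=> fi f0i ee tq; have qk : (q <= k)%N by rewrite kE leq_addr.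
have tk : (t < k)%N := leq_trans tq qk.
have : f (shn (st i) t) \in ew f0 i by rewrite -ee; apply/imsetP; exists (Ordinal tk).
move=> /imsetP[t' _ e]; have t'q : (t' < q)%N.
  rewrite ltnNge; apply/negP => qt'.
  have : f (shn (st i) t) \in ew f i.+1.
    rewrite ee e -addn1 /ew st_add mul1n; apply/imsetP.
    have jk : (t' - q < k)%N by apply: leq_ltn_trans (ltn_ord t'); apply: leq_subr.
    by exists (Ordinal jk) => //; rewrite sh_add /= subnKC.
  rewrite -addn1 /ew st_add mul1n => /imsetP[u _ /fi]; rewrite sh_add => /sh_inj e2.
  have : t = (q + u)%N by apply: e2; [exact: lt_k_n | apply: lt_k_qn; apply: ltn_ord].
  by move=> e3; move: tq; rewrite e3 ltnNge leq_addr.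
exists t'; split=> //; by rewrite -(mem_left i fi tq) -(mem_left i f0i t'q) -ee -e.
Qed.

Lemma perm_local (f f0 : FV) i (c m : nat) : injective f ->
  (forall t : nat, (t < m)%N -> exists2 t', (t' < m)%N & f (shn (st i) (c + t)) = f0 (shn (st i) (c + t'))) ->
  (c + m <= n)%N -> exists w : {perm 'I_m}, forall r : 'I_m, f (shn (st i) (c + r)) = f0 (shn (st i) (c + w r)).
Proof.
move=> fi h cm.
have /boolp.choice[w0 hw] : forall r : 'I_m, exists r' : 'I_m, f (shn (st i) (c + r)) = f0 (shn (st i) (c + r')).
  by move=> r; have [t' tm e] := h r (ltn_ord r); exists (Ordinal tm).
have wi : injective w0.
  move=> r r' e; have : f (shn (st i) (c + r)) = f (shn (st i) (c + r')) by rewrite !hw e.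
  move=> /fi /sh_inj e'; apply: val_inj; apply/eqP; rewrite -(eqn_add2l c); apply/eqP; apply: e'.
    by apply: leq_trans cm; rewrite ltn_add2l.
  by apply: leq_trans cm; rewrite ltn_add2l.
by exists (perm wi) => r; rewrite permE.
Qed.

Lemma ew_perms (f f0 : FV) : injective f -> injective f0 -> (forall i, ew f i = ew f0 i) ->
  exists w : {ffun 'I_N -> {perm 'I_p1} * {perm 'I_p2}}, forall i : 'I_N,
   (forall r : 'I_p1, f (shn (st i) r) = f0 (shn (st i) ((w i).1 r))) /\
   (forall r : 'I_p2, f (shn (st i) (p1 + r)) = f0 (shn (st i) (p1 + (w i).2 r))).
Proof.
move=> fi f0i ee; have pq := ltn_pmod k q_gt0.
have /boolp.choice[w hw] : forall i : 'I_N, exists w : {perm 'I_p1} * {perm 'I_p2},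
   (forall r : 'I_p1, f (shn (st i) r) = f0 (shn (st i) (w.1 r))) /\
   (forall r : 'I_p2, f (shn (st i) (p1 + r)) = f0 (shn (st i) (p1 + w.2 r))).
  move=> i.
  have [|| w1 h1] := @perm_local f f0 i 0 p1 fi.
  - move=> t tp; have [t' [_ e e']] := ew_local i fi f0i ee (ltn_trans tp pq).
    by exists t' => //; rewrite -e'.
  - by move: n_big pq; clear; lia.
  have [|| w2 h2] := @perm_local f f0 i p1 p2 fi.
  - move=> t tp; have tq : (p1 + t < q)%N by rewrite -ltn_subRL.
    have [t' [t'q e e']] := ew_local i fi f0i ee tq.
    have pt' : (p1 <= t')%N by rewrite leqNgt -e' -leqNgt leq_addr.
    exists (t' - p1)%N; first by rewrite ltn_sub2r.
    by rewrite subnKC.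
  - by rewrite subnKC ?(ltnW pq) //; move: n_big; clear; lia.
  by exists (w1, w2); split=> r /=; [have := h1 r | have := h2 r].
by exists [ffun i => w i] => i; rewrite ffunE; apply: hw.
Qed.

Lemma card_fibre (A B : finType) (S : {set A}) (h : A -> B) (c : nat) :
  (forall x0, x0 \in S -> (#|[set x in S | h x == h x0]| <= c)%N) -> (#|S| <= #|h @: S| * c)%N.
Proof.
move=> hc; rewrite -sum1_card (partition_big_imset h) /= -sum_nat_const.
apply: leq_sum => y /imsetP[x0 x0S ->]; apply: leq_trans (hc x0 x0S).
by rewrite -sum1_card; apply: eq_leq; apply: eq_bigl => x; rewrite inE.
Qed.

Definition eseq (f : FV) : {ffun 'I_N -> {set V}} := [ffun i : 'I_N => ew f i].
Lemma eseqE (f f0 : FV) : eseq f = eseq f0 -> forall i, ew f i = ew f0 i.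
Proof.
move=> e i; have := congr1 (fun h : {ffun 'I_N -> {set V}} => h (Ordinal (ltn_pmod i N_gt0))) e.
by rewrite !ffunE /= /ew !st_mod.
Qed.

Lemma pos_split (p : 'I_n) : exists i : 'I_N, (exists r : 'I_p1, p = shn (st i) r) \/ (exists r : 'I_p2, p = shn (st i) (p1 + r)).
Proof.
have iN : (p %/ q < N)%N by rewrite ltn_divLR // N_q.
have pE : p = shn (st (p %/ q)) (p %% q) by apply: val_inj; rewrite /= modnDml -divn_eq modn_small.
exists (Ordinal iN) => /=; case: (ltnP (p %% q) p1) => h; first by left; exists (Ordinal h).
have h2 : (p %% q - p1 < p2)%N by rewrite ltn_sub2r ?ltn_pmod.
by right; exists (Ordinal h2); rewrite /= subnKC.
Qed.

Lemma eseq_count (S : {set FV}) : (forall f, f \in S -> injective f) ->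
  (#|S| <= #|eseq @: S| * (p1`! * p2`!) ^ N)%N.
Proof.
move=> Si; apply: card_fibre => f0 f0S.
apply: leq_trans (_ : #|[set: {ffun 'I_N -> {perm 'I_p1} * {perm 'I_p2}}]| <= _)%N; last first.
  by rewrite cardsT card_ffun card_prod !card_Sn card_ord.
pose Rl (f : FV) (w : {ffun 'I_N -> {perm 'I_p1} * {perm 'I_p2}}) := forall i : 'I_N,
   (forall r : 'I_p1, f (shn (st i) r) = f0 (shn (st i) ((w i).1 r))) /\
   (forall r : 'I_p2, f (shn (st i) (p1 + r)) = f0 (shn (st i) (p1 + (w i).2 r))).
apply: (card_le_rel (Rl := Rl)).
  move=> f; rewrite inE => /andP[fS /eqP /eseqE e].
  by have [w hw] := ew_perms (Si f fS) (Si f0 f0S) e; exists w.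
move=> f f' w _ _ h h'; apply/ffunP => p; have [i [[r ->]|[r ->]]] := pos_split p.
  by rewrite (h i).1 (h' i).1.
by rewrite (h i).2 (h' i).2.
Qed.

Variable E : {set {set V}}.
Local Notation ham := [set F : {set {set V}} | (F \subset E) && is_spanning_lcycle k l F].
Local Notation S0 := (ord_le E k q n_gt0 0).

Lemma S0_inj (f : FV) : f \in S0 -> injective f.
Proof. by rewrite inE => /andP[/injectiveP]. Qed.

Lemma eseq_img (f : FV) : eseq f @: [set: 'I_N] = cyc f.
Proof. by apply/setP => e; apply/imsetP/imsetP => -[i _ ->]; exists i; rewrite ?ffunE. Qed.

Lemma S0_ham (f : FV) : f \in S0 -> cyc f \in ham.
Proof.
move=> fS; rewrite inE (cyc_spanning (S0_inj fS)) andbT; apply/fintype.subsetP => e /imsetP[i _ ->].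
move: fS; rewrite inE leqn0 cards_eq0 => /andP[_ /eqP/setP/(_ (st i))].
by rewrite !inE st_small // dvdn_mull //= => /negbFE.
Qed.

(** The next edge meets the current one in [l] vertices, so it is the successor or the predecessor;
    the latter is excluded because edges at distance two differ. Hence the first two edges fix the
    start and the direction. *)
Lemma eseq_ext (f f' : FV) : (0 < l)%N -> injective f -> injective f' -> cyc f = cyc f' -> ew f 0 = ew f' 0 -> ew f 1 = ew f' 1 ->
  forall i, ew f i = ew f' i /\ ew f i.+1 = ew f' i.+1.
Proof.
move=> l0 fi fi' ec e0 e1; elim=> [|i [h1 h2]] //; split=> //.
have : ew f' i.+2 \in cyc f by rewrite ec ew_cyc.
move=> /imsetP[j0 _ e].
have [j jN ej] : exists2 j, (j < N)%N & ew f' i.+2 = ew f (i.+1 + j).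
  exists ((j0 + N - i.+1 %% N) %% N)%N; first by rewrite ltn_pmod ?N_gt0.
  rewrite e /ew -st_mod -[in RHS]st_mod; congr (cw f (st _)); rewrite modnDmr -modnDml subnKC.
    by rewrite modnDr modn_small.
  by apply: leq_trans (ltnW (ltn_pmod _ N_gt0)) (leq_addl _ _).
have N3 := N_ge3.
have lt : #|ew f i.+1 :&: ew f (i.+1 + j)| = l by rewrite -ej h2 ew_next.
case: (posnP j) => j0'.
  move: lt; rewrite j0' addn0 finset.setIid; rewrite [#|ew f i.+1|](cwin_card _ fi).
  by rewrite kE; move: q_gt0; clear; lia.
have [ej1|ej1] := ew_inter_l fi l0 j0' jN lt; first by rewrite ej ej1 addn1.
have e2 : ew f' i.+2 = ew f' i.
  rewrite ej ej1 -h1 /ew; congr (cw f _); rewrite -(st_per i); congr st; move: N3; clear; lia.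
exfalso; have := ew_inter i fi' (isT : 0 < 2)%N (N3 : 2 < N)%N; rewrite addn2 e2 finset.setIid.
rewrite [#|ew f' i|](cwin_card _ fi').
by move: n_big; rewrite kE; move: q_gt0 l0; clear; lia.
Qed.

Lemma eseq_bound_l : (0 < l)%N -> (#|eseq @: S0| <= num_hamilton_lcycles k l E * (n * n))%N.
Proof.
move=> l0; apply: leq_trans (_ : #|finset.setX ham [set: 'I_n * 'I_n]| <= _)%N; last first.
  by rewrite cardsX cardsT card_prod card_ord.
pose Rl (e : {ffun 'I_N -> {set V}}) (z : {set {set V}} * ('I_n * 'I_n)) :=
  exists f, [/\ f \in S0, e = eseq f, z.1 = cyc f, ew f 0 = nth finset.set0 (enum z.1) z.2.1 & ew f 1 = nth finset.set0 (enum z.1) z.2.2].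
have ix f i : exists a : 'I_n, ew f i = nth finset.set0 (enum (cyc f)) a.
  have : ew f i \in enum (cyc f) by rewrite mem_enum ew_cyc.
  move=> /(nthP finset.set0)[a]; rewrite -cardE => ac <-.
  have an : (a < n)%N.
    apply: leq_trans ac _; apply: leq_trans (leq_imset_card _ _) _; rewrite card_ord; exact: leq_div.
  by exists (Ordinal an).
apply: (card_le_rel (Rl := Rl)).
  move=> e /imsetP[f fS ->]; have [a ha] := ix f 0%N; have [b hb] := ix f 1%N.
  exists (cyc f, (a, b)); split; first by rewrite finset.in_setX S0_ham // inE.
  by exists f.
move=> e e' [F [a b]] _ _ [f [/= fS -> eF h0 h1]] [f' [fS' -> eF' h0' h1']].
apply/ffunP => i; rewrite !ffunE.
have := @eseq_ext f f' l0 (S0_inj fS) (S0_inj fS'); rewrite -eF -eF' h0 h0' h1 h1' => /(_ erefl erefl erefl i) [] //.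
Qed.

(** The sequence enumerates the edge set. This weak bound suffices for [l = 0], where [N!] is a
    factor of [Cnkl]. *)
Lemma eseq_bound_0 : (#|eseq @: S0| <= num_hamilton_lcycles k l E * N`!)%N.
Proof.
apply: leq_trans (card_fibre (h := fun e : {ffun 'I_N -> {set V}} => e @: [set: 'I_N]) (c := N`!) _) _.
  move=> e0 /imsetP[f0 f0S ->].
  have cF : #|eseq f0 @: [set: 'I_N]| = N.
    rewrite card_imset ?cardsT ?card_ord // => i j; rewrite !ffunE => /ew_inj h; apply: val_inj; apply: h => //; exact: S0_inj.
  have cI : #|[set e : {ffun 'I_N -> {set V}} in ffun_on (mem (eseq f0 @: [set: 'I_N])) | injectiveb e]| = N`!.
    by rewrite card_inj_ffuns_on card_ord [X in X ^_ _]cF ffactnn.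
  rewrite -[leqRHS]cI; apply: subset_leq_card.
  apply/fintype.subsetP => e; rewrite !inE => /andP[/imsetP[f fS ->] /eqP eF]; apply/andP; split.
    by apply/ffun_onP => i; rewrite -eF; apply: imset_f.
  by apply/injectiveP => i j; rewrite !ffunE => /ew_inj h; apply: val_inj; apply: h => //; exact: S0_inj.
rewrite leq_mul2r; apply/orP; right; apply: subset_leq_card; apply/fintype.subsetP => F /imsetP[e /imsetP[f fS ->] ->].
by rewrite eseq_img; apply: S0_ham.
Qed.
End Windows.

Theorem ham_lower (V : finType) (E : {set {set V}}) (k l : nat) (n_gt0 : (0 < #|V|)%N) :
  (l < k)%N -> (k - l %| #|V|)%N -> (3 * k <= #|V|)%N ->
  (#|ord_le E k (k - l) n_gt0 0| <= num_hamilton_lcycles k l E * (#|V| ^ 2 * Cnkl #|V| k l))%N.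
Proof.
move=> lk qn nb; have q0 : (0 < k - l)%N by rewrite subn_gt0.
have kE : k = (k - l + l)%N by rewrite subnK // ltnW.
have n_big : (2 * k + (k - l) <= #|V|)%N by move: nb; clear; lia.
have inj f : f \in ord_le E k (k - l) n_gt0 0 -> injective f by rewrite inE => /andP[/injectiveP].
have h1 := eseq_count n_gt0 q0 kE qn n_big inj; apply: (leq_trans h1).
rewrite /Cnkl; case: (posnP l) => l0.
  have := eseq_bound_0 n_gt0 q0 kE qn n_big E; rewrite l0 subn0 modnn fact0 mul1n subn0 => h2.
  apply: leq_trans (leq_mul h2 (leqnn _)) _.
  rewrite -mulnA leq_mul2l; apply/orP; right; apply: leq_pmull; by rewrite expn_gt0 n_gt0.
rewrite mulnA leq_mul2r; apply/orP; right; have := eseq_bound_l n_gt0 q0 kE qn n_big E l0; by rewrite mulnn.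
Qed.

(** * Asymptotics *)

Lemma pow_le_fact_exp (R : realType) (x : R) b : 0 <= x -> x ^+ b <= b`!%:R * expR x.
Proof.
move=> x0; case: b => [|b]; first by rewrite expr0 fact0 mul1r -expR0 ler_expR.
have := @expR_ge1Dxn R x b x0 => h.
rewrite mulrC -ler_pdivrMr ?ltr0n ?fact_gt0 //; apply: le_trans h; by rewrite lerDr.
Qed.

(** Write [K n] as [t K n] times [1 / t], with [t K] at most [e2]. The [b]-th power of the first
    factor is at most [b! exp (t K n)]; that of the second is [exp (b ln (1 / t))], harmless when
    [b] is a small enough multiple of [n]. *)
Lemma switch_exp (R : realType) (K : nat) (e2 : R) : 0 < e2 ->
  exists2 e1 : R, 0 < e1 <= e2 & forall n b : nat, b%:R <= e1 * n%:R ->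
    (K%:R * n%:R) ^+ b <= b`!%:R * expR (2 * e2 * n%:R) :> R.
Proof.
move=> e20; have K1 : 0 < K%:R + 1 :> R by rewrite ltr_wpDl.
pose t : R := Num.min 1 (e2 / (K%:R + 1)).
have t0 : 0 < t by rewrite lt_min ltr01 divr_gt0.
have t1 : t <= 1 by rewrite ge_min lexx.
have tK : t * K%:R <= e2.
  apply: (@le_trans _ _ (t * (K%:R + 1))); first by rewrite ler_pM2l // lerDl.
  by rewrite -ler_pdivlMr // ge_min lexx orbT.
pose L := ln t^-1; have L0 : 0 <= L by rewrite ln_ge0 // invr_ge1 ?unitfE ?gt_eqF.
have L1 : 0 < 1 + L by lra.
have e12 : e2 / (1 + L) <= e2 by rewrite ler_pdivrMr // ler_peMr ?(ltW e20) //; lra.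
exists (e2 / (1 + L)); first by rewrite divr_gt0.
move=> n b hb.
have -> : K%:R * n%:R = (t * K%:R * n%:R) * t^-1 by field; rewrite gt_eqF.
have n0 := ler0n R n.
rewrite exprMn; apply: (@le_trans _ _ (b`!%:R * expR (t * K%:R * n%:R) * expR (L * b%:R))).
  apply: ler_pM.
  - by rewrite exprn_ge0 // !mulr_ge0 // ltW.
  - by rewrite exprn_ge0 // invr_ge0 ltW.
  - by apply: pow_le_fact_exp; rewrite !mulr_ge0 // ltW.
  - by rewrite expRM_natr lnK // posrE invr_gt0.
rewrite -mulrA -expRD; apply: ler_wpM2l; first by rewrite ler0n.
rewrite ler_expR; have h1 : t * K%:R * n%:R <= e2 * n%:R by apply: ler_wpM2r.
have h2 : L * b%:R <= e2 * n%:R.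
  apply: (@le_trans _ _ ((1 + L) * b%:R)); first by have := ler0n R b; lra.
  have := ler_wpM2l (ltW L1) hb; rewrite mulrA mulrCA mulfV ?mulr1 // gt_eqF //.
lra.
Qed.

Lemma entropy_bounded (R : realType) (V : finType) (E : {set {set V}}) (x : {set V} -> R) :
  perfect_fractional_matching E x -> matching_entropy E x <= #|E|%:R / ln 2.
Proof.
move=> [x0 _]; have l2 : 0 < ln 2 :> R by rewrite ln_gt0 // ltr1n.
rewrite /matching_entropy -sum1_card natr_sum mulr_suml; apply: ler_sum => e eE.
rewrite /log2 mulrA ler_pM2r ?invr_gt0 //; have := x0 e eE; rewrite le_eqVlt => /orP[/eqP <-|xp]; first by rewrite mul0r.
have := ln_le_subr1 (_ : 0 < (x e)^-1); rewrite invr_gt0 => /(_ xp) h.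
have := ler_wpM2l (ltW xp) h; rewrite mulrBr mulfV ?gt_eqF // mulr1; lra.
Qed.

(** The matching must also be at least as good as [x0], in order to inherit the bound on [mvalue]
    that makes the constants uniform. *)
Lemma near_entropy (R : realType) (V : finType) (E : {set {set V}}) (x0 : {set V} -> R) (eta : R) : 0 < eta ->
  perfect_fractional_matching E x0 -> exists x : {set V} -> R, [/\ perfect_fractional_matching E x,
    matching_entropy E x0 <= matching_entropy E x & graph_entropy R E - eta <= matching_entropy E x].
Proof.
move=> eta0 px0.
case: (lerP (graph_entropy R E - eta) (matching_entropy E x0)) => h; first by exists x0.
have hs : has_sup [set matching_entropy E x | x in [set x : {set V} -> R | perfect_fractional_matching E x]]%classic.
  split; first by exists (matching_entropy E x0); exists x0.
  by exists (#|E|%:R / ln 2) => _ [x px <-]; apply: entropy_bounded.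
have [_ [x px <-] hx] := sup_adherent eta0 hs.
exists x; split=> //; last exact: ltW.
by apply: ltW; apply: lt_trans h hx.
Qed.

Lemma tuples_ord (R : realType) (V : finType) (E : {set {set V}}) (k q : nat) (n_gt0 : (0 < #|V|)%N) (e : R) (b : nat) :
  (0 < q)%N -> (q %| #|V|)%N -> (2 * k + q <= #|V|)%N -> (forall m : nat, m%:R <= e -> (m <= b)%N) ->
  (#|[set s : #|V|.-tuple V | uniq s && ((nbad k q E s)%:R <= e)%R]| <= #|ord_le E k q n_gt0 b|)%N.
Proof.
move=> q0 qn nb hb; pose h (s : #|V|.-tuple V) : {ffun 'I_#|V| -> V} := [ffun i => tnth s i].
have hi : injective h.
  by move=> s s' e'; apply: eq_from_tnth => i; have := congr1 (fun f : {ffun 'I_#|V| -> V} => f i) e'; rewrite !ffunE.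
rewrite -(card_imset _ hi); apply: subset_leq_card; apply/fintype.subsetP => f /imsetP[s]; rewrite inE => /andP[us hs] ->.
have sE : [seq h s i | i <- enum 'I_#|V|] = s.
  by rewrite -[RHS]map_tnth_enum; apply: eq_map => i; rewrite ffunE.
have hsi : injective (h s).
  by move=> i j; rewrite !ffunE; move: i j; apply/tuple_uniqP.
rewrite inE; apply/andP; split; first exact/injectiveP.
apply: leq_trans (hb _ hs); rewrite /nbad.
apply: leq_trans (leq_imset_card (fun i : 'I_(#|V| %/ q) => st q n_gt0 i) _).
apply: subset_leq_card; apply/fintype.subsetP => p; rewrite inE => /andP[qp wp].
have iN : (p %/ q < #|V| %/ q)%N by rewrite ltn_divLR // divnK.
apply/imsetP; exists (Ordinal iN); last by apply: val_inj; rewrite /= divnK // modn_small.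
rewrite inE /= divnK //; move: wp; rewrite -(window_cwin n_gt0 nb) sE //.
Qed.

Lemma ffact_ge (n l : nat) : (l <= n)%N -> ((n - l) ^ l <= n ^_ l)%N.
Proof.
move=> ln; suff h j : (j <= l)%N -> ((n - l) ^ j <= n ^_ j)%N by exact: h.
elim: j => // j IH jl; rewrite ffactnSr expnSr leq_mul ?(IH (ltnW jl)) //; apply: leq_sub2l; exact: ltnW.
Qed.

(** [A] is the falling factorial [n ^_ l] divided by [(k-1)! n]. Comparing it with [n^l] and
    applying Stirling's formula, the terms in [n ln n] cancel because [q = k - l]. *)
Lemma entropy_constant (R : realType) (n k l : nat) : (0 < n)%N -> (2 <= k)%N -> (l < k)%N -> (2 * k <= n)%N ->
  forall q A : R, q = (k - l)%:R -> A = 'C(n, k - 1)%:R * (((n - k + 1)`!)%:R / (((n - l)`!)%:R * n%:R)) ->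
  - (n%:R / q * ln A) - n%:R - 2 * l%:R ^+ 2 <= ln n`!%:R - n%:R / q * ln (n%:R ^+ k.-1 / (k.-1)`!%:R).
Proof.
move=> n0 k2 lk kn q A qD AD.
have nR : 0 < n%:R :> R by rewrite ltr0n.
have q1 : 1 <= q by rewrite qD (ler_nat _ 1) subn_gt0.
have q0 : 0 < q by lra.
have fp m : 0 < m`!%:R :> R by rewrite ltr0n fact_gt0.
have ln' : (l <= n)%N by apply: leq_trans (ltnW lk) _; move: kn; clear; lia.
have ffp : 0 < (n ^_ l)%:R :> R by rewrite ltr0n ffact_gt0.
have AE : A = (n ^_ l)%:R / ((k.-1)`!%:R * n%:R).
  have k1n : (k.-1 <= n)%N by move: kn; clear; lia.
  have e1 : (n - k + 1 = n - k.-1)%N by move: kn k2; clear; lia.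
  have b1 := bin_fact k1n; have b2 := ffact_fact ln'.
  have b3 : 'C(n, k.-1)%:R * ((k.-1)`!%:R * (n - k.-1)`!%:R) = (n ^_ l)%:R * (n - l)`!%:R :> R.
    by rewrite -!natrM b1 b2.
  rewrite AD subn1 e1; apply/eqP.
  have fn m : m`!%:R != 0 :> R by rewrite gt_eqF.
  have nn : n%:R != 0 :> R by rewrite gt_eqF.
  by rewrite mulrA eqr_div ?mulf_neq0 //; apply/eqP; rewrite [RHS]mulrA -b3; ring.
have lnA : ln A = ln (n ^_ l)%:R - ln (k.-1)`!%:R - ln n%:R.
  by rewrite AE ln_div ?posrE // ?mulr_gt0 // lnM ?posrE //; ring.
have k1 : k.-1%:R = k%:R - 1 :> R by rewrite -[in RHS](prednK (ltnW k2)) -natr1 addrK.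
have qE : q = k%:R - l%:R by rewrite qD natrB // ltnW.
have lnB : ln (n%:R ^+ k.-1 / (k.-1)`!%:R) = (k%:R - 1) * ln n%:R - ln (k.-1)`!%:R :> R.
  by rewrite ln_div ?posrE ?exprn_gt0 // lnXn // -k1 mulr_natl.
have s1 : n%:R * ln n%:R - n%:R <= ln n`!%:R :> R.
  have := fact_lb R n; rewrite -ler_ln ?posrE ?exprn_gt0 ?mulr_gt0 ?expR_gt0 //.
  by rewrite lnXn // lnM ?posrE ?expR_gt0 // expRK -mulr_natl; lra.
have nl : 0 < (n - l)%:R :> R by rewrite ltr0n subn_gt0; move: kn lk; clear; lia.
have nlE : (n - l)%:R = n%:R - l%:R :> R by rewrite natrB.
have s2 : l%:R * ln n%:R - l%:R ^+ 2 / (n - l)%:R <= ln (n ^_ l)%:R :> R.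
  have h1 : l%:R * ln (n - l)%:R <= ln (n ^_ l)%:R :> R.
    by rewrite mulr_natl -lnXn // ler_ln ?posrE ?exprn_gt0 // -natrX ler_nat ffact_ge.
  have h2 : ln n%:R - ln (n - l)%:R <= l%:R / (n - l)%:R :> R.
    rewrite -ln_div ?posrE //; have := ln_le_subr1 (_ : 0 < n%:R / (n - l)%:R :> R); rewrite divr_gt0 // => /(_ isT) h.
    apply: le_trans h _; rewrite le_eqVlt; apply/orP; left; apply/eqP.
    have -> : n%:R = (n - l)%:R + l%:R :> R by rewrite nlE subrK.
    by rewrite mulrDl mulfV ?gt_eqF // addrAC subrr add0r.
  have := ler_wpM2l (ler0n R l) h2; move: h1; rewrite mulrA -expr2; lra.
have s3 : n%:R / q * (l%:R ^+ 2 / (n - l)%:R) <= 2 * l%:R ^+ 2 :> R.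
  have h : n%:R <= 2 * (n - l)%:R :> R.
    rewrite -natrM ler_nat; move: kn lk; clear; lia.
  have -> : n%:R / q * (l%:R ^+ 2 / (n - l)%:R) = l%:R ^+ 2 * (n%:R / (q * (n - l)%:R)).
    by field; rewrite !gt_eqF.
  rewrite [leRHS]mulrC; apply: ler_wpM2l; first exact: exprn_ge0.
  rewrite ler_pdivrMr ?mulr_gt0 //; apply: le_trans h _; apply: ler_wpM2l => //.
  by rewrite ler_peMl // ltW.
have s4 := ler_wpM2l (ltW (divr_gt0 nR q0)) s2.
rewrite lnA lnB; set c := n%:R / q in s3 s4 *.
have cq : c * q = n%:R by rewrite /c divfK ?gt_eqF.
rewrite -{1}cq qE in s1.
move: s1 s3 s4; set X := l%:R ^+ 2 / _; set a := ln n%:R; set F := ln (k.-1)`!%:R; set Z := ln (n ^_ l)%:R.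
have -> : c * (k%:R - l%:R) * a = c * k%:R * a - c * (l%:R * a) by ring.
move: (c * (l%:R * a - X)) (mulrBr c (l%:R * a) X) => y ->; lra.
Qed.

Lemma big_minn_le (I : eqType) (r : seq I) (P : pred I) (F : I -> nat) d i :
  i \in r -> P i -> (\big[minn/d]_(j <- r | P j) F j <= F i)%N.
Proof.
elim: r => // j r IH; rewrite inE big_cons => /orP[/eqP <- ->|ir Pi]; first exact: geq_minl.
by case: ifP => _; [apply: leq_trans (geq_minr _ _) _|]; apply: IH.
Qed.

Lemma entropy_ln (R : realType) (V : finType) (E : {set {set V}}) (x : {set V} -> R) :
  \sum_(e in E) x e * ln (x e)^-1 = ln 2 * matching_entropy E x.
Proof.
have l2 : ln 2 != 0 :> R by rewrite gt_eqF // ln_gt0 // ltr1n.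
rewrite /matching_entropy mulr_sumr; apply: eq_bigr => e _; rewrite /log2 mulrCA; congr (_ * _).
by rewrite mulrC divfK.
Qed.

Theorem theorem1p8 (R : realType) (k l : nat) (delta : R)
    (hk : (2 <= k)%N) (hl : (l < k)%N) (hdelta : 1 / 2 < delta) :
  forall eps : R, 0 < eps ->
  exists n0 : nat, forall (V : finType) (E : {set {set V}}),
    let n := #|V| in
    is_kuniform k E ->
    (n0 <= n)%N ->
    (k - l %| n)%N ->
    delta * n%:R <= (min_codegree k E)%:R ->
    (0 < num_hamilton_lcycles k l E)%N /\
    log2 (num_hamilton_lcycles k l E)%:R >=
      k%:R / (k - l)%:R * graph_entropy R E
      - n%:R / (k - l)%:R
        * log2 ('C(n, k - 1)%:R * (((n - k + 1)`!)%:R / (((n - l)`!)%:R * n%:R)))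
      - n%:R * log2 (expR 1)
      - log2 (Cnkl n k l)%:R
      - eps * n%:R.
Proof.
move=> eps eps0; have l2 : 0 < ln 2 :> R by rewrite ln_gt0 // ltr1n.
(* The cap [1 / 4] is what [switching] asks for. *)
pose gam : R := Num.min (delta - 1 / 2) (1 / 4).
have gam0 : 0 < gam by rewrite lt_min; apply/andP; split; lra.
have gam1 : gam <= 1 / 4 by rewrite ge_min lexx orbT.
have gamd : 1 / 2 + gam <= delta.
  have : gam <= delta - 1 / 2 by rewrite ge_min lexx.
  lra.
have q0 : (0 < k - l)%N by rewrite subn_gt0.
have qlk : (k - l + l = k)%N by rewrite subnK // ltnW.
(* Error budget in natural logarithms: the bad windows, the switching, the factor [n ^+ 2] and the
   constant [2 * l ^+ 2] cost [e2 * n] once, twice, once and once; the approximation of the supremum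
   costs [eps * ln 2 * n / 4]. Together this is at most seven eighths of [eps * ln 2 * n]. *)
pose e2 := Num.min 1 (eps * ln 2 / 8).
have e20 : 0 < e2 by rewrite lt_min ltr01 divr_gt0 // mulr_gt0.
have e21 : e2 <= 1 by rewrite ge_min lexx.
have e2e : e2 <= eps * ln 2 / 8 by rewrite ge_min lexx orbT.
have [K [ns hs]] := switching hk gam0 gam1.
have [e1 /andP[e10 e12] he1] := switch_exp K e20.
have gam2 : gam <= 1 / 2 by apply: le_trans gam1 _; lra.
have [nd hd] := dirac_mvalue hk gam0 gam2.
have [na ha] := almost_count l (ln (k%:R * (8 / gam) ^+ k.-1)) q0 e10.
rewrite qlk in ha.
have [nb hb] := nat_above_all [:: 2 * ln (2 / (e2 / 2)) / (e2 / 2); 2 * l%:R ^+ 2 / e2; 1].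
exists (maxn (3 * k) (maxn ns (maxn nd (maxn na nb)))) => V E n Ek.
rewrite !geq_max => /and5P[k3 nns nnd nna nnb] qn codeg.
have := hb _ nnb; rewrite /= andbT => /and3P[h1 h2 h3].
have nR : 0 < n%:R :> R by apply: lt_le_trans h3.
have n_gt0 : (0 < n)%N by rewrite ltr0n in nR.
have cod (X : {set V}) : #|X| = k.-1 -> (1 / 2 + gam) * n%:R <= #|[set v | v |: X \in E]|%:R.
  move=> cX; apply: le_trans (_ : delta * n%:R <= _); first by apply: ler_wpM2r; rewrite ?ler0n.
  apply: le_trans codeg _; rewrite ler_nat.
  by apply: (@big_minn_le _ _ _ (codegree E) _ X); rewrite ?mem_index_enum // cX.
have [x0 px0 vx0] := hd V E Ek nnd cod.
have qR : 0 < (k - l)%:R :> R by rewrite ltr0n.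
have kR : 0 < k%:R :> R by rewrite ltr0n ltnW.
(* Multiplied by [k / (k - l)], this tolerance becomes [eps * n / 4]. *)
have eta0 : 0 < eps * (k - l)%:R / (4 * k%:R) * n%:R by rewrite mulr_gt0 // divr_gt0 ?mulr_gt0.
have [x [px hx0 hx]] := near_entropy eta0 px0.
have vx : mvalue k E x <= ln (k%:R * (8 / gam) ^+ k.-1).
  apply: le_trans vx0; rewrite /mvalue !entropy_ln lerD2l lerN2; apply: ler_wpM2l; first by rewrite divr_ge0 ?ler0n.
  by apply: ler_wpM2l => //; apply: ltW.
have cnt := ha V E x Ek nna qn px vx.
pose b := Num.truncn (e1 * n%:R).
have /andP[b1 b2] : b%:R <= e1 * n%:R < b.+1%:R by apply: truncn_itv; rewrite mulr_ge0 ?ler0n // ltW.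
have bn : (b <= n)%N.
  rewrite -(ler_nat R); apply: le_trans b1 _; rewrite -[leRHS]mul1r; apply: ler_wpM2r; rewrite ?ler0n //; exact: le_trans e12 e21.
have tup : (#|[set s : #|V|.-tuple V | uniq s && ((nbad k (k - l) E s)%:R <= e1 * n%:R)%R]| <= #|ord_le E k (k - l) n_gt0 b|)%N.
  apply: tuples_ord => //; first by move: k3 hl; rewrite /n; clear; lia.
  by move=> m hm; rewrite -ltnS -(ltr_nat R); apply: le_lt_trans hm b2.
have sw := hs V E (k - l)%N n_gt0 Ek nns cod b bn.
have low := ham_lower E n_gt0 hl qn k3.
set Psi := num_hamilton_lcycles k l E in low *.
have C0 : (0 < Cnkl n k l)%N.
  by rewrite /Cnkl; case: ifP => _; rewrite ?muln_gt0 ?expn_gt0 ?fact_gt0 ?muln_gt0 ?fact_gt0.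
have main : n`!%:R * expR (- (n%:R / (k - l)%:R * mvalue k E x) - e1 * n%:R) <=
    Psi%:R * (n%:R ^+ 2 * (Cnkl n k l)%:R) * expR (2 * e2 * n%:R) :> R.
  apply: le_trans cnt _; apply: (@le_trans _ _ #|ord_le E k (k - l) n_gt0 b|%:R); first by rewrite ler_nat.
  have bf : 0 < b`!%:R :> R by rewrite ltr0n fact_gt0.
  have s1 : #|ord_le E k (k - l) n_gt0 b|%:R <= #|ord_le E k (k - l) n_gt0 0|%:R * expR (2 * e2 * n%:R) :> R.
    rewrite -(ler_pM2r bf); apply: le_trans sw _; rewrite -[leRHS]mulrA; apply: ler_wpM2l; first exact: ler0n.
    by rewrite [leRHS]mulrC; apply: he1.
  apply: le_trans s1 _; apply: ler_wpM2r; first exact: expR_ge0.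
  by rewrite -natrX -!natrM ler_nat.
have nf : 0 < n`!%:R :> R by rewrite ltr0n fact_gt0.
have Psi0 : (0 < Psi)%N.
  rewrite lt0n; apply/negP => /eqP z; move: main; rewrite z !mul0r leNgt => /negP; apply.
  by rewrite mulr_gt0 ?expR_gt0.
split=> //.
have PR : 0 < Psi%:R :> R by rewrite ltr0n.
have CR : 0 < (Cnkl n k l)%:R :> R by rewrite ltr0n.
move: main; rewrite -ler_ln ?posrE ?mulr_gt0 ?expR_gt0 ?exprn_gt0 //.
rewrite !lnM ?posrE ?mulr_gt0 ?expR_gt0 ?exprn_gt0 // !expRK => main.
have kn2 : (2 * k <= n)%N by move: k3; rewrite /n; clear; lia.
have ec := entropy_constant n_gt0 hk hl kn2 (erefl ((k - l)%:R : R)) erefl.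
have ls := ln_sublinear (divr_gt0 e20 (ltr0n R 2)) nR h1.
rewrite ler_pdivrMr // in h2.
rewrite /log2 expRK ler_pdivlMr //.
set A := 'C(n, k - 1)%:R * _ in ec *; set q := (k - l)%:R in qR eta0 hx main ec *.
have mv : n%:R / q * mvalue k E x = n%:R / q * ln (n%:R ^+ k.-1 / (k.-1)`!%:R) - k%:R / q * (ln 2 * matching_entropy E x).
  by rewrite /mvalue entropy_ln -/n; field; rewrite !gt_eqF.
have hxx : k%:R / q * (ln 2 * graph_entropy R E) - ln 2 * eps * n%:R / 4 <= k%:R / q * (ln 2 * matching_entropy E x).
  have c0 : 0 <= k%:R / q * ln 2 by rewrite mulr_ge0 ?divr_ge0 // ltW.
  have := ler_wpM2l c0 hx; congr (_ <= _); last by rewrite mulrA.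
  by field; rewrite !gt_eqF.
have -> : (k%:R / q * graph_entropy R E - n%:R / q * (ln A / ln 2) - n%:R * (1 / ln 2) - ln (Cnkl n k l)%:R / ln 2 - eps * n%:R) * ln 2
  = k%:R / q * (ln 2 * graph_entropy R E) - n%:R / q * ln A - n%:R - ln (Cnkl n k l)%:R - eps * ln 2 * n%:R.
  by field; rewrite !gt_eqF.
have r1 : e1 * n%:R <= e2 * n%:R by apply: ler_wpM2r; rewrite ?ler0n.
have r2 : e2 * n%:R <= eps * ln 2 / 8 * n%:R by apply: ler_wpM2r; rewrite ?ler0n.
rewrite mv in main.
have r3 : 0 <= eps * ln 2 * n%:R by rewrite !mulr_ge0 // ltW.
move: main ec ls h2 hxx r1 r2 r3.
move: (n%:R / q * ln A) (n%:R / q * ln (_ / _)) (k%:R / q * (ln 2 * graph_entropy R E)) (k%:R / q * (ln 2 * matching_entropy E x)) => t1 t2 t3 t4; clear; lra.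
Qed.
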